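(* Let $d\ge2$ and let $D\subset\mathbb{R}^d$ be a bounded open set with $C^2$ boundary or $D=\mathbb{R}^d$. Let $\mu\in\mathbb{R}$ and let $\Omega^*\subset D$ be a measurable set with $P(\Omega^* )+|\Omega^*|<\infty$ which is a local shape supersolution for the functional $P+\mu|\cdot|$ in $D$, i.e. there is $r_0>0$ such that $$P(\Omega^* )+\mu|\Omega^*|\le P(\Omega)+\mu|\Omega|$$ for every measurable set $\Omega$ with $\Omega^*\subset\Omega\subset D$ and $\Omega\Delta\Omega^*\subset B_{r_0}(x_0)$ for some $x_0\in\mathbb{R}^d$. Then: (a) There are constants $r_1>0$ and $\mu_1\in\mathbb{R}$ such that $\Omega^*$ is a local shape supersolution in $\mathbb{R}^d$ for the functional $P+\mu_1|\cdot|$, i.e. $P(\Omega^* )+\mu_1|\Omega^*|\le P(\Omega)+\mu_1|\Omega|$ for every measurable set $\Omega\supset\Omega^*$ with $\Omega\Delta\Omega^*\subset B_{r_1}(x_1)$ for some $x_1\in\mathbb{R}^d$. (b) If $\Omega^*$ is identified with the set of its points of density $1$, then $\Omega^*$ is open and $H^1_0(\Omega^* )=\widetilde H^1_0(\Omega^* )$. In particular, $\lambda_k(\Omega^* )=\widetilde\lambda_k(\Omega^* )$ for all $k\ge1$, and $E_f(\Omega^* )=\widetilde E_f(\Omega^* )$ for all $f\in L^p(D)$, $p\in[2,\infty]$. (c) With the same identification, the energy function $w_{\Omega^*}$, solution of $$-\Delta w_{\Omega^*}=1\ \text{ in }\Omega^*,\qquad w_{\Omega^*}\in H^1_0(\Omega^*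 ),$$ is Lipschitz continuous on $\mathbb{R}^d$.
   Context: $|\cdot|$ is Lebesgue measure; $P(\Omega)=\sup\{\int_\Omega \mathrm{div}\,\phi\,dx:\ \phi\in C^1_c(\mathbb{R}^d;\mathbb{R}^d),\ |\phi|\le 1\}$. The set of points of density $1$ of $\Omega$ is $\Omega^{(1)}=\{x:\ \lim_{r\to0}|\Omega\cap B_r(x)|/|B_r|=1\}$, which coincides with $\Omega$ a.e. For measurable $\Omega$ of finite measure, $\widetilde H^1_0(\Omega)=\{u\in H^1(\mathbb{R}^d):u=0\text{ a.e. on }\mathbb{R}^d\setminus\Omega\}$; for open $\Omega$, $H^1_0(\Omega)$ is the closure of $C^\infty_c(\Omega)$ in $H^1$ (functions extended by $0$). $E_f(\Omega)$ and $\widetilde E_f(\Omega)$ are the minima of $u\mapsto\frac12\int|\nabla u|^2dx-\int fu\,dx$ over $H^1_0(\Omega)$ and $\widetilde H^1_0(\Omega)$ respectively; $\lambda_k(\Omega)$ and $\widetilde\lambda_k(\Omega)$ are the min-max values $\min_{S_k}\max_{u\in S_k\setminus\{0\}}\int|\nabla u|^2dx/\int u^2dx$ over $k$-dimensional subspaces $S_k$ of $H^1_0(\Omega)$ and $\widetilde H^1_0(\Omega)$ respectively. The equation $-\Delta w=1$ is understood weakly, with test functions in $H^1_0(\Omega^* )$; $w$ is extended by $0$ outside $\Omega^*$. *)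

(* Defs.v *)
From HB Require Import structures.
From mathcomp Require Import all_boot all_order all_algebra.
From mathcomp Require Import all_classical all_reals all_analysis.
Set Implicit Arguments.
Unset Strict Implicit.
Unset Printing Implicit Defensive.
Import Order.TTheory GRing.Theory Num.Theory.
Import numFieldNormedType.Exports.
Local Open Scope classical_set_scope.
Local Open Scope ring_scope.

(* Lebesgue measure on R^d: the d-fold product of [lebesgue_measure] on Borel
   sets of [d.-tuple R], transported to ['rV[R]_d] and completed by
   Caratheodory's construction, so that [measurable] on ['rV[R]_d] means
   Lebesgue measurable. *)
Section product_lebesgue.
Context {R : realType}.

Definition tcons n (p : measurableTypeR R * n.-tuple (measurableTypeR R)) :
  n.+1.-tuple (measurableTypeR R) := [tuple of p.1 :: p.2].

Lemma measurable_tcons n : measurable_fun [set: _] (@tcons n).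
Proof. exact: measurable_cons. Qed.

Section step.
Context n
  (m : {sigma_finite_measure set (n.-tuple (measurableTypeR R)) -> \bar R}).

Definition cons_measure : set (n.+1.-tuple (measurableTypeR R)) -> \bar R :=
  pushforward (lebesgue_measure \x m)%E (@tcons n).

Let cons_measure0 : cons_measure set0 = 0%E.
Proof. by rewrite /cons_measure /pushforward preimage_set0 measure0. Qed.

Let cons_measure_ge0 A : (0 <= cons_measure A)%E.
Proof. by rewrite /cons_measure /pushforward measure_ge0. Qed.

Let cons_measure_sigma_additive : semi_sigma_additive cons_measure.
Proof.
have mpre A : measurable A -> measurable (@tcons n @^-1` A).
  by move=> mA; rewrite -[X in measurable X]setTI; exact: measurable_tcons.
move=> F mF tF mUF; rewrite /cons_measure /pushforward preimage_bigcup.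
apply: measure_semi_sigma_additive.
- by move=> k; exact: mpre.
- apply/trivIsetP => /= i j _ _ ij; rewrite -preimage_setI.
  by move/trivIsetP : tF => /(_ _ _ _ _ ij) ->//; rewrite preimage_set0.
- by rewrite -preimage_bigcup; exact: mpre.
Qed.

HB.instance Definition _ := isMeasure.Build _ _ _ cons_measure
  cons_measure0 cons_measure_ge0 cons_measure_sigma_additive.

Lemma cons_measure_sigma_finite : sigma_finite setT cons_measure.
Proof.
have /sigma_finiteP[F [TF ndF Foo]] := sigma_finiteT (@lebesgue_measure R).
have /sigma_finiteP[G [TG ndG Goo]] := sigma_finiteT m.
pose uncons (t : n.+1.-tuple (measurableTypeR R)) :=
  (thead t, [tuple of behead t]).
have unconsK p : uncons (tcons p) = p.
  by case: p => x t; congr pair; apply/val_inj.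
have muncons : measurable_fun setT uncons.
  by apply: measurable_fun_pair; [exact: measurable_tnth|
    exact: measurable_behead].
have mFG k : measurable (F k `*` G k).
  by apply: measurableX; [exact: (Foo k).1|exact: (Goo k).1].
exists (fun k => uncons @^-1` (F k `*` G k)).
  rewrite -preimage_bigcup (_ : \bigcup_k _ = setT) ?preimage_setT//.
  apply/seteqP; split => // -[x y] _.
  have [i _ Fix] : (\bigcup_k F k) x by rewrite -TF.
  have [j _ Gjy] : (\bigcup_k G k) y by rewrite -TG.
  exists (maxn i j) => //; split.
    by move: x Fix; exact/subsetPset/ndF/leq_maxl.
  by move: y Gjy; exact/subsetPset/ndG/leq_maxr.
move=> k; split; first by rewrite -[X in measurable X]setTI; exact: muncons.
rewrite /cons_measure /pushforward (_ : _ @^-1` _ = F k `*` G k); last first.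
  by apply/funext => p; rewrite -[in RHS](unconsK p).
have [mF Foo'] := Foo k; have [mG Goo'] := Goo k.
by rewrite product_measure1E// lte_mul_pinfty// ge0_fin_numE.
Qed.

HB.instance Definition _ := Measure_isSigmaFinite.Build _ _ _
  cons_measure cons_measure_sigma_finite.
End step.

Fixpoint tuple_lebesgue n :
    {sigma_finite_measure set (n.-tuple (measurableTypeR R)) -> \bar R} :=
  match n with
  | 0 => [the {sigma_finite_measure set _ -> \bar R} of dirac [tuple]]
  | n'.+1 => [the {sigma_finite_measure set _ -> \bar R}
               of cons_measure (tuple_lebesgue n')]
  end.

Lemma measurable_tuple_box n (a b : 'I_n -> R) :
  measurable [set t : n.-tuple (measurableTypeR R) |
    forall i, `]a i, b i]%classic (tnth t i)].
Proof.
rewrite (_ : [set t | _] = \bigcap_(i in [set: 'I_n])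
    ((fun t => tnth t i) @^-1` `]a i, b i]%classic)).
  apply: fin_bigcap_measurable => // i _; rewrite -[X in measurable X]setTI.
  exact: measurable_tnth.
by apply/seteqP; split => t /= h i; [move=> _; exact: h|exact: h].
Qed.

Lemma tuple_lebesgue_box n (a b : 'I_n -> R) : (forall i, a i <= b i) ->
  tuple_lebesgue n [set t | forall i, `]a i, b i]%classic (tnth t i)] =
  (\prod_i (b i - a i))%:E.
Proof.
elim: n a b => [|n IH] a b ab.
  by rewrite big_ord0 /= diracE mem_set//= => -[].
rewrite /= /cons_measure /pushforward (_ : _ @^-1` _ =
    `]a ord0, b ord0]%classic `*`
    [set t | forall i, `]a (lift ord0 i), b (lift ord0 i)]%classic (tnth t i)]);
  last first.
  apply/seteqP; split => -[x t] /=.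
    move=> h; split; first exact: (h ord0).
    by move=> i; have := h (lift ord0 i); rewrite /tcons tnthS.
  move=> [h1 h2] i; case: (unliftP ord0 i) => [j|] ->; last exact: h1.
  by rewrite /tcons tnthS; exact: h2.
rewrite product_measure1E; [|by []|exact: measurable_tuple_box].
rewrite IH; last by move=> i; exact: ab.
rewrite big_ord_recl EFinM; congr (_ * _)%E.
have := lebesgue_measure_itv `]a ord0, b ord0] => /= h.
rewrite h; case: ifPn => //; rewrite lte_fin -leNgt => ba.
suff -> : a ord0 = b ord0 by rewrite subrr.
by apply: le_anti; rewrite ba ab.
Qed.

End product_lebesgue.

Section lebesgue_rV.
Context {R : realType} {d : nat}.

Definition row_of_tuple (t : d.-tuple (measurableTypeR R)) : 'rV[R]_d :=
  \row_i tnth t i.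

Definition lebesgue_outer (A : set 'rV[R]_d) : \bar R :=
  ((tuple_lebesgue d)^*)%mu (row_of_tuple @^-1` A).

Let outer0 : lebesgue_outer set0 = 0%E.
Proof. by rewrite /lebesgue_outer preimage_set0 outer_measure0. Qed.

Let outer_ge0 A : (0 <= lebesgue_outer A)%E.
Proof. exact: outer_measure_ge0. Qed.

Let le_outer : {homo lebesgue_outer : A B / A `<=` B >-> (A <= B)%E}.
Proof. by move=> A B AB; apply: le_outer_measure; exact: preimage_subset. Qed.

Let outer_sigma_subadditive : sigma_subadditive lebesgue_outer.
Proof.
by move=> F; rewrite /lebesgue_outer preimage_bigcup;
  exact: outer_measure_sigma_subadditive.
Qed.

HB.instance Definition _ := isOuterMeasure.Build R 'rV[R]_d lebesgue_outer
  outer0 outer_ge0 le_outer outer_sigma_subadditive.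
End lebesgue_rV.

HB.instance Definition _ (R : realType) (d : nat) :=
  @isMeasurable.Build (caratheodory_display (@lebesgue_outer R d)) 'rV[R]_d
    lebesgue_outer.-caratheodory
    (caratheodory_measurable_set0 lebesgue_outer)
    (@caratheodory_measurable_setC _ _ lebesgue_outer)
    (@caratheodory_measurable_bigcup _ _ lebesgue_outer).

Definition leb {R : realType} {d : nat} : set 'rV[R]_d -> \bar R :=
  lebesgue_outer.

Section lebesgue_measure_instance.
Context {R : realType} {d : nat}.
Let mu : {outer_measure set 'rV[R]_d -> \bar R} := lebesgue_outer.

Let leb0 : leb (set0 : set 'rV[R]_d) = 0%E.
Proof. exact: (caratheodory_measure0 mu). Qed.

Let leb_ge0 (A : set 'rV[R]_d) : (0 <= leb A)%E.
Proof. exact: (outer_measure_ge0 mu A). Qed.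

Let leb_sigma_additive : semi_sigma_additive (@leb R d).
Proof. exact: (@caratheodory_measure_sigma_additive _ _ mu). Qed.

HB.instance Definition _ := isMeasure.Build _ 'rV[R]_d R leb
  leb0 leb_ge0 leb_sigma_additive.

Lemma measurable_row_of_tuple (A : set 'rV[R]_d) :
  measurable (row_of_tuple @^-1` A) -> measurable A.
Proof.
move=> mA; apply: le_caratheodory_measurable => X.
have /(_ (row_of_tuple @^-1` X)) h :
    caratheodory_measurable ((tuple_lebesgue d)^*)%mu (row_of_tuple @^-1` A).
  by apply: sub_caratheodory; exact: sub_sigma_algebra.
by rewrite /lebesgue_outer [leRHS]h.
Qed.

Lemma leb_box (a b : 'rV[R]_d) : (forall i, a 0 i <= b 0 i) ->
  leb [set x : 'rV[R]_d | forall i, `]a 0 i, b 0 i]%classic (x 0 i)] =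
  (\prod_i (b 0 i - a 0 i))%:E.
Proof.
move=> ab; rewrite /leb /lebesgue_outer (_ : _ @^-1` _ =
    [set t | forall i, `]a 0 i, b 0 i]%classic (tnth t i)]).
  rewrite (@measurable_mu_extE _ R _ (tuple_lebesgue d)).
    exact: (@tuple_lebesgue_box _ _ (a 0) (b 0)).
  exact: (@measurable_tuple_box _ _ (a 0) (b 0)).
by apply/seteqP; split => t /= h i; have := h i; rewrite mxE.
Qed.

End lebesgue_measure_instance.

Section euclidean_space.
Context {R : realType} {d : nat}.
Implicit Types (x y : 'rV[R]_d) (U : set 'rV[R]_d).

(* The topology of ['rV[R]_d] comes from the sup norm; the Euclidean norm is
   the one that enters balls, unit vector fields and Lipschitz constants. *)
Definition enorm x : R := Num.sqrt (\sum_i x 0 i ^+ 2).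

Definition eball x (r : R) : set 'rV[R]_d := [set y | enorm (y - x) < r].

Definition partial (i : 'I_d) (f : 'rV[R]_d -> R) : 'rV[R]_d -> R :=
  'D_(delta_mx 0 i) f.

Fixpoint Ck (k : nat) (f : 'rV[R]_d -> R) : Prop :=
  continuous f /\
  if k is k'.+1 then
    forall i, (forall x, derivable f x (delta_mx 0 i)) /\ Ck k' (partial i f)
  else True.

Definition compactly_supported (V : nmodType) U (f : 'rV[R]_d -> V) : Prop :=
  exists K, [/\ compact K, K `<=` U & forall x, ~ K x -> f x = 0].

Definition Ccoo U : set ('rV[R]_d -> R) :=
  [set f | (forall k, Ck k f) /\ compactly_supported U f].

Definition divergence (phi : 'rV[R]_d -> 'rV[R]_d) x : R :=
  \sum_i partial i (fun y => phi y 0 i) x.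

Definition perimeter U : \bar R :=
  ereal_sup [set (\int[leb]_(x in U) (divergence phi x)%:E)%E | phi in
    [set phi : 'rV[R]_d -> 'rV[R]_d |
      [/\ forall i, Ck 1 (fun x => phi x 0 i),
          compactly_supported setT phi &
          forall x, enorm (phi x) <= 1]]].

Definition density1 U : set 'rV[R]_d :=
  [set x | (fun r : R => fine (leb (U `&` eball x r)) / fine (leb (eball x r)))
             @ 0^'+ --> (1 : R)].

Definition local_supersolution (mu : R) (D E : set 'rV[R]_d) : Prop :=
  exists2 r0 : R, 0 < r0 & forall U, measurable U ->
    E `<=` U -> U `<=` D -> (exists x0, U `+` E `<=` eball x0 r0) ->
    (perimeter E + mu%:E * leb E <= perimeter U + mu%:E * leb U)%E.

End euclidean_space.

Section regularity.
Context {R : realType} {d : nat}.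

(* In orthogonal coordinates [x *m Q], [D] is near each boundary point
   the strict epigraph of a C^2 function of all the coordinates but one. *)
Definition C2_boundary (D : set 'rV[R]_d) : Prop :=
  forall x0, (closure D `\` interior D) x0 ->
  exists (r : R) (Q : 'M[R]_d) (i : 'I_d) (g : 'rV[R]_d.-1 -> R),
    [/\ 0 < r, Q *m Q^T = 1%:M, Ck 2 g &
        forall x, eball x0 r x ->
          (D x <-> g (col' i (x *m Q)) < (x *m Q) 0 i)].

Definition elipschitz (f : 'rV[R]_d -> R) : Prop :=
  exists L : R, forall x y, `|f x - f y| <= L * enorm (x - y).

End regularity.

Section sobolev.
Context {R : realType} {d : nat}.
Implicit Types (u v w f g : 'rV[R]_d -> R) (U : set 'rV[R]_d).

Definition weak_partial u (i : 'I_d) g : Prop :=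
  forall phi, Ccoo setT phi ->
    \int[leb]_x (u x * partial i phi x) = - \int[leb]_x (g x * phi x).

(* Elements of H^1 are functions, not classes: [H1], [H10] and [H10_tilde] are
   closed under almost everywhere equality. *)
Definition H1 : set ('rV[R]_d -> R) :=
  [set u | u \in Lfun leb 2%:E /\
           forall i, exists2 g, g \in Lfun leb 2%:E & weak_partial u i g].

(* The weak derivative is unique up to a null set, so the integrals below do
   not depend on the choice; [0] is a dummy value outside [H1]. *)
Definition wpartial u (i : 'I_d) : 'rV[R]_d -> R :=
  xget (cst 0) [set g | g \in Lfun leb 2%:E /\ weak_partial u i g].

Definition dirichlet u v : R :=
  \int[leb]_x (\sum_i wpartial u i x * wpartial v i x).

Definition H1norm u : R :=
  Num.sqrt ((\int[leb]_x (u x ^+ 2)) + dirichlet u u).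

Definition H10 U : set ('rV[R]_d -> R) :=
  [set u | H1 u /\ forall e : R, 0 < e ->
             exists2 phi, Ccoo U phi & H1norm (u \- phi) < e].

Definition H10_tilde U : set ('rV[R]_d -> R) :=
  [set u | H1 u /\ {ae leb, forall x, ~ U x -> u x = 0}].

(* Least (resp. greatest) element when there is one; the default [+oo] is the
   usual convention for eigenvalues when no k-dimensional subspace exists. *)
Definition minimum (A : set (\bar R)) : \bar R :=
  xget +oo%E [set m | A m /\ lbound A m].

Definition maximum (A : set (\bar R)) : \bar R :=
  xget +oo%E [set m | A m /\ ubound A m].

Definition energy f u : R :=
  2^-1 * dirichlet u u - \int[leb]_x (f x * u x).

Definition min_energy f (H : set ('rV[R]_d -> R)) : \bar R :=
  minimum [set (energy f u)%:E | u in H].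

Definition ae_zero : set ('rV[R]_d -> R) :=
  [set u | {ae leb, forall x, u x = 0}].

Definition lincomb k (b : 'I_k -> 'rV[R]_d -> R) (c : 'I_k -> R) :
  'rV[R]_d -> R := fun x => \sum_i c i * b i x.

(* [S] is spanned by a basis of [k] elements of [H], linear independence being
   that of the classes modulo almost everywhere equality. *)
Definition subspace k (H S : set ('rV[R]_d -> R)) : Prop :=
  exists b : 'I_k -> 'rV[R]_d -> R,
    [/\ forall i, H (b i),
        forall c, ae_zero (lincomb b c) -> forall i, c i = 0 &
        S = range (lincomb b)].

Definition rayleigh u : R := dirichlet u u / \int[leb]_x (u x ^+ 2).

Definition min_max k (H : set ('rV[R]_d -> R)) : \bar R :=
  minimum [set maximum [set (rayleigh u)%:E | u in S `\` ae_zero]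
             | S in subspace k H].

Definition energy_function U w : Prop :=
  H10 U w /\
  forall v, H10 U v -> dirichlet w v = \int[leb]_(x in U) v x.

End sobolev.

(* Main.v *)
(* Write E for the set of density-one points. A competitor for the perimeter of
   Omega | U is obtained by testing with (1 - a) Y - a X, where Y almost realises
   the perimeter and X is a unit field with divergence bounded below (a calibration).

   (a) Near the boundary of D, the normalised gradient of phi = g - x_i (a C^2 chart)
   calibrates the part of a competitor outside D, so cutting it off costs at most C
   times its volume; compactness of a neighbourhood of D makes C uniform.

   (b) Taking for - X an arbitrary unit field and for a a cut-off of a ball gives a
   Caccioppoli inequality; with the isoperimetric inequality it yields: if Omega misses less than delta r^d of a ball, it
   misses nothing of the concentric half ball. Hence E is open, E = Omega a.e., and
   the complement of E has density at least delta at each of its points. This gives a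
   Hardy-type inequality near the boundary, so cutting off a function that vanishes
   off E is bounded in H^1, and weak compactness identifies the two spaces.

   (c) The averages W(r, x) of the torsion function w over a smooth kernel satisfy
   that W + C r^2 is nondecreasing in r, which gives an upper semicontinuous
   representative vanishing off E. To bound it by a multiple of the distance to the
   complement, maximise w(x) - psi(|x - y|) over y outside E, psi(t) = a t - B t^2: at
   a maximum, w translated by y - x touches E from inside, and its level set has mean
   curvature too negative for the supersolution E, by calibration. Interior
   regularity then follows by comparing averages at the scale of the distance. *)

From HB Require Import structures.
From mathcomp Require Import all_boot all_order all_algebra.
From mathcomp Require Import all_classical all_reals all_analysis.
From mathcomp Require Import measurable_realfun ring lra.
Require Import Defs.
Set Implicit Arguments.
Unset Strict Implicit.
Unset Printing Implicit Defensive.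
Import Order.TTheory GRing.Theory Num.Theory.
Import numFieldNormedType.Exports.
Local Open Scope classical_set_scope.
Local Open Scope ring_scope.

(** * Lebesgue measure and square integrable functions *)

(** The perimeter is handled only as a supremum over smooth fields, so every geometric step inserts
    a test field into that supremum, and each boundary term is the integral of a cut-off gradient
    that must be controlled before a limit is taken. In (b) this asks for a radius at which the
    volume of the missing part grows at a controlled rate; it is found by optimising a function of
    one variable. In (c) the distance to the complement is not smooth; doubling the points moves the
    regularity question to [w] at an interior point, where averages replace it. There the choice
    [B = 1 + Lam a] gives the normalised gradient the divergence [(2 B - 1) / p > Lam] for every
    slope [p <= a], and [a] can be taken large because the admissible range of [|x - y|] depends on
    [Lam] alone. Weak gradients of [|w|] and of [max (w - t phi) 0] enter only through an inequality
    between Dirichlet integrals, obtained from difference quotients. *)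

Section borel.
Context {R : realType} {d : nat}.
Local Notation V := 'rV[R]_d.

Lemma measurable_coord i : measurable_fun [set: V] (fun x : V => x 0 i).
Proof.
move=> _ A mA; rewrite setTI; apply: measurable_row_of_tuple.
rewrite (_ : _ @^-1` _ = (fun t => tnth t i) @^-1` A); last first.
  by apply/seteqP; split => t /=; rewrite mxE.
by rewrite -[X in measurable X]setTI; exact: measurable_tnth.
Qed.

(** An open set is a countable union of rational sup-norm balls, so measurable coordinates suffice.
    The source is an arbitrary measurable space because sums and differences of two points, as
    functions on the product of two copies of the space, are needed later. *)
Lemma measurable_open_preimage dT (T : measurableType dT) (f : T -> V) (U : set V) :
  (forall i, measurable_fun setT (fun t => f t 0 i)) -> open U ->
  measurable (f @^-1` U).
Proof.
move=> mf oU.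
pose box (q : 'rV[rat]_d * nat) : set V :=
  [set y | forall i, `|y 0 i - ratr (q.1 0 i)| < q.2.+1%:R^-1].
have -> : U = \bigcup_(q in [set q | box q `<=` U]) box q.
  apply/seteqP; split => [x Ux|x [q qU]]; last exact: qU.
  have /nbhs_ballP[e /= e0 eU] : nbhs x U by exact: open_nbhs_nbhs.
  have e20 : 0 < e / 2 by rewrite divr_gt0.
  have [n _ /(_ n (leqnn n)) ne] := near_infty_natSinv_lt (PosNum e20).
  rewrite /= in ne.
  have hq i : exists q : rat, `|x 0 i - ratr q| < n.+1%:R^-1.
    have n0 : 0 < n.+1%:R^-1 :> R by rewrite invr_gt0.
    have [r [/= Hr [q _ qr]]] := @dense_rat R (ball (x 0 i) n.+1%:R^-1)
      (ex_intro _ (x 0 i) (ballxx (x 0 i) n0)) (ball_open (x 0 i) _).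
    by exists q; move: Hr; rewrite -qr /ball /=.
  have [q qP] := choice hq.
  exists (\row_i q i, n); last by move=> i /=; rewrite mxE.
  move=> y /= yq; apply: eU; split => // i j; rewrite ord1 => {i}.
  have := yq j; rewrite mxE => h; rewrite /ball /= .
  have -> : x 0 j - y 0 j = (x 0 j - ratr (q j)) - (y 0 j - ratr (q j)) by ring.
  by apply: (le_lt_trans (ler_normB _ _)); rewrite (splitr e) ltrD// (lt_trans _ ne).
rewrite preimage_bigcup bigcup_mkcond.
apply: countable_bigcupT_measurable; first exact: countableP.
move=> q; case: ifPn => // _.
rewrite (_ : _ @^-1` _ = \bigcap_(i in [set: 'I_d])
   ((fun t => f t 0 i) @^-1` [set r : R | `|r - ratr (q.1 0 i)| < q.2.+1%:R^-1])); last first.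
  by apply/seteqP; split => x /= h i; [move=> _; exact: h|exact: h].
apply: fin_bigcap_measurable => // i _; rewrite -[X in measurable X]setTI.
apply: mf => //.
rewrite (_ : [set _ | _] = ball (ratr (q.1 0 i) : R) q.2.+1%:R^-1); first by apply: open_measurable; apply: ball_open; rewrite invr_gt0.
by apply/seteqP; split => r; rewrite /ball/= distrC.
Qed.

Lemma measurable_comp_continuous dT (T : measurableType dT) (f : T -> V) (g : V -> R) :
  (forall i, measurable_fun setT (fun t => f t 0 i)) -> continuous g ->
  measurable_fun setT (g \o f).
Proof.
move=> mf cg; apply: (measurability (@RGenOpens.G R)).
  exact: RGenOpens.measurableE.
move=> _ [_ [a [b ->] <-]]; rewrite setTI comp_preimage.
by apply: measurable_open_preimage => //; apply: open_comp => // x _; exact: cg.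
Qed.

Lemma open_measurable_leb (U : set V) : open U -> measurable U.
Proof.
by move=> oU; exact: (measurable_open_preimage (f := @id V) measurable_coord oU).
Qed.

Lemma continuous_measurable_leb (g : V -> R) :
  continuous g -> measurable_fun setT g.
Proof.
by move=> cg; exact: (measurable_comp_continuous (f := @id V) measurable_coord cg).
Qed.

Lemma leb_finite_box (a : R) :
  (leb [set x : V | (forall i, `]- a, a]%classic (x 0 i))%R] < +oo)%E.
Proof.
(* A box of negative half-side is empty only in positive dimension; for [d = 0] it is the whole
   one-point space. *)
have [a0|a0] := leP 0 a; last first.
  have [d0|d0] := posnP d.
    apply: (@le_lt_trans _ _ (leb [set x : V | (forall i, `](0 : V) 0 i, (0 : V) 0 i]%classic (x 0 i))%R])).
      by apply: (le_outer_measure (lebesgue_outer : {outer_measure set V -> \bar R})) => x _ i; exfalso; case: i; rewrite d0.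
    by rewrite leb_box ?ltry.
  rewrite [X in leb X](_ : _ = set0) ?measure0//.
  apply/seteqP; split => // x /(_ (Ordinal d0)) /=; rewrite in_itv/= => /andP[h1 h2].
  by have := lt_le_trans h1 h2; lra.
have h := @leb_box R d (const_mx (- a)) (const_mx a).
have -> : [set x : V | (forall i, `]- a, a]%classic (x 0 i))%R] =
   [set x : V | forall i, `](const_mx (- a) : V) 0 i, (const_mx a : V) 0 i]%classic (x 0 i)].
  by apply/seteqP; split => x /= + i => /(_ i); rewrite !mxE.
by rewrite h ?ltry// => i; rewrite !mxE; lra.
Qed.
End borel.

(** * Translation invariance of Lebesgue measure *)

Section translation.
Context {R : realType}.

Lemma lebesgue_shift (h : R) (A : set (measurableTypeR R)) : measurable A ->
  lebesgue_measure ((fun x => x + h) @^-1` A) = lebesgue_measure A.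
Proof.
move=> mA.
have mf : measurable_fun setT (fun x : measurableTypeR R => x + h : measurableTypeR R).
  exact: measurable_funD.
pose f : {mfun measurableTypeR R >-> measurableTypeR R} :=
  HB.pack (fun x : measurableTypeR R => x + h : measurableTypeR R)
  (isMeasurableFun.Build _ _ _ _ _ mf).
suff : forall A, measurable A -> lebesgue_measure A = pushforward lebesgue_measure f A.
  by move=> /(_ _ mA) ->.
apply: lebesgue_measure_unique => _ [[a b]] /= _ <-.
rewrite /pushforward /= (_ : _ @^-1` _ = `]a - h, b - h]%classic); last first.
  by apply/seteqP; split => x /=; rewrite !in_itv/= => /andP[h1 h2]; apply/andP; split; lra.
by rewrite !lebesgue_measure_itv/= !lte_fin ltrD2r -!EFinD; case: ifPn => // _; congr EFin; ring.
Qed.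

Definition tshift n (h : 'I_n -> R) (t : n.-tuple (measurableTypeR R)) :
  n.-tuple (measurableTypeR R) := [tuple tnth t i + h i | i < n].

Lemma measurable_tshift n (h : 'I_n -> R) : measurable_fun setT (tshift h).
Proof.
apply/measurable_fun_tnthP => i.
rewrite (_ : _ \o _ = fun t => tnth t i + h i).
  by apply: measurable_funD => //; exact: measurable_tnth.
by apply/funext => t /=; rewrite tnth_mktuple.
Qed.

Lemma tuple_lebesgue_shift n (h : 'I_n -> R) A : measurable A ->
  tuple_lebesgue n (tshift h @^-1` A) = tuple_lebesgue n A.
Proof.
elim: n h A => [|n IH] h A mA.
  rewrite (_ : tshift h @^-1` A = A)//.
  by apply/seteqP; split => t /=; rewrite (tuple0 (tshift h t)) (tuple0 t).
rewrite /= /cons_measure /pushforward.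
pose g (p : measurableTypeR R * n.-tuple (measurableTypeR R)) :
  measurableTypeR R * n.-tuple (measurableTypeR R) :=
  (p.1 + h ord0, tshift (fun i => h (lift ord0 i)) p.2).
have mg : measurable_fun setT g.
  apply: measurable_fun_pair; first exact: measurable_funD.
  by apply: measurableT_comp; [exact: measurable_tshift|exact: measurable_snd].
pose f : {mfun _ >-> _} := HB.pack g (isMeasurableFun.Build _ _ _ _ _ mg).
have mB : measurable (@tcons R n @^-1` A).
  by rewrite -[X in measurable X]setTI; exact: measurable_tcons.
rewrite (_ : _ @^-1` (_ @^-1` _) = f @^-1` (@tcons R n @^-1` A)); last first.
  apply/seteqP; suff e p : tshift h (tcons p) = tcons (f p).
    by split => p /=; rewrite e.
  apply: eq_from_tnth => i; rewrite tnth_mktuple.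
  case: (unliftP ord0 i) => [j|] ->; last by rewrite /tcons !tnth0.
  by rewrite /tcons !tnthS /= tnth_mktuple.
apply/esym.
apply: (@product_measure_unique _ _ _ _ R lebesgue_measure (tuple_lebesgue n)
  (pushforward (lebesgue_measure \x tuple_lebesgue n)%E f)) => // B C mB' mC.
rewrite /= /pushforward (_ : _ @^-1` _ = ((fun x => x + h ord0) @^-1` B) `*`
  (tshift (fun i => h (lift ord0 i)) @^-1` C)); last by apply/seteqP; split.
rewrite product_measure1E.
- rewrite IH//; congr (_ * _)%E; exact: lebesgue_shift.
- by rewrite -[X in measurable X]setTI; exact: measurable_funD.
- by rewrite -[X in measurable X]setTI; exact: measurable_tshift.
Qed.

Context {d : nat}.
Local Notation V := 'rV[R]_d.

(** Covers are translated, so the argument bears on the outer measure and the invariance holds for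
    every set; the measurability of translates then follows from Caratheodory's criterion. *)
Lemma leb_shift_le (h : V) (A : set V) : (leb ((fun x => x + h)%R @^-1` A) <= leb A)%E.
Proof.
apply: le_ereal_inf_tmp => _ /= [F [mF AF] <-].
apply: ereal_inf_lbound => /=.
exists (fun k => tshift (h 0) @^-1` F k).
  split; first by move=> k; rewrite -[X in measurable X]setTI; exact: measurable_tshift.
  rewrite -preimage_bigcup => t /= At; apply: AF => /=.
  suff -> : row_of_tuple (tshift (h 0) t) = row_of_tuple t + h by [].
  by apply/rowP => i; rewrite !mxE tnth_mktuple.
by apply: eq_eseriesr => k _; rewrite tuple_lebesgue_shift.
Qed.

Lemma leb_shift (h : V) (A : set V) : leb ((fun x => x + h)%R @^-1` A) = leb A.
Proof.
apply/eqP; rewrite eq_le leb_shift_le/=.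
have := leb_shift_le (- h) ((fun x => x + h)%R @^-1` A).
by rewrite -comp_preimage (_ : (_ \o _)%FUN = id) ?preimage_id//; apply/funext => x /=; rewrite subrK.
Qed.

End translation.
Section translation2.
Context {R : realType} {d : nat}.
Local Notation V := 'rV[R]_d.
Lemma measurable_shift (h : V) : measurable_fun setT (fun x : V => (x + h)%R).
Proof.
move=> _ A mA; rewrite setTI.
suff : caratheodory_measurable (@lebesgue_outer R d) ((fun x => (x + h)%R) @^-1` A) by [].
move=> X.
have e (B : set V) : lebesgue_outer B = lebesgue_outer ((fun x => x - h) @^-1` B).
  by rewrite -[LHS](leb_shift (- h)).
have sK : (fun x : V => (x - h)%R) @^-1` ((fun x : V => (x + h)%R) @^-1` A) = A.
  by rewrite -comp_preimage (_ : (_ \o _)%FUN = id) ?preimage_id//; apply/funext => x /=; rewrite subrK.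
have cA : caratheodory_measurable (@lebesgue_outer R d) A := mA.
have := cA ((fun x : V => (x - h)%R) @^-1` X).
have H1 : (fun x : V => (x - h)%R) @^-1` X `&` A =
    (fun x : V => (x - h)%R) @^-1` (X `&` (fun x : V => (x + h)%R) @^-1` A).
  by rewrite preimage_setI sK.
have H2 : (fun x : V => (x - h)%R) @^-1` X `&` ~` A =
    (fun x : V => (x - h)%R) @^-1` (X `&` ~` ((fun x : V => (x + h)%R) @^-1` A)).
  by rewrite preimage_setI -preimage_setC sK.
rewrite H1 H2 => H.
exact: (etrans (e X) (etrans H (esym (congr2 adde (e _) (e _))))).
Qed.

End translation2.
Section leb_sigma_finite.
Context {R : realType} {d : nat}.
Local Notation V := 'rV[R]_d.

Definition cube (a : R) : set V := [set x | forall i, `]- a, a]%classic (x 0 i)].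

Lemma cubeP a x : cube a x <-> forall i, - a < x 0 i <= a.
Proof. by split => h i; have := h i; rewrite /= in_itv. Qed.

Lemma measurable_cube a : measurable (cube a).
Proof.
rewrite (_ : cube a = \bigcap_(i in [set: 'I_d]) ((fun x : V => x 0 i) @^-1` `]- a, a]%classic)).
  apply: fin_bigcap_measurable => // i _; rewrite -[X in measurable X]setTI.
  exact: measurable_coord.
by apply/seteqP; split => x h i; [move=> _; exact: h|exact: h].
Qed.

Lemma leb_sigma_finite : sigma_finite setT (@leb R d).
Proof.
exists (fun n => cube n%:R).
  apply/seteqP; split => // x _.
  have [n hn] : exists n : nat, forall i, `|x 0 i| < n%:R.
    exists (\max_i Num.bound `|x 0%R i|%R)%N => i.
    apply: (lt_le_trans (archi_boundP (normr_ge0 _))); rewrite ler_nat.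
    exact: (leq_bigmax_cond (F := fun i => Num.bound `|x 0%R i|%R)).
  exists n => //; apply/cubeP => i.
  by have := hn i; rewrite ltr_norml => /andP[-> /ltW ->].
by move=> n; split; [exact: measurable_cube|exact: leb_finite_box].
Qed.

HB.instance Definition _ := Measure_isSigmaFinite.Build _ _ _ (@leb R d) leb_sigma_finite.

Lemma leb_cube (a : R) : 0 <= a -> leb (cube a) = ((a *+ 2) ^+ d)%:E.
Proof.
move=> a0; have h := @leb_box R d (const_mx (- a)) (const_mx a).
rewrite (_ : cube a = [set x : V | forall i, `](const_mx (- a) : V) 0 i, (const_mx a : V) 0 i]%classic (x 0 i)]); last first.
  by apply/seteqP; split => x /= + i => /(_ i); rewrite !mxE.
rewrite h => [|i]; last by rewrite !mxE; lra.
congr EFin; under eq_bigr do rewrite !mxE opprK -mulr2n.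
by rewrite prodr_const card_ord.
Qed.

End leb_sigma_finite.

(** * Real-valued integrals *)

Section integral_toolkit.
Context {dT : measure_display} {T : measurableType dT} {R : realType}.
Variable mu : {measure set T -> \bar R}.
Local Notation V := T.
Implicit Types f g : V -> R.

(** All integrals are real and over the whole space; an integral over a subset carries an indicator
    factor, which keeps linearity and monotonicity free of domain bookkeeping. *)
Definition mintegrable f := mu.-integrable [set: T] (EFin \o f).
Definition mintegral f : R := \int[mu]_x f x.
Local Notation itg := mintegrable.
Local Notation rint := mintegral.

Lemma itg_measurable f : itg f -> measurable_fun setT f.
Proof. by move/measurable_int/measurable_EFinP. Qed.

Lemma itgD f g : itg f -> itg g -> itg (fun x => f x + g x).
Proof. by move=> hf hg; have := integrableD measurableT hf hg. Qed.

Lemma itgB f g : itg f -> itg g -> itg (fun x => f x - g x).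
Proof. by move=> hf hg; have := integrableB measurableT hf hg. Qed.

Lemma itgZ c f : itg f -> itg (fun x => c * f x).
Proof. by move=> hf; have := integrableZl measurableT c hf. Qed.

Lemma itg0 : itg (cst 0).
Proof. exact: integrable0. Qed.

Lemma itg_norm f : itg f -> itg (fun x => `|f x|).
Proof. by move/integrable_norm. Qed.

Lemma itg_le g f : measurable_fun setT f -> (forall x, `|f x| <= g x) -> itg g -> itg f.
Proof.
move=> mf fg ig; apply: (le_integrable measurableT _ _ ig).
  exact/measurable_EFinP.
by move=> x _; rewrite /= lee_fin (le_trans (fg x))// ler_norm.
Qed.

Lemma itg_sum (I : Type) (s : seq I) (h : I -> V -> R) :
  (forall i, itg (h i)) -> itg (fun x => \sum_(i <- s) h i x).
Proof.
move=> hi; elim: s => [|i s IH].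
  by under [X in itg X]funext do rewrite big_nil; exact: itg0.
by under [X in itg X]funext do rewrite big_cons; exact: itgD.
Qed.

Lemma itg_mulb C f g : itg f -> measurable_fun setT g -> (forall x, `|g x| <= C) ->
  itg (fun x => f x * g x).
Proof.
move=> hf mg gC; apply: (@itg_le (fun x => C * `|f x|)).
- exact: (measurable_funM (itg_measurable hf) mg).
- by move=> x; rewrite normrM mulrC ler_wpM2r.
- by apply: itgZ; exact: itg_norm.
Qed.

Lemma intD f g : itg f -> itg g -> rint (fun x => f x + g x) = rint f + rint g.
Proof. by move=> hf hg; exact: RintegralD. Qed.

Lemma intB f g : itg f -> itg g -> rint (fun x => f x - g x) = rint f - rint g.
Proof. by move=> hf hg; exact: RintegralB. Qed.

Lemma intZ c f : itg f -> rint (fun x => c * f x) = c * rint f.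
Proof. by move=> hf; exact: RintegralZl. Qed.

Lemma intN f : itg f -> rint (fun x => - f x) = - rint f.
Proof. by move=> hf; under [X in rint X]funext do rewrite -mulN1r; rewrite intZ// mulN1r. Qed.

Lemma int0 : rint (cst 0) = 0.
Proof. by rewrite /mintegral /Rintegral /= integral0. Qed.

Lemma int_sum (I : Type) (s : seq I) (h : I -> V -> R) :
  (forall i, itg (h i)) -> rint (fun x => \sum_(i <- s) h i x) = \sum_(i <- s) rint (h i).
Proof.
move=> hi; elim: s => [|i s IH].
  by rewrite big_nil; under [X in rint X]funext do rewrite big_nil; exact: int0.
rewrite big_cons; under [X in rint X]funext do rewrite big_cons.
by rewrite intD// ?IH//; exact: itg_sum.
Qed.

Lemma int_le f g : itg f -> itg g -> (forall x, f x <= g x) -> rint f <= rint g.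
Proof. by move=> hf hg h; apply: le_Rintegral. Qed.

Lemma int_ge0 f : (forall x, 0 <= f x) -> 0 <= rint f.
Proof. by move=> h; apply: Rintegral_ge0. Qed.

Lemma int_norm f : itg f -> `|rint f| <= rint (fun x => `|f x|).
Proof. by move=> hf; exact: le_normr_Rintegral. Qed.

Lemma EFin_int f : itg f -> (rint f)%:E = (\int[mu]_x (f x)%:E)%E.
Proof. by move=> hf; rewrite /mintegral /Rintegral fineK//; exact: integrable_fin_num. Qed.

Lemma int_dct (fn : nat -> V -> R) f g : (forall n, measurable_fun setT (fn n)) ->
  itg g -> (forall n x, `|fn n x| <= g x) ->
  (forall x, fn n x @[n --> \oo] --> f x) ->
  itg f /\ rint (fn n) @[n --> \oo] --> rint f.
Proof.
move=> mfn ig fng fnf.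
have mf : measurable_fun setT f.
  by apply: (measurable_fun_cvg mfn) => // x _; exact: fnf.
have := @dominated_convergence _ _ _ mu _ measurableT (fun n => EFin \o fn n)
   (EFin \o f) (EFin \o g) _ _ _ ig _.
case.
- by move=> n; exact/measurable_EFinP.
- exact/measurable_EFinP.
- by apply: aeW => x _ /=; apply: cvg_EFin; [exact: nearW|exact: fnf].
- by apply: aeW => x n _; rewrite /= lee_fin.
- move=> h1 _ h3; split => //.
  by apply: fine_cvg; rewrite -[X in _ --> X]/((rint f)%:E) EFin_int.
Qed.

Lemma int_preserving (phi : T -> T) f : measurable_fun setT phi ->
  (forall A, measurable A -> mu (phi @^-1` A) = mu A) -> itg f ->
  itg (f \o phi) /\ rint (f \o phi) = rint f.
Proof.
move=> ms pE hf.
pose phi' : {mfun T >-> T} := HB.pack phi (isMeasurableFun.Build _ _ _ _ _ ms).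
have ifh : itg (f \o phi).
  apply/integrableP; split.
    by apply/measurable_EFinP; exact: (measurableT_comp (itg_measurable hf) ms).
  move/integrableP : hf => [mf]; apply: le_lt_trans.
  rewrite le_eqVlt; apply/orP; left; apply/eqP.
  transitivity (\int[pushforward mu phi']_x `|(f x)%:E|)%E.
    rewrite (@ge0_integral_pushforward _ _ _ _ _ phi' _ mu setT (abse \o (EFin \o f)))//.
      by apply: measurableT_comp.
    by move=> y _; exact: abse_ge0.
  by apply: eq_measure_integral => //= A mA _; rewrite /pushforward -[RHS]pE.
split => //; rewrite /mintegral /Rintegral; congr fine.
transitivity (\int[pushforward mu phi']_x (f x)%:E)%E.
  rewrite (@integral_pushforward _ _ _ _ _ phi' _ mu setT (EFin \o f))//.
  exact/measurable_EFinP/itg_measurable.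
by apply: eq_measure_integral => //= A mA _; rewrite /pushforward -[RHS]pE.
Qed.

Lemma int_ae f g : measurable_fun setT f -> measurable_fun setT g ->
  {ae mu, forall x, f x = g x} -> rint f = rint g.
Proof.
move=> mf mg fg; rewrite /mintegral /Rintegral; congr fine.
apply: ae_eq_integral => //; try exact/measurable_EFinP.
by apply: filterS fg => x -> .
Qed.

Lemma itg_ae f g : measurable_fun setT g -> itg f ->
  {ae mu, forall x, f x = g x} -> itg g.
Proof.
move=> mg /integrableP[mf fo] fg; apply/integrableP; split; first exact/measurable_EFinP.
rewrite (@ae_eq_integral _ _ _ _ _ (abse \o (EFin \o f)) (abse \o (EFin \o g))) //.
- by apply: measurableT_comp => //; exact/measurable_EFinP.
- exact: measurableT_comp.
- by apply: filterS fg => x /= -> .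
Qed.

Lemma int_eq0_ae f : itg f -> (forall x, 0 <= f x) -> rint f = 0 ->
  {ae mu, forall x, f x = 0}.
Proof.
move=> hf f0 h.
have mf : measurable_fun setT (EFin \o f) by exact/measurable_EFinP/itg_measurable.
have : (\int[mu]_x `|(EFin \o f) x| = 0)%E.
  under eq_integral do rewrite /= ger0_norm//.
  by rewrite -EFin_int// h.
move/(ae_eq_integral_abs mu measurableT mf); apply: filterS => x /=.
by move=> /(_ Logic.I) [].
Qed.

Lemma itg_indic (A : set T) : measurable A -> (mu A < +oo)%E -> itg \1_A.
Proof.
move=> mA fA; apply/integrableP; split; first exact/measurable_EFinP.
under eq_integral do rewrite /= ger0_norm//.
by rewrite integral_indic// setIT.
Qed.

Lemma int_indic (A : set T) : measurable A -> rint \1_A = fine (mu A).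
Proof. by move=> mA; rewrite /mintegral /Rintegral integral_indic// setIT. Qed.

End integral_toolkit.

Local Notation itg := mintegrable.
Local Notation rint := mintegral.

(** * Riesz representation by minimising sequences *)

Section riesz.
Context {R : realType} {U : lmodType R}.
Variables (S : set U) (B : U -> U -> R).
Hypothesis S0 : S 0.
Hypothesis Slin : forall c u v, S u -> S v -> S (c *: u + v).
Hypothesis Blin : forall c u v w, S u -> S v -> S w ->
  B (c *: u + v) w = c * B u w + B v w.
Hypothesis Bsym : forall u v, S u -> S v -> B u v = B v u.
Hypothesis Bge0 : forall u, S u -> 0 <= B u u.

Let Bexp c u v : S u -> S v ->
  B (c *: u + v) (c *: u + v) = c ^+ 2 * B u u + 2 * c * B u v + B v v.
Proof.
move=> Su Sv; have Sw := Slin c Su Sv.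
by rewrite Blin// (Bsym Su Sw) (Bsym Sv Sw) !Blin// (Bsym Sv Su); ring.
Qed.

(** [S] need not be complete, so the conclusion speaks of a minimising sequence of
    [B u u / 2 - l u]. Comparing two terms with their midpoint gives the Cauchy estimate (the factor
    4 inverts the 1/4 of the parallelogram identity), and comparing [x n] with [x n + t y] gives the
    convergence of [B (x n) y]. *)
Lemma riesz_sequence (l : U -> R) (C : R) :
  (forall c u v, S u -> S v -> l (c *: u + v) = c * l u + l v) ->
  (forall u, S u -> l u ^+ 2 <= C * B u u) ->
  exists x : nat -> U, [/\ forall n, S (x n),
    forall n m, B (x n - x m) (x n - x m) <= 4 * (n.+1%:R^-1 + m.+1%:R^-1) &
    forall y, S y -> B (x n) y @[n --> \oo] --> l y].
Proof.
move=> llin lC.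
pose J u := 2^-1 * B u u - l u.
have Jlb u : S u -> - (`|C| / 2) <= J u.
  move=> Su; rewrite /J.
  have h1 : l u ^+ 2 <= `|C| * B u u.
    by apply: (le_trans (lC u Su)); rewrite ler_wpM2r ?Bge0// ler_norm.
  have h2 : l u ^+ 2 <= ((`|C| + B u u) / 2) ^+ 2.
    apply: (le_trans h1); have := sqr_ge0 (`|C| - B u u); nra.
  have b0 := Bge0 Su; have c0 : 0 <= `|C| by [].
  have := h2; rewrite -ler_sqrt ?sqr_ge0// !sqrtr_sqr [X in _ <= X]ger0_norm; last by rewrite divr_ge0// addr_ge0.
  by have := ler_norm (l u); lra.
pose A := [set J u | u in S].
have Ai : has_inf A.
  split; first by exists (J 0); exists 0.
  by exists (- (`|C| / 2)) => _ [u Su <-]; exact: Jlb.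
have hx n : exists u, S u /\ J u <= inf A + n.+1%:R^-1.
  have n0 : 0 < n.+1%:R^-1 :> R by rewrite invr_gt0.
  by have [_ [u Su <-] /ltW h] := inf_adherent n0 Ai; exists u.
have [x hx'] := choice hx.
have Jinf u : S u -> inf A <= J u.
  by move=> Su; apply: ge_inf; [exact: Ai.2|exists u].
have Sx n := (hx' n).1.
exists x; split => //.
- move=> n m.
  have Sd : S (2^-1 *: (x n + x m)).
    have := Slin 2^-1 (Sx n) (Slin 2^-1 (Sx m) S0).
    by rewrite addr0 -scalerDr.
  have e1 : B (x n - x m) (x n - x m) = B (x n) (x n) - 2 * B (x n) (x m) + B (x m) (x m).
    by rewrite addrC -scaleN1r Bexp// (Bsym (Sx m) (Sx n)); ring.
  have Jh : J (2^-1 *: (x n + x m)) = 2^-1 * (4^-1 * (B (x n) (x n) + 2 * B (x n) (x m) + B (x m) (x m)))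
      - 2^-1 * (l (x n) + l (x m)).
    have l0 : l 0 = 0.
      by have := llin 1 0 0 S0 S0; rewrite scaler0 addr0 => /eqP; lra.
    have B0 u : S u -> B u 0 = 0.
      by move=> Su; rewrite (Bsym Su S0); have := Blin 1 S0 S0 Su; rewrite scaler0 addr0 => /eqP; lra.
    have Sm := Slin 2^-1 (Sx m) S0.
    rewrite scalerDr -[2^-1 *: x m]addr0 /J !Bexp// llin// llin// l0.
    rewrite (Bsym (Sx n) Sm) Blin// (B0 _ (Sx m)) (B0 _ S0) (Bsym S0 (Sx n)) (B0 _ (Sx n)).
    by rewrite (Bsym (Sx m) (Sx n)); field.
  have := Jinf _ Sd; rewrite Jh e1.
  by move: (hx' n).2 (hx' m).2; move: (n.+1%:R^-1) (m.+1%:R^-1) => a b; rewrite /J; lra.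
- move=> y Sy.
  have key n t : - n.+1%:R^-1 <= t * (B (x n) y - l y) + 2^-1 * t ^+ 2 * B y y.
    move: (Jinf _ (Slin t Sy (Sx n))) (hx' n).2; move: (n.+1%:R^-1) => a; rewrite /J.
    by rewrite Bexp// llin// (Bsym Sy (Sx n)); lra.
  apply/cvgrPdist_le => e e0.
  have By := Bge0 Sy.
  (* With this [t] the quadratic term costs at most half of [t e]; the other half absorbs the
     minimisation error [1 / (n + 1)]. *)
  pose t := e / (2 * (B y y + 1)).
  have t0 : 0 < t by rewrite divr_gt0// mulr_gt0//; lra.
  have tB : t * B y y <= e / 2.
    have tE : t * (2 * (B y y + 1)) = e by rewrite /t divfK// mulf_neq0//; lra.
    by nra.
  have te : 0 < t * (e / 2) by rewrite mulr_gt0// divr_gt0.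
  near=> n.
  have hn : n.+1%:R^-1 <= t * (e / 2).
    by apply: ltW; near: n; exact: (near_infty_natSinv_lt (PosNum te)).
  move: hn (key n t) (key n (- t)); move: (n.+1%:R^-1) => a hn k2 k1.
  have k1' : t * (B (x n) y - l y) <= t * e by nra.
  have k2' : - (t * e) <= t * (B (x n) y - l y) by nra.
  rewrite ler_norml; apply/andP; split.
    by rewrite -(ler_pM2l t0); lra.
  by rewrite -(ler_pM2l t0); lra.
Unshelve. all: by end_near. Qed.

End riesz.

(** * Square integrable functions and completeness *)

Section L2.
Context {dT : measure_display} {T : measurableType dT} {R : realType}.
Variable mu : {measure set T -> \bar R}.
Implicit Types f g u v : T -> R.
Local Notation itg := (mintegrable mu).
Local Notation rint := (mintegral mu).

Definition L2fun f := measurable_fun setT f /\ itg (fun x => f x ^+ 2).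
Local Notation L2 := L2fun.

Lemma LfunP f : f \in Lfun mu 2%:E <-> L2 f.
Proof.
split=> [h|[mf hf]].
  split; last exact: Lfun2_integrable_sqr.
  by move: h; rewrite inE => /andP[/[!inE]/=].
rewrite inE; apply/andP; split; rewrite inE//= /finite_norm.
apply: (lty_poweRy (r := 2)) => //; rewrite poweR_Lnorm//.
move/integrableP : hf => [_]; apply: le_lt_trans; rewrite le_eqVlt; apply/orP; left; apply/eqP.
apply: eq_integral => x _ /=.
by rewrite powR_mulrn// normrX.
Qed.

Lemma L2_mul f g : L2 f -> L2 g -> itg (fun x => f x * g x).
Proof.
move=> [mf hf] [mg hg]; apply: (@itg_le _ _ _ _ (fun x => f x ^+ 2 + g x ^+ 2)).
- exact: measurable_funM.
- by move=> x; rewrite ler_norml; apply/andP; split; nra.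
- exact: itgD.
Qed.

Lemma L2Z c f : L2 f -> L2 (fun x => c * f x).
Proof.
move=> [mf hf]; split; first exact: measurable_funM.
by under [X in itg X]funext do rewrite exprMn; exact: itgZ.
Qed.

Lemma L2D f g : L2 f -> L2 g -> L2 (fun x => f x + g x).
Proof.
move=> hf hg; have hfg := L2_mul hf hg; move: hf hg => [mf hf] [mg hg].
split; first exact: measurable_funD.
under [X in itg X]funext do rewrite sqrrD -mulr_natl.
by apply: itgD => //; apply: itgD => //; exact: itgZ.
Qed.

Lemma L2N f : L2 f -> L2 (fun x => - f x).
Proof. by move=> hf; under [X in L2 X]funext do rewrite -mulN1r; exact: L2Z. Qed.

Lemma L2B f g : L2 f -> L2 g -> L2 (fun x => f x - g x).
Proof. by move=> hf hg; exact: (L2D hf (L2N hg)). Qed.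

Lemma L2_le g f : measurable_fun setT f -> (forall x, `|f x| <= `|g x|) -> L2 g -> L2 f.
Proof.
move=> mf fg [mg hg]; split => //; apply: (@itg_le _ _ _ _ (fun x => g x ^+ 2)) => //.
  exact: measurable_funX.
by move=> x; rewrite normrX -[leRHS]real_normK ?num_real// ler_pXn2r ?nnegrE.
Qed.

Lemma L2_mulb C f g : L2 f -> measurable_fun setT g -> (forall x, `|g x| <= C) ->
  L2 (fun x => f x * g x).
Proof.
move=> hf mg gC; apply: (@L2_le (fun x => C * f x)).
- exact: (measurable_funM hf.1 mg).
- by move=> x; rewrite !normrM mulrC ler_wpM2r// (le_trans (gC x))// ler_norm.
- exact: L2Z.
Qed.

Lemma L2_bounded C f : itg f -> (forall x, `|f x| <= C) -> L2 f.
Proof.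
move=> hf fC; split; first exact: (itg_measurable hf).
under [X in itg X]funext do rewrite expr2.
exact: (itg_mulb hf (itg_measurable hf) fC).
Qed.

Lemma L2_ae f g : measurable_fun setT g -> L2 f -> {ae mu, forall x, f x = g x} -> L2 g.
Proof.
move=> mg [mf hf] fg; split => //; apply: (itg_ae _ hf); first exact: measurable_funX.
by apply: filterS fg => x ->.
Qed.

Lemma int_sqr_ge0 f : 0 <= rint (fun x => f x ^+ 2).
Proof. by apply: int_ge0 => x; rewrite sqr_ge0. Qed.

Lemma int_sqr_lin c f g : L2 f -> L2 g -> rint (fun x => (f x + c * g x) ^+ 2) =
  rint (fun x => f x ^+ 2) + 2 * c * rint (fun x => f x * g x) + c ^+ 2 * rint (fun x => g x ^+ 2).
Proof.
move=> hf hg; have fg := L2_mul hf hg.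
rewrite -!intZ ?hg.2// -!intD ?hg.2 ?hf.2//.
- by congr (lebesgue_Rintegral.Rintegral _ _ _); apply/funext => x; ring.
- by apply: itgD; [exact: hf.2|exact: itgZ].
- exact: (itgZ _ hg.2).
- exact: itgZ.
Qed.

Lemma cauchy_schwarz f g : L2 f -> L2 g ->
  rint (fun x => f x * g x) ^+ 2 <= rint (fun x => f x ^+ 2) * rint (fun x => g x ^+ 2).
Proof.
move=> hf hg.
have h c : 0 <= rint (fun x => f x ^+ 2) + 2 * c * rint (fun x => f x * g x) + c ^+ 2 * rint (fun x => g x ^+ 2).
  by rewrite -int_sqr_lin//; exact: int_sqr_ge0.
set a := rint (fun x => f x ^+ 2) in h *; set b := rint (fun x => f x * g x) in h *.
set c := rint (fun x => g x ^+ 2) in h *.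
have c0 : 0 <= c by exact: int_sqr_ge0.
have a0 : 0 <= a by exact: int_sqr_ge0.
have [c00|cn0] := eqVneq c 0.
  have [->|bn0] := eqVneq b 0; first by rewrite expr0n /= mulr_ge0.
  have := h (- (a + 1) / (2 * b)); rewrite c00 mulr0 addr0.
  have -> : 2 * (- (a + 1) / (2 * b)) * b = - (a + 1) by field.
  by lra.
have cp : 0 < c by rewrite lt_neqAle eq_sym cn0.
have := h (- b / c).
have -> : a + 2 * (- b / c) * b + (- b / c) ^+ 2 * c = (a * c - b ^+ 2) / c by field.
by rewrite pmulr_lge0 ?invr_gt0// subr_ge0.
Qed.

Lemma int_sqrD_le f g : L2 f -> L2 g -> rint (fun x => (f x + g x) ^+ 2) <=
  2 * rint (fun x => f x ^+ 2) + 2 * rint (fun x => g x ^+ 2).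
Proof.
move=> hf hg; rewrite -!intZ ?hf.2 ?hg.2// -intD; try exact: (itgZ _ hf.2); try exact: (itgZ _ hg.2).
apply: int_le; first exact: (L2D hf hg).2.
  by apply: itgD; [exact: (itgZ _ hf.2)|exact: (itgZ _ hg.2)].
by move=> x; have := sqr_ge0 (f x - g x); lra.
Qed.

End L2.

Local Notation L2 := L2fun.
Section L2_complete.
Context {dT : measure_display} {T : measurableType dT} {R : realType}.
Variable mu : {measure set T -> \bar R}.
Implicit Types f g u v : T -> R.
Local Notation itg := (mintegrable mu).
Local Notation rint := (mintegral mu).
Local Notation L2 := (L2fun mu).

Lemma int_fatou (fn : nat -> T -> R) f C : (forall n, itg (fn n)) ->
  (forall n x, 0 <= fn n x) -> (forall x, fn n x @[n --> \oo] --> f x) ->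
  (forall n, rint (fn n) <= C) -> itg f /\ rint f <= C.
Proof.
move=> hfn fn0 fnf fC.
have mf : measurable_fun setT f.
  by apply: (measurable_fun_cvg (fun n => itg_measurable (hfn n))) => // x _; exact: fnf.
have f0 x : 0 <= f x.
  by apply: (cvgr_to_ge (fnf x)); apply: nearW => n; exact: fn0.
have key : (\int[mu]_x (f x)%:E <= C%:E)%E.
  have := @fatou _ _ _ mu _ measurableT (fun n => EFin \o fn n).
  move=> /(_ _ _)/wrap[]; first by move=> n; exact/measurable_EFinP/itg_measurable.
    by move=> n x _; rewrite lee_fin.
  under eq_integral => x _.
    have /cvg_limn_einf_sup [-> _] : (EFin \o fn ^~ x) n @[n --> \oo] --> (f x)%:E.
      by apply: cvg_EFin; [exact: nearW|exact: fnf].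
    over.
  move=> h; apply: (le_trans h); rewrite limn_einf_lim.
  apply: lime_le; first exact: is_cvg_einfs.
  apply: nearW => n; apply: (@le_trans _ _ (\int[mu]_x (EFin \o fn n) x)%E).
    by apply: ereal_inf_lbound; exists n => //=.
  by rewrite -EFin_int// lee_fin.
have hf : itg f.
  apply/integrableP; split; first exact/measurable_EFinP.
  under eq_integral do rewrite /= ger0_norm//.
  by apply: (le_lt_trans key); rewrite ltry.
by split => //; rewrite -lee_fin EFin_int.
Qed.

(** The sum of [2^k (v k.+1 - v k)^2] has integral at most 2, hence is finite almost everywhere; the
    inequality [|a| <= (2^-k + 2^k a^2) / 2] then makes the increments absolutely summable. *)
Lemma L2_subseq_cvg (v : nat -> T -> R) : (forall n, L2 (v n)) ->
  (forall k, rint (fun x => (v k.+1 x - v k x) ^+ 2) <= 4^-1 ^+ k) ->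
  {ae mu, forall x, cvgn (v ^~ x)}.
Proof.
move=> hv hk.
pose G n x := \sum_(0 <= k < n) 2 ^+ k * (v k.+1 x - v k x) ^+ 2.
have t2 k : itg (fun x => 2 ^+ k * (v k.+1 x - v k x) ^+ 2).
  by apply: itgZ; exact: (L2B (hv _) (hv _)).2.
have hG n : itg (G n) by exact: itg_sum.
have G0 n x : 0 <= G n x.
  by apply: sumr_ge0 => k _; rewrite mulr_ge0 ?sqr_ge0// exprn_ge0.
have Gnd x : {homo (G ^~ x) : n m / (n <= m)%N >-> n <= m}.
  apply: homo_leq => [//|a b c|n]; first exact: le_trans.
  by rewrite /G big_nat_recr//= lerDl mulr_ge0 ?sqr_ge0// exprn_ge0.
have intG n : rint (G n) <= 2.
  have p2 : 0 < 2 ^+ n :> R by rewrite exprn_gt0.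
  have q2 : 0 < 2 / 2 ^+ n :> R by rewrite divr_gt0.
  (* The sharper bound is the one that propagates by induction. *)
  suff : rint (G n) <= 2 - 2 / 2 ^+ n by lra.
  rewrite int_sum//; elim: n {p2 q2} => [|n IH].
    by rewrite big_geq// expr0; lra.
  have p2 : 0 < 2 ^+ n :> R by rewrite exprn_gt0.
  rewrite big_nat_recr//= intZ; last exact: (L2B (hv _) (hv _)).2.
  apply: (le_trans (lerD IH (ler_wpM2l (ltW p2) (hk n)))).
  have -> : (4^-1 : R) = 2^-1 * 2^-1 by field.
  rewrite exprMn !exprVn exprS.
  by rewrite le_eqVlt; apply/orP; left; apply/eqP; field; lra.
pose Gi x := limn (fun n => (G n x)%:E).
have mGi : measurable_fun setT Gi.
  apply: (emeasurable_fun_cvg (fun n => EFin \o G n)).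
    by move=> n; exact/measurable_EFinP/itg_measurable.
  move=> x _; apply: ereal_nondecreasing_is_cvgn => m n mn.
  by rewrite lee_fin; exact: Gnd.
have Gi0 x : (0 <= Gi x)%E.
  apply: lime_ge; last by apply: nearW => n; rewrite lee_fin.
  by apply: ereal_nondecreasing_is_cvgn => m n mn; rewrite lee_fin; exact: Gnd.
have iGi : mu.-integrable setT Gi.
  apply/integrableP; split => //.
  under eq_integral do rewrite gee0_abs//.
  apply: (@le_lt_trans _ _ 2%:E); last by rewrite ltry.
  rewrite monotone_convergence//.
  - apply: lime_le.
      apply: ereal_nondecreasing_is_cvgn => m n mn.
      by rewrite -!EFin_int// lee_fin; apply: int_le => // x; exact: Gnd.
    by apply: nearW => n; rewrite -EFin_int// lee_fin.
  - by move=> n; exact/measurable_EFinP/itg_measurable.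
  - by move=> n x _; rewrite lee_fin.
  - by move=> x _ m n mn; rewrite lee_fin; exact: Gnd.
apply: filterS (integrable_ae measurableT iGi) => x /(_ Logic.I) fx.
have Gb n : G n x <= fine (Gi x).
  rewrite -lee_fin fineK//; apply: lime_ge.
    by apply: ereal_nondecreasing_is_cvgn => m k mk; rewrite lee_fin; exact: Gnd.
  by exists n => // m /= nm; rewrite lee_fin; exact: Gnd.
have cs : cvgn (series (fun k => v k.+1 x - v k x)).
  apply: normed_cvg; apply: nondecreasing_is_cvgn.
    by apply: nondecreasing_series => k _ _ /=.
  exists (1 + 2^-1 * fine (Gi x)) => _ [n _ <-].
  apply: (@le_trans _ _ ((1 - (2 ^+ n)^-1) + 2^-1 * G n x)); last first.
    have p2 : 0 < (2 ^+ n)^-1 :> R by rewrite invr_gt0 exprn_gt0.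
    by have := Gb n; lra.
  rewrite /normed_series_of seriesEnat /G /=; elim: n => [|n IH].
    by rewrite !big_geq// expr0 invr1; lra.
  rewrite !big_nat_recr//=.
  have p2 : 0 < 2 ^+ n :> R by rewrite exprn_gt0.
  have e1 : (2 ^+ n.+1)^-1 = 2^-1 * (2 ^+ n)^-1 :> R by rewrite exprS; field; lra.
  rewrite e1; move: IH.
  set w := v n.+1 x - v n x; set q := 2 ^+ n in p2 *.
  have amgm : `|w| <= 2^-1 * q^-1 + 2^-1 * (q * w ^+ 2).
    have : 0 <= (q * `|w| - 1) ^+ 2 / q by rewrite divr_ge0 ?sqr_ge0// ltW.
    have -> : (q * `|w| - 1) ^+ 2 / q = q * `|w| ^+ 2 - 2 * `|w| + q^-1 by field; lra.
    by rewrite real_normK ?num_real//; lra.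
  by lra.
have -> : v ^~ x = fun n => v 0%N x + series (fun k => v k.+1 x - v k x) n.
  apply/funext; elim => [|n IH]; first by rewrite seriesEnat /= big_geq// addr0.
  by move: IH; rewrite seriesEnat /= => IH; rewrite big_nat_recr//= addrA -IH; ring.
by apply: is_cvgD => //; exact: is_cvg_cst.
Qed.

Lemma L2_complete (u : nat -> T -> R) : (forall n, L2 (u n)) ->
  (forall e, 0 < e -> exists N, forall m n, (N <= m)%N -> (N <= n)%N ->
     rint (fun x => (u m x - u n x) ^+ 2) <= e) ->
  exists2 f, L2 f & rint (fun x => (u n x - f x) ^+ 2) @[n --> \oo] --> 0.
Proof.
move=> hu hc.
have /choice[N hN] : forall k, exists N, forall m n, (N <= m)%N -> (N <= n)%N ->
     rint (fun x => (u m x - u n x) ^+ 2) <= 4^-1 ^+ k.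
  by move=> k; apply: hc; rewrite exprn_gt0.
pose n_ := fix n_ k := if k is k'.+1 then maxn (n_ k').+1 (N k) else N 0%N.
have nN k : (N k <= n_ k)%N by case: k => //= k; rewrite leq_maxr.
have nS k : (n_ k < n_ k.+1)%N by rewrite /= leq_maxl.
have nk k : (k <= n_ k)%N by elim: k => // k IH; apply: leq_ltn_trans (nS k).
pose v k := u (n_ k).
have hv k : L2 (v k) by exact: hu.
have cv : {ae mu, forall x, cvgn (v ^~ x)}.
  apply: L2_subseq_cvg => // k; apply: hN => //.
  by apply: (leq_trans (nN k)); exact: ltnW.
have [Z [mZ Z0 cZ]] := cv.
pose A := ~` Z.
have mA : measurable A by exact: measurableC.
have Av x : A x -> cvgn (v ^~ x).
  by move=> Ax; apply: contrapT => h; apply: Ax; exact: cZ.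
(* Killing the terms on the exceptional null set makes the subsequence converge everywhere, so that
   its limit is measurable. *)
pose w k x := v k x * \1_A x.
have m1A : measurable_fun setT (\1_A : T -> R) by exact: measurable_indic.
have wb x : `|(\1_A x : R)| <= 1 by rewrite indicE; case: (x \in A); rewrite ?normr1 ?normr0.
have hw k : L2 (w k) by apply: (L2_mulb (C := 1)).
have wv k : {ae mu, forall x, w k x = v k x}.
  exists Z; split => // x /= h; apply: contrapT => Zx; apply: h.
  by rewrite /w indicE mem_set ?mulr1.
pose f x := limn (w ^~ x).
have wf x : w k x @[k --> \oo] --> f x.
  rewrite -[X in _ --> X]/(limn (w ^~ x)) /w indicE.
  have [/set_mem Ax|_] := boolP (x \in A).
    by under eq_fun do rewrite mulr1; exact: Av.
  by under eq_fun do rewrite mulr0; exact: is_cvg_cst.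
have mf : measurable_fun setT f.
  by apply: (measurable_fun_cvg (fun k => (hw k).1)) => x _; exact: wf.
have bnd e n : 0 < e -> (exists K, forall k, (K <= k)%N -> rint (fun x => (u n x - v k x) ^+ 2) <= e) ->
    itg (fun x => (u n x - f x) ^+ 2) /\ rint (fun x => (u n x - f x) ^+ 2) <= e.
  move=> e0 [K hK].
  apply: (@int_fatou (fun k x => (u n x - w (k + K)%N x) ^+ 2)).
  - by move=> k; exact: (L2B (hu _) (hw _)).2.
  - by move=> k x; rewrite sqr_ge0.
  - move=> x; have wK : w (k + K)%N x @[k --> \oo] --> f x.
      by have := wf x; rewrite -(cvg_shiftn K).
    under eq_fun do rewrite expr2; rewrite expr2.
    have wB : u n x - w (k + K)%N x @[k --> \oo] --> u n x - f x by apply: cvgB => //; exact: cvg_cst.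
    exact: (cvgM wB wB).
  - move=> k; rewrite (int_ae (g := fun x => (u n x - v (k + K)%N x) ^+ 2)).
    + by apply: hK; rewrite leq_addl.
    + exact/measurable_funX/(L2B (hu _) (hw _)).1.
    + exact/measurable_funX/(L2B (hu _) (hv _)).1.
    + by apply: filterS (wv (k + K)%N) => x ->.
have hf : L2 f.
  have [M hM] := hc 1 ltr01.
  have [|i1 _] := @bnd 1 M ltr01.
    by exists M => k Mk; apply: hM => //; exact: leq_trans (nk k).
  have : L2 (fun x => u M x - (u M x - f x)).
    by apply: L2B => //; split => //; apply: measurable_funB => //; exact: (hu M).1.
  by under [X in L2 X -> _]funext do rewrite subKr.
exists f => //.
apply/cvgrPdist_le => e e0; have [M hM] := hc e e0.
exists M => // n /= Mn; rewrite sub0r normrN ger0_norm ?int_sqr_ge0//.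
have [|_ //] := bnd e n e0.
by exists M => k Mk; apply: hM => //; exact: leq_trans (nk k).
Qed.

End L2_complete.

(** * Differential calculus *)

Section oneD.
Context {R : realType}.
Implicit Types (f g : R -> R).

Lemma MVT0 (g dg : R -> R) (t : R) : (forall s : R, is_derive s (1 : R) g (dg s)) ->
  exists2 c, `|c| <= `|t| & g t - g 0 = t * dg c.
Proof.
move=> h; have cg a b : {within `[a, b], continuous g}.
  apply: continuous_subspaceT => x; apply: differentiable_continuous.
  by apply/derivable1_diffP; have [] := h x.
have [t0|t0] := leP 0 t.
  have [c /[!in_itv]/= /andP[c0 ct] e] := @MVT_segment R g dg 0 t t0 (fun x _ => h x) (cg _ _).
  by exists c; [rewrite !ger0_norm|rewrite e subr0 mulrC].
have [c /[!in_itv]/= /andP[tc c0] e] := @MVT_segment R g dg t 0 (ltW t0) (fun x _ => h x) (cg _ _).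
exists c; first by rewrite !ler0_norm ?lerN2// ltW.
by rewrite -[LHS]opprB e; ring.
Qed.

Lemma is_derive_cvg (f : R -> R) (x df : R) : is_derive x (1 : R) f df <->
  (fun h => h^-1 * (f (x + h) - f x)) @ 0^' --> df.
Proof.
have E : (fun h => h^-1 *: ((f \o shift x) (h *: (1 : R)) - f x)) =
   (fun h => h^-1 * (f (x + h) - f x)).
  by apply/funext => h /=; congr (_ * (f _ - _)); rewrite [h%:A]mulr1 addrC.
split=> [[d1 d2]|h].
  have := d1; rewrite /derivable -d2 /derive E; exact: cvgP.
by apply: DeriveDef; rewrite /derivable ?/derive E; [exact: cvgP h|exact: cvg_lim h].
Qed.
End oneD.

Section line.
Context {R : realType} {d : nat}.
Local Notation V := 'rV[R]_d.
Local Notation e_ i := (delta_mx 0 i : V).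
Implicit Types (f g : V -> R) (x v : V).

Lemma is_derive_line f x v t df :
  is_derive t (1 : R) (fun s : R => f (x + s *: v)) df <-> is_derive (x + t *: v) v f df.
Proof.
have E : (fun h => h^-1 *: (((fun s : R => f (x + s *: v)) \o shift t) (h *: (1 : R)) - f (x + t *: v))) =
         (fun h => h^-1 *: ((f \o shift (x + t *: v)) (h *: v) - f (x + t *: v))).
  apply/funext => h; rewrite /= [h%:A]mulr1 scalerDl.
  by congr (_ *: (f _ - _)); rewrite addrCA.
split=> -[d1 d2].
  by apply: DeriveDef; [rewrite /derivable -E|rewrite /derive -E].
by apply: DeriveDef; [rewrite /derivable E|rewrite /derive E].
Qed.

Lemma is_derive_line0 f x v df :
  is_derive 0 (1 : R) (fun s : R => f (x + s *: v)) df <-> is_derive x v f df.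
Proof. by rewrite is_derive_line scale0r addr0. Qed.

Lemma is_derive_comp1 (h : R -> R) f x v dh df :
  is_derive (f x) (1 : R) h dh -> is_derive x v f df -> is_derive x v (fun y => h (f y)) (dh * df).
Proof.
move=> Hh /is_derive_line0 Hf; apply/is_derive_line0.
rewrite -[f x]addr0 in Hh.
have Hh' : is_derive ((fun s : R => f (x + s *: v)) 0) (1 : R) h dh.
  by move: Hh; rewrite /= scale0r !addr0.
by have := @is_derive1_comp R h (fun s : R => f (x + s *: v)) 0 _ _ Hh' Hf.
Qed.

Lemma contD f g : continuous f -> continuous g -> continuous (fun x => f x + g x).
Proof. by move=> hf hg x; exact: (cvgD (hf x) (hg x)). Qed.

Lemma contM f g : continuous f -> continuous g -> continuous (fun x => f x * g x).
Proof. by move=> hf hg x; exact: (cvgM (hf x) (hg x)). Qed.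

Lemma cont_affine (c : R) (a : V) : continuous (fun x : V => a + c *: x).
Proof.
move=> x; have F := @nbhs_filter V x; apply/cvgrPdist_lt => e e0.
have c1 : 0 < `|c| + 1 by rewrite ltr_wpDl.
near=> y.
have xy : `|x - y| < e / (`|c| + 1).
  by near: y; apply: cvgr_dist_lt; [exact: cvg_id|rewrite divr_gt0].
have -> : a + c *: x - (a + c *: y) = c *: (x - y).
  by rewrite opprD addrACA subrr add0r scalerBr.
rewrite normrZ; apply: (@le_lt_trans _ _ ((`|c| + 1) * `|x - y|)).
  by rewrite ler_wpM2r// lerDl.
by rewrite mulrC -ltr_pdivlMr.
Unshelve. all: by end_near. Qed.

Arguments cont_affine : clear implicits.

Lemma Ck_cont k f : Ck k f -> continuous f.
Proof. by case: k => [|k] []. Qed.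

Lemma Ck_der k f i x : Ck k.+1 f -> is_derive x (e_ i) f (partial i f x).
Proof. by case=> _ /(_ i) [h _]; apply: DeriveDef. Qed.

Lemma Ck_partial k f i : Ck k.+1 f -> Ck k (partial i f).
Proof. by case=> _ /(_ i) []. Qed.

Lemma CkS k f : Ck k.+1 f -> Ck k f.
Proof.
elim: k f => [|k IH] f [cf hf]; first by split.
by split => // i; have [h1 h2] := hf i; split => //; exact: IH.
Qed.

Lemma Ck_le m k f : (m <= k)%N -> Ck k f -> Ck m f.
Proof. by move=> /subnK <-; elim: (k - m)%N => [//|j IH] /CkS /IH. Qed.

Lemma CkI k f (df : 'I_d -> V -> R) : continuous f ->
  (forall i x, is_derive x (e_ i) f (df i x)) -> (forall i, Ck k (df i)) -> Ck k.+1 f.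
Proof.
move=> cf h hk; split => // i; split; first by move=> x; have [] := h i x.
have -> : partial i f = df i; last exact: hk.
by apply/funext => x; have [_ <-] := h i x.
Qed.

Lemma partialE f i x df : is_derive x (e_ i) f df -> partial i f x = df.
Proof. by case. Qed.

Lemma Ck_cst k (c : R) : Ck k (fun _ : V => c).
Proof.
elim: k c => [|k IH] c; first by split=> //; exact: cst_continuous.
apply: (@CkI _ _ (fun _ _ => 0)) => //; exact: cst_continuous.
Qed.

Lemma CkD k f g : Ck k f -> Ck k g -> Ck k (fun x => f x + g x).
Proof.
elim: k f g => [|k IH] f g hf hg.
  by split=> //; exact: (contD (Ck_cont hf) (Ck_cont hg)).
apply: (@CkI _ _ (fun i x => partial i f x + partial i g x)).
- exact: (contD (Ck_cont hf) (Ck_cont hg)).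
- by move=> i x; exact: (is_deriveD (Ck_der i x hf) (Ck_der i x hg)).
- by move=> i; apply: IH; exact: Ck_partial.
Qed.

Lemma CkM k f g : Ck k f -> Ck k g -> Ck k (fun x => f x * g x).
Proof.
elim: k f g => [|k IH] f g hf hg.
  by split=> //; exact: (contM (Ck_cont hf) (Ck_cont hg)).
apply: (@CkI _ _ (fun i x => f x * partial i g x + g x * partial i f x)).
- exact: (contM (Ck_cont hf) (Ck_cont hg)).
- by move=> i x; exact: (is_deriveM (Ck_der i x hf) (Ck_der i x hg)).
- by move=> i; apply: CkD; apply: IH; try exact: CkS; exact: Ck_partial.
Qed.

Lemma CkZ k c f : Ck k f -> Ck k (fun x => c * f x).
Proof. by apply: CkM; exact: Ck_cst. Qed.

Lemma CkN k f : Ck k f -> Ck k (fun x => - f x).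
Proof. by move=> hf; under [X in Ck k X]funext do rewrite -mulN1r; exact: CkZ. Qed.

Lemma CkB k f g : Ck k f -> Ck k g -> Ck k (fun x => f x - g x).
Proof. by move=> hf hg; exact: (CkD hf (CkN hg)). Qed.

Lemma Ck_sum k (I : Type) (s : seq I) (h : I -> V -> R) :
  (forall i, Ck k (h i)) -> Ck k (fun x => \sum_(i <- s) h i x).
Proof.
move=> hi; elim: s => [|i s IH].
  by under [X in Ck k X]funext do rewrite big_nil; exact: Ck_cst.
by under [X in Ck k X]funext do rewrite big_cons; exact: CkD.
Qed.

Lemma partialD k f g i x : Ck k.+1 f -> Ck k.+1 g ->
  partial i (fun x => f x + g x) x = partial i f x + partial i g x.
Proof. by move=> hf hg; apply: partialE; exact: (is_deriveD (Ck_der i x hf) (Ck_der i x hg)). Qed.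

Lemma partialM k f g i x : Ck k.+1 f -> Ck k.+1 g ->
  partial i (fun x => f x * g x) x = f x * partial i g x + g x * partial i f x.
Proof. by move=> hf hg; apply: partialE; exact: (is_deriveM (Ck_der i x hf) (Ck_der i x hg)). Qed.

Lemma partialN k f i x : Ck k.+1 f -> partial i (fun x => - f x) x = - partial i f x.
Proof. by move=> hf; apply: partialE; exact: (is_deriveN (Ck_der i x hf)). Qed.

Lemma partialB k f g i x : Ck k.+1 f -> Ck k.+1 g ->
  partial i (fun x => f x - g x) x = partial i f x - partial i g x.
Proof. by move=> hf hg; apply: partialE; exact: (is_deriveB (Ck_der i x hf) (Ck_der i x hg)). Qed.

Lemma partialZ k c f i x : Ck k.+1 f -> partial i (fun x => c * f x) x = c * partial i f x.
Proof. by move=> hf; apply: partialE; exact: (is_deriveZ c (Ck_der i x hf)). Qed.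

Lemma partial_cst c i x : partial i (fun _ : V => c) x = 0.
Proof. by apply: partialE; exact: is_derive_cst. Qed.

Lemma is_derive_coord i (x v : V) : is_derive x v (fun y : V => y 0 i) (v 0 i).
Proof.
apply/is_derive_line0; under [X in is_derive _ _ X]funext do rewrite !mxE.
have := is_deriveD (is_derive_cst (x 0 i) (0 : R) 1)
  (is_deriveM (@is_derive_id R R 0 1) (is_derive_cst (v 0 i) (0 : R) 1)).
by rewrite /= scaler0 add0r [_ *: _]mulr1 add0r.
Qed.

Lemma Ck_coord k i : Ck k (fun x : V => x 0 i).
Proof.
have c : continuous (fun x : V => x 0 i) by move=> x; exact: coord_continuous.
case: k => [|k]; first by split.
apply: (@CkI _ _ (fun j _ => e_ j 0 i)) => //.
  by move=> j x; exact: is_derive_coord.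
by move=> j; exact: Ck_cst.
Qed.

Lemma partial_coord i j x : partial j (fun x : V => x 0 i) x = (i == j)%:R.
Proof. by rewrite (partialE (is_derive_coord i x (e_ j))) mxE eqxx. Qed.

Lemma Ck_affine k f (c : R) (a : V) : Ck k f -> Ck k (fun x => f (a + c *: x)).
Proof.
have ca := cont_affine c a.
elim: k f => [|k IH] f hf.
  by split=> // x; apply: (continuous_comp (ca x)); exact: (Ck_cont hf).
apply: (@CkI _ _ (fun i x => c * partial i f (a + c *: x))).
- by move=> x; apply: (continuous_comp (ca x)); exact: (Ck_cont hf).
- move=> i x; apply/is_derive_line0.
  have /is_derive_line0 h1 := Ck_der i (a + c *: x) hf.
  have h2 : is_derive (0 : R) (1 : R) (fun s : R => c * s) c.
    have := is_deriveM (is_derive_cst c (0 : R) 1) (@is_derive_id R R 0 1).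
    by rewrite /= scaler0 addr0 [_ *: _]mulr1.
  rewrite -[0](mulr0 c) in h1.
  have := @is_derive1_comp R (fun s => f (a + c *: x + s *: e_ i)) (fun s : R => c * s) 0 _ _ h1 h2.
  rewrite mulrC (_ : _ \o _ = fun s : R => f (a + c *: (x + s *: e_ i)))//; apply/funext => s /=.
  by rewrite scalerDr scalerA addrA.
- by move=> i; apply: CkZ; apply: IH; exact: Ck_partial.
Qed.

Lemma partial_affine k f (c : R) (a : V) i x : Ck k.+1 f ->
  partial i (fun x => f (a + c *: x)) x = c * partial i f (a + c *: x).
Proof.
move=> hf; apply: partialE; apply/is_derive_line0.
have /is_derive_line0 h1 := Ck_der i (a + c *: x) hf.
have h2 : is_derive (0 : R) (1 : R) (fun s : R => c * s) c.
  have := is_deriveM (is_derive_cst c (0 : R) 1) (@is_derive_id R R 0 1).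
  by rewrite /= scaler0 addr0 [_ *: _]mulr1.
rewrite -[0](mulr0 c) in h1.
have := @is_derive1_comp R (fun s => f (a + c *: x + s *: e_ i)) (fun s : R => c * s) 0 _ _ h1 h2.
rewrite mulrC (_ : _ \o _ = fun s : R => f (a + c *: (x + s *: e_ i)))//; apply/funext => s /=.
by rewrite scalerDr scalerA addrA.
Qed.
End line.
Section dir.
Context {R : realType} {d : nat}.
Local Notation V := 'rV[R]_d.
Local Notation e_ i := (delta_mx 0 i : V).
Implicit Types (f g : V -> R) (x v : V).

Lemma continuousP_norm f : continuous f -> forall x e, 0 < e ->
  exists2 r : R, 0 < r & forall y, `|y - x| < r -> `|f y - f x| < e.
Proof.
move=> cf x e e0; have F := @nbhs_filter V x.
have /cvgrPdist_lt /(_ _ e0) /nbhs_ballP[r /= r0 h] := cf x.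
exists r => // y yr; rewrite distrC; apply: h.
by rewrite -ball_normE /ball_ /= distrC.
Qed.

Lemma continuous_normP f : (forall x e, 0 < e ->
  exists2 r : R, 0 < r & forall y, `|y - x| < r -> `|f y - f x| < e) -> continuous f.
Proof.
move=> h x; have F := @nbhs_filter V x; apply/cvgrPdist_lt => e e0.
have [r r0 hr] := h x e e0.
suff : nbhs (x : V) [set t | `|f x - f t| < e] by [].
apply/nbhs_ballP; exists r => // y.
by rewrite -ball_normE /ball_ /= distrC => /hr; rewrite distrC.
Qed.

Lemma Ck1_increment f x v (s : seq 'I_d) e : Ck 1 f -> 0 < e ->
  exists2 r : R, 0 < r & forall t, `|t| < r ->
    `|f (x + t *: \sum_(i <- s) v 0 i *: e_ i) - f x - t * \sum_(i <- s) v 0 i * partial i f x|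
     <= e * `|t|.
Proof.
move=> hf; elim: s e => [|i s IH] e e0.
  exists 1 => // t _; rewrite !big_nil scaler0 addr0 mulr0 subrr subr0 normr0.
  by rewrite mulr_ge0// ltW.
have e2 : 0 < e / 2 by rewrite divr_gt0.
have [r1 r10 h1] := IH _ e2.
have v1 : 0 < `|v 0 i| + 1 by rewrite ltr_wpDl.
have e3 : 0 < e / 2 / (`|v 0 i| + 1) by rewrite divr_gt0.
have [r2 r20 h2] := continuousP_norm (Ck_cont (Ck_partial i hf)) x e3.
set w := \sum_(j <- s) v 0 j *: e_ j in h1.
pose K := `|w| + `|v 0 i| * `|e_ i| + 1.
have K0 : 0 < K by rewrite ltr_wpDl// addr_ge0// mulr_ge0.
exists (Num.min r1 (r2 / K)); first by rewrite lt_min r10 divr_gt0.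
move=> t; rewrite lt_min => /andP[t1 t2].
rewrite !big_cons -/w.
have [c ct Hc] := @MVT0 R (fun s : R => f (x + t *: w + s *: e_ i))
   (fun s => partial i f (x + t *: w + s *: e_ i)) (t * v 0 i)
   (fun s => (is_derive_line f _ _ _ _).2 (Ck_der i _ hf)).
move: Hc; rewrite scale0r addr0 => Hc.
have -> : x + t *: (v 0 i *: e_ i + w) = x + t *: w + (t * v 0 i) *: e_ i.
  by rewrite scalerDr scalerA addrA addrAC.
have close : `|partial i f (x + t *: w + c *: e_ i) - partial i f x| < e / 2 / (`|v 0 i| + 1).
  apply: h2; rewrite addrAC (addrAC x) subrr add0r.
  apply: (le_lt_trans (ler_normD _ _)); rewrite !normrZ.
  apply: (@le_lt_trans _ _ (`|t| * K)); last by rewrite -ltr_pdivlMr.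
  have := ct; rewrite normrM => ct'.
  have := ler_wpM2r (normr_ge0 (e_ i)) ct'.
  have := normr_ge0 t; rewrite /K; nra.
have -> : f (x + t *: w + (t * v 0 i) *: e_ i) - f x -
    t * (v 0 i * partial i f x + \sum_(j <- s) v 0 j * partial j f x) =
  (f (x + t *: w) - f x - t * \sum_(j <- s) v 0 j * partial j f x) +
  t * v 0 i * (partial i f (x + t *: w + c *: e_ i) - partial i f x).
  by rewrite mulrBr -Hc; ring.
apply: (le_trans (ler_normD _ _)).
have -> : e * `|t| = e / 2 * `|t| + e / 2 * `|t| by field.
apply: lerD; first exact: h1.
rewrite !normrM.
have := ler_wpM2l (mulr_ge0 (normr_ge0 t) (normr_ge0 (v 0 i))) (ltW close).
move=> /le_trans; apply.
rewrite -mulrA [leRHS]mulrC; apply: ler_wpM2l => //.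
rewrite mulrCA ger_pMr//.
by rewrite ler_pdivrMr// mul1r lerDl.
Qed.

Lemma Ck1_dir f x v : Ck 1 f -> is_derive x v f (\sum_i v 0 i * partial i f x).
Proof.
move=> hf; apply/is_derive_line0/is_derive_cvg; apply/cvgrPdist_le => e e0.
have [r r0 h] := @Ck1_increment f x v (index_enum 'I_d) e hf e0.
near=> t.
have t0 : t != 0 by near: t; exact: nbhs_dnbhs_neq.
have tr : `|t| < r.
  near: t; apply: dnbhs0_lt => //.
have := h t tr; rewrite -row_sum_delta add0r scale0r addr0 => ht.
rewrite distrC.
have -> : t^-1 * (f (x + t *: v) - f x) - \sum_i v 0 i * partial i f x =
  t^-1 * (f (x + t *: v) - f x - t * \sum_i v 0 i * partial i f x).
  by rewrite [RHS]mulrBr mulKf.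
by rewrite normrM normfV mulrC ler_pdivrMr ?normr_gt0.
Unshelve. all: by end_near. Qed.

Lemma Ck1_MVT f x v : Ck 1 f -> exists2 c : R, `|c| <= 1 &
  f (x + v) - f x = \sum_i v 0 i * partial i f (x + c *: v).
Proof.
move=> hf.
have [c c1 H] := @MVT0 R (fun s : R => f (x + s *: v))
   (fun s => \sum_i v 0 i * partial i f (x + s *: v)) 1
   (fun s => (is_derive_line f _ _ _ _).2 (Ck1_dir _ v hf)).
exists c; first by rewrite normr1 in c1.
by move: H; rewrite scale1r scale0r addr0 mul1r.
Qed.

Lemma Ck1_lipschitz f C x v : Ck 1 f -> (forall i y, `|partial i f y| <= C) ->
  `|f (x + v) - f x| <= C * \sum_i `|v 0 i|.
Proof.
move=> hf hC; have [c _ ->] := Ck1_MVT x v hf.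
apply: (le_trans (ler_norm_sum _ _ _)); rewrite mulr_sumr; apply: ler_sum => i _.
by rewrite normrM mulrC ler_wpM2r.
Qed.

End dir.

(** * Euclidean norm and compact supports *)

Section enorm.
Context {R : realType} {d : nat}.
Local Notation V := 'rV[R]_d.
Implicit Types (x y : V).

Definition dot x y : R := \sum_i x 0 i * y 0 i.

Lemma quadratic_discriminant (a b c : R) :
  (forall t, 0 <= a + 2 * t * b + t ^+ 2 * c) -> b ^+ 2 <= a * c.
Proof.
move=> h; have a0 : 0 <= a by have := h 0; rewrite mulr0 mul0r expr0n mul0r !addr0.
have [c00|cn0] := eqVneq c 0.
  have [->|bn0] := eqVneq b 0; first by rewrite expr0n /= c00 mulr0.
  have := h (- (a + 1) / (2 * b)); rewrite c00 mulr0 addr0.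
  have -> : 2 * (- (a + 1) / (2 * b)) * b = - (a + 1) by field.
  by lra.
have e : a + 2 * (- b / c) * b + (- b / c) ^+ 2 * c = (a * c - b ^+ 2) / c by field.
have := h (- b / c); rewrite e => h1.
have [cp|cN] := ltP 0 c; first by rewrite pmulr_lge0 ?invr_gt0// subr_ge0 in h1.
have {}cN : c < 0 by rewrite lt_neqAle cn0.
(* For negative [c], a value of [t] this far from the vertex makes the quadratic negative. *)
have := h ((- b + (`|b| + (a + 1) * (- c) + 1)) / c).
set m := `|b| + (a + 1) * (- c) + 1.
have -> : a + 2 * ((- b + m) / c) * b + ((- b + m) / c) ^+ 2 * c = (a * c - b ^+ 2 + m ^+ 2) / c by field.
rewrite nmulr_lge0 ?invr_lt0// => h2.
have m4 : `|b| ^+ 2 = b ^+ 2 by rewrite real_normK// num_real.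
move: h2; rewrite /m; set A := (a + 1) * - c.
have A0 : 0 <= A by rewrite /A; nra.
have A1 : a * - c <= A by rewrite /A; nra.
have := mulr_ge0 (normr_ge0 b) A0; have := normr_ge0 b; have := sqr_ge0 A; nra.
Qed.

Lemma enorm_ge0 x : 0 <= enorm x. Proof. exact: sqrtr_ge0. Qed.

Lemma enorm_sqr x : enorm x ^+ 2 = dot x x.
Proof.
rewrite /enorm sqr_sqrtr; first by apply: eq_bigr => i _; rewrite expr2.
by apply: sumr_ge0 => i _; rewrite sqr_ge0.
Qed.

Lemma dotC x y : dot x y = dot y x.
Proof. by apply: eq_bigr => i _; rewrite mulrC. Qed.

Lemma dotDl x y z : dot (x + y) z = dot x z + dot y z.
Proof. by rewrite -big_split; apply: eq_bigr => i _; rewrite mxE mulrDl. Qed.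

Lemma dotZl c x y : dot (c *: x) y = c * dot x y.
Proof. by rewrite mulr_sumr; apply: eq_bigr => i _; rewrite mxE mulrA. Qed.

Lemma dotDr x y z : dot x (y + z) = dot x y + dot x z.
Proof. by rewrite dotC dotDl !(dotC x). Qed.

Lemma dotZr c x y : dot x (c *: y) = c * dot x y.
Proof. by rewrite dotC dotZl dotC. Qed.

Lemma dot_ge0 x : 0 <= dot x x.
Proof. by rewrite -enorm_sqr sqr_ge0. Qed.

Lemma dot_le x y : `|dot x y| <= enorm x * enorm y.
Proof.
rewrite -(@ler_pXn2r _ 2) ?nnegrE ?mulr_ge0 ?enorm_ge0// exprMn !enorm_sqr real_normK ?num_real//.
apply: quadratic_discriminant => t.
have := dot_ge0 (x + t *: y); rewrite !dotDl !dotDr !dotZl !dotZr (dotC y x).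
by congr (_ <= _); ring.
Qed.

Lemma enormZ c x : enorm (c *: x) = `|c| * enorm x.
Proof.
apply/eqP; rewrite -(@eqrXn2 _ 2) ?mulr_ge0 ?enorm_ge0// exprMn !enorm_sqr dotZl dotZr.
by rewrite real_normK ?num_real// mulrA expr2.
Qed.

Lemma enormN x : enorm (- x) = enorm x.
Proof. by rewrite -scaleN1r enormZ normrN1 mul1r. Qed.

Lemma enormB x y : enorm (x - y) = enorm (y - x).
Proof. by rewrite -enormN opprB. Qed.

Lemma enormD x y : enorm (x + y) <= enorm x + enorm y.
Proof.
rewrite -(@ler_pXn2r _ 2) ?nnegrE ?addr_ge0 ?enorm_ge0// sqrrD !enorm_sqr dotDl !dotDr (dotC y x).
have := ler_norm (dot x y); have := dot_le x y; lra.
Qed.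

Lemma enorm_coord x i : `|x 0 i| <= enorm x.
Proof.
rewrite -(@ler_pXn2r _ 2) ?nnegrE ?enorm_ge0// real_normK ?num_real// enorm_sqr.
rewrite /dot (bigD1 i)//= -expr2 lerDl; apply: sumr_ge0 => j _.
by rewrite -expr2 sqr_ge0.
Qed.

Lemma norm_le_enorm x : `|x| <= enorm x.
Proof.
rewrite (_ : `|x| = mx_norm x)// mx_normrE; apply/bigmax_leP; split; first exact: enorm_ge0.
by move=> [i j] _ /=; rewrite ord1; exact: enorm_coord.
Qed.

Lemma coord_le_norm x i : `|x 0 i| <= `|x|.
Proof. by rewrite (_ : `|x| = mx_norm x)// mx_normrE; exact: (le_bigmax _ (fun ij => `|x ij.1 ij.2|) (0, i)). Qed.

Lemma enorm_le_sum x : enorm x <= \sum_i `|x 0 i|.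
Proof.
have s0 : 0 <= \sum_i `|x 0 i| by apply: sumr_ge0.
rewrite -(@ler_pXn2r _ 2) ?nnegrE ?enorm_ge0// enorm_sqr.
rewrite expr2 mulr_suml; apply: ler_sum => i _.
rewrite (le_trans (ler_norm _))// normrM ler_wpM2l//.
by rewrite (bigD1 i)//= lerDl; apply: sumr_ge0.
Qed.

Lemma sum_le_norm x : \sum_i `|x 0 i| <= d%:R * `|x|.
Proof.
have -> : d%:R * `|x| = \sum_(i < d) `|x| by rewrite sumr_const card_ord mulr_natl.
by apply: ler_sum => i _; exact: coord_le_norm.
Qed.

Lemma enorm_le_norm x : enorm x <= d%:R * `|x|.
Proof. exact: le_trans (enorm_le_sum x) (sum_le_norm x). Qed.

Lemma enorm0 : enorm (0 : V) = 0.
Proof. by rewrite -(scale0r (0 : V)) enormZ normr0 mul0r. Qed.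

Lemma enorm_eq0 x : enorm x = 0 -> x = 0.
Proof. by move=> h; apply/eqP; rewrite -normr_le0 -h norm_le_enorm. Qed.

Lemma enorm_triangle x y z : enorm (x - z) <= enorm (x - y) + enorm (y - z).
Proof. by have := enormD (x - y) (y - z); rewrite addrA subrK. Qed.

Lemma enorm_dist x y : `|enorm x - enorm y| <= enorm (x - y).
Proof.
rewrite ler_norml; have := enormD (x - y) y; have := enormD (y - x) x.
by rewrite !subrK (enormB y x) => h1 h2; apply/andP; split; lra.
Qed.

Lemma continuous_enorm : continuous (@enorm R d).
Proof.
apply: continuous_normP => x e e0.
have d1 : 0 < d%:R + 1 :> R by rewrite ltr_wpDl.
exists (e / (d%:R + 1)); first by rewrite divr_gt0.
move=> y; rewrite ltr_pdivlMr// => h.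
apply: (le_lt_trans (enorm_dist _ _)); apply: (le_lt_trans (enorm_le_norm _)).
by apply: (le_lt_trans _ h); rewrite mulrC ler_wpM2l// lerDl.
Qed.

Lemma compact_closed_ball (r : R) : compact [set x : V | enorm x <= r].
Proof.
apply: bounded_closed_compact.
  exists r; split; first exact: num_real.
  by move=> M rM x /= h; apply: (le_trans (norm_le_enorm x)); apply: (le_trans h); exact: ltW.
rewrite (_ : [set _ | _] = (@enorm R d) @^-1` [set t | t <= r])//.
by apply: preimage_closed; [move=> x _; exact: continuous_enorm|exact: closed_le].
Qed.

Arguments compact_closed_ball : clear implicits.

Lemma csuppP (f : V -> R) : compactly_supported setT f <->
  exists r, forall x, r <= enorm x -> f x = 0.
Proof.
split=> [[K [cK _ h]]|[r h]].
  have [M [_ hM]] := compact_bounded cK.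
  exists (d%:R * (M + 1) + 1) => x hx; apply: h => Kx.
  have := hM (M + 1) _ x Kx; rewrite ltrDl ltr01 => /(_ isT) /=.
  move=> /(ler_wpM2l (ler0n R d)) hh.
  by have := le_trans hx (le_trans (enorm_le_norm x) hh); rewrite gerDl ler10.
exists [set x | enorm x <= r]; split => //; first exact: compact_closed_ball.
by move=> x /= /negP; rewrite -ltNge => /ltW; exact: h.
Qed.

Lemma csupp_bounded (f : V -> R) r : continuous f -> (forall x, r <= enorm x -> f x = 0) ->
  exists2 C, 0 <= C & forall x, `|f x| <= C.
Proof.
move=> cf h; have [r0|r0] := ltP r 0.
  by exists 0 => // x; rewrite h ?normr0// (le_trans (ltW r0))// enorm_ge0.
have [||c _ hc] := @EVT_max_rV R d (fun x => `|f x|) _ _ (compact_closed_ball r).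
- by exists 0 => /=; rewrite enorm0.
- by apply: continuous_subspaceT => x; apply: (continuous_comp (cf x)); exact: norm_continuous.
exists `|f c| => // x; have [xr|/ltW/h ->] := leP (enorm x) r; last by rewrite normr0.
by apply: hc; rewrite inE.
Qed.

End enorm.

(** * Profiles of one variable: flat functions, cut-offs, inverse square root *)

Section smooth1.
Context {R : realType}.

(** Derivatives are two-sided but only required at the points of [P]: this allows [(s + K)^(-1/2)],
    regular for [s >= 0], to be composed with a squared gradient. *)
Fixpoint Sk (P : set R) (k : nat) (h : R -> R) : Prop :=
  (forall s, P s -> {for s, continuous h}) /\
  if k is k'.+1 then
    exists2 h', forall s, P s -> is_derive s (1 : R) h (h' s) & Sk P k' h'
  else True.

Lemma is_derive_continuous (h : R -> R) (s dh : R) : is_derive s (1 : R) h dh -> {for s, continuous h}.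
Proof.
by move=> [hd _]; apply: differentiable_continuous; apply/derivable1_diffP.
Qed.

Lemma near_is_derive (f g : R -> R) (s df : R) : (\forall t \near s, f t = g t) ->
  is_derive s (1 : R) f df -> is_derive s (1 : R) g df.
Proof.
move=> fg /is_derive_cvg h; apply/is_derive_cvg.
have e0 : f s = g s by exact: nbhs_singleton fg.
apply: cvg_trans h; apply: near_eq_cvg.
move: fg => /nbhs_ballP[r /= r0 fg].
near=> t; congr (_ * (_ - _)) => //.
apply: fg; rewrite /ball /= opprD addNKr normrN.
by near: t; apply: dnbhs0_lt.
Unshelve. all: by end_near. Qed.

(** The functions [s^-m exp (-1/s)], extended by 0, form a family closed under differentiation: the
    derivative of [em m] is [- m em m.+1 + em m.+2]. Smoothness thus follows by one induction, and
    the bump, the averaging kernel and its potential all come from this family. *)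
Definition em (m : nat) (s : R) : R := if 0 < s then s^-1 ^+ m * expR (- s^-1) else 0.

Lemma em_ge0 m s : 0 <= em m s.
Proof.
by rewrite /em; case: ifPn => // s0; rewrite mulr_ge0 ?expR_ge0// exprn_ge0// invr_ge0 ltW.
Qed.

Lemma em_le0 m s : s <= 0 -> em m s = 0.
Proof. by move=> s0; rewrite /em ltNge s0. Qed.

Lemma em_gt0 m s : 0 < s -> 0 < em m s.
Proof. by move=> s0; rewrite /em s0 mulr_gt0 ?expR_gt0// exprn_gt0// invr_gt0. Qed.

Lemma em0_le1 s : em 0 s <= 1.
Proof.
rewrite /em; case: ifPn => // s0; rewrite expr0 mul1r -expR0 ler_expR oppr_le0.
by rewrite invr_ge0 ltW.
Qed.

(** From [1 + t <= exp t] at [t = y / (n + 1)], raised to the power [n + 1]. It bounds every [em m]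
    linearly near 0, which gives the derivative 0 there. *)
Lemma powexp_le n (y : R) : 0 <= y -> y ^+ n.+1 * expR (- y) <= n.+1%:R ^+ n.+1.
Proof.
move=> y0; have n0 : 0 < n.+1%:R :> R by [].
rewrite expRN ler_pdivrMr ?expR_gt0//.
have -> : expR y = expR (y / n.+1%:R) ^+ n.+1 by rewrite -expRM_natl mulrC divfK// gt_eqF.
rewrite -exprMn; apply: lerXn2r; rewrite ?nnegrE ?mulr_ge0 ?expR_ge0//.
apply: (@le_trans _ _ (n.+1%:R * (1 + y / n.+1%:R))); last by rewrite ler_pM2l// expR_ge1Dx.
by rewrite mulrDr mulr1 mulrCA divff ?gt_eqF// mulr1 lerDr ltW.
Qed.

Lemma em_bound m : exists2 C : R, 0 <= C & forall s, em m s <= C * `|s|.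
Proof.
exists (m.+1%:R ^+ m.+1); first by rewrite exprn_ge0.
move=> s; rewrite /em; case: ifPn => s0; last by rewrite mulr_ge0// exprn_ge0.
have := @powexp_le m (s^-1); rewrite invr_ge0 => /(_ (ltW s0)) h.
rewrite gtr0_norm// -ler_pdivrMr//.
by apply: le_trans h; rewrite exprSr mulrAC.
Qed.

Lemma is_derive_em m s : is_derive s (1 : R) (em m) (- m%:R * em m.+1 s + em m.+2 s).
Proof.
have [s0|s0|s0] := ltgtP s 0.
- rewrite !em_le0 ?(ltW s0)// mulr0 addr0.
  have h0 := is_derive_cst (0 : R) s (1 : R).
  apply: (near_is_derive _ h0).
  near=> t; rewrite em_le0//; apply/ltW; near: t; exact: lt_nbhsl.
- rewrite /em s0.
  apply: (near_is_derive (f := fun s => s^-1 ^+ m * expR (- s^-1))).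
    by near=> t; rewrite ifT//; near: t; exact: lt_nbhsr.
  have sn : s != 0 by rewrite gt_eqF.
  have h1 : is_derive s (1 : R) (fun t : R => t^-1) (- s ^- 2).
    by have := is_deriveV sn (@is_derive_id R R s 1); rewrite [_ *: _]mulr1.
  have h2 : is_derive s (1 : R) (fun t : R => - t^-1) (s ^- 2).
    by have := is_deriveN h1; rewrite opprK.
  have h3 := @is_derive1_comp R expR (fun t => - t^-1) s _ _ (is_derive_expR _) h2.
  have h4 : is_derive s (1 : R) (fun t : R => t^-1 ^+ m) (m%:R * s^-1 ^+ m.-1 * - s ^- 2).
    have := is_deriveX m h1; move/is_derive_eq => /(_ _ erefl).
    by congr (is_derive s _ _ _); apply/funext => t; rewrite !fctE.
  have := is_deriveM h4 h3; move/is_derive_eq; apply.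
  rewrite /GRing.scale /= !exprS; case: m {h4} => [|m].
    by rewrite !expr0 !mul0r !mulr0 /= !mul1r; field.
  by rewrite /= exprS; field.
- rewrite s0 !em_le0// mulr0 addr0.
  apply/is_derive_cvg; rewrite (em_le0 m (lexx 0)).
  have [C C0 hC] := em_bound m.+1.
  apply/cvgrPdist_le => e e0; near=> t.
  have t0 : t != 0 by near: t; exact: nbhs_dnbhs_neq.
  rewrite sub0r normrN add0r subr0.
  have [tp|tn] := ltP 0 t; last by rewrite em_le0// mulr0 normr0 ltW.
  have -> : t^-1 * em m t = em m.+1 t by rewrite /em tp exprS mulrA.
  rewrite ger0_norm ?em_ge0//; apply: (le_trans (hC _)).
  apply: (@le_trans _ _ ((C + 1) * `|t|)); first by rewrite ler_wpM2r// lerDl.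
  rewrite mulrC -ler_pdivlMr; last by rewrite ltr_wpDl.
  by near: t; apply: dnbhs0_le; rewrite divr_gt0// ltr_wpDl.
Unshelve. all: by end_near. Qed.

Lemma Sk_lin P k f g (a : R) : Sk P k f -> Sk P k g -> Sk P k (fun s => a * f s + g s).
Proof.
have c f' g' : (forall s, P s -> {for s, continuous f'}) -> (forall s, P s -> {for s, continuous g'}) ->
    forall s, P s -> {for s, continuous (fun s => a * f' s + g' s)}.
  move=> hf hg s Ps; apply: cvgD; last exact: hg.
  by apply: cvgM; [exact: cvg_cst|exact: hf].
elim: k f g => [|k IH] f g; first by move=> [cf _] [cg _]; split=> //; exact: c.
move=> [cf [f' df hf]] [cg [g' dg hg]]; split; first exact: c.
exists (fun s => a * f' s + g' s); last exact: IH.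
by move=> s Ps; exact: (is_deriveD (is_deriveZ a (df s Ps)) (dg s Ps)).
Qed.

Lemma Sk_em k m : Sk setT k (em m).
Proof.
have c m' s : {for s, continuous (em m')}.
  exact: (is_derive_continuous (is_derive_em m' s)).
elim: k m => [|k IH] m; split => //.
by exists (fun s => - m%:R * em m.+1 s + em m.+2 s); [move=> s _; exact: is_derive_em|exact: Sk_lin].
Qed.

Definition pos2 (s : R) := (Num.max s 0) ^+ 2.

Lemma continuous_max0 : continuous (fun s : R => Num.max s 0).
Proof. by move=> s; apply: continuous_max; [exact: cvg_id|exact: cst_continuous]. Qed.

Lemma is_derive_pos2 s : is_derive s (1 : R) pos2 (2 * Num.max s 0).
Proof.
apply/is_derive_cvg; apply/cvgrPdist_le => e e0; near=> t.
have t0 : t != 0 by near: t; exact: nbhs_dnbhs_neq.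
have te : `|t| <= e by near: t; exact: dnbhs0_le.
rewrite distrC -(@ler_pM2l _ `|t|) ?normr_gt0// -normrM mulrBr mulVKf// (le_trans _ (ler_wpM2l (normr_ge0 _) te))//.
rewrite -normrM -expr2 [leRHS]ger0_norm ?sqr_ge0// /pos2 ler_norml.
by rewrite /Num.max; case: ifPn; case: ifPn; rewrite -?leNgt => h1 h2; apply/andP; split; nra.
Unshelve. all: by end_near. Qed.

(** A piecewise quadratic step from 0 to 1 on the unit interval. Being C^1 is enough because
    calibrations use C^1 fields, and its slope has the explicit bound 2. *)
Definition theta (s : R) := 2 * pos2 s - 4 * pos2 (s - 2^-1) + 2 * pos2 (s - 1).
Definition dtheta (s : R) := 4 * Num.max s 0 - 8 * Num.max (s - 2^-1) 0 + 4 * Num.max (s - 1) 0.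

Lemma is_derive_theta s : is_derive s (1 : R) theta (dtheta s).
Proof.
have sh c : is_derive s (1 : R) (fun s => pos2 (s - c)) (2 * Num.max (s - c) 0).
  have h2 : is_derive s (1 : R) (fun t => t - c) 1.
    by have := is_deriveB (@is_derive_id R R s 1) (is_derive_cst c s 1); rewrite subr0.
  by have := @is_derive1_comp R pos2 (fun t => t - c) s _ _ (is_derive_pos2 _) h2; rewrite mulr1.
have := is_deriveD (is_deriveB (is_deriveZ 2 (is_derive_pos2 s)) (is_deriveZ 4 (sh 2^-1))) (is_deriveZ 2 (sh 1)).
by move/is_derive_eq; apply; rewrite /dtheta /GRing.scale /=; ring.
Qed.

Lemma dtheta_bounds s : 0 <= dtheta s <= 2.
Proof.
by rewrite /dtheta /Num.max; do 3 (case: ifPn; rewrite -?leNgt => ?); apply/andP; split; lra.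
Qed.

Lemma dtheta_le0 s : s <= 0 -> dtheta s = 0.
Proof. by move=> ?; rewrite /dtheta /Num.max; do 3 (case: ifPn; rewrite -?leNgt => ?); lra. Qed.

Lemma dtheta_ge1 s : 1 <= s -> dtheta s = 0.
Proof. by move=> ?; rewrite /dtheta /Num.max; do 3 (case: ifPn; rewrite -?leNgt => ?); lra. Qed.

Lemma theta_le0 s : s <= 0 -> theta s = 0.
Proof. by move=> ?; rewrite /theta /pos2 /Num.max; do 3 (case: ifPn; rewrite -?leNgt => ?); nra. Qed.

Lemma theta_ge1 s : 1 <= s -> theta s = 1.
Proof. by move=> ?; rewrite /theta /pos2 /Num.max; do 3 (case: ifPn; rewrite -?leNgt => ?); nra. Qed.

Lemma theta_bounds s : 0 <= theta s <= 1.
Proof.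
by rewrite /theta /pos2 /Num.max; do 3 (case: ifPn; rewrite -?leNgt => ?); apply/andP; split; nra.
Qed.

Lemma Sk_theta : Sk setT 1 theta.
Proof.
split; first by move=> s _; exact: (is_derive_continuous (is_derive_theta s)).
exists dtheta; first by move=> s _; exact: is_derive_theta.
have c (a : R) s : {for s, continuous (fun s => Num.max (s - a) 0)}.
  apply: (@continuous_comp _ _ _ (fun s => s - a) (fun s => Num.max s 0)).
    by apply: cvgB; [exact: cvg_id|exact: cvg_cst].
  exact: continuous_max0.
have cz (a b : R) s : {for s, continuous (fun s => a * Num.max (s - b) 0)}.
  by apply: cvgM; [exact: cvg_cst|exact: c].
split => // s _; rewrite /dtheta; apply: cvgD; last exact: cz.
by apply: cvgB; [have := cz 4 0 s; under [X in {for _, continuous X} -> _]funext do rewrite subr0|exact: cz].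
Qed.

Lemma is_derive_rsqrt (K s : R) : 0 < s + K ->
  is_derive s (1 : R) (fun s => (Num.sqrt (s + K))^-1) (- (2 * (s + K) * Num.sqrt (s + K))^-1).
Proof.
move=> sK; have q0 : 0 < Num.sqrt (s + K) by rewrite sqrtr_gt0.
have h2 : is_derive s (1 : R) (fun t => t + K) 1.
  by have := is_deriveD (@is_derive_id R R s 1) (is_derive_cst K s 1); rewrite addr0.
have h3 := @is_derive1_comp R Num.sqrt (fun t => t + K) s _ _ (is_derive1_sqrt sK) h2.
have qn : Num.sqrt (s + K) != 0 by rewrite gt_eqF.
have := @is_deriveV R (fun t => Num.sqrt (t + K)) s _ 1 qn h3; move/is_derive_eq; apply.
have e : s + K = Num.sqrt (s + K) ^+ 2 by rewrite sqr_sqrtr// ltW.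
rewrite [X in _ = - (2 * X * _)^-1]e /GRing.scale /=; field; lra.
Qed.

Lemma Sk_rsqrt (K : R) : 0 < K -> Sk [set s | 0 <= s] 1 (fun s => (Num.sqrt (s + K))^-1).
Proof.
move=> K0; split; first by move=> s /= s0; apply: (is_derive_continuous (is_derive_rsqrt _)); lra.
exists (fun s => - (2 * (s + K) * Num.sqrt (s + K))^-1).
  by move=> s /= s0; apply: is_derive_rsqrt; lra.
split; last by [].
move=> s /= s0; have sK : 0 < s + K by lra.
have c1 : {for s, continuous (fun t : R => t + K)} by apply: cvgD; [exact: cvg_id|exact: cvg_cst].
have c2 : {for s, continuous (fun t : R => Num.sqrt (t + K))}.
  by apply: (@continuous_comp _ _ _ (fun t => t + K) Num.sqrt) => //; exact: sqrt_continuous.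
apply: cvgN; apply: cvgV; first by rewrite !mulf_neq0// ?gt_eqF// sqrtr_gt0.
by apply: cvgM => //; apply: cvgM => //; exact: cvg_cst.
Qed.

End smooth1.

Section Ck_comp.
Context {R : realType} {d : nat}.
Local Notation V := 'rV[R]_d.

Lemma Ck_comp P k (h : R -> R) (f : V -> R) : Sk P k h -> Ck k f -> (forall x, P (f x)) ->
  Ck k (fun x => h (f x)).
Proof.
move=> + + Pf; elim: k h f Pf => [|k IH] h f Pf.
  move=> [ch _] [cf _]; split => // x; exact: (continuous_comp (cf x) (ch _ (Pf x))).
move=> [ch [h' dh hh]] hf.
apply: (@CkI _ _ _ _ (fun i x => h' (f x) * partial i f x)).
- by have cf := Ck_cont hf; move=> x; exact: (continuous_comp (cf x) (ch _ (Pf x))).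
- by move=> i x; exact: (is_derive_comp1 (dh _ (Pf x)) (Ck_der i x hf)).
- by move=> i; apply: CkM; [apply: IH => //; exact: CkS|exact: Ck_partial].
Qed.

Lemma partial_comp (h h' : R -> R) (f : V -> R) i x k : is_derive (f x) (1 : R) h (h' (f x)) -> Ck k.+1 f ->
  partial i (fun x => h (f x)) x = h' (f x) * partial i f x.
Proof. by move=> dh hf; apply: partialE; exact: (is_derive_comp1 dh (Ck_der i x hf)). Qed.

Definition nsq (x : V) : R := dot x x.

Lemma Ck_nsq k (c : V) : Ck k (fun x => nsq (x - c)).
Proof.
have h : Ck k nsq by apply: Ck_sum => i; apply: CkM; exact: Ck_coord.
have := Ck_affine 1 (- c) h.
by under [X in Ck k X -> _]funext do rewrite scale1r addrC.
Qed.

Lemma partial_nsq i (c x : V) : partial i (fun x => nsq (x - c)) x = 2 * (x 0 i - c 0 i).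
Proof.
apply: partialE; apply/is_derive_line0.
rewrite (_ : (fun _ => _) = fun s => nsq (x - c) + 2 * (x 0 i - c 0 i) * s + s ^+ 2).
  have h1 := is_deriveM (is_derive_cst (2 * (x 0 i - c 0 i)) (0 : R) 1) (@is_derive_id R R 0 1).
  have h2 := is_deriveX 2 (@is_derive_id R R 0 1).
  have := is_deriveD (is_deriveD (is_derive_cst (nsq (x - c)) (0 : R) 1) h1) h2.
  by move/is_derive_eq; apply; rewrite /GRing.scale /=; ring.
apply/funext => s; rewrite addrAC.
have de (y : V) : dot y (delta_mx 0 i) = y 0 i.
  rewrite /dot (bigD1 i)//= mxE !eqxx mulr1 big1 ?addr0// => j ji.
  by rewrite mxE eqxx (negbTE ji) mulr0.
have E (y : V) : nsq (y + s *: delta_mx 0 i) = nsq y + 2 * y 0 i * s + s ^+ 2.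
  rewrite /nsq dotDl (dotDr y) (dotDr (s *: _)) !dotZr !dotZl (dotC (delta_mx _ _) y) !de mxE !eqxx.
  by rewrite (_ : (true && true)%:R = 1 :> R)//; ring.
by rewrite E !mxE.
Qed.

Lemma nsqE (x : V) : nsq x = enorm x ^+ 2. Proof. by rewrite enorm_sqr. Qed.

(** On the open ball this equals [exp (- e / (r^2 - |x - c|^2))], so it increases to the indicator
    of the ball as [e] decreases to 0. *)
Definition bump (c : V) (r e : R) (x : V) : R := em 0 ((r ^+ 2 - nsq (x - c)) / e).

Lemma Ck_bump k c r e : Ck k (bump c r e).
Proof.
apply: (@Ck_comp setT k (em 0) (fun x => (r ^+ 2 - nsq (x - c)) / e)) => //; first exact: Sk_em.
apply: (@CkM _ _ _ _ (fun=> e^-1)); last exact: Ck_cst.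
by apply: CkB; [exact: Ck_cst|exact: Ck_nsq].
Qed.

Lemma bump_bounds c r e x : 0 <= bump c r e x <= 1.
Proof. by rewrite em_ge0 em0_le1. Qed.

Lemma bump_out c r e x : 0 < e -> 0 <= r -> r <= enorm (x - c) -> bump c r e x = 0.
Proof.
move=> e0 r0 h; rewrite /bump em_le0// pmulr_lle0 ?invr_gt0// nsqE subr_le0.
by rewrite ler_pXn2r// nnegrE ?enorm_ge0.
Qed.

Lemma compact_eball_closed (c : V) (r : R) : compact [set x : V | enorm (x - c) <= r].
Proof.
have -> : [set x : V | enorm (x - c) <= r] = (fun x => c + 1 *: x) @` [set x : V | enorm x <= r].
  apply/seteqP; split => [x /= h|_ [x /= h <-]]; last by rewrite scale1r addrC addKr.
  by exists (x - c) => //=; rewrite scale1r addrC subrK.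
apply: continuous_compact; last exact: compact_closed_ball.
by apply: continuous_subspaceT => x; exact: cont_affine.
Qed.

Lemma Ccoo_bump (U : set V) c r e : 0 < e -> 0 <= r ->
  (forall x, enorm (x - c) <= r -> U x) -> Ccoo U (bump c r e).
Proof.
move=> e0 r0 h; split; first by move=> k; exact: Ck_bump.
exists [set x | enorm (x - c) <= r]; split => //; first exact: compact_eball_closed.
by move=> x /= /negP; rewrite -ltNge => /ltW; exact: bump_out.
Qed.

Lemma bump_cvg c r x : 0 <= r ->
  bump c r n.+1%:R^-1 x @[n --> \oo] --> ((enorm (x - c) < r)%R%:R : R).
Proof.
move=> r0; have [xr|xr] := ltP (enorm (x - c)) r; last first.
  by under eq_fun do rewrite bump_out// ?invr_gt0//; exact: cvg_cst.
have q0 : 0 < r ^+ 2 - nsq (x - c) by rewrite nsqE subr_gt0 ltr_pXn2r// nnegrE enorm_ge0.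
rewrite /bump; set q := r ^+ 2 - _ in q0 *.
have -> : (fun n => em 0 (q / n.+1%:R^-1)) = (fun n => expR (- (q^-1 * n.+1%:R^-1))).
  apply/funext => n; rewrite /em invrK mulr_gt0// expr0 mul1r invfM.
  by [].
have h : - (q^-1 * n.+1%:R^-1) @[n --> \oo] --> - (q^-1 * 0).
  by apply: cvgN; apply: cvgM; [exact: cvg_cst|exact: cvg_harmonic].
rewrite mulr0 oppr0 in h.
have H := cvg_comp _ _ h (@continuous_expR R 0); rewrite expR0 in H; exact: H.
Qed.

End Ck_comp.

(** * Convolution and density of test functions *)

Section leb_local.
Context {R : realType} {d : nat}.
Local Notation V := 'rV[R]_d.
Local Notation rint := (mintegral (@leb R d)).
Local Notation itg := (mintegrable (@leb R d)).
Local Notation L2 := (L2fun (@leb R d)).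
Implicit Types (u f g phi : V -> R) (x c h : V).

Lemma open_eball c r : open (eball c r).
Proof.
rewrite (_ : eball c r = (fun x => enorm (- c + 1 *: x)) @^-1` [set t | t < r]); last first.
  by apply/seteqP; split => x; rewrite /eball /= scale1r addrC.
apply: open_comp; last exact: open_lt.
have ca : continuous (fun x : V => - c + 1 *: x) by exact: cont_affine.
have ce : continuous (@enorm R d) by exact: continuous_enorm.
by move=> x _; exact: (continuous_comp (ca x) (ce _)).
Qed.

Lemma measurable_eball c r : measurable (eball c r).
Proof. by apply: open_measurable_leb; exact: open_eball. Qed.

Lemma leb_eball_le c r : 0 <= r -> (leb (eball c r) <= ((r *+ 2) ^+ d)%:E)%E.
Proof.
move=> r0; rewrite -leb_cube// -(leb_shift (- c) (cube r)).
apply: (le_outer_measure (lebesgue_outer : {outer_measure set V -> \bar R})) => x /= xr.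
apply/cubeP => i; have := le_lt_trans (enorm_coord (x - c) i) xr.
by rewrite ltr_norml => /andP[-> /ltW ->].
Qed.

Lemma leb_eball_lty c r : (leb (eball c r) < +oo)%E.
Proof.
have [r0|r0] := leP 0 r; first by apply: (le_lt_trans (leb_eball_le c r0)); rewrite ltry.
rewrite (_ : eball c r = set0) ?measure0//.
by apply/seteqP; split => // x; rewrite /eball /= => h; have := enorm_ge0 (x - c); lra.
Qed.

Lemma leb_eball_gt0 c r : 0 < r -> (0 < leb (eball c r))%E.
Proof.
move=> r0; pose a := r / (d%:R + 1).
have d1 : 0 < d%:R + 1 :> R by rewrite ltr_wpDl.
have a0 : 0 < a by rewrite divr_gt0.
have sub : (fun x : V => x - c) @^-1` cube a `<=` eball c r.
  move=> x /= /cubeP h; apply: (le_lt_trans (enorm_le_sum _)).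
  apply: (@le_lt_trans _ _ (\sum_(i < d) a)).
    by apply: ler_sum => i _; rewrite ler_norml; have /andP[/ltW -> ->] := h i.
  rewrite sumr_const card_ord -mulr_natl /a mulrCA gtr_pMr//.
  by rewrite ltr_pdivrMr// mul1r ltrDl.
apply: (@lt_le_trans _ _ (leb (cube a : set V))).
  by rewrite leb_cube ?(ltW a0)// lte_fin exprn_gt0// mulrn_wgt0.
rewrite -(leb_shift (- c) (cube a)).
exact: (le_outer_measure (lebesgue_outer : {outer_measure set V -> \bar R})).
Qed.

Lemma indic01 (A : set V) x : 0 <= (\1_A x : R) <= 1.
Proof. by rewrite indicE; case: (x \in A); rewrite ?lexx ?ler01. Qed.

Lemma indic_norm_le1 (A : set V) x : `|\1_A x : R| <= 1.
Proof. by have /andP[h1 h2] := indic01 A x; rewrite ger0_norm. Qed.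

Lemma measurable_indic_leb (A : set V) : measurable A -> measurable_fun setT (\1_A : V -> R).
Proof. exact: measurable_indic. Qed.

Definition loc u := measurable_fun setT u /\ forall r, itg (fun x => u x * \1_(eball 0 r) x).

Lemma loc_bounded u C : measurable_fun setT u -> (forall x, `|u x| <= C) -> loc u.
Proof.
move=> mu uC; split => // r.
have h := itg_indic (measurable_eball 0 r) (leb_eball_lty 0 r).
have := itg_mulb h mu uC.
by under [X in itg X -> _]funext do rewrite mulrC.
Qed.

Lemma loc_L2 u : L2 u -> loc u.
Proof.
move=> hu; split; first exact: hu.1.
move=> r; apply: (L2_mul hu).
apply: (L2_bounded (C := 1)); last exact: indic_norm_le1.
exact: (itg_indic (measurable_eball 0 r) (leb_eball_lty 0 r)).
Qed.

Lemma loc_itg u : itg u -> loc u.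
Proof.
move=> hu; split; first exact: (itg_measurable hu).
move=> r; apply: (itg_mulb hu (measurable_indic_leb (measurable_eball 0 r))).
exact: indic_norm_le1.
Qed.

Lemma loc_mul u f C r : loc u -> measurable_fun setT f -> (forall x, `|f x| <= C) ->
  (forall x, r <= enorm x -> f x = 0) -> itg (fun x => u x * f x).
Proof.
move=> [mu hu] mf fC f0.
have := itg_mulb (hu r) mf fC.
congr itg; apply/funext => x; rewrite indicE.
have [_|/negP] := boolP (x \in eball 0 r); first by rewrite mulr1.
rewrite inE /eball /= subr0 => /negP; rewrite -leNgt => /f0 ->.
by rewrite !mulr0.
Qed.

Lemma itg_csupp f C r : measurable_fun setT f -> (forall x, `|f x| <= C) ->
  (forall x, r <= enorm x -> f x = 0) -> itg f.
Proof.
move=> mf fC f0.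
have l1 : loc (cst 1) by apply: (@loc_bounded _ 1) => // x; rewrite normr1.
have := loc_mul l1 mf fC f0.
by under [X in itg X -> _]funext do rewrite mul1r.
Qed.

Lemma itg_csuppc f r : continuous f -> (forall x, r <= enorm x -> f x = 0) -> itg f.
Proof.
move=> cf f0; have [C _ fC] := csupp_bounded cf f0.
exact: (itg_csupp (continuous_measurable_leb cf) fC f0).
Qed.

Lemma L2_csupp f C r : measurable_fun setT f -> (forall x, `|f x| <= C) ->
  (forall x, r <= enorm x -> f x = 0) -> L2 f.
Proof. by move=> mf fC f0; exact: (L2_bounded (itg_csupp mf fC f0) fC). Qed.

Lemma L2_csuppc f r : continuous f -> (forall x, r <= enorm x -> f x = 0) -> L2 f.
Proof.
move=> cf f0; have [C _ fC] := csupp_bounded cf f0.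
exact: (L2_csupp (continuous_measurable_leb cf) fC f0).
Qed.

(** The common support in a ball makes a multiple of [|u|] on that ball a dominating function. The
    statement covers both uses of differentiation under the integral: a test function moved along a
    line and a kernel whose scale varies. *)
Lemma derive_int u (K K' : R -> V -> R) (a p q C r : R) : loc u ->
  p < a < q ->
  (forall s, measurable_fun setT (K s)) -> measurable_fun setT (K' a) ->
  (forall s y, p < s < q -> is_derive s (1 : R) (K ^~ y) (K' s y)) ->
  (forall s y, p < s < q -> `|K s y| <= C /\ `|K' s y| <= C) ->
  (forall s y, p < s < q -> r <= enorm y -> K s y = 0 /\ K' s y = 0) ->
  is_derive a (1 : R) (fun s => rint (fun y => u y * K s y)) (rint (fun y => u y * K' a y)).
Proof.
move=> lu apq mK mK' dK bK sK.
have inI s : `]p, q[%classic s <-> p < s < q by rewrite /= in_itv.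
have hd s y : p < s < q -> is_derive s (1 : R) (fun s => u y * K s y) (u y * K' s y).
  by move=> hs; have := is_deriveZ (u y) (dK s y hs).
have d1E s y : p < s < q -> partial1of2 (fun s y => u y * K s y) s y = u y * K' s y.
  by move=> hs; rewrite partial1of2E; have [_ ->] := hd s y hs.
have := @cvg_differentiation_under_integral R _ _ (@leb R d) (fun s y => u y * K s y) setT measurableT
  a p q _ _ _ (fun y => C * `|u y * \1_(eball 0 r) y|).
move=> h; apply/is_derive_cvg.
have C0 : 0 <= C by have [h1 _] := bK a 0 apq; exact: le_trans h1.
have h' := h _ _ _ _ _ _.
have {h h'} : h^-1 *: (rint (fun y => u y * K (h + a) y) - rint (fun y => u y * K a y)) @[h --> 0^'] -->
   rint (fun y => partial1of2 (fun s y => u y * K s y) a y).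
  apply: h.
  - exact/inI.
  - move=> s /inI hs; apply: (loc_mul (C := C) (r := r)) => //.
      by move=> x; have [] := bK s x hs.
    by move=> x xr; have [] := sK s x hs xr.
  - by move=> s y /inI hs _; have [] := hd s y hs.
  - by move=> y; rewrite mulr_ge0.
  - by apply: itgZ; apply: itg_norm; exact: lu.2.
  - move=> s y /inI hs _; rewrite d1E// !normrM indicE.
    have [yr|yr] := boolP (y \in eball 0 r).
      by rewrite normr1 mulr1 mulrC ler_wpM2r//; have [] := bK s y hs.
    have [_ ->] : K s y = 0 /\ K' s y = 0.
      apply: sK => //; rewrite leNgt; apply: contra yr => yr.
      by rewrite inE /eball /= subr0.
    by rewrite normr0 mulr0 !mulr0.
have -> : rint (fun y => partial1of2 (fun s y => u y * K s y) a y) = rint (fun y => u y * K' a y).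
  by congr rint; apply/funext => y; exact: d1E.
by apply: cvg_trans; apply: near_eq_cvg; apply: nearW => t; rewrite (addrC a).
Qed.

End leb_local.
Section convolution.
Context {R : realType} {d : nat}.
Local Notation V := 'rV[R]_d.
Local Notation e_ i := (delta_mx 0 i : V).
Local Notation rint := (mintegral (@leb R d)).
Local Notation itg := (mintegrable (@leb R d)).
Implicit Types (u f g phi k : V -> R) (x c h : V).

Definition supp_in (r : R) f := forall x, r <= enorm x -> f x = 0.

Lemma supp_in_le r s f : r <= s -> supp_in r f -> supp_in s f.
Proof. by move=> rs h x sx; apply: h; exact: le_trans sx. Qed.

Lemma partial_csupp r f i x : Ck 1 f -> supp_in r f -> r < enorm x -> partial i f x = 0.
Proof.
move=> hf h rx; apply: partialE; apply/is_derive_line0.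
have z : is_derive (0 : R) (1 : R) (fun _ : R => (0 : R)) 0 by exact: is_derive_cst.
apply: (near_is_derive _ z); near=> t.
apply/esym; apply: h.
have tb : `|t| <= enorm x - r.
  near: t; apply/nbhs_ballP; exists (enorm x - r); first by rewrite /= subr_gt0.
  by move=> t; rewrite /ball /= sub0r normrN => /ltW.
have ei : enorm (e_ i) <= 1.
  apply: (le_trans (enorm_le_sum _)); rewrite (bigD1 i)//= mxE !eqxx normr1 big1 ?addr0// => j ji.
  by rewrite mxE eqxx (negbTE ji) normr0.
have := enorm_dist x (x + t *: e_ i); rewrite opprD addNKr enormN enormZ.
have := ler_wpM2l (normr_ge0 t) ei.
have := ler_norm (enorm x - enorm (x + t *: e_ i)); lra.
Unshelve. all: by end_near. Qed.

Lemma supp_partial r f i : Ck 1 f -> supp_in r f -> supp_in (r + 1) (partial i f).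
Proof. by move=> hf h x rx; apply: (partial_csupp i hf h); lra. Qed.

Lemma Ccoo_partial i f : Ccoo setT f -> Ccoo setT (partial i f).
Proof.
move=> [h1 /csuppP[r h2]]; split; first by move=> k; exact: Ck_partial (h1 k.+1).
by apply/csuppP; exists (r + 1); apply: supp_partial.
Qed.

Lemma derive_int_line u f h a r : loc u -> Ck 1 f -> supp_in r f ->
  is_derive a (1 : R) (fun s => rint (fun x => u x * f (x + s *: h)))
    (rint (fun x => u x * \sum_i h 0 i * partial i f (x + a *: h))).
Proof.
move=> lu hf hr.
have [C C0 fC] := csupp_bounded (Ck_cont hf) hr.
have hp i : exists C, 0 <= C /\ forall x, `|partial i f x| <= C.
  by have [D D0 DC] := csupp_bounded (Ck_cont (Ck_partial i hf)) (supp_partial i hf hr); exists D.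
have [D hD] := choice hp.
have contl s : continuous (fun x => f (x + s *: h)).
  have := Ck_cont (Ck_affine 1 (s *: h) hf).
  by under [X in continuous X -> _]funext do rewrite scale1r addrC.
have contp s : continuous (fun x => \sum_i h 0 i * partial i f (x + s *: h)).
  have : Ck 0 (fun x => \sum_i h 0 i * partial i f (s *: h + 1 *: x)).
    by apply: Ck_sum => i; apply: CkZ; apply: Ck_affine; exact: Ck_partial.
  rewrite (_ : (fun x => _) = (fun x => \sum_i h 0 i * partial i f (x + s *: h))).
    exact: Ck_cont.
  by apply/funext => x; under eq_bigr do rewrite scale1r addrC.
have M0 : 0 <= \sum_i `|h 0 i| * D i by apply: sumr_ge0 => i _; rewrite mulr_ge0// (hD i).1.
apply: (@derive_int _ _ u (fun s x => f (x + s *: h))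
  (fun s x => \sum_i h 0 i * partial i f (x + s *: h)) a (a - 1) (a + 1)
  (C + \sum_i `|h 0 i| * D i) (r + 1 + (`|a| + 1) * enorm h)).
- exact: lu.
- by apply/andP; split; lra.
- by move=> s; exact: continuous_measurable_leb.
- exact: continuous_measurable_leb.
- by move=> s y _; apply/is_derive_line; exact: Ck1_dir.
- move=> s y _; split; first by rewrite (le_trans (fC _))// lerDl.
  apply: (le_trans (ler_norm_sum _ _ _)).
  apply: (@le_trans _ _ (\sum_i `|h 0 i| * D i)); last by rewrite lerDr.
  by apply: ler_sum => i _; rewrite normrM ler_wpM2l// (hD i).2.
- move=> s y /andP[s1 s2] hy.
  have ys : r + 1 <= enorm (y + s *: h).
    have := enorm_dist y (y + s *: h); rewrite opprD addNKr enormN enormZ.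
    have sa : `|s| <= `|a| + 1.
      by have := ler_normD a (s - a); rewrite addrC subrK; have : `|s - a| <= 1; [rewrite ler_norml; apply/andP; split; lra|lra].
    have := ler_wpM2r (enorm_ge0 h) sa.
    have := ler_norm (enorm y - enorm (y + s *: h)); lra.
  split; first by apply: hr; lra.
  by rewrite big1// => i _; rewrite (supp_partial i hf hr)// mulr0.
Qed.

(** The integral of [f (x + s e_i)] does not depend on [s] by translation invariance, and its
    derivative at 0 is the integral of the partial derivative. *)
Lemma int_partial0 f i r : Ck 1 f -> supp_in r f -> rint (partial i f) = 0.
Proof.
move=> hf hr.
have l1 : loc (cst 1 : V -> R) by apply: (@loc_bounded _ _ _ 1) => // x; rewrite normr1.
have := derive_int_line (e_ i) 0 l1 hf hr.
have fi := itg_csuppc (Ck_cont hf) hr.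
have -> : (fun s => rint (fun x => (cst 1 : V -> R) x * f (x + s *: e_ i))) = (fun _ => rint f).
  apply/funext => s; under [X in rint X]funext do rewrite /= mul1r.
  have [_ ->//] := int_preserving (@measurable_shift R d (s *: e_ i))
    (fun A _ => leb_shift (s *: e_ i) A) fi.
move=> [_ h1]; have [_ h2] := is_derive_cst (rint f) (0 : R) (1 : R).
move: h1; rewrite [LHS]h2 => ->; congr rint; apply/funext => x.
rewrite /= mul1r (bigD1 i)//= mxE !eqxx mul1r scale0r addr0 big1 ?addr0// => j ji.
by rewrite mxE eqxx (negbTE ji) mul0r.
Qed.

Lemma supp_mul r f g : supp_in r f -> supp_in r (fun x => f x * g x).
Proof. by move=> h x /h ->; rewrite mul0r. Qed.

Lemma supp_mulr r f g : supp_in r g -> supp_in r (fun x => f x * g x).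
Proof. by move=> h x /h ->; rewrite mulr0. Qed.

Lemma int_by_parts f g i r : Ck 1 f -> Ck 1 g -> supp_in r g ->
  rint (fun x => f x * partial i g x) = - rint (fun x => g x * partial i f x).
Proof.
move=> hf hg sg.
have := int_partial0 i (CkM hf hg) (@supp_mulr r f g sg).
have -> : partial i (fun x => f x * g x) = (fun x => f x * partial i g x + g x * partial i f x).
  by apply/funext => x; exact: (partialM _ _ hf hg).
have c1 := contM (Ck_cont hf) (Ck_cont (Ck_partial i hg)).
have c2 := contM (Ck_cont hg) (Ck_cont (Ck_partial i hf)).
have s1 : supp_in (r + 1) (fun x => f x * partial i g x) by apply: supp_mulr; exact: supp_partial.
have s2 : supp_in r (fun x => g x * partial i f x) by exact: supp_mul.
rewrite intD; [|exact: itg_csuppc c1 s1|exact: itg_csuppc c2 s2].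
by move/eqP; rewrite addr_eq0 => /eqP.
Qed.

Definition conv u k x := rint (fun y => u y * k (x - y)).

Lemma conv_is_derive u k i x r : loc u -> Ck 1 k -> supp_in r k ->
  is_derive x (e_ i) (conv u k) (conv u (partial i k) x).
Proof.
move=> lu hk hr; apply/is_derive_line0.
have hf := Ck_affine (-1) x hk.
have sf : supp_in (r + enorm x) (fun y => k (x + -1 *: y)).
  move=> y hy; apply: hr; rewrite scaleN1r.
  have := enorm_dist y x; rewrite enormB => h; have := ler_norm (enorm y - enorm x); lra.
have := derive_int_line (- e_ i) 0 lu hf sf.
rewrite /conv (_ : rint _ = rint (fun y => u y * partial i k (x - y))); last first.
  congr rint; apply/funext => y; congr (_ * _).
  under eq_bigr do rewrite (partial_affine _ _ _ _ hk).
  rewrite (bigD1 i)//= !mxE !eqxx big1 ?addr0 => [|j ji]; last first.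
    by rewrite !mxE eqxx (negbTE ji) oppr0 mul0r.
  by rewrite scale0r addr0 scaleN1r mulrA mulrNN mulr1 /= mul1r.
congr (is_derive _ _ _ _); apply/funext => s; congr rint; apply/funext => y.
by congr (_ * k _); rewrite scalerN scaleN1r opprD opprK addrA addrAC.
Qed.

Lemma conv_cont u k r : loc u -> Ck 1 k -> supp_in r k -> continuous (conv u k).
Proof.
move=> lu hk hr.
have hp i : exists C, 0 <= C /\ forall x, `|partial i k x| <= C.
  by have [D D0 DC] := csupp_bounded (Ck_cont (Ck_partial i hk)) (supp_partial i hk hr); exists D.
have [D hD] := choice hp.
pose L := \sum_i D i.
have L0 : 0 <= L by apply: sumr_ge0 => i _; exact: (hD i).1.
have kL x v : `|k (x + v) - k x| <= L * \sum_i `|v 0 i|.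
  apply: Ck1_lipschitz => // i y; apply: (le_trans ((hD i).2 y)).
  by rewrite /L (bigD1 i)//= lerDl; apply: sumr_ge0 => j _; exact: (hD j).1.
have mk x : measurable_fun setT (fun y : V => k (x - y)).
  apply: continuous_measurable_leb; have := Ck_cont (Ck_affine (-1) x hk).
  by under [X in continuous X -> _]funext do rewrite scaleN1r.
have [C C0 kC] := csupp_bounded (Ck_cont hk) hr.
have sx x : supp_in (r + enorm x) (fun y : V => k (x - y)).
  move=> y hy; apply: hr.
  have := enorm_dist y x; rewrite enormB => h; have := ler_norm (enorm y - enorm x); lra.
have iu x : itg (fun y => u y * k (x - y)).
  exact: (loc_mul lu (mk x) (fun y => kC _) (sx x)).
apply: continuous_normP => x e e0.
pose M := rint (fun y => `|u y * \1_(eball 0 (r + enorm x + d%:R)) y|).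
have M0 : 0 <= M by apply: int_ge0.
have den : 0 < L * d%:R * M + 1 by rewrite ltr_wpDl// !mulr_ge0.
exists (Num.min 1 (e / (L * d%:R * M + 1))); first by rewrite lt_min ltr01 divr_gt0.
move=> z; rewrite lt_min => /andP[z1 z2].
rewrite -intB//; apply: (le_lt_trans (int_norm (itgB (iu z) (iu x)))).
pose s := L * \sum_i `|(z - x) 0 i|.
have s0 : 0 <= s by rewrite mulr_ge0// sumr_ge0.
apply: (@le_lt_trans _ _ (rint (fun y => s * `|u y * \1_(eball 0 (r + enorm x + d%:R)) y|))).
  apply: int_le; [by apply: itg_norm; apply: itgB|by apply: itgZ; apply: itg_norm; exact: lu.2|].
  move=> y; rewrite -mulrBr !normrM indicE.
  have [yr|yr] := boolP (y \in eball 0 (r + enorm x + d%:R)).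
    rewrite normr1 mulr1 mulrC ler_wpM2r//.
    by have := kL (x - y) (z - x); rewrite (_ : x - y + (z - x) = z - y)// addrC addrA subrK.
  have {}yr : r + enorm x + d%:R <= enorm y.
    by rewrite leNgt; apply: contra yr => yr; rewrite inE /eball /= subr0.
  have zx : enorm (z - x) <= d%:R.
    by apply: (le_trans (enorm_le_norm _)); rewrite ler_piMr// ltW.
  have h1 : k (x - y) = 0 by apply: sx; have := ler0n R d; lra.
  have h2 : k (z - y) = 0.
    by apply: sx; have := enormD (z - x) x; rewrite subrK; lra.
  by rewrite h1 h2 subrr normr0 !mulr0.
rewrite intZ; last by apply: itg_norm; exact: lu.2.
rewrite -/M; apply: (@le_lt_trans _ _ (`|z - x| * (L * d%:R * M + 1))); last by rewrite -ltr_pdivlMr.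
have := sum_le_norm (z - x); rewrite /s => hs.
have := ler_wpM2l (mulr_ge0 L0 M0) hs.
have := normr_ge0 (z - x); nra.
Qed.

Lemma partial_conv u k i x r : loc u -> Ck 1 k -> supp_in r k ->
  partial i (conv u k) x = conv u (partial i k) x.
Proof. by move=> lu hk hr; apply: partialE; exact: conv_is_derive hr. Qed.

Lemma Ck_conv u k r n : loc u -> (forall m, Ck m k) -> supp_in r k -> Ck n (conv u k).
Proof.
move=> lu; elim: n k r => [|n IH] k r hk hr; first by split=> //; exact: conv_cont (hk 1%N) hr.
apply: (CkI (df := fun i => conv u (partial i k))); first exact: conv_cont (hk 1%N) hr.
  by move=> i x; exact: conv_is_derive hr.
move=> i; apply: (IH _ (r + 1)); first by move=> m; exact: Ck_partial (hk m.+1).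
exact: supp_partial.
Qed.

End convolution.
Lemma mfun_norm dT (T : measurableType dT) (R : realType) (f : T -> R) :
  measurable_fun setT f -> measurable_fun setT (fun x => `|f x|).
Proof. by move=> mf; exact: measurableT_comp. Qed.

(** * Approximation of measurable sets by test functions *)

Section approximation.
Context {R : realType} {d : nat}.
Local Notation V := 'rV[R]_d.
Local Notation rint := (mintegral (@leb R d)).
Local Notation itg := (mintegrable (@leb R d)).
Local Notation L2 := (L2fun (@leb R d)).
Implicit Types (u f g phi k : V -> R) (x c h : V) (A B : set V).

Lemma Ccoo_Ck U m f : Ccoo U f -> Ck m f. Proof. by case. Qed.

Lemma Ccoo_supp U f : Ccoo U f -> exists r, supp_in r f.
Proof. by move=> [_ [K [cK KU h]]]; apply/csuppP; exists K. Qed.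

Lemma Ccoo_measurable U f : Ccoo U f -> measurable_fun setT f.
Proof. by move=> h; exact: (continuous_measurable_leb (Ck_cont (Ccoo_Ck 0 h))). Qed.

Lemma Ccoo_itg U f : Ccoo U f -> itg f.
Proof. by move=> h; have [r hr] := Ccoo_supp h; exact: itg_csuppc (Ck_cont (Ccoo_Ck 0 h)) hr. Qed.

Lemma Ccoo_L2 U f : Ccoo U f -> L2 f.
Proof. by move=> h; have [r hr] := Ccoo_supp h; exact: L2_csuppc (Ck_cont (Ccoo_Ck 0 h)) hr. Qed.

Lemma Ccoo_lin U (c : R) f g : Ccoo U f -> Ccoo U g -> Ccoo U (fun x => c * f x + g x).
Proof.
move=> [hf [K [cK KU hK]]] [hg [K' [cK' KU' hK']]]; split.
  by move=> k; apply: CkD => //; exact: CkZ.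
exists (K `|` K'); split; first exact: compactU.
  by move=> x [/KU|/KU'].
by move=> x h; rewrite hK ?hK' ?mulr0 ?addr0// => ?; apply: h; [right|left].
Qed.

Lemma Ccoo_mul U f g : (forall m, Ck m f) -> Ccoo U g -> Ccoo U (fun x => f x * g x).
Proof.
move=> hf [hg [K [cK KU hK]]]; split; first by move=> k; exact: CkM.
by exists K; split => // x /hK ->; rewrite mulr0.
Qed.

Lemma Ccoo0 U : Ccoo U (cst 0 : V -> R).
Proof.
split; first by move=> k; exact: Ck_cst.
by exists set0; split => //; exact: compact0.
Qed.

(** A Lindelof property for balls: only rational balls satisfying [P] are listed, and the radius 0,
    whose ball is empty, fills the remaining indices. It is applied to open sets and to balls in
    which a set is null. *)
Lemma countable_eballs (P : V -> R -> Prop) :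
  (forall x e y r, P x e -> eball y r `<=` eball x e -> P y r) ->
  exists F : nat -> V * R, (forall n, (F n).2 = 0 \/ P (F n).1 (F n).2) /\
    forall x e, 0 < e -> P x e -> exists n, eball (F n).1 (F n).2 x.
Proof.
move=> hP.
pose F (n : nat) : V * R := if @unpickle ('rV[rat]_d * nat)%type n is Some q then
   (if `[< P (map_mx ratr q.1) q.2.+1%:R^-1 >] then (map_mx ratr q.1, q.2.+1%:R^-1) else (0, 0))
   else (0, 0).
exists F; split=> [n|x e e0 Pxe].
  rewrite /F; case: unpickle => [q|]; last by left.
  by case: asboolP => [h|_]; [right|left].
have e20 : 0 < e / 2 by rewrite divr_gt0.
have [n _ /(_ n (leqnn n)) ne] := near_infty_natSinv_lt (PosNum e20); rewrite /= in ne.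
have d1 : 0 < d%:R + 1 :> R by rewrite ltr_wpDl.
have n0 : 0 < n.+1%:R^-1 :> R by rewrite invr_gt0.
pose s : R := n.+1%:R^-1 / (d%:R + 1).
have s0 : 0 < s by rewrite divr_gt0.
have hq i : exists q : rat, `|x 0 i - ratr q| < s.
  have [r [/= Hr [q _ qr]]] := @dense_rat R (ball (x 0 i) s)
    (ex_intro _ (x 0 i) (ballxx (x 0 i) s0)) (ball_open (x 0 i) _).
  by exists q; move: Hr; rewrite -qr /ball /=.
have [q qP] := choice hq.
have xq : enorm (x - map_mx ratr (\row_i q i)) < n.+1%:R^-1.
  apply: (le_lt_trans (enorm_le_sum _)).
  apply: (@le_lt_trans _ _ (\sum_(i < d) s)).
    by apply: ler_sum => i _; rewrite !mxE ltW.
  rewrite sumr_const card_ord -[_ *+ d]mulr_natl /s mulrCA gtr_pMr//.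
  by rewrite ltr_pdivrMr// mul1r ltrDl.
exists (pickle (\row_i q i, n)); rewrite /F pickleK /=.
case: asboolP => // h; exfalso; apply: h; apply: hP Pxe _ => y; rewrite /eball /= => yq.
have := enorm_triangle y (map_mx ratr (\row_i q i)) x.
by rewrite [X in _ <= _ + X]enormB; move: xq ne yq; move: (n.+1%:R^-1) => a; lra.
Qed.

Lemma open_bigcup_eball (U : set V) : open U ->
  exists F : nat -> V * R, U = \bigcup_n eball (F n).1 (F n).2.
Proof.
move=> oU; have [|F [h1 h2]] := @countable_eballs (fun c r => eball c r `<=` U).
  by move=> x e y r h /subset_trans; apply.
exists F; apply/seteqP; split => [x Ux|x [n _ hx]]; last first.
  case: (h1 n) => [F0|]; last exact.
  by move: hx; rewrite F0 /eball /= => h; have := enorm_ge0 (x - (F n).1); lra.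
have /nbhs_ballP[e /= e0 eU] : nbhs x U by exact: open_nbhs_nbhs.
have [|n hn] := h2 x e e0; last by exists n.
move=> y; rewrite /eball /= => yx; apply: eU; rewrite -ball_normE /ball_ /= distrC.
exact: le_lt_trans (norm_le_enorm _) yx.
Qed.

Section class.
Variable (g : V -> R).
Hypothesis ig : itg g.

(** Approximation of [A] in the L^1 norm weighted by the integrable [|g|], so that sets of infinite
    measure are allowed. Values in [0, 1] let the class be closed under unions and complements,
    hence contain the Borel sets. *)
Definition approximable A := measurable A /\ forall e, 0 < e -> exists phi,
  [/\ Ccoo setT phi, forall x, 0 <= phi x <= 1 & rint (fun x => `|g x| * `|\1_A x - phi x|) < e].

Let ph_le1 phi A x : (0 <= phi x <= 1) -> `|\1_A x - phi x| <= 1.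
Proof.
by move=> /andP[h1 h2]; have /andP[h3 h4] := indic01 A x; rewrite ler_norml; apply/andP; split; lra.
Qed.

Let ph_itg phi A : measurable A -> Ccoo setT phi -> (forall x, 0 <= phi x <= 1) ->
  itg (fun x => `|g x| * `|\1_A x - phi x|).
Proof.
move=> mA hp hb; apply: (itg_mulb (C := 1) (itg_norm ig)).
  apply: mfun_norm.
  exact: (measurable_funB (measurable_indic_leb mA) (Ccoo_measurable hp)).
by move=> x; rewrite normr_id; exact: ph_le1.
Qed.

Let cvg_sets (F : nat -> set V) A : (forall n, measurable (F n)) -> measurable A ->
  (forall x, (\1_(F n) x : R) @[n --> \oo] --> (\1_A x : R)) ->
  rint (fun x => `|g x| * `|\1_A x - \1_(F n) x|) @[n --> \oo] --> 0.
Proof.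
move=> mF mA h; rewrite -(int0 (@leb R d)).
have b01 n x : `|\1_A x - \1_(F n) x : R| <= 1.
  have /andP[h3 h4] := indic01 A x; have /andP[h1 h2] := indic01 (F n) x.
  by rewrite ler_norml; apply/andP; split; lra.
have [||||_ //] := @int_dct _ _ _ (@leb R d) (fun n x => `|g x| * `|\1_A x - \1_(F n) x|) (cst 0) (fun x => `|g x|).
- move=> n; apply: measurable_funM; first exact: (itg_measurable (itg_norm ig)).
  apply: mfun_norm.
  exact: (measurable_funB (measurable_indic_leb mA) (measurable_indic_leb (mF n))).
- exact: itg_norm.
- by move=> n x; rewrite normrM !normr_id ler_piMr.
- move=> x /=; rewrite -(mulr0 `|g x|); apply: cvgM; first exact: cvg_cst.
  rewrite -[X in _ --> X](normr0 R); apply: cvg_norm.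
  by rewrite -(subrr (\1_A x : R)); apply: cvgB; [exact: cvg_cst|exact: h].
Qed.

Lemma approximable_eball c r : approximable (eball c r).
Proof.
split; first exact: measurable_eball.
move=> e e0; have [r0|r0] := ltP r 0.
  exists (cst 0); split; [exact: Ccoo0|by move=> x /=; rewrite lexx ler01|].
  rewrite (_ : (fun _ => _) = cst 0) ?int0//; apply/funext => x /=.
  rewrite (_ : eball c r = set0) ?indic0 ?subrr ?normr0 ?mulr0//.
  by apply/seteqP; split => // y; rewrite /eball /= => h; have := enorm_ge0 (y - c); lra.
have hb n : Ccoo setT (bump c r n.+1%:R^-1) by apply: Ccoo_bump => //; rewrite invr_gt0.
have bb n x := bump_bounds c r n.+1%:R^-1 x.
have : rint (fun x => `|g x| * `|\1_(eball c r) x - bump c r n.+1%:R^-1 x|) @[n --> \oo] --> 0.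
  rewrite -(int0 (@leb R d)).
  have [||||_ //] := @int_dct _ _ _ (@leb R d) (fun n x => `|g x| * `|\1_(eball c r) x - bump c r n.+1%:R^-1 x|) (cst 0) (fun x => `|g x|).
  - by move=> n; exact: (itg_measurable (ph_itg (measurable_eball c r) (hb n) (bb n))).
  - exact: itg_norm.
  - by move=> n x; rewrite normrM !normr_id ler_piMr// ph_le1.
  - move=> x /=; rewrite -(mulr0 `|g x|); apply: cvgM; first exact: cvg_cst.
    rewrite -[X in _ --> X](normr0 R); apply: cvg_norm.
    rewrite -(subrr (\1_(eball c r) x : R)); apply: cvgB; first exact: cvg_cst.
    have -> : (\1_(eball c r) x : R) = (enorm (x - c) < r)%R%:R.
      by rewrite indicE; congr (nat_of_bool _)%:R; apply/idP/idP; rewrite inE.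
    exact: bump_cvg.
move/cvgrPdist_lt => /(_ e e0)[n _ /(_ n (leqnn n))] /=.
rewrite sub0r normrN ger0_norm; last by apply: int_ge0 => x; rewrite mulr_ge0.
by move=> h; exists (bump c r n.+1%:R^-1).
Qed.

Lemma approximableU A B : approximable A -> approximable B -> approximable (A `|` B).
Proof.
move=> [mA hA] [mB hB]; split; first exact: measurableU.
move=> e e0; have e2 : 0 < e / 2 by rewrite divr_gt0.
have [p [p1 p2 p3]] := hA _ e2; have [q [q1 q2 q3]] := hB _ e2.
have mAB := measurableU _ _ mA mB.
(* This is [p + q - p q], which stays in [0, 1]. *)
pose w x := (-1 * q x) * p x + (1 * p x + q x).
have hw : Ccoo setT w.
  have := Ccoo_lin 1 (Ccoo_mul (f := fun x => -1 * q x) (fun m => CkZ (-1) (Ccoo_Ck m q1)) p1) (Ccoo_lin 1 p1 q1).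
  by congr (Ccoo _ _); apply/funext => x; rewrite mul1r.
have wb x : 0 <= w x <= 1.
  by rewrite /w; have /andP[? ?] := p2 x; have /andP[? ?] := q2 x; apply/andP; split; nra.
exists w; split => //.
apply: (@le_lt_trans _ _ (rint (fun x => `|g x| * `|\1_A x - p x| + `|g x| * `|\1_B x - q x|))); last first.
  by rewrite intD; [lra|exact: ph_itg|exact: ph_itg].
apply: int_le; [exact: ph_itg|by apply: itgD; exact: ph_itg|].
move=> x; rewrite -mulrDr; apply: ler_wpM2l => //.
rewrite /w !indicE in_setU; have /andP[? ?] := p2 x; have /andP[? ?] := q2 x.
case: (x \in A); case: (x \in B) => /=; rewrite ?sub0r ?normrN.
- rewrite !ger0_norm; nra.
- rewrite !ger0_norm; nra.
- rewrite !ger0_norm; nra.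
- rewrite !ger0_norm; nra.
Qed.

Lemma approximable_bigcup (F : nat -> set V) : (forall n, approximable (F n)) ->
  approximable (\bigcup_n F n).
Proof.
move=> hF; have mU : measurable (\bigcup_n F n) by apply: bigcup_measurable => n _; exact: (hF n).1.
pose G n := \big[setU/set0]_(i < n.+1) F i.
have hG n : approximable (G n).
  elim: n => [|n IH]; first by rewrite /G big_ord_recr big_ord0 /= set0U.
  by rewrite /G big_ord_recr /=; exact: approximableU.
split=> // e e0; have e2 : 0 < e / 2 by rewrite divr_gt0.
have : rint (fun x => `|g x| * `|\1_(\bigcup_n F n) x - \1_(G n) x|) @[n --> \oo] --> 0.
  apply: cvg_sets => //; first by move=> n; exact: (hG n).1.
  move=> x; have [/set_mem [n _ Fx]|xF] := boolP (x \in \bigcup_n F n).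
    apply: cvg_near_cst; exists n => // m /= nm.
    rewrite !indicE !mem_set//; first by exists n.
    by rewrite /G -bigcup_mkord; exists n => //=; rewrite ltnS.
  apply: cvg_near_cst; apply: nearW => m; rewrite !indicE (negbTE xF) memNset//.
  move=> Gx; move/negP : xF; apply; apply/mem_set.
  by move: Gx; rewrite /G -bigcup_mkord => -[i _ Fi]; exists i.
move/cvgrPdist_lt => /(_ _ e2)[n _ /(_ n (leqnn n))] /=.
rewrite sub0r normrN ger0_norm; last by apply: int_ge0 => x; rewrite mulr_ge0.
move=> h; have [p [p1 p2 p3]] := (hG n).2 _ e2.
exists p; split => //.
have iGF : itg (fun x => `|g x| * `|\1_(\bigcup_n F n) x - \1_(G n) x|).
  apply: (itg_mulb (C := 1) (itg_norm ig)).
    apply: mfun_norm.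
    exact: (measurable_funB (measurable_indic_leb mU) (measurable_indic_leb (hG n).1)).
  move=> x; rewrite normr_id; have /andP[h3 h4] := indic01 (\bigcup_n F n) x; have /andP[h1 h2] := indic01 (G n) x.
  by rewrite ler_norml; apply/andP; split; lra.
apply: (@le_lt_trans _ _ (rint (fun x => `|g x| * `|\1_(\bigcup_n F n) x - \1_(G n) x| + `|g x| * `|\1_(G n) x - p x|))); last first.
  by rewrite intD//; [lra|exact: ph_itg (hG n).1 p1 p2].
apply: int_le; [exact: ph_itg|by apply: itgD => //; exact: ph_itg (hG n).1 p1 p2|].
move=> x; rewrite -mulrDr; apply: ler_wpM2l => //.
by have := ler_normD (\1_(\bigcup_n F n) x - \1_(G n) x) (\1_(G n) x - p x); rewrite addrA subrK.
Qed.

Lemma approximable_open (U : set V) : open U -> approximable U.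
Proof.
by move=> /open_bigcup_eball[F ->]; apply: approximable_bigcup => n; exact: approximable_eball.
Qed.

Lemma approximableC A : approximable A -> approximable (~` A).
Proof.
move=> [mA hA]; split; first exact: measurableC.
move=> e e0; have e2 : 0 < e / 2 by rewrite divr_gt0.
have [mT hT] := approximable_open (@openT V).
have [p [p1 p2 p3]] := hA _ e2; have [q [q1 q2 q3]] := hT _ e2.
(* The function [1 - p] is not compactly supported; it is multiplied by a test function [q] that is
   close to 1 for the weight. *)
pose w x := (-1 * p x) * q x + q x.
have hw : Ccoo setT w.
  have := Ccoo_lin 1 (Ccoo_mul (f := fun x => -1 * p x) (fun m => CkZ (-1) (Ccoo_Ck m p1)) q1) q1.
  by congr (Ccoo _ _); apply/funext => x; rewrite mul1r.
have wb x : 0 <= w x <= 1.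
  by rewrite /w; have /andP[? ?] := p2 x; have /andP[? ?] := q2 x; apply/andP; split; nra.
exists w; split => //.
apply: (@le_lt_trans _ _ (rint (fun x => `|g x| * `|\1_A x - p x| + `|g x| * `|\1_setT x - q x|))); last first.
  by rewrite intD; [lra|exact: ph_itg|exact: ph_itg].
apply: int_le; [by apply: ph_itg => //; exact: measurableC|by apply: itgD; exact: ph_itg|].
move=> x; rewrite -mulrDr; apply: ler_wpM2l => //.
rewrite /w !indicE in_setC in_setT; have /andP[? ?] := p2 x; have /andP[? ?] := q2 x.
case: (x \in A) => /=; rewrite ?sub0r ?normrN.
- rewrite !ger0_norm; nra.
- rewrite !ger0_norm; nra.
Qed.

Lemma approximable_tuple (A : set (d.-tuple (measurableTypeR R))) : measurable A ->
  approximable ((fun x : V => [tuple x 0 i | i < d]) @^-1` A).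
Proof.
move: A; pose T x : d.-tuple (measurableTypeR R) := [tuple (x : V) 0 i | i < d].
have a0 : approximable set0 by apply: approximable_open; exact: open0.
have S : sigma_algebra setT [set A | approximable (T @^-1` A)].
  split => /=.
  - by rewrite preimage_set0.
  - by move=> A hA; rewrite setTD preimage_setC; exact: (approximableC hA).
  - by move=> F hF; rewrite preimage_bigcup; exact: approximable_bigcup.
apply: smallest_sub => // B; rewrite -bigcup_seq => -[i _ [C mC <-]] /=; rewrite setTI.
have S1 : sigma_algebra setT [set C : set R | approximable ((fun x : V => x 0 i) @^-1` C)].
  split => /=.
  - by rewrite preimage_set0.
  - by move=> A hA; rewrite setTD preimage_setC; exact: (approximableC hA).
  - by move=> F hF; rewrite preimage_bigcup; exact: approximable_bigcup.
suff /(_ C mC) : (@measurable _ (measurableTypeR R)) `<=` [set C : set R | approximable ((fun x : V => x 0 i) @^-1` C)].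
  rewrite /= (_ : _ @^-1` _ = T @^-1` ((fun t => tnth t i) @^-1` C))//.
  by apply/seteqP; split => x; rewrite /T /= tnth_mktuple.
rewrite RGenOpens.measurableE; apply: smallest_sub => // _ [a [b ->]] /=.
apply: approximable_open; apply: open_comp => // x _; exact: coord_continuous.
Qed.

End class.
End approximation.
Section density.
Context {R : realType} {d : nat}.
Local Notation V := 'rV[R]_d.
Local Notation rint := (mintegral (@leb R d)).
Local Notation itg := (mintegrable (@leb R d)).
Implicit Types (u f g phi : V -> R) (A B : set V).

(** Measurability means Caratheodory measurability for an outer measure defined by Borel covers;
    intersecting nearly optimal covers gives a Borel set that differs from [A] by a null set. *)
Lemma borel_hull A : measurable A -> (leb A < +oo)%E ->
  exists H : set (d.-tuple (measurableTypeR R)),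
    [/\ measurable H, A `<=` (fun x : V => [tuple x 0 i | i < d]) @^-1` H &
        leb ((fun x : V => [tuple x 0 i | i < d]) @^-1` H `\` A) = 0%E].
Proof.
move=> mA fA; pose T (x : V) : d.-tuple (measurableTypeR R) := [tuple x 0 i | i < d].
have TK t : T (row_of_tuple t) = t.
  by apply: eq_from_tnth => i; rewrite tnth_mktuple mxE.
have TKi : (T \o row_of_tuple)%FUN = id by apply/funext => t /=; rewrite TK.
have lebT (H : set (d.-tuple (measurableTypeR R))) : measurable H -> leb (T @^-1` H) = tuple_lebesgue d H.
  move=> mH; rewrite /leb /lebesgue_outer -comp_preimage TKi preimage_id.
  exact: measurable_mu_extE.
have lA : leb A \is a fin_num by rewrite ge0_fin_numE.
have hc n : exists H : set (d.-tuple (measurableTypeR R)), [/\ measurable H, A `<=` T @^-1` H &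
    (leb (T @^-1` H) <= leb A + (n.+1%:R^-1)%:E)%E].
  have n0 : 0 < n.+1%:R^-1 :> R by rewrite invr_gt0.
  have := @lb_ereal_inf_adherent R [set (\sum_(k <oo) tuple_lebesgue d (F k))%E | F in measurable_cover (row_of_tuple @^-1` A)] _ n0 lA.
  move=> [_ [F [mF AF] <-] /ltW h].
  have mU : measurable (\bigcup_k F k) by exact: bigcupT_measurable.
  exists (\bigcup_k F k); split => //.
    move=> x Ax; apply: AF => /=; rewrite (_ : row_of_tuple _ = x)//.
    by apply/rowP => i; rewrite mxE tnth_mktuple.
  rewrite lebT//; apply: le_trans h; exact: measure_sigma_subadditive.
have [H hH] := choice hc.
exists (\bigcap_n H n); split.
- by apply: bigcapT_measurable => n; have [] := hH n.
- by move=> x Ax n _; have [_ h _] := hH n; exact: h.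
have mH n : measurable (T @^-1` H n) by apply: measurable_row_of_tuple; rewrite -comp_preimage TKi preimage_id; have [] := hH n.
have mI : measurable (T @^-1` \bigcap_n H n) by rewrite preimage_bigcap; exact: bigcapT_measurable.
have sub : A `<=` T @^-1` \bigcap_n H n by move=> x Ax n _; have [_ h _] := hH n; exact: h.
have le1 : (leb (T @^-1` \bigcap_n H n) <= leb A)%E.
  apply/lee_addgt0Pr => e e0.
  have [n _ /(_ n (leqnn n)) ne] := near_infty_natSinv_lt (PosNum e0); rewrite /= in ne.
  have [_ _ h] := hH n.
  apply: (@le_trans _ _ (leb (T @^-1` H n))).
    apply: (le_outer_measure (lebesgue_outer : {outer_measure set V -> \bar R})).
    by move=> x; apply.
  by apply: (le_trans h); rewrite leeD2l// lee_fin ltW.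
rewrite measureD//; last by apply: (le_lt_trans le1).
rewrite setIidr//; apply/eqP; rewrite eq_le; apply/andP; split.
  by rewrite sube_le0.
rewrite sube_ge0; last by rewrite lA.
exact: (le_outer_measure (lebesgue_outer : {outer_measure set V -> \bar R})).
Qed.

Lemma approximable_measurable g A : itg g -> measurable A -> approximable g A.
Proof.
move=> ig mA.
have -> : A = \bigcup_n (A `&` eball 0 n%:R).
  rewrite -setI_bigcupr [X in _ `&` X](_ : _ = setT) ?setIT//.
  apply/seteqP; split => // x _; exists (Num.bound (enorm x)) => //.
  by rewrite /eball /= subr0; exact: archi_boundP (enorm_ge0 x).
apply: approximable_bigcup => // n.
set B := A `&` _; have mB : measurable B by apply: measurableI => //; exact: measurable_eball.
have fB : (leb B < +oo)%E.
  apply: le_lt_trans (leb_eball_lty (0 : V) n%:R).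
  by apply: (le_outer_measure (lebesgue_outer : {outer_measure set V -> \bar R})); exact: subIsetr.
have [H [mH BH BH0]] := borel_hull mB fB.
have [mTH hTH] := approximable_tuple ig mH.
split=> // e e0; have [p [p1 p2 p3]] := hTH e e0; exists p; split => //.
apply: le_lt_trans p3; rewrite le_eqVlt; apply/orP; left; apply/eqP.
have mg := itg_measurable (itg_norm ig).
apply: int_ae.
- exact: (measurable_funM mg (mfun_norm (measurable_funB (measurable_indic_leb mB) (Ccoo_measurable p1)))).
- exact: (measurable_funM mg (mfun_norm (measurable_funB (measurable_indic_leb mTH) (Ccoo_measurable p1)))).
exists ((fun x : V => [tuple x 0 i | i < d]) @^-1` H `\` B); split => //.
  exact: measurableD.
move=> x /= hx; apply: contrapT => nx; apply: hx; congr (_ * `|_ - _|); rewrite !indicE.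
have [/set_mem Bx|Bx] := boolP (x \in B); first by rewrite mem_set//; exact: BH.
rewrite memNset// => Hx; apply: nx; split => // /mem_set; exact/negP.
Qed.

(** After multiplication by a bump that is positive on a ball, [g] becomes integrable; its integral
    against test functions vanishes, hence against every indicator, in particular that of the set
    where the product is positive. *)
Lemma ae_eq0_of_test g : loc g -> (forall phi, Ccoo setT phi -> rint (fun x => g x * phi x) = 0) ->
  {ae leb, forall x, g x = 0}.
Proof.
move=> lg h.
have key n : {ae leb, forall x, eball 0 n%:R x -> g x = 0}.
  pose P := bump (0 : V) n%:R 1.
  have hP : Ccoo setT P by exact: Ccoo_bump.
  have [r sP] := Ccoo_supp hP.
  have Pb x := bump_bounds (0 : V) n%:R 1 x.
  have mP := Ccoo_measurable hP.
  have Pn x : `|P x| <= 1 by have /andP[h1 h2] := Pb x; rewrite ger0_norm.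
  have igP : itg (fun x => g x * P x) by exact: (loc_mul lg mP Pn sP).
  have mgP := itg_measurable igP.
  have z A : measurable A -> rint (fun x => (g x * P x) * \1_A x) = 0.
    move=> mA; apply/eqP; rewrite -normr_le0; apply/ler_addgt0Pr => e e0; rewrite add0r.
    have [_ /(_ e e0)[p [p1 p2 p3]]] := approximable_measurable igP mA.
    have i1 : itg (fun x => (g x * P x) * \1_A x).
      by apply: (itg_mulb (C := 1) igP (measurable_indic_leb mA)); exact: indic_norm_le1.
    have pn x : `|p x| <= 1 by have /andP[h1 h2] := p2 x; rewrite ger0_norm.
    have i2 : itg (fun x => (g x * P x) * p x) by exact: (itg_mulb igP (Ccoo_measurable p1) pn).
    have -> : rint (fun x => (g x * P x) * \1_A x) =
        rint (fun x => (g x * P x) * \1_A x - (g x * P x) * p x).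
      rewrite intB// [X in _ - X](_ : _ = 0) ?subr0//.
      rewrite -(h (fun x => P x * p x)); last by apply: Ccoo_mul => // m; exact: (Ccoo_Ck m hP).
      by congr rint; apply/funext => x; rewrite mulrA.
    apply: (le_trans (int_norm (itgB i1 i2))); apply: ltW; apply: le_lt_trans p3.
    rewrite le_eqVlt; apply/orP; left; apply/eqP; congr rint; apply/funext => x.
    by rewrite -mulrBr normrM.
  have mpos : measurable [set x | 0 < g x * P x].
    rewrite (_ : [set _ | _] = setT `&` (fun x => g x * P x) @^-1` `]0, +oo[%classic).
      by apply: mgP.
    by apply/seteqP; split => x /=; rewrite in_itv/= andbT => // -[].
  have ann : {ae leb, forall x, `|g x * P x| = 0}.
    apply: int_eq0_ae => //; first exact: itg_norm.
    have i1 : itg (fun x => (g x * P x) * \1_[set x | 0 < g x * P x] x).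
      by apply: (itg_mulb (C := 1) igP (measurable_indic_leb mpos)); exact: indic_norm_le1.
    have -> : (fun x => `|g x * P x|) = (fun x => 2 * ((g x * P x) * \1_[set x | 0 < g x * P x] x) - g x * P x).
      apply/funext => x; rewrite indicE; case: (ltP 0 (g x * P x)) => hx.
        by rewrite mem_set//= gtr0_norm//; ring.
      by rewrite memNset /= ?ler0_norm//; [ring|apply/negP; rewrite -leNgt].
    rewrite intB ?intZ ?z// ?mulr0 ?sub0r; last exact: itgZ.
    by rewrite h// oppr0.
  apply: filterS ann => x /eqP; rewrite normr_eq0 mulf_eq0 => /orP[/eqP//|/eqP P0] xb.
  exfalso; move: xb; rewrite /eball /= => xb.
  have : 0 < P x.
    apply: em_gt0; rewrite invr1 mulr1 nsqE subr_gt0 ltr_pXn2r// nnegrE ?enorm_ge0//.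
  by rewrite P0 ltxx.
have : {ae leb, forall x, forall n, eball 0 n%:R x -> g x = 0}.
  by apply/ae_foralln => n; exact: key.
apply: filterS => x hx; apply: (hx (Num.bound (enorm x))).
by rewrite /eball /= subr0; exact: archi_boundP (enorm_ge0 x).
Qed.

End density.

(** * Riesz representation on test functions *)

Section hilbert.
Context {R : realType}.

Lemma riesz_functions (T : Type) (S : set (T -> R)) (B : (T -> R) -> (T -> R) -> R)
    (l : (T -> R) -> R) (C : R) :
  S (cst 0) ->
  (forall c u v, S u -> S v -> S (fun x => c * u x + v x)) ->
  (forall c u v w, S u -> S v -> S w -> B (fun x => c * u x + v x) w = c * B u w + B v w) ->
  (forall u v, S u -> S v -> B u v = B v u) ->
  (forall u, S u -> 0 <= B u u) ->
  (forall c u v, S u -> S v -> l (fun x => c * u x + v x) = c * l u + l v) ->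
  (forall u, S u -> l u ^+ 2 <= C * B u u) ->
  exists x : nat -> T -> R, [/\ forall n, S (x n),
    forall e, 0 < e -> exists N, forall n m, (N <= n)%N -> (N <= m)%N ->
      B (fun t => x n t - x m t) (fun t => x n t - x m t) <= e &
    forall y, S y -> B (x n) y @[n --> \oo] --> l y].
Proof.
move=> S0 Sl Bl Bs Bp ll lC.
have [x [Sx xx xl]] := @riesz_sequence R (T -> R^o)%type S B S0 Sl Bl Bs Bp l C ll lC.
exists x; split => // e e0.
have e8 : 0 < e / 8 by rewrite divr_gt0.
have [N _ hN] := near_infty_natSinv_lt (PosNum e8).
exists N => n m Nn Nm; apply: (le_trans (xx n m)).
move: (hN n Nn) (hN m Nm) => /=; move: (n.+1%:R^-1) (m.+1%:R^-1) => a b; lra.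
Qed.

Section L2cvg.
Context {dT : measure_display} {T : measurableType dT}.
Variable mu : {measure set T -> \bar R}.
Local Notation itg := (mintegrable mu).
Local Notation rint := (mintegral mu).
Local Notation L2 := (L2fun mu).

Lemma cvg0_of_sqr (a b : nat -> R) (K : R) : (forall n, a n ^+ 2 <= K * b n) ->
  b n @[n --> \oo] --> 0 -> a n @[n --> \oo] --> 0.
Proof.
move=> h b0; apply/cvgrPdist_lt => e e0.
have K1 : 0 < `|K| + 1 by rewrite ltr_wpDl.
have e1 : 0 < e ^+ 2 / (`|K| + 1) by rewrite divr_gt0// exprn_gt0.
move/cvgrPdist_lt : b0 => /(_ _ e1)[N _ hN]; exists N => // n /hN /=.
rewrite !sub0r !normrN ltr_pdivlMr// => hb.
rewrite -(@ltr_pXn2r _ 2) ?nnegrE// ?ltW// real_normK ?num_real//.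
apply: (le_lt_trans (h n)); apply: le_lt_trans hb.
apply: (le_trans (ler_norm _)); rewrite normrM mulrC ler_wpM2l// lerDl; exact: ler01.
Qed.

Lemma int_lin c f g : itg f -> itg g -> rint (fun t => c * f t + g t) = c * rint f + rint g.
Proof. by move=> hf hg; rewrite -intZ // -intD //; exact: itgZ. Qed.

Lemma L2cvg_ip (x : nat -> T -> R) f g : (forall n, L2 (x n)) -> L2 f -> L2 g ->
  rint (fun t => (x n t - f t) ^+ 2) @[n --> \oo] --> 0 ->
  rint (fun t => x n t * g t) @[n --> \oo] --> rint (fun t => f t * g t).
Proof.
move=> hx hf hg h; apply/subr_cvg0.
apply: (cvg0_of_sqr (K := rint (fun t => g t ^+ 2)) _ h) => n.
rewrite -intB; [|exact: (L2_mul (hx n) hg)|exact: (L2_mul hf hg)].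
rewrite mulrC; under [X in rint X ^+ 2]funext do rewrite -mulrBl.
exact: (cauchy_schwarz (L2B (hx n) hf) hg).
Qed.

Lemma L2cvg_nrm (x : nat -> T -> R) f : (forall n, L2 (x n)) -> L2 f ->
  rint (fun t => (x n t - f t) ^+ 2) @[n --> \oo] --> 0 ->
  rint (fun t => x n t ^+ 2) @[n --> \oo] --> rint (fun t => f t ^+ 2).
Proof.
move=> hx hf h.
have h1 := L2cvg_ip hx hf hf h.
have -> : (fun n => rint (fun t => x n t ^+ 2)) =
  (fun n => rint (fun t => (x n t - f t) ^+ 2) + 2 * rint (fun t => x n t * f t) - rint (fun t => f t ^+ 2)).
  apply/funext => n.
  rewrite -intZ; last exact: (L2_mul (hx n) hf).
  have i1 := (L2B (hx n) hf).2; have i2 := itgZ 2 (L2_mul (hx n) hf).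
  rewrite -intD// -intB; [|exact: itgD|exact: hf.2].
  by congr rint; apply/funext => t; ring.
have E : rint (fun t => f t ^+ 2) = 0 + 2 * rint (fun t => f t * f t) - rint (fun t => f t ^+ 2).
  by rewrite (_ : rint (fun t => f t * f t) = rint (fun t => f t ^+ 2)); [ring|congr rint].
rewrite [X in _ --> X]E; apply: cvgB; last exact: cvg_cst.
by apply: cvgD => //; apply: cvgM => //; exact: cvg_cst.
Qed.

End L2cvg.

Context {d : nat}.
Local Notation V := 'rV[R]_d.
Local Notation rint := (mintegral (@leb R d)).
Local Notation itg := (mintegrable (@leb R d)).
Local Notation L2 := (L2fun (@leb R d)).

(* The Riesz sequence stays in [Ccoo], so its limit represents the functional. *)
Lemma riesz_Ccoo (l : (V -> R) -> R) (C : R) : 0 <= C ->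
  (forall c u v, Ccoo setT u -> Ccoo setT v -> l (fun x => c * u x + v x) = c * l u + l v) ->
  (forall u, Ccoo setT u -> l u ^+ 2 <= C * rint (fun x => u x ^+ 2)) ->
  exists x f, [/\ forall n : nat, Ccoo setT (x n), L2 f,
     rint (fun t => (x n t - f t) ^+ 2) @[n --> \oo] --> 0,
     forall phi, Ccoo setT phi -> rint (fun t => f t * phi t) = l phi &
     rint (fun t => f t ^+ 2) <= C].
Proof.
move=> C0 ll lC.
pose B (f g : V -> R) : R := rint (fun x => f x * g x).
have hL (f : V -> R) : Ccoo setT f -> L2 f by exact: Ccoo_L2.
have B2 f : B f f = rint (fun x => f x ^+ 2) by congr rint.
have [|c u v|c f g w hf hg hw|f g _ _|f _|||x [Sx xx xl]] := @riesz_functions V (Ccoo setT) B l C.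
- exact: Ccoo0.
- exact: Ccoo_lin.
- rewrite /B -intZ -?intD; [|exact: itgZ (L2_mul (hL _ hf) (hL _ hw))|exact: (L2_mul (hL _ hg) (hL _ hw))|exact: (L2_mul (hL _ hf) (hL _ hw))].
  by congr rint; apply/funext => x; ring.
- by rewrite /B; congr rint; apply/funext => x; rewrite mulrC.
- by rewrite B2; apply: int_sqr_ge0.
- exact: ll.
- by move=> u hu; rewrite B2; exact: lC.
have [f hf xf] : exists2 f, L2 f & rint (fun t => (x n t - f t) ^+ 2) @[n --> \oo] --> 0.
  apply: L2_complete => [n|e e0]; first exact: hL.
  have [N hN] := xx e e0; exists N => m n Nm Nn; rewrite -B2; exact: hN.
have fl phi : Ccoo setT phi -> rint (fun t => f t * phi t) = l phi.
  move=> hp; have h1 := L2cvg_ip (fun n => hL _ (Sx n)) hf (hL _ hp) xf.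
  exact: (cvg_unique _ h1 (xl _ hp)).
exists x, f; split => //.
have h1 := L2cvg_ip (fun n => hL _ (Sx n)) hf hf xf.
have h2 := L2cvg_nrm (fun n => hL _ (Sx n)) hf xf.
set F := rint (fun t => f t ^+ 2) in h2 *.
rewrite -/(B f f) B2 -/F in h1.
have h3 : (rint (fun t => x n t * f t)) ^+ 2 @[n --> \oo] --> F ^+ 2.
  rewrite expr2 (_ : (fun n => _) = (fun n => rint (fun t => x n t * f t) * rint (fun t => x n t * f t))); first exact: cvgM.
  by apply/funext => n; rewrite expr2.
have h4 : C * rint (fun t => x n t ^+ 2) @[n --> \oo] --> C * F.
  by apply: cvgM => //; exact: cvg_cst.
have : F ^+ 2 <= C * F.
  apply: (ler_cvg_to h3 h4); apply: nearW => n.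
  have -> : rint (fun t => x n t * f t) = l (x n).
    by rewrite -fl//; congr rint; apply/funext => t; rewrite mulrC.
  exact: lC.
have F0 : 0 <= F by exact: int_sqr_ge0.
have [->//|Fn0 h] := eqVneq F 0.
have Fp : 0 < F by rewrite lt_neqAle eq_sym Fn0.
by rewrite -(ler_pM2r Fp) -expr2.
Qed.

(** Represent the functional [phi -> int u phi] on test functions: the representing function is an
    L^2 limit of test functions, and it equals [u] almost everywhere because both act alike on test
    functions. *)
Lemma Ccoo_dense_L2 u e : L2 u -> 0 < e ->
  exists2 phi, Ccoo setT phi & rint (fun x => (u x - phi x) ^+ 2) < e.
Proof.
move=> hu e0.
have hL (f : V -> R) : Ccoo setT f -> L2 f by exact: Ccoo_L2.
have [|c f g hf hg|f hf|x [f [hx hf xf fl _]]] :=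
  riesz_Ccoo (l := fun f => rint (fun t => u t * f t)) (C := rint (fun t => u t ^+ 2)).
- exact: int_sqr_ge0.
- rewrite -intZ -?intD; [|exact: itgZ (L2_mul hu (hL _ hf))|exact: (L2_mul hu (hL _ hg))|exact: (L2_mul hu (hL _ hf))].
  by congr rint; apply/funext => x; ring.
- exact: (cauchy_schwarz hu (hL _ hf)).
have fu : {ae @leb R d, forall x, u x - f x = 0}.
  apply: ae_eq0_of_test.
  - exact: (loc_L2 (L2B hu hf)).
  - move=> phi hp; rewrite (_ : (fun x => _) = (fun x => u x * phi x - f x * phi x)); last by apply/funext => y; ring.
    rewrite intB; [|exact: (L2_mul hu (hL _ hp))|exact: (L2_mul hf (hL _ hp))].
    by rewrite fl// subrr.
move/cvgrPdist_lt : xf => /(_ _ e0)[N _ /(_ N (leqnn N))] /=.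
rewrite sub0r normrN ger0_norm; last exact: int_sqr_ge0.
move=> h; exists (x N); first exact: hx.
rewrite (_ : rint _ = rint (fun t => (x N t - f t) ^+ 2)) //.
apply: int_ae; [exact: (itg_measurable (L2B hu (hL _ (hx N))).2)|exact: (itg_measurable (L2B (hL _ (hx N)) hf).2)|].
by apply: filterS fu => y /eqP; rewrite subr_eq0 => /eqP ->; rewrite -sqrrN opprB.
Qed.

End hilbert.

(** * A smooth averaging kernel and its potential *)

Section kernel.
Context {R : realType} {d : nat}.
Local Notation V := 'rV[R]_d.
Local Notation rint := (mintegral (@leb R d)).
Local Notation itg := (mintegrable (@leb R d)).
Implicit Types (x y z : V) (r s : R) (u f : V -> R) (i : 'I_d).

Lemma Ck_nsq0 k : Ck k (@nsq R d).
Proof. by have := Ck_nsq k (0 : V); congr Ck; apply/funext => x; rewrite subr0. Qed.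

Lemma partial_nsq0 i x : partial i (@nsq R d) x = 2 * x 0 i.
Proof.
have -> : @nsq R d = (fun y => nsq (y - 0)) by apply/funext => y; rewrite subr0.
by rewrite partial_nsq mxE subr0.
Qed.

Lemma nsq_ge0 x : 0 <= nsq x. Proof. by rewrite nsqE sqr_ge0. Qed.

Lemma em_le m : exists2 C : R, 0 <= C & forall s : R, s <= 1 -> `|em m s| <= C.
Proof.
have [C C0 hC] := @em_bound R m; exists C => // s s1; rewrite ger0_norm ?em_ge0//.
have [s0|s0] := leP s 0; first by rewrite em_le0.
by apply: (le_trans (hC s)); rewrite ger0_norm ?(ltW s0)// ler_piMr.
Qed.

Definition karg r z : R := 1 - r^-1 ^+ 2 * nsq z.

Definition kern0 r z : R := r^-1 ^+ d * em 2 (karg r z).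

Definition kmass : R := rint (kern0 1).

Definition kern r z : R := kmass^-1 * kern0 r z.

(** The profile is [em 0] because its derivative is [em 2], the profile of [kern]: the gradient of
    [Kpot r] at [z] is [- z kern r z]. *)
Definition Kpot r z : R := kmass^-1 * (2^-1 * r ^+ 2 * (r^-1 ^+ d * em 0 (karg r z))).

Lemma karg_le1 r z : karg r z <= 1.
Proof. by rewrite lerBlDr lerDl mulr_ge0// ?sqr_ge0// nsq_ge0. Qed.

Lemma karg_le0 r z : 0 < r -> r <= enorm z -> karg r z <= 0.
Proof.
move=> r0 rz; rewrite subr_le0 nsqE -exprMn; apply: exprn_ege1.
by rewrite mulrC ler_pdivlMr// mul1r.
Qed.

Lemma Ck_em_karg m k r : Ck k (fun z => em m (karg r z)).
Proof.
apply: (@Ck_comp _ _ setT k (em m) (karg r)) => //; first exact: Sk_em.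
by apply: CkB; [exact: Ck_cst|apply: CkZ; exact: Ck_nsq0].
Qed.

Lemma Ck_kern0 k r : Ck k (kern0 r).
Proof. by apply: CkZ; exact: Ck_em_karg. Qed.

Lemma Ck_kern k r : Ck k (kern r).
Proof. by apply: CkZ; exact: Ck_kern0. Qed.

Lemma Ck_Kpot k r : Ck k (Kpot r).
Proof. by do 3!apply: CkZ; exact: Ck_em_karg. Qed.

Lemma kern0_supp r : 0 < r -> supp_in r (kern0 r).
Proof. by move=> r0 z rz; rewrite /kern0 em_le0 ?mulr0//; exact: karg_le0. Qed.

Lemma kern_supp r : 0 < r -> supp_in r (kern r).
Proof. by move=> r0 z rz; rewrite /kern kern0_supp// mulr0. Qed.

Lemma Kpot_supp r : 0 < r -> supp_in r (Kpot r).
Proof. by move=> r0 z rz; rewrite /Kpot em_le0 ?mulr0//; exact: karg_le0. Qed.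

Lemma kern_even r z : kern r (- z) = kern r z.
Proof. by rewrite /kern /kern0 /karg !nsqE enormN. Qed.

Lemma itg_kern0 r : 0 < r -> itg (kern0 r).
Proof. by move=> r0; exact: (itg_csuppc (Ck_cont (Ck_kern0 0 r)) (kern0_supp r0)). Qed.

Lemma kern0_ge0 r z : 0 <= r -> 0 <= kern0 r z.
Proof. by move=> r0; rewrite mulr_ge0 ?em_ge0// exprn_ge0// invr_ge0. Qed.

Lemma kern0_lower : exists2 c : R, 0 < c & forall r z, 0 < r -> enorm z <= r / 2 ->
  c * r^-1 ^+ d <= kern0 r z.
Proof.
exists (expR (- (4 / 3))) => [|r z r0 rz]; first exact: expR_gt0.
rewrite mulrC /kern0 ler_wpM2l ?exprn_ge0 ?invr_ge0 ?(ltW r0)//.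
set s := karg r z.
have sh : 3 / 4 <= s.
  have h : r^-1 ^+ 2 * nsq z <= 4^-1.
    rewrite nsqE -exprMn (_ : 4^-1 = (2^-1) ^+ 2 :> R); last by field.
    rewrite ler_pXn2r// ?nnegrE ?mulr_ge0 ?enorm_ge0 ?invr_ge0 ?(ltW r0)//.
    by rewrite mulrC ler_pdivrMr// mulrC.
  by rewrite /s /karg; move: (_ * nsq z) h => a; lra.
have s1 : s <= 1 by exact: karg_le1.
have s0 : 0 < s by lra.
have si : 1 <= s^-1 <= 4 / 3.
  rewrite invf_ge1// s1 /= (_ : 4 / 3 = (3 / 4)^-1 :> R); last by field.
  by rewrite lef_pV2// ?posrE//; lra.
rewrite /em s0; move: si => /andP[si1 si2].
apply: (@le_trans _ _ (1 * expR (- s^-1))); first by rewrite mul1r ler_expR lerN2.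
by rewrite ler_wpM2r ?expR_ge0// exprn_ege1.
Qed.

Lemma kmass_gt0 : 0 < kmass.
Proof.
have [c c0 hc] := kern0_lower; rewrite /kmass.
have me := measurable_eball (0 : V) 2^-1.
have fe := leb_eball_lty (0 : V) 2^-1.
have h : rint (fun x => c * \1_(eball (0 : V) 2^-1) x) <= rint (kern0 1).
  apply: int_le; [exact: (itgZ c (itg_indic me fe))|exact: itg_kern0 ltr01|move=> x].
  rewrite indicE; case: (boolP (x \in _)); rewrite ?inE /eball /= ?subr0 => hx.
    rewrite mulr1; have := hc 1 x ltr01; rewrite invr1 expr1n mulr1 mul1r; apply.
    exact: ltW.
  by rewrite mulr0; exact: kern0_ge0 ler01.
apply: lt_le_trans h; rewrite intZ; last exact: itg_indic me fe.
rewrite int_indic// mulr_gt0// fine_gt0// fe andbT; apply: leb_eball_gt0; lra.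
Qed.

Lemma kern_ge0 r z : 0 <= r -> 0 <= kern r z.
Proof. by move=> r0; rewrite mulr_ge0 ?kern0_ge0// invr_ge0 ltW// kmass_gt0. Qed.

Lemma Kpot_ge0 r z : 0 <= r -> 0 <= Kpot r z.
Proof.
move=> r0; rewrite !mulr_ge0 ?em_ge0// ?exprn_ge0 ?invr_ge0 ?(ltW kmass_gt0)//.
Qed.

Lemma kern_upper : exists2 C : R, 0 < C & forall r z, 0 < r -> kern r z <= C * r^-1 ^+ d.
Proof.
have [C C0 hC] := em_le 2; exists (kmass^-1 * (C + 1)) => [|r z r0].
  by rewrite mulr_gt0 ?invr_gt0 ?kmass_gt0// ltr_wpDl.
rewrite /kern -mulrA ler_wpM2l ?invr_ge0 ?(ltW kmass_gt0)// /kern0 mulrC ler_wpM2r//.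
  by rewrite exprn_ge0// invr_ge0 ltW.
by have := hC _ (karg_le1 r z); have := ler_norm (em 2 (karg r z)); lra.
Qed.

Lemma kern_lower : exists2 c : R, 0 < c & forall r z, 0 < r -> enorm z <= r / 2 ->
  c * r^-1 ^+ d <= kern r z.
Proof.
have [c c0 hc] := kern0_lower; exists (kmass^-1 * c) => [|r z r0 rz].
  by rewrite mulr_gt0 ?invr_gt0 ?kmass_gt0.
by rewrite /kern -mulrA ler_wpM2l ?invr_ge0 ?(ltW kmass_gt0)//; exact: hc.
Qed.

Definition dem2 (s : R) : R := - 2%:R * em 3 s + em 4 s.

Lemma dem2_bound : exists2 C : R, 0 <= C & forall s, s <= 1 -> `|dem2 s| <= C.
Proof.
have [C3 C30 h3] := em_le 3; have [C4 C40 h4] := em_le 4.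
exists (2 * C3 + C4) => [|s s1]; first by lra.
have := h3 s s1; have := h4 s s1; rewrite (ger0_norm (em_ge0 3 s)) (ger0_norm (em_ge0 4 s)) => h5 h6.
have := em_ge0 3 s; have := em_ge0 4 s => h7 h8.
by rewrite ler_norml /dem2; apply/andP; split; lra.
Qed.

Lemma partial_em_karg m i r z : partial i (fun z => em m (karg r z)) z =
  (- m%:R * em m.+1 (karg r z) + em m.+2 (karg r z)) * (- (2 * r^-1 ^+ 2) * z 0 i).
Proof.
have ck : Ck 1 (karg r) by apply: CkB; [exact: Ck_cst|apply: CkZ; exact: Ck_nsq0].
rewrite (partial_comp (h' := fun s => - m%:R * em m.+1 s + em m.+2 s) i (is_derive_em m (karg r z)) ck).
congr (_ * _); rewrite /karg (@partialB _ _ 0 (fun=> 1) (fun z => r^-1 ^+ 2 * nsq z)); last 2 first.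
- exact: Ck_cst.
- by apply: CkZ; exact: Ck_nsq0.
rewrite partial_cst (@partialZ _ _ 0 _ (@nsq R d)) ?partial_nsq0; first by ring.
exact: Ck_nsq0.
Qed.

Lemma partial_kern i r z :
  partial i (kern r) z = - (2 * kmass^-1 * r^-1 ^+ d * r^-1 ^+ 2 * dem2 (karg r z) * z 0 i).
Proof.
rewrite (@partialZ _ _ 0 _ (kern0 r)) ?(@partialZ _ _ 0 _ (fun z => em 2 (karg r z))) ?partial_em_karg.
- by rewrite /dem2; ring.
- exact: Ck_em_karg.
- exact: Ck_kern0.
Qed.

Lemma partial_Kpot i r z : r != 0 -> partial i (Kpot r) z = - (z 0 i * kern r z).
Proof.
move=> r0; rewrite (@partialZ _ _ 0); last by do 2!apply: CkZ; exact: Ck_em_karg.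
rewrite (@partialZ _ _ 0); last by apply: CkZ; exact: Ck_em_karg.
rewrite (@partialZ _ _ 0); last by exact: Ck_em_karg.
rewrite partial_em_karg /kern /kern0; set a := r^-1 ^+ d; set c := kmass^-1; set m := em 2 _.
by rewrite (_ : r^-1 ^+ 2 = (r ^+ 2)^-1) ?exprVn//; field.
Qed.

Lemma kern_lipschitz : exists2 C : R, 0 < C & forall r x y, 0 < r ->
  `|kern r x - kern r y| <= C * r^-1 ^+ d * r^-1 * enorm (x - y).
Proof.
have [D D0 hD] := dem2_bound; have k0 := kmass_gt0.
pose C := 2 * kmass^-1 * D.
have C0 : 0 <= C by rewrite !mulr_ge0 ?invr_ge0 ?(ltW k0).
exists (C * d%:R + 1) => [|r x y r0]; first by rewrite ltr_wpDl// mulr_ge0.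
have ri : 0 <= r^-1 by rewrite invr_ge0 ltW.
have rd : 0 <= r^-1 ^+ d by exact: exprn_ge0.
have hb i z : `|partial i (kern r) z| <= C * r^-1 ^+ d * r^-1.
  have [rz|zr] := leP r (enorm z).
    rewrite partial_kern /dem2 !em_le0 ?karg_le0// !mulr0 addr0 mulr0 mul0r oppr0 normr0.
    by apply: mulr_ge0 => //; exact: mulr_ge0.
  rewrite partial_kern normrN.
  have -> : 2 * kmass^-1 * r^-1 ^+ d * r^-1 ^+ 2 * dem2 (karg r z) * z 0 i =
    (2 * kmass^-1) * (dem2 (karg r z) * (r^-1 * z 0 i)) * r^-1 ^+ d * r^-1 by ring.
  rewrite !normrM (ger0_norm ri) (ger0_norm rd) !ler_wpM2r//.
  have -> : `|2| * `|kmass^-1| = 2 * kmass^-1 by rewrite !ger0_norm// invr_ge0 ltW.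
  rewrite /C ler_wpM2l ?mulr_ge0 ?invr_ge0 ?(ltW k0)//.
  rewrite -[leRHS]mulr1; apply: ler_pM => //; first by rewrite mulr_ge0.
    exact/hD/karg_le1.
  by rewrite mulrC ler_pdivrMr// mul1r; apply: (le_trans (enorm_coord z i)); exact: ltW.
clearbody C.
have := Ck1_lipschitz y (x - y) (Ck_kern 1 r) hb; rewrite [y + _]addrC subrK => h.
apply: (le_trans h).
have h2 : \sum_i `|(x - y) 0 i| <= d%:R * enorm (x - y).
  by apply: (le_trans (sum_le_norm _)); rewrite ler_wpM2l// norm_le_enorm.
apply: (le_trans (ler_wpM2l _ h2)); first by rewrite !mulr_ge0.
set e := enorm _; have e0 : 0 <= e by exact: enorm_ge0.
have -> : C * r^-1 ^+ d * r^-1 * (d%:R * e) = (C * d%:R) * (r^-1 ^+ d * r^-1 * e) by ring.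
have -> : (C * d%:R + 1) * r^-1 ^+ d * r^-1 * e = (C * d%:R) * (r^-1 ^+ d * r^-1 * e) + r^-1 ^+ d * r^-1 * e by ring.
by rewrite lerDl !mulr_ge0.
Qed.

Definition lap f x : R := \sum_i partial i (partial i f) x.

Lemma lap_Kpot r z : r != 0 -> lap (Kpot r) z = - d%:R * kern r z - \sum_i z 0 i * partial i (kern r) z.
Proof.
move=> r0; rewrite /lap.
have h i : partial i (partial i (Kpot r)) z = - kern r z - z 0 i * partial i (kern r) z.
  have -> : partial i (Kpot r) = (fun z => - (z 0 i * kern r z)).
    by apply/funext => y; exact: partial_Kpot.
  rewrite (@partialN _ _ 0); last by apply: CkM; [exact: Ck_coord|exact: Ck_kern].
  rewrite (@partialM _ _ 0); [|exact: Ck_coord|exact: Ck_kern].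
  by rewrite partial_coord eqxx mulr1 opprD addrC.
under eq_bigr do rewrite h.
by rewrite sumrB; congr (_ - _); rewrite sumr_const card_ord -[LHS]mulr_natl; ring.
Qed.

Lemma is_derive_invX (n : nat) r : r != 0 ->
  is_derive r (1 : R) (fun r => r^-1 ^+ n) (- n%:R * r^-1 ^+ n.+1).
Proof.
move=> r0; have h1 : is_derive r (1 : R) (fun t : R => t^-1) (- r ^- 2).
  by have := is_deriveV r0 (@is_derive_id R R r 1); rewrite [_ *: _]mulr1.
have := is_deriveX n h1; move/is_derive_eq => h.
have {}h := h _ erefl.
have -> : (fun r : R => r^-1 ^+ n) = (fun t : R => t^-1) ^+ n by apply/funext => t; rewrite !fctE.
move/is_derive_eq : h; apply; rewrite /GRing.scale /=.
case: n => [|n]; first by rewrite mulr0n oppr0 !mul0r.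
by rewrite /= -exprVn !exprS expr0; ring.
Qed.

(** Euler's relation: [kern] is homogeneous of degree [- d] in [(r, z)], so [r] times its derivative
    in [r] is minus the divergence of [z kern r z], that is the Laplacian of [Kpot r]. It turns the
    dependence of an average on its radius into the action of a Laplacian. *)
Lemma is_derive_kern r z : 0 < r ->
  is_derive r (1 : R) (fun r => kern r z) (r^-1 * lap (Kpot r) z).
Proof.
move=> r0; have rn : r != 0 by rewrite gt_eqF.
have h1 := is_derive_invX d rn.
have h2 : is_derive r (1 : R) (fun r => karg r z) (2 * r^-1 ^+ 3 * nsq z).
  have a := is_deriveM (is_derive_invX 2 rn) (is_derive_cst (nsq z) r (1 : R)).
  have := is_deriveB (is_derive_cst (1 : R) r (1 : R)) a.
  move/is_derive_eq; apply; rewrite /GRing.scale /=; ring.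
have h3 := @is_derive1_comp R (em 2) (fun r => karg r z) r _ _ (is_derive_em 2 _) h2.
have h4 := is_deriveM h1 h3.
have := is_deriveM (is_derive_cst (kmass^-1) r (1 : R)) h4; move/is_derive_eq; apply.
rewrite lap_Kpot// (eq_bigr (fun i => - (2 * kmass^-1 * r^-1 ^+ d * r^-1 ^+ 2 * dem2 (karg r z)) * (z 0 i * z 0 i))); last first.
  by move=> i _; rewrite partial_kern; ring.
rewrite -mulr_sumr -/(dot z z) -/(nsq z) /kern /kern0 /dem2 /GRing.scale /= !exprS expr0; ring.
Qed.

(** The bound is uniform for radii between [a / 2] and [2 a], as domination requires when the radius
    is differentiated. *)
Lemma lap_bound (a : R) : 0 < a -> exists2 C, 0 <= C & forall r z, a / 2 < r < 2 * a -> `|kern r z| <= C /\ `|r^-1 * lap (Kpot r) z| <= C.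
Proof.
move=> a0; have [D D0 hD] := dem2_bound; have k0 := kmass_gt0.
have [C2 C20 h2] := em_le 2.
pose b := (a / 2)^-1; have b0 : 0 <= b by rewrite invr_ge0; lra.
have kb0 : 0 <= kmass^-1 by rewrite invr_ge0 ltW.
pose C := kmass^-1 * b ^+ d * C2 + b * (d%:R * kmass^-1 * b ^+ d * C2 + 2 * kmass^-1 * b ^+ d * D).
have bd : 0 <= b ^+ d by exact: exprn_ge0.
have t1 : 0 <= kmass^-1 * b ^+ d * C2 by rewrite !mulr_ge0.
have t2 : 0 <= b * (d%:R * kmass^-1 * b ^+ d * C2 + 2 * kmass^-1 * b ^+ d * D).
  by rewrite mulr_ge0// addr_ge0// !mulr_ge0//; lra.
exists C => [|r z /andP[ar ra]]; first by rewrite /C addr_ge0.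
have r0 : 0 < r by lra.
have rn : r != 0 by rewrite gt_eqF.
have ri : 0 <= r^-1 <= b.
  by rewrite invr_ge0 ltW//= /b lef_pV2 ?posrE//; lra.
have rd : 0 <= r^-1 ^+ d <= b ^+ d.
  case/andP: ri => ri0 rib; rewrite exprn_ge0//=.
  by apply: lerXn2r; rewrite ?nnegrE.
have hk : `|kern r z| <= kmass^-1 * b ^+ d * C2.
  rewrite /kern /kern0 !normrM -mulrA ger0_norm//.
  rewrite ler_wpM2l// ler_pM//; last exact/h2/karg_le1.
  by case/andP: rd => rd0; rewrite ger0_norm.
split; first by rewrite /C; move: t1 t2 hk; set p := _ * C2; set q := b * _; lra.
suff h : `|lap (Kpot r) z| <= d%:R * kmass^-1 * b ^+ d * C2 + 2 * kmass^-1 * b ^+ d * D.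
  rewrite normrM /C; apply: (@le_trans _ _ (b * (d%:R * kmass^-1 * b ^+ d * C2 + 2 * kmass^-1 * b ^+ d * D))).
    by case/andP: ri => ri0 rib; rewrite ler_pM// ger0_norm.
  by move: t1; set p := kmass^-1 * _ * C2; set q := b * _; lra.
rewrite lap_Kpot// (eq_bigr (fun i => - (2 * kmass^-1 * r^-1 ^+ d * r^-1 ^+ 2 * dem2 (karg r z)) * (z 0 i * z 0 i))); last first.
  by move=> i _; rewrite partial_kern; ring.
rewrite -mulr_sumr -/(dot z z) -/(nsq z).
apply: (le_trans (ler_normB _ _)); apply: lerD.
  by rewrite mulNr normrN normrM (ger0_norm (ler0n _ _)) -!mulrA ler_wpM2l// !mulrA.
have [a2 Ea2] : exists a2, a2 = r^-1 ^+ 2 * nsq z by exists (r^-1 ^+ 2 * nsq z).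
have -> : - (2 * kmass^-1 * r^-1 ^+ d * r^-1 ^+ 2 * dem2 (karg r z)) * nsq z =
  - (2 * (kmass^-1 * (r^-1 ^+ d * (dem2 (karg r z) * a2)))) by rewrite Ea2; ring.
rewrite normrN !normrM (ger0_norm kb0) (ger0_norm (ler0n _ 2)) -!mulrA ler_wpM2l// ler_wpM2l//.
case/andP: rd => rd0 rdb.
apply: ler_pM; [exact: normr_ge0|apply: mulr_ge0; exact: normr_ge0|by rewrite ger0_norm|].
have [rz|zr] := leP r (enorm z).
  by rewrite /dem2 !em_le0 ?karg_le0// !mulr0 addr0 normr0 mul0r.
rewrite -[leRHS]mulr1; apply: ler_pM => //; first exact/hD/karg_le1.
rewrite Ea2 nsqE -exprMn ger0_norm ?sqr_ge0//.
rewrite exprn_ile1 ?mulr_ge0 ?enorm_ge0 ?invr_ge0 ?(ltW r0)//.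
by rewrite mulrC ler_pdivrMr// mul1r ltW.
Qed.

Lemma Ck_reflect k f x : Ck k f -> Ck k (fun y => f (x - y)).
Proof. by move=> /(Ck_affine (-1) x); congr Ck; apply/funext => y; rewrite scaleN1r. Qed.

Lemma supp_reflect r f x : supp_in r f -> supp_in (r + enorm x) (fun y => f (x - y)).
Proof.
move=> hr y hy; apply: hr.
have := enorm_dist y x; rewrite enormB => h; have := ler_norm (enorm y - enorm x); lra.
Qed.

Lemma is_derive_conv_kern u x r : loc u -> 0 < r ->
  is_derive r (1 : R) (fun r => conv u (kern r) x) (r^-1 * conv u (lap (Kpot r)) x).
Proof.
move=> lu r0; have [C C0 hC] := lap_bound r0.
have Clap s : Ck 0 (lap (Kpot s)) by apply: Ck_sum => i; do 2!apply: Ck_partial; exact: Ck_Kpot.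
have := @derive_int _ _ u (fun s y => kern s (x - y)) (fun s y => s^-1 * lap (Kpot s) (x - y)) r (r / 2) (2 * r) C (2 * r + enorm x) lu.
have -> : r^-1 * conv u (lap (Kpot r)) x = rint (fun y => u y * (r^-1 * lap (Kpot r) (x - y))).
  rewrite /conv -intZ.
    by congr rint; apply/funext => y; ring.
  have cl := Ck_cont (Ck_reflect x (CkZ r^-1 (Clap r))).
  have r1 : r / 2 < r < 2 * r by lra.
  apply: (@loc_mul _ _ u _ (r * C) (r + 1 + 1 + enorm x) lu).
  - exact: (continuous_measurable_leb (Ck_cont (Ck_reflect x (Clap r)))).
  - move=> y; have [_] := hC r (x - y) r1; rewrite normrM ger0_norm ?invr_ge0 ?(ltW r0)//.
    by rewrite mulrC ler_pdivrMr// mulrC.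
  - apply: supp_reflect => z hz; rewrite /lap big1// => i _.
    apply: (supp_partial (r := r + 1)) hz; first exact: Ck_partial (Ck_Kpot 2 r).
    by apply: supp_partial; [exact: Ck_Kpot|exact: Kpot_supp].
apply.
- lra.
- by move=> s; exact: (continuous_measurable_leb (Ck_cont (Ck_reflect x (Ck_kern 0 s)))).
- exact: (continuous_measurable_leb (Ck_cont (Ck_reflect x (CkZ _ (Clap r))))).
- by move=> s y hs; apply: is_derive_kern; lra.
- by move=> s y hs; exact: hC.
- move=> s y hs hy.
  have hz : s <= enorm (x - y).
    have := enorm_dist y x; rewrite enormB => h; have := ler_norm (enorm y - enorm x); lra.
  have s0 : 0 < s by lra.
  split; first exact: kern_supp.
  rewrite lap_Kpot ?gt_eqF// kern_supp// mulr0 sub0r big1 ?oppr0 ?mulr0// => i _.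
  by rewrite partial_kern /dem2 !em_le0 ?karg_le0// !mulr0 addr0 !mulr0 mul0r oppr0 mulr0.
Qed.

End kernel.

Section derive1D.
Context {R : realType}.

Lemma derive_ge0_le (f df : R -> R) (a b : R) : a <= b ->
  (forall s, a <= s <= b -> is_derive s (1 : R) f (df s)) ->
  (forall s, a <= s <= b -> 0 <= df s) -> f a <= f b.
Proof.
move=> ab h h0.
have [||c cab E] := @MVT_segment R f df a b ab.
- by move=> x; rewrite in_itv/= => /andP[x1 x2]; apply: h; rewrite !ltW.
- apply: derivable_within_continuous => x; rewrite in_itv/= => hx; exact: (@ex_derive _ _ _ _ _ _ _ (h x hx)).
- by rewrite -subr_ge0 E mulr_ge0 ?subr_ge0// h0// -in_itv.
Qed.

End derive1D.

Section tonelli.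
Context {R : realType} {d1 d2 : measure_display}.
Context {T1 : measurableType d1} {T2 : measurableType d2}.
Variables (m1 : {sigma_finite_measure set T1 -> \bar R}).
Variables (m2 : {sigma_finite_measure set T2 -> \bar R}).

Lemma tonelli (f : T1 -> T2 -> R) : measurable_fun setT (fun p => f p.1 p.2) ->
  (forall x y, 0 <= f x y) -> (forall x, itg m2 (f x)) -> (forall y, itg m1 (f ^~ y)) ->
  itg m2 (fun y => rint m1 (f ^~ y)) ->
  itg m1 (fun x => rint m2 (f x)) /\
  rint m1 (fun x => rint m2 (f x)) = rint m2 (fun y => rint m1 (f ^~ y)).
Proof.
move=> mf f0 i2 i1 ii.
pose F (p : T1 * T2) := (f p.1 p.2)%:E.
have mF : measurable_fun setT F by exact/measurable_EFinP.
have F0 p : (0 <= F p)%E by rewrite lee_fin.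
have E := fubini_tonelli (m1 := m1) (m2 := m2) F mF F0.
have E1 : (fun x => (\int[m2]_y F (x, y))%E) = (fun x => (rint m2 (f x))%:E).
  by apply/funext => x; rewrite EFin_int.
have E2 : (fun y => (\int[m1]_x F (x, y))%E) = (fun y => (rint m1 (f ^~ y))%:E).
  by apply/funext => y; rewrite EFin_int.
have E' : (\int[m1]_x (rint m2 (f x))%:E = \int[m2]_y (rint m1 (f ^~ y))%:E)%E.
  by have := E; rewrite -[X in integral m1 _ X]/((fun x => (\int[m2]_y F (x, y))%E)) E1
    -[X in integral m2 _ X]/((fun y => (\int[m1]_x F (x, y))%E)) E2.
split; last by rewrite /mintegral /Rintegral /= -/(rint _ _) E'.
apply/integrableP; split.
  have := measurable_fun_fubini_tonelli_F (m2 := m2) F mF F0.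
  by rewrite /fubini_F E1.
move/integrableP : ii => [_]; apply: le_lt_trans.
under eq_integral do rewrite /= ger0_norm ?int_ge0//.
under [X in (_ <= X)%E]eq_integral do rewrite /= ger0_norm ?int_ge0//.
by rewrite E'.
Qed.

End tonelli.

(** * Mollification in L^2 *)

Section mollifier.
Context {R : realType} {d : nat}.
Local Notation V := 'rV[R]_d.
Local Notation rint := (mintegral (@leb R d)).
Local Notation itg := (mintegrable (@leb R d)).
Local Notation L2 := (L2fun (@leb R d)).
Implicit Types (x y z h : V) (r s : R) (u v k f : V -> R) (i : 'I_d).

Lemma int_shift h f : itg f -> itg (fun x => f (x + h)) /\ rint (fun x => f (x + h)) = rint f.
Proof.
by move=> hf; apply: (int_preserving (measurable_shift h) _ hf) => A _; exact: leb_shift.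
Qed.

Lemma measurable_sub_coord i :
  measurable_fun setT (fun p : V * V => (p.1 - p.2) 0 i).
Proof.
under eq_fun do rewrite !mxE.
apply: measurable_funB.
  exact: (measurableT_comp (measurable_coord i) measurable_fst).
exact: (measurableT_comp (measurable_coord i) measurable_snd).
Qed.

Lemma cont_reflect k x : continuous k -> continuous (fun y => k (x - y)).
Proof.
move=> ck; have <- : (fun y => k (x + -1 *: y)) = (fun y => k (x - y)).
  by apply/funext => y; rewrite scaleN1r.
move=> y; apply: (@continuous_comp _ _ _ (fun y => x + -1 *: y) k); last exact: ck.
exact: cont_affine.
Qed.

Lemma partial_reflect f x y i : Ck 1 f -> partial i (fun y => f (x - y)) y = - partial i f (x - y).
Proof.
move=> hf; have := partial_affine (- 1) x i y hf; rewrite scaleN1r mulN1r => <-.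
by have -> : (fun y => f (x - y)) = (fun y => f (x + -1 *: y)) by apply/funext => w; rewrite scaleN1r.
Qed.

Lemma itg_partial_reflect f i r x : Ck 1 f -> supp_in r f ->
  itg (fun y => partial i f (x - y)).
Proof.
move=> hf hr; have c := cont_reflect (x := x) (Ck_cont (Ck_partial i hf)).
exact: (itg_csuppc c (supp_reflect (x := x) (supp_partial i hf hr))).
Qed.

Lemma int_partial0_reflect f i r x : Ck 1 f -> supp_in r f ->
  rint (fun y => partial i f (x - y)) = 0.
Proof.
move=> hf hr; have h1 := Ck_reflect x hf; have h2 := supp_reflect (x := x) hr.
have := int_partial0 i h1 h2.
have -> : partial i (fun y => f (x - y)) = (fun y => - 1 * partial i f (x - y)).
  by apply/funext => y; rewrite (partial_reflect _ _ _ hf) mulN1r.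
rewrite intZ; first by rewrite mulN1r => /eqP; rewrite oppr_eq0 => /eqP.
exact: itg_partial_reflect hf hr.
Qed.

Lemma itg_kern_reflect r x : 0 < r -> itg (fun y => kern r (x - y)).
Proof.
move=> r0; have c := Ck_cont (Ck_reflect x (Ck_kern 0 r)).
exact: (itg_csuppc c (supp_reflect (x := x) (kern_supp r0))).
Qed.

(** The mass does not depend on [r], since its derivative in [r] is a multiple of the integral of
    the Laplacian of a compactly supported function; at [r = 1] it is 1 by the choice of [kmass]. *)
Lemma int_kern_reflect0 r x : 0 < r -> rint (fun y => kern r (x - y)) = 1.
Proof.
move=> r0.
have l1 : loc (fun _ : V => 1 : R).
  by apply: (@loc_bounded _ _ _ 1) => [|y]; [exact: measurable_cst|rewrite normr1].
have D s : 0 < s -> is_derive s (1 : R) (fun s => conv (fun=> 1) (kern s) x) 0.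
  move=> s0; have := is_derive_conv_kern x l1 s0.
  suff -> : conv (fun=> 1) (lap (Kpot s)) x = 0 by rewrite mulr0.
  rewrite /conv /lap (_ : (fun y => _) = (fun y => \sum_i partial i (partial i (Kpot s)) (x - y))).
    have hi i : Ck 1 (partial i (Kpot s)) by exact: Ck_partial (Ck_Kpot 2 s).
    have si i : supp_in (s + 1) (partial i (Kpot s)).
      by apply: supp_partial; [exact: Ck_Kpot|exact: Kpot_supp].
    rewrite int_sum => [|i]; last exact: itg_partial_reflect (hi i) (si i).
    by rewrite big1// => i _; exact: int_partial0_reflect (hi i) (si i).
  by apply/funext => y; rewrite mul1r.
have E s : conv (fun=> 1) (kern s) x = rint (fun y => kern s (x - y)).
  by rewrite /conv; congr rint; apply/funext => y; rewrite mul1r.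
have mono a b : 0 < a -> a <= b -> conv (fun=> 1) (kern a) x = conv (fun=> 1) (kern b) x.
  move=> a0 ab; apply/eqP; rewrite eq_le; apply/andP; split.
    apply: (derive_ge0_le (f := fun s => conv (fun=> 1) (kern s) x) (df := fun=> 0) ab) => // s /andP[as_ _].
    by apply: D; exact: lt_le_trans as_.
  rewrite -lerN2.
  apply: (derive_ge0_le (f := fun s => - conv (fun=> 1) (kern s) x) (df := fun=> 0) ab) => // s /andP[as_ _].
  by have := is_deriveN (D s (lt_le_trans a0 as_)); rewrite oppr0.
have -> : rint (fun y => kern r (x - y)) = rint (fun y => kern 1 (x - y)).
  rewrite -!E; have [r1|r1] := leP r 1; first exact: mono.
  by apply/esym/mono => //; exact: ltW.
have -> : (fun y => kern 1 (x - y)) = (fun y => kern 1 (y - x)).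
  by apply/funext => y; rewrite -kern_even opprB.
have ik0 : itg (kern0 1 : V -> R) := itg_kern0 ltr01.
have ik : itg (kern 1 : V -> R) := itgZ (kmass^-1) ik0.
have [_ ->] := int_shift (- x) ik.
by rewrite /kern intZ// mulVf// gt_eqF// kmass_gt0.
Qed.

Lemma int_kern r : 0 < r -> rint (kern r) = 1.
Proof.
move=> r0; rewrite -(int_kern_reflect0 0 r0); congr rint; apply/funext => y.
by rewrite sub0r kern_even.
Qed.

Lemma Ccoo_reflect f x : Ccoo setT f -> Ccoo setT (fun y => f (x - y)).
Proof.
move=> hf; have [r hr] := Ccoo_supp hf; split => [m|]; first exact: Ck_reflect (hf.1 m).
by apply/csuppP; exists (r + enorm x); exact: supp_reflect.
Qed.

Lemma Ccoo_kern r : 0 < r -> Ccoo setT (kern r : V -> R).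
Proof.
move=> r0; split => [m|]; first exact: Ck_kern.
by apply/csuppP; exists r; exact: kern_supp.
Qed.

Lemma itg_conv1 v k r x : loc v -> continuous k -> supp_in r k -> itg (fun y => v y * k (x - y)).
Proof.
move=> lv ck hr; have [C C0 hC] := csupp_bounded ck hr.
apply: (loc_mul (C := C) lv _ _ (supp_reflect (x := x) hr)) => [|y]; last exact: hC.
exact: continuous_measurable_leb (cont_reflect (x := x) ck).
Qed.

Lemma conv_tonelli v k r : itg v -> (forall y, 0 <= v y) ->
  continuous k -> (forall y, 0 <= k y) -> supp_in r k ->
  itg (conv v k) /\ rint (conv v k) = rint v * rint k.
Proof.
move=> iv v0 ck k0 kr.
have ik : itg k by exact: itg_csuppc ck kr.
have sh y : itg (fun x => k (x - y)) /\ rint (fun x => k (x - y)) = rint k by exact: int_shift.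
have E y : rint (fun x => v y * k (x - y)) = v y * rint k.
  by rewrite intZ ?(sh y).2//; exact: (sh y).1.
have E' : (fun y => rint (fun x => v y * k (x - y))) = (fun y => rint k * v y).
  by apply/funext => y; rewrite E mulrC.
have [||||| i1 i2] := @tonelli R _ _ _ _ (@leb R d) (@leb R d) (fun x y => v y * k (x - y)).
- apply: measurable_funM; first exact: (measurableT_comp (itg_measurable iv) measurable_snd).
  exact: (measurable_comp_continuous measurable_sub_coord ck).
- by move=> x y; rewrite mulr_ge0.
- by move=> x; exact: itg_conv1 (loc_itg iv) ck kr.
- by move=> y; apply: itgZ; exact: (sh y).1.
- by rewrite E'; exact: itgZ.
- split; first exact: i1.
  have -> : rint (conv v k) = rint (fun y => rint k * v y) by rewrite -E'; exact: i2.
  by rewrite (intZ _ iv) mulrC.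
Qed.

(** Jensen's inequality, read off from the nonnegative integral of [(u y - c)^2 k (x - y)] with [c]
    the average itself; integrating in [x] is then Tonelli's theorem. *)
Lemma conv_L2 u k r : L2 u -> Ck 1 k -> (forall y, 0 <= k y) -> supp_in r k -> rint k = 1 ->
  (forall x, rint (fun y => k (x - y)) = 1) ->
  L2 (conv u k) /\ rint (fun x => conv u k x ^+ 2) <= rint (fun x => u x ^+ 2).
Proof.
move=> hu hk k0 kr k1 k1'; have ck := Ck_cont hk.
have [i1 i2] := conv_tonelli hu.2 (fun y => sqr_ge0 (u y)) ck k0 kr.
have mc : measurable_fun setT (conv u k).
  exact: (continuous_measurable_leb (conv_cont (loc_L2 hu) hk kr)).
have pw x : conv u k x ^+ 2 <= conv (fun y => u y ^+ 2) k x.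
  set c := conv u k x.
  have a1 := itg_conv1 x (loc_itg hu.2) ck kr; have a2 := itg_conv1 x (loc_L2 hu) ck kr.
  have a3 : itg (fun y => k (x - y)).
    have l1 : loc (fun _ : V => 1 : R).
      by apply: (@loc_bounded _ _ _ 1) => [|y]; [exact: measurable_cst|rewrite normr1].
    by have := itg_conv1 x l1 ck kr; under eq_fun do rewrite mul1r.
  have : 0 <= rint (fun y => (u y - c) ^+ 2 * k (x - y)).
    by apply: int_ge0 => y; rewrite mulr_ge0 ?sqr_ge0.
  have -> : (fun y => (u y - c) ^+ 2 * k (x - y)) =
    (fun y => (- (2 * c)) * (u y * k (x - y)) + (c ^+ 2 * k (x - y) + u y ^+ 2 * k (x - y))).
    by apply/funext => y; ring.
  have a4 : itg (fun y => c ^+ 2 * k (x - y) + u y ^+ 2 * k (x - y)) by apply: itgD => //; exact: itgZ.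
  rewrite int_lin// int_lin// k1' -/(conv _ _ x) -/c -/(conv (fun y => u y ^+ 2) k x).
  move: (conv _ k x) => w; rewrite mulr1 !expr2; lra.
have ic : itg (fun x => conv u k x ^+ 2).
  apply: (itg_le _ _ i1) => [|x]; first exact: measurable_funX.
  by rewrite ger0_norm ?sqr_ge0.
split; first by split.
by apply: (le_trans (int_le ic i1 pw)); rewrite i2 k1 mulr1.
Qed.

Lemma convB u v k r x : loc u -> loc v -> continuous k -> supp_in r k ->
  conv (fun y => u y - v y) k x = conv u k x - conv v k x.
Proof.
move=> lu lv ck kr; rewrite /conv -intB; [|exact: itg_conv1 ck kr|exact: itg_conv1 ck kr].
by congr rint; apply/funext => y; ring.
Qed.

Lemma kern_conv_L2 u r : 0 < r -> L2 u ->
  L2 (conv u (kern r)) /\ rint (fun x => conv u (kern r) x ^+ 2) <= rint (fun x => u x ^+ 2).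
Proof.
move=> r0 hu; apply: (conv_L2 hu (Ck_kern 1 r) _ (kern_supp r0)) => [y||x].
- by apply: kern_ge0; exact: ltW.
- exact: int_kern.
- exact: int_kern_reflect0.
Qed.

(* The oscillation of [u] near [x] is only needed almost everywhere. *)
Lemma conv_kern_dist u r x c e : 0 < r -> loc u ->
  (forall y, enorm (x - y) < r -> `|u y - c| <= e) -> `|conv u (kern r) x - c| <= e.
Proof.
move=> r0 lu h; have ck := Ck_cont (Ck_kern 0 r : Ck 0 (kern r : V -> R)).
have a1 := itg_conv1 x lu ck (kern_supp r0); have a2 := itg_kern_reflect x r0.
have -> : conv u (kern r) x - c = rint (fun y => (u y - c) * kern r (x - y)).
  rewrite (_ : (fun y => _) = (fun y => (- c) * kern r (x - y) + u y * kern r (x - y))); last by apply/funext => y; ring.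
  by rewrite int_lin// int_kern_reflect0// mulr1 addrC.
have a3 : itg (fun y => (u y - c) * kern r (x - y)).
  rewrite (_ : (fun y => _) = (fun y => (- c) * kern r (x - y) + u y * kern r (x - y))); last by apply/funext => y; ring.
  by apply: itgD => //; exact: itgZ.
apply: (le_trans (int_norm a3)).
have -> : e = rint (fun y => e * kern r (x - y)) by rewrite intZ// int_kern_reflect0// mulr1.
apply: int_le; [exact: itg_norm|exact: itgZ|move=> y].
rewrite normrM [X in _ * X]ger0_norm; last by apply: kern_ge0; exact: ltW.
have [hr|hr] := ltP (enorm (x - y)) r; last by rewrite kern_supp// !mulr0.
by rewrite ler_wpM2r ?h// kern_ge0// ltW.
Qed.

Lemma Ccoo_lipschitz f : Ccoo setT f -> exists2 C, 0 <= C & forall x y, `|f x - f y| <= C * enorm (x - y).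
Proof.
move=> hf.
have hb i : exists2 C, 0 <= C & forall x, `|partial i f x| <= C.
  have hi := Ccoo_partial i hf; have [r hr] := Ccoo_supp hi.
  exact: csupp_bounded (Ck_cont (hi.1 0)) hr.
have [C hC1 hC2] := fin_all_exists2 hb.
pose K := \sum_i C i.
have K0 : 0 <= K by apply: sumr_ge0 => i _; exact: hC1.
have hK i x : `|partial i f x| <= K.
  apply: (le_trans (hC2 i x)); rewrite /K (bigD1 i)//= lerDl.
  by apply: sumr_ge0 => j _; exact: hC1.
exists (K * d%:R) => [|x y]; first exact: mulr_ge0.
have := Ck1_lipschitz y (x - y) (hf.1 1) hK; rewrite [y + _]addrC subrK => h.
apply: (le_trans h); rewrite -mulrA ler_wpM2l//.
by apply: (le_trans (sum_le_norm _)); rewrite ler_wpM2l// norm_le_enorm.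
Qed.

Lemma conv_supp f k r s : supp_in r f -> supp_in s k -> supp_in (r + s) (conv f k).
Proof.
move=> hr hs x hx; rewrite /conv (_ : (fun y => _) = cst 0) ?int0//; apply/funext => y.
have [ry|yr] := leP r (enorm y); first by rewrite hr// mul0r.
rewrite hs ?mulr0//; have := enorm_dist x y => h; have := ler_norm (enorm x - enorm y); lra.
Qed.

Lemma mollify_L2 u e : L2 u -> 0 < e -> exists2 r0, 0 < r0 &
  forall r, 0 < r -> r < r0 -> rint (fun x => (conv u (kern r) x - u x) ^+ 2) < e.
Proof.
(* The three errors are at most [e / 12] each and enter with the factors 2, 4 and 4. *)
move=> hu e0; have e12 : 0 < e / 12 by rewrite divr_gt0.
have [f hf fu] := Ccoo_dense_L2 hu e12.
have hf2 := Ccoo_L2 hf; have [C C0 hC] := Ccoo_lipschitz hf; have [s hs] := Ccoo_supp hf.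
pose A := rint (\1_(eball 0 (s + 1))); have A0 : 0 <= A by apply: int_ge0 => y; case/andP: (indic01 (eball 0 (s + 1)) y).
have mA := measurable_eball (0 : V) (s + 1); have fA := leb_eball_lty (0 : V) (s + 1).
pose r0 := Num.min 1 (e / (12 * (C ^+ 2 + 1) * (A + 1))).
have C21 : 0 < C ^+ 2 + 1 by rewrite ltr_wpDl// sqr_ge0.
have A1 : 0 < A + 1 by rewrite ltr_wpDl.
exists r0 => [|r rp]; first by rewrite lt_min ltr01/= divr_gt0// !mulr_gt0.
rewrite lt_min => /andP[r1 r2].
have ck : continuous (kern r : V -> R) := Ck_cont (Ck_kern 0 r).
have [h1 h2] := kern_conv_L2 rp hu; have [h3 _] := kern_conv_L2 rp hf2.
have [h5 h6] := kern_conv_L2 rp (L2B hu hf2).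
have ef : rint (fun x => (conv f (kern r) x - f x) ^+ 2) <= e / 12.
  have pw x : (conv f (kern r) x - f x) ^+ 2 <= (C * r) ^+ 2 * \1_(eball 0 (s + 1)) x.
    have [xs|sx] := ltP (enorm x) (s + 1).
      rewrite indicE mem_set ?mulr1; last by rewrite /eball /= subr0.
      rewrite -ler_sqrt ?sqr_ge0// !sqrtr_sqr [leRHS]ger0_norm ?mulr_ge0 ?(ltW rp)//.
      apply: (conv_kern_dist rp (loc_L2 hf2)) => y xy; apply: (le_trans (hC _ _)).
      by rewrite ler_wpM2l// enormB ltW.
    have s1 : s + r <= s + 1 by rewrite lerD2l ltW.
    have sx' : s <= enorm x by apply: le_trans sx; rewrite lerDl.
    rewrite (supp_in_le s1 (conv_supp hs (kern_supp rp)) sx) (hs _ sx') subrr expr0n /= mulr_ge0 ?sqr_ge0//.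
  apply: (le_trans (int_le (L2B h3 hf2).2 (itgZ ((C * r) ^+ 2) (itg_indic mA fA)) pw)).
  rewrite intZ; last exact: itg_indic.
  rewrite -/A exprMn.
  have r4 : r ^+ 2 <= r by rewrite expr2 ler_piMl// ltW.
  rewrite ltr_pdivlMr in r2; last by rewrite !mulr_gt0.
  have : C ^+ 2 * r ^+ 2 * A <= r * ((C ^+ 2 + 1) * (A + 1)).
    apply: (@le_trans _ _ (C ^+ 2 * r * A)); first by rewrite ler_wpM2r// ler_wpM2l// sqr_ge0.
    rewrite [X in X * A]mulrC -mulrA ler_wpM2l ?(ltW rp)//.
    by apply: ler_pM; rewrite ?sqr_ge0// lerDl.
  rewrite (_ : r * (12 * (C ^+ 2 + 1) * (A + 1)) = 12 * (r * ((C ^+ 2 + 1) * (A + 1)))) in r2; last by ring.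
  by move: r2; move: (r * _) (C ^+ 2 * r ^+ 2 * A) => q p; lra.
have E : (fun x => (conv u (kern r) x - u x) ^+ 2) = (fun x => (conv (fun y => u y - f y) (kern r) x + ((conv f (kern r) x - f x) + (f x - u x))) ^+ 2).
  apply/funext => x; rewrite (convB x (loc_L2 hu) (loc_L2 hf2) ck (kern_supp rp)); congr (_ ^+ 2); ring.
rewrite E.
have g1 := L2B h3 hf2; have g2 := L2B hf2 hu.
apply: (le_lt_trans (int_sqrD_le h5 (L2D g1 g2))).
have := int_sqrD_le g1 g2.
have -> : rint (fun x => (f x - u x) ^+ 2) = rint (fun x => (u x - f x) ^+ 2).
  by congr rint; apply/funext => x; rewrite -sqrrN opprB.
lra.
Qed.

Lemma partial_conv_weak u g k i x r : loc u -> Ccoo setT k -> supp_in r k -> weak_partial u i g ->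
  partial i (conv u k) x = conv g k x.
Proof.
move=> lu hk kr hg; rewrite (partial_conv i x lu (hk.1 1) kr).
have := hg _ (Ccoo_reflect x hk); rewrite -/(rint _) -/(rint _) -/(conv g k x).
have -> : (fun y => u y * partial i (fun y => k (x - y)) y) = (fun y => - (u y * partial i k (x - y))).
  by apply/funext => y; rewrite (partial_reflect _ _ _ (hk.1 1)) mulrN.
rewrite intN; first by move/oppr_inj.
exact: (itg_conv1 x lu (Ck_cont (Ck_partial i (hk.1 1))) (supp_partial i (hk.1 1) kr)).
Qed.

End mollifier.

(** * Sobolev functions *)

Section sobolev_calculus.
Context {R : realType} {d : nat}.
Local Notation V := 'rV[R]_d.
Local Notation rint := (mintegral (@leb R d)).
Local Notation itg := (mintegrable (@leb R d)).
Local Notation L2 := (L2fun (@leb R d)).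
Local Notation e_ := (delta_mx 0).
Implicit Types (x y z h : V) (r s : R) (u v k f phi : V -> R) (i : 'I_d) (g : 'I_d -> V -> R).

(** The weak gradient is carried as an explicit witness; [dirichletE] translates to the
    representative chosen by [wpartial]. *)
Definition grad u g := L2 u /\ forall i, L2 (g i) /\ weak_partial u i (g i).

Lemma weakE u i (g : V -> R) phi : weak_partial u i g -> Ccoo setT phi ->
  rint (fun x => u x * partial i phi x) = - rint (fun x => g x * phi x).
Proof. by move=> h hp; exact: h. Qed.

Definition gip g g' := \sum_i rint (fun x => g i x * g' i x).

Lemma H1P u : H1 u <-> exists g, grad u g.
Proof.
split=> [[/LfunP hu h]|[g [hu h]]]; last first.
  split; first exact/LfunP.
  by move=> i; exists (g i); [apply/LfunP; exact: (h i).1|exact: (h i).2].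
have h' i : exists g : V -> R, L2 g /\ weak_partial u i g.
  by have [g /LfunP g1 g2] := h i; exists g.
by have [g hg] := fin_all_exists h'; exists g.
Qed.

Lemma wpartialP u i (g0 : V -> R) : L2 g0 -> weak_partial u i g0 ->
  L2 (wpartial u i) /\ weak_partial u i (wpartial u i).
Proof.
move=> h1 h2; rewrite /wpartial.
have [|/LfunP] := @xgetPex _ (cst 0) [set g | g \in Lfun leb 2%:E /\ weak_partial u i g] ; last by [].
by exists g0; split => //; apply/LfunP.
Qed.

Lemma weak_partial_uniq u i (g g' : V -> R) : loc g -> loc g' -> weak_partial u i g -> weak_partial u i g' ->
  {ae @leb R d, forall x, g x = g' x}.
Proof.
move=> lg lg' h h'.
have it (f phi : V -> R) : loc f -> Ccoo setT phi -> itg (fun x => f x * phi x).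
  move=> lf hp; have [r hr] := Ccoo_supp hp; have c := Ck_cont (hp.1 0).
  have [C C0 hC] := csupp_bounded c hr.
  exact: (loc_mul lf (Ccoo_measurable hp) hC hr).
have l : loc (fun x => g x - g' x).
  split; first exact: measurable_funB lg.1 lg'.1.
  move=> r; have := itgB (lg.2 r) (lg'.2 r); congr mintegrable; apply/funext => x; ring.
have : {ae @leb R d, forall x, g x - g' x = 0}.
  apply: (ae_eq0_of_test l) => phi hp.
  rewrite (_ : (fun x => _) = (fun x => g x * phi x - g' x * phi x)); last by apply/funext => x; ring.
  rewrite intB; [|exact: it|exact: it].
  by apply/eqP; rewrite subr_eq0 -eqr_opp; apply/eqP; rewrite -(weakE h hp) -(weakE h' hp).
by apply: filterS => x /eqP; rewrite subr_eq0 => /eqP.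
Qed.

Lemma int_mul_ae (f g f' g' : V -> R) : L2 f -> L2 g -> L2 f' -> L2 g' ->
  {ae @leb R d, forall x, f x = f' x} -> {ae @leb R d, forall x, g x = g' x} ->
  rint (fun x => f x * g x) = rint (fun x => f' x * g' x).
Proof.
move=> hf hg hf' hg' a b; apply: int_ae.
- exact: (itg_measurable (L2_mul hf hg)).
- exact: (itg_measurable (L2_mul hf' hg')).
- by apply: filterS2 a b => x -> ->.
Qed.

Lemma dirichletE u v g g' : grad u g -> grad v g' -> dirichlet u v = gip g g'.
Proof.
move=> [hu hg] [hv hg'].
have wu i := wpartialP (hg i).1 (hg i).2; have wv i := wpartialP (hg' i).1 (hg' i).2.
rewrite /dirichlet -/(rint _) (int_sum _ (h := fun i x => wpartial u i x * wpartial v i x)) => [|i]; last first.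
  exact: (L2_mul (wu i).1 (wv i).1).
apply: eq_bigr => i _.
apply: (int_mul_ae (wu i).1 (wv i).1 (hg i).1 (hg' i).1).
- exact: (weak_partial_uniq (loc_L2 (wu i).1) (loc_L2 (hg i).1) (wu i).2 (hg i).2).
- exact: (weak_partial_uniq (loc_L2 (wv i).1) (loc_L2 (hg' i).1) (wv i).2 (hg' i).2).
Qed.

Lemma grad_lin c u v g g' : grad u g -> grad v g' ->
  grad (fun x => c * u x + v x) (fun i x => c * g i x + g' i x).
Proof.
move=> [hu hg] [hv hg']; split; first exact: (L2D (L2Z c hu) hv).
move=> i; split; first exact: (L2D (L2Z c (hg i).1) (hg' i).1).
move=> phi hp; rewrite -/(rint _) -/(rint _).
have h1 := Ccoo_L2 hp; have h2 := Ccoo_L2 (Ccoo_partial i hp).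
rewrite (_ : (fun x => _) = (fun x => c * (u x * partial i phi x) + v x * partial i phi x)); last by apply/funext => x; ring.
rewrite [in RHS](_ : (fun x => _) = (fun x => c * (g i x * phi x) + g' i x * phi x)); last by apply/funext => x; ring.
rewrite !int_lin; [|exact: (L2_mul (hg i).1 h1)|exact: (L2_mul (hg' i).1 h1)|exact: (L2_mul hu h2)|exact: (L2_mul hv h2)].
by rewrite (weakE (hg i).2 hp) (weakE (hg' i).2 hp) opprD mulrN.
Qed.

Lemma grad_ae u v g : grad u g -> measurable_fun setT v -> {ae @leb R d, forall x, u x = v x} -> grad v g.
Proof.
move=> [hu hg] mv uv; have hv := L2_ae mv hu uv; split => // i; split; first exact: (hg i).1.
move=> phi hp; rewrite -!/(rint _) -(weakE (hg i).2 hp); have h2 := Ccoo_L2 (Ccoo_partial i hp).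
apply: (int_mul_ae hv h2 hu h2); last by apply: nearW.
by apply: filterS uv => x ->.
Qed.

Lemma weak_partial_Ck1 f i : Ck 1 f -> weak_partial f i (partial i f).
Proof.
move=> hf phi hp; have [r hr] := Ccoo_supp hp; rewrite -!/(rint _).
rewrite (int_by_parts i hf (hp.1 1) hr); congr (- _); congr rint.
by apply/funext => x; rewrite mulrC.
Qed.

Lemma grad_Ccoo U phi : Ccoo U phi -> grad phi (fun i => partial i phi).
Proof.
move=> hp; split; first exact: Ccoo_L2 hp.
have hpT : Ccoo setT phi by case: hp => h1 [K [h2 _ h3]]; split => //; exists K; split.
move=> i; split; first exact: Ccoo_L2 (Ccoo_partial i hpT).
exact: weak_partial_Ck1 (hp.1 1).
Qed.

Lemma gip_sym g g' : gip g g' = gip g' g.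
Proof. by apply: eq_bigr => i _; congr rint; apply/funext => x; rewrite mulrC. Qed.

Lemma gip_ge0 g : 0 <= gip g g.
Proof. by apply: sumr_ge0 => i _; apply: int_ge0 => x; rewrite -expr2 sqr_ge0. Qed.

Definition gL2 g := forall i, L2 (g i).

Lemma grad_gL2 u g : grad u g -> gL2 g. Proof. by move=> [_ h] i; exact: (h i).1. Qed.

Lemma gip_lin c g1 g2 g3 : gL2 g1 -> gL2 g2 -> gL2 g3 ->
  gip (fun i x => c * g1 i x + g2 i x) g3 = c * gip g1 g3 + gip g2 g3.
Proof.
move=> h1 h2 h3; rewrite /gip mulr_sumr -big_split; apply: eq_bigr => i _ /=.
rewrite -int_lin; [|exact: (L2_mul (h1 i) (h3 i))|exact: (L2_mul (h2 i) (h3 i))].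
by congr rint; apply/funext => x; ring.
Qed.

Lemma gip_sqr_lin c g1 g2 : gL2 g1 -> gL2 g2 ->
  gip (fun i x => c * g1 i x + g2 i x) (fun i x => c * g1 i x + g2 i x) =
  c ^+ 2 * gip g1 g1 + 2 * c * gip g1 g2 + gip g2 g2.
Proof.
move=> h1 h2.
have h3 : gL2 (fun i x => c * g1 i x + g2 i x) by move=> i; exact: (L2D (L2Z c (h1 i)) (h2 i)).
rewrite gip_lin// [gip g1 _]gip_sym [gip g2 _]gip_sym !gip_lin// [gip g2 g1]gip_sym; ring.
Qed.

(** The Riesz limit of the functional defined by [u] has square norm at most [C] and coincides with
    [u] almost everywhere. *)
Lemma L2_dual u C : 0 <= C -> L2 u ->
  (forall phi, Ccoo setT phi -> rint (fun x => u x * phi x) ^+ 2 <= C * rint (fun x => phi x ^+ 2)) ->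
  rint (fun x => u x ^+ 2) <= C.
Proof.
move=> C0 hu h.
have [|x [f [_ hf _ fl fC]]] := riesz_Ccoo (l := fun f => rint (fun t => u t * f t)) C0 _ h.
  move=> c f g hf hg; have h1 := L2_mul hu (Ccoo_L2 hf); have h2 := L2_mul hu (Ccoo_L2 hg).
  by rewrite -int_lin//; congr rint; apply/funext => x; ring.
have fu : {ae @leb R d, forall x, f x = u x}.
  have : {ae @leb R d, forall x, f x - u x = 0}.
    apply: (ae_eq0_of_test (loc_L2 (L2B hf hu))) => phi hp.
    rewrite (_ : (fun x => _) = (fun x => f x * phi x - u x * phi x)); last by apply/funext => y; ring.
    by rewrite intB; [rewrite fl// subrr|exact: (L2_mul hf (Ccoo_L2 hp))|exact: (L2_mul hu (Ccoo_L2 hp))].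
  by apply: filterS => y /eqP; rewrite subr_eq0 => /eqP.
apply: le_trans fC; rewrite le_eqVlt; apply/orP; left; apply/eqP.
apply: int_ae; [exact: (itg_measurable hu.2)|exact: (itg_measurable hf.2)|].
by apply: filterS fu => y ->.
Qed.

Lemma L2_shift h u : L2 u -> L2 (fun x => u (x + h)).
Proof.
move=> hu; split; first exact: (measurableT_comp hu.1 (measurable_shift h)).
exact: (int_shift h hu.2).1.
Qed.

Lemma Ccoo_shift h phi : Ccoo setT phi -> Ccoo setT (fun x => phi (x + h)).
Proof.
move=> hp; have [r hr] := Ccoo_supp hp; split=> [m|].
  by have := Ck_affine 1 h (hp.1 m); congr Ck; apply/funext => x; rewrite scale1r addrC.
apply/csuppP; exists (r + enorm h) => x hx; apply: hr.
by have := enormD (x + h) (- h); rewrite addrK enormN; lra.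
Qed.

Lemma int_shift_swap h u phi : L2 u -> L2 phi ->
  rint (fun x => u (x + h) * phi x) = rint (fun x => u x * phi (x - h)).
Proof.
move=> hu hp; have := (int_shift (- h) (L2_mul (L2_shift h hu) hp)).2.
move=> <-; congr rint; apply/funext => x.
by rewrite subrK.
Qed.

(** By duality the shift passes to the test function, the mean value theorem on a segment gives its
    derivative along [h], and a translate of the test function is tested against [g]. The hypothesis
    is an arbitrary bound so that it applies both to the full gradient and to one direction. *)
Lemma diffquot u g h C : 0 <= C -> grad u g ->
  (forall phi, Ccoo setT phi -> (\sum_i h 0 i * rint (fun x => g i x * phi x)) ^+ 2 <= C * rint (fun x => phi x ^+ 2)) ->
  rint (fun x => (u (x + h) - u x) ^+ 2) <= C.
Proof.
move=> C0 [hu hg] hC; apply: (L2_dual C0 (L2B (L2_shift h hu) hu)) => phi hp.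
have h1 := Ccoo_L2 hp; have [r hr] := Ccoo_supp hp.
rewrite (_ : (fun x => _) = (fun x => u (x + h) * phi x - u x * phi x)); last by apply/funext => x; ring.
rewrite intB; [|exact: (L2_mul (L2_shift h hu) h1)|exact: (L2_mul hu h1)].
rewrite (int_shift_swap _ hu h1).
pose G (s : R) := rint (fun x => u x * phi (x + s *: (- h))).
pose G' (s : R) := rint (fun x => u x * \sum_i (- h) 0 i * partial i phi (x + s *: (- h))).
have [c _ E] := @MVT0 _ G G' 1 (fun s => derive_int_line (- h) s (loc_L2 hu) (hp.1 1) hr).
have -> : rint (fun x => u x * phi (x - h)) = G 1 by rewrite /G; congr rint; apply/funext => x; rewrite scale1r.
have -> : rint (fun x => u x * phi x) = G 0 by rewrite /G; congr rint; apply/funext => x; rewrite scale0r addr0.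
rewrite E mul1r; pose w := c *: (- h); pose psi x := phi (x + w).
have hpsi : Ccoo setT psi := Ccoo_shift w hp.
have pE i x : partial i phi (x + w) = partial i psi x.
  have := partial_affine 1 w i x (hp.1 1); rewrite mul1r scale1r addrC => <-.
  by rewrite /psi (_ : (fun x => phi (w + 1 *: x)) = (fun x => phi (x + w)))//; apply/funext => y; rewrite scale1r addrC.
have -> : G' c = \sum_i h 0 i * rint (fun x => g i x * psi x).
  rewrite /G' (_ : (fun x => _) = (fun x => \sum_i (- h 0 i) * (u x * partial i psi x))); last first.
    by apply/funext => x; rewrite mulr_sumr; apply: eq_bigr => i _; rewrite mxE pE; ring.
  have it i : itg (fun x => u x * partial i psi x) by exact: (L2_mul hu (Ccoo_L2 (Ccoo_partial i hpsi))).
  rewrite int_sum => [|i]; last exact: itgZ.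
  by apply: eq_bigr => i _; rewrite (intZ _ (it i)) (weakE (hg i).2 hpsi) mulrNN.
apply: (le_trans (hC _ hpsi)); rewrite ler_wpM2l//.
by rewrite (int_shift w h1.2).2.
Qed.

Lemma sqr_sum_le (a b : 'I_d -> R) : (\sum_i a i * b i) ^+ 2 <= (\sum_i a i ^+ 2) * (\sum_i b i ^+ 2).
Proof.
have := dot_le (\row_i a i) (\row_i b i).
have e (c : 'I_d -> R) : enorm (\row_i c i) ^+ 2 = \sum_i c i ^+ 2.
  by rewrite enorm_sqr /dot; apply: eq_bigr => i _; rewrite mxE expr2.
rewrite -!e -exprMn -[X in _ -> X <= _]real_normK ?num_real// ler_pXn2r ?nnegrE ?mulr_ge0 ?enorm_ge0//.
by rewrite /dot; under eq_bigr do rewrite !mxE.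
Qed.

Lemma diffquot_le u g h : grad u g ->
  rint (fun x => (u (x + h) - u x) ^+ 2) <= nsq h * gip g g.
Proof.
move=> hg; apply: (diffquot _ hg) => [|phi hp]; first by rewrite mulr_ge0 ?gip_ge0 ?nsq_ge0.
apply: (le_trans (sqr_sum_le _ _)).
rewrite -mulrA; apply: ler_pM.
- by apply: sumr_ge0 => i _; exact: sqr_ge0.
- by apply: sumr_ge0 => i _; exact: sqr_ge0.
- by rewrite /nsq /dot; under eq_bigr do rewrite expr2.
rewrite /gip mulr_suml; apply: ler_sum => i _.
exact: (cauchy_schwarz (hg.2 i).1 (Ccoo_L2 hp)).
Qed.

(** For a contraction [T], the difference quotients of [T \o u] are bounded by those of [u], so
    [phi -> - int T(u) d_i phi], a limit of such quotients, is a bounded functional; its Riesz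
    representative is the weak derivative. The inequality between Dirichlet integrals is all that
    energy comparisons use. *)
Lemma grad_trunc (T : R -> R) u g : measurable_fun setT T -> (forall a b, `|T a - T b| <= `|a - b|) -> T 0 = 0 ->
  grad u g -> exists2 g', grad (T \o u) g' & gip g' g' <= gip g g.
Proof.
move=> mT Tl T0 hg; have [hu hgi] := hg.
have hT : L2 (T \o u).
  apply: (L2_le (measurableT_comp mT hu.1) _ hu) => x.
  by have := Tl (u x) 0; rewrite T0 !subr0.
have key i : exists g' : V -> R, (L2 g' /\ weak_partial (T \o u) i g') /\ rint (fun x => g' x * g' x) <= rint (fun x => g i x * g i x).
  pose C := rint (fun x => g i x ^+ 2).
  have C0 : 0 <= C by exact: int_sqr_ge0.
  pose l phi := - rint (fun x => T (u x) * partial i phi x).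
  have lC phi : Ccoo setT phi -> l phi ^+ 2 <= C * rint (fun x => phi x ^+ 2).
    move=> hp; have h1 := Ccoo_L2 hp; have [r hr] := Ccoo_supp hp.
    have := derive_int_line (- (e_ i : V)) 0 (loc_L2 hT) (hp.1 1) hr.
    have -> : rint (fun x => (T \o u) x * \sum_j (- (e_ i : V)) 0 j * partial j phi (x + 0 *: (- (e_ i : V)))) = l phi.
      rewrite /l -intN; last exact: (L2_mul hT (Ccoo_L2 (Ccoo_partial i hp))).
      congr rint; apply/funext => x; rewrite /= -mulrN; congr (_ * _).
      rewrite (bigD1 i)//= big1 => [|j ji]; last by rewrite !mxE eqxx (negbTE ji) oppr0 mul0r.
      by rewrite !mxE !eqxx scale0r !addr0 mulN1r.
    move/is_derive_cvg; set Q := (fun t : R => _) => lim.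
    have lim2 : Q t ^+ 2 @[t --> 0^'] --> l phi ^+ 2.
      rewrite expr2 (_ : (fun t => Q t ^+ 2) = (fun t => Q t * Q t)); first exact: (cvgM lim lim).
      by apply/funext => t; rewrite expr2.
    suff nr : \forall t \near 0^', Q t ^+ 2 <= C * rint (fun x => phi x ^+ 2).
      have cl : closed [set a : R | a <= C * rint (fun x => phi x ^+ 2)] by exact: closed_le.
      exact: (closed_cvg _ cl nr _ lim2).
    (* For fixed [t], the shift is moved back to [T \o u] and Cauchy-Schwarz is applied. *)
    near=> t; have t0 : t != 0 by near: t; exact: nbhs_dnbhs_neq.
    rewrite /Q add0r scale0r; under [X in _ - rint X]eq_fun do rewrite addr0.
    pose h : V := t *: (e_ i : V).
    have -> : rint (fun x => T (u x) * phi (x + t *: - (e_ i : V))) = rint (fun x => T (u (x + h)) * phi x).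
      by rewrite (int_shift_swap (u := T \o u) h hT h1); congr rint; apply/funext => x; rewrite /h scalerN.
    rewrite -intB; [|exact: (L2_mul (L2_shift h hT) h1)|exact: (L2_mul hT h1)].
    under [X in rint X]eq_fun do rewrite -mulrBl.
    rewrite exprMn; have CS := cauchy_schwarz (L2B (L2_shift h hT) hT) h1.
    have D1 : rint (fun x => (T (u (x + h)) - T (u x)) ^+ 2) <= t ^+ 2 * C.
      apply: (@le_trans _ _ (rint (fun x => (u (x + h) - u x) ^+ 2))).
        apply: int_le; [exact: (L2B (L2_shift h hT) hT).2|exact: (L2B (L2_shift h hu) hu).2|move=> x].
        by rewrite -[leLHS]real_normK ?num_real// -[leRHS]real_normK ?num_real// ler_sqr ?nnegrE.
      apply: (diffquot _ hg) => [|psi hpsi]; first by rewrite mulr_ge0 ?sqr_ge0.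
      rewrite (bigD1 i)//= big1 => [|j ji]; last by rewrite !mxE eqxx (negbTE ji) mulr0 mul0r.
      have -> : h 0 i = t by rewrite /h !mxE !eqxx mulr1.
      rewrite addr0 exprMn -[leRHS]mulrA ler_wpM2l ?sqr_ge0//.
      exact: (cauchy_schwarz (hgi i).1 (Ccoo_L2 hpsi)).
    rewrite exprVn mulrC ler_pdivrMr ?exprn_even_gt0//.
    apply: (le_trans CS); rewrite mulrC mulrAC [leRHS]mulrC [C * _]mulrC ler_wpM2l ?int_sqr_ge0// mulrC.
  have [|x [f [_ hf _ fl fC]]] := riesz_Ccoo (l := l) C0 _ lC.
    move=> c f f' hf hf'; rewrite /l.
    have h1 := L2_mul hT (Ccoo_L2 (Ccoo_partial i hf)); have h2 := L2_mul hT (Ccoo_L2 (Ccoo_partial i hf')).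
    rewrite mulrN -opprD -int_lin//; congr (- rint _); apply/funext => x /=.
    rewrite (@partialD _ _ 0 (fun x => c * f x)) ?(@partialZ _ _ 0); first by ring.
    - exact: hf.1 1.
    - by apply: CkZ; exact: hf.1 1.
    - exact: hf'.1 1.
  exists f; split; first by split=> // phi hp; rewrite -!/(rint _) fl// /l opprK.
  exact: fC.
have [g' hg'] := fin_all_exists key.
exists g'; first by split=> // i; exact: (hg' i).1.
by apply: ler_sum => i _; exact: (hg' i).2.
Unshelve. all: by end_near. Qed.

Lemma grad_mul (xi : V -> R) C u g : (forall m, Ck m xi) -> (forall x, `|xi x| <= C) ->
  (forall i x, `|partial i xi x| <= C) -> grad u g ->
  grad (fun x => u x * xi x) (fun i x => g i x * xi x + u x * partial i xi x).
Proof.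
move=> hx b1 b2 [hu hg].
have m1 : measurable_fun setT xi := continuous_measurable_leb (Ck_cont (hx 0)).
have m2 i : measurable_fun setT (partial i xi) := continuous_measurable_leb (Ck_cont (Ck_partial i (hx 1))).
have hux := L2_mulb hu m1 b1; have hud i := L2_mulb hu (m2 i) (b2 i).
have hgx i := L2_mulb (hg i).1 m1 b1.
split; first exact: hux.
move=> i; split; first exact: (L2D (hgx i) (hud i)).
move=> phi hp; rewrite -!/(rint _); have h1 := Ccoo_L2 hp; have h2 := Ccoo_L2 (Ccoo_partial i hp).
have hxp : Ccoo setT (fun x => xi x * phi x) := Ccoo_mul hx hp.
rewrite (_ : (fun x => _) = (fun x => u x * partial i (fun x => xi x * phi x) x - u x * partial i xi x * phi x)); last first.
  by apply/funext => x; rewrite (@partialM _ _ 0); [ring|exact: hx|exact: hp.1].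
rewrite intB; [|exact: (L2_mul hu (Ccoo_L2 (Ccoo_partial i hxp)))|exact: (L2_mul (hud i) h1)].
rewrite (weakE (hg i).2 hxp).
rewrite [in RHS](_ : (fun x => _) = (fun x => g i x * (xi x * phi x) + u x * partial i xi x * phi x)); last by apply/funext => x; ring.
by rewrite intD; [rewrite opprD|exact: (L2_mul (hg i).1 (Ccoo_L2 hxp))|exact: (L2_mul (hud i) h1)].
Qed.

Lemma grad_closed (un : nat -> V -> R) (gn : nat -> 'I_d -> V -> R) u g :
  (forall n, grad (un n) (gn n)) -> L2 u -> gL2 g ->
  rint (fun x => (un n x - u x) ^+ 2) @[n --> \oo] --> 0 ->
  (forall i, rint (fun x => (gn n i x - g i x) ^+ 2) @[n --> \oo] --> 0) -> grad u g.
Proof.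
move=> h hu hg cu cg; split=> // i; split; first exact: hg.
move=> phi hp; rewrite -!/(rint _); have h1 := Ccoo_L2 hp; have h2 := Ccoo_L2 (Ccoo_partial i hp).
have l1 := L2cvg_ip (fun n => (h n).1) hu h2 cu.
have l2 := L2cvg_ip (fun n => ((h n).2 i).1) (hg i) h1 (cg i).
suff l3 : rint (fun t => un n t * partial i phi t) @[n --> \oo] --> - rint (fun t => g i t * phi t).
  exact: (cvg_unique _ l1 l3).
have -> : (fun n => rint (fun t => un n t * partial i phi t)) = (fun n => - rint (fun t => gn n i t * phi t)).
  by apply/funext => n; exact: (weakE ((h n).2 i).2 hp).
exact: cvgN.
Qed.

Lemma grad_complete (un : nat -> V -> R) (gn : nat -> 'I_d -> V -> R) :
  (forall n, grad (un n) (gn n)) ->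
  (forall e, 0 < e -> exists N, forall m n, (N <= m)%N -> (N <= n)%N ->
     rint (fun x => (un m x - un n x) ^+ 2) <= e /\
     gip (fun i x => gn m i x - gn n i x) (fun i x => gn m i x - gn n i x) <= e) ->
  exists u g, [/\ grad u g, rint (fun x => (un n x - u x) ^+ 2) @[n --> \oo] --> 0 &
    forall i, rint (fun x => (gn n i x - g i x) ^+ 2) @[n --> \oo] --> 0].
Proof.
move=> h hc.
have [u hu cu] : exists2 u, L2 u & rint (fun x => (un n x - u x) ^+ 2) @[n --> \oo] --> 0.
  apply: L2_complete => [n|e e0]; first exact: (h n).1.
  by have [N hN] := hc e e0; exists N => m n Nm Nn; exact: (hN m n Nm Nn).1.
have key i : exists g : V -> R, L2 g /\ rint (fun x => (gn n i x - g x) ^+ 2) @[n --> \oo] --> 0.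
  suff [f hf cf] : exists2 f, L2 f & rint (fun x => (gn n i x - f x) ^+ 2) @[n --> \oo] --> 0 by exists f.
  apply: L2_complete => [n|e e0].
  - exact: ((h n).2 i).1.
  - have [N hN] := hc e e0; exists N => m n Nm Nn; apply: le_trans (hN m n Nm Nn).2.
    rewrite /gip (bigD1 i)//= lerDl.
    by apply: sumr_ge0 => j _; apply: int_ge0 => x; rewrite -expr2 sqr_ge0.
have [g hg] := fin_all_exists key; exists u, g; split=> // [|i]; last exact: (hg i).2.
by apply: (grad_closed h hu _ cu) => i; [exact: (hg i).1|exact: (hg i).2].
Qed.

End sobolev_calculus.

Section tonelli_bound.
Context {R : realType} {d1 d2 : measure_display}.
Context {T1 : measurableType d1} {T2 : measurableType d2}.
Variables (m1 : {sigma_finite_measure set T1 -> \bar R}).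
Variables (m2 : {sigma_finite_measure set T2 -> \bar R}).

Lemma tonelli_le (f : T1 -> T2 -> R) G : measurable_fun setT (fun p => f p.1 p.2) ->
  (forall x y, 0 <= f x y) -> (forall x, itg m2 (f x)) -> (forall y, itg m1 (f ^~ y)) ->
  itg m2 G -> (forall y, rint m1 (f ^~ y) <= G y) ->
  itg m1 (fun x => rint m2 (f x)) /\ rint m1 (fun x => rint m2 (f x)) <= rint m2 G.
Proof.
move=> mf f0 i2 i1 iG hG.
have mg : measurable_fun setT (fun y => rint m1 (f ^~ y)).
  have mF : measurable_fun setT (fun p => (f p.1 p.2)%:E) by exact/measurable_EFinP.
  have := measurable_fun_fubini_tonelli_G (m1 := m1) (fun p => (f p.1 p.2)%:E) mF (fun p => f0 p.1 p.2).
  rewrite /fubini_G (_ : (fun y => _) = EFin \o (fun y => rint m1 (f ^~ y))).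
    by move/measurable_EFinP.
  by apply/funext => y /=; rewrite EFin_int.
have ii : itg m2 (fun y => rint m1 (f ^~ y)).
  apply: (itg_le mg _ iG) => y; rewrite ger0_norm; first exact: hG.
  exact: int_ge0.
have [j1 j2] := tonelli mf f0 i2 i1 ii; split; first exact: j1.
by rewrite j2; exact: int_le.
Qed.

End tonelli_bound.

(** * Poincare and Hardy-type inequalities *)

Section thick.
Context {R : realType} {d : nat}.
Local Notation V := 'rV[R]_d.
Local Notation rint := (mintegral (@leb R d)).
Local Notation itg := (mintegrable (@leb R d)).
Implicit Types (x y z h : V) (r s : R) (u v k f phi : V -> R) (i : 'I_d) (g : 'I_d -> V -> R).

Lemma measurable_add_coord i :
  measurable_fun setT (fun p : V * V => (p.1 + p.2) 0 i).
Proof.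
under eq_fun do rewrite !mxE.
apply: measurable_funD.
  exact: (measurableT_comp (measurable_coord i) measurable_fst).
exact: (measurableT_comp (measurable_coord i) measurable_snd).
Qed.

Lemma indicC (T : Type) (A : set T) (t : T) : \1_(~` A) t = 1 - \1_A t :> R.
Proof.
by rewrite !indicE in_setC; case: (t \in A); rewrite /= ?subrr ?subr0.
Qed.

(** The volume of the complement seen in the cube of half-side [rho] about [x], kept as an integral
    in [h] ready to be exchanged with one in [x]. *)
Definition voidc (E : set V) (rho : R) x :=
  rint (fun h => \1_(cube rho) h * \1_(~` E) (x + h)).

Lemma measurable_indic_shift (E : set V) x : measurable E ->
  measurable_fun setT (fun h => \1_E (x + h) : R).
Proof.
move=> mE; have := measurableT_comp (measurable_indic_leb mE) (measurable_shift x).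
by congr measurable_fun; apply/funext => h /=; rewrite addrC.
Qed.

Lemma itg_cube rho : 0 <= rho -> itg (\1_(cube rho)) /\ rint (\1_(cube rho)) = (rho *+ 2) ^+ d.
Proof.
move=> r0; have mc := @measurable_cube R d rho; have lc := @leb_cube R d _ r0.
have fc : (leb (cube rho : set V) < +oo)%E by rewrite lc ltry.
by split; [exact: itg_indic mc fc|rewrite (int_indic _ mc) [X in fine X]lc].
Qed.

Lemma cube_nsq rho h : 0 <= rho -> cube rho h -> nsq h <= d%:R * rho ^+ 2.
Proof.
move=> r0 hc; rewrite /nsq /dot.
apply: (@le_trans _ _ (\sum_(i < d) rho ^+ 2)); last by rewrite sumr_const card_ord mulr_natl.
apply: ler_sum => i _; have /cubeP/(_ i)/andP[h1 h2] := hc.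
rewrite -expr2 -real_normK ?num_real// ler_pXn2r ?nnegrE//.
by rewrite ler_norml h2 andbT ltW.
Qed.

(** Where [x + h] lies outside [E], [u x ^ 2] equals [(u (x + h) - u x)^2]. Integrating the
    difference quotient bound over [h] in a cube controls [u^2] weighted by the void seen from [x].
    A large cube gives Poincare's inequality, a small one the estimate near the complement. *)
Lemma thick (E N : set V) u g kappa rho : open E -> measurable N -> grad u g ->
  (forall x, ~ E x -> u x = 0) -> 0 <= rho ->
  (forall x, N x -> kappa <= voidc E rho x) ->
  kappa * rint (fun x => u x ^+ 2 * \1_N x) <= (rho *+ 2) ^+ d * (d%:R * rho ^+ 2) * gip g g.
Proof.
move=> oE mN hg u0 r0 hN; have [hu _] := hg.
have [ic ec] := itg_cube r0; have mE := open_measurable_leb oE.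
have mC : measurable (~` E) := measurableC mE.
pose f x h := u x ^+ 2 * (\1_(cube rho) h * \1_(~` E) (x + h)).
have c01 (A : set V) x : 0 <= (\1_A x : R) by case/andP: (indic01 A x).
have mi x : measurable_fun setT (fun h => \1_(~` E) (x + h) : R) := @measurable_indic_shift (~` E) x mC.
have mi' h : measurable_fun setT (fun x => \1_(~` E) (x + h) : R) := measurableT_comp (measurable_indic_leb mC) (measurable_shift h).
have [||||| | i1 i2] := @tonelli_le R _ _ _ _ (@leb R d) (@leb R d) f (fun h => (d%:R * rho ^+ 2 * gip g g) * \1_(cube rho) h).
- apply: measurable_funM.
    exact: (measurableT_comp (itg_measurable hu.2) measurable_fst).
  apply: measurable_funM.
    exact: (measurableT_comp (measurable_indic_leb (measurable_cube rho)) measurable_snd).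
  have -> : (fun p : V * V => \1_(~` E) (p.1 + p.2) : R) = (fun p => 1 - \1_((fun p : V * V => p.1 + p.2) @^-1` E) p).
    by apply/funext => p; rewrite indicC.
  apply: measurable_funB; first exact: measurable_cst.
  by apply: measurable_indic; exact: (measurable_open_preimage measurable_add_coord oE).
- by move=> x h; apply: mulr_ge0; [exact: sqr_ge0|apply: mulr_ge0; exact: c01].
- move=> x; apply: itgZ; apply: (itg_mulb (C := 1) ic (mi x)) => h; exact: indic_norm_le1.
- move=> h; rewrite (_ : f ^~ h = (fun x => \1_(cube rho) h * (u x ^+ 2 * \1_(~` E) (x + h)))).
    apply: itgZ; apply: (itg_mulb (C := 1) hu.2 (mi' h)) => x; exact: indic_norm_le1.
  by apply/funext => x; rewrite /f; ring.
- exact: itgZ.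
- move=> h; rewrite (_ : f ^~ h = (fun x => \1_(cube rho) h * (u x ^+ 2 * \1_(~` E) (x + h)))); last first.
    by apply/funext => x; rewrite /f; ring.
  have ii : itg (fun x => u x ^+ 2 * \1_(~` E) (x + h)).
    by apply: (itg_mulb (C := 1) hu.2 (mi' h)) => x; exact: indic_norm_le1.
  rewrite (intZ _ ii) mulrC indicE; case: (boolP (h \in _)) => [|_]; last by rewrite !mulr0.
  rewrite inE => hc; rewrite !mulr1.
  apply: (@le_trans _ _ (nsq h * gip g g)); last by rewrite ler_wpM2r ?gip_ge0// cube_nsq.
  apply: le_trans (diffquot_le h hg).
  apply: int_le ii (L2B (L2_shift h hu) hu).2 _ => x.
  rewrite indicE; case: (boolP (_ \in _)) => [|_]; last by rewrite mulr0 sqr_ge0.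
  by rewrite inE => /u0 ->; rewrite mulr1 sub0r sqrrN.
have i3 : itg (fun x => u x ^+ 2 * \1_N x).
  apply: (itg_mulb (C := 1) hu.2 (measurable_indic_leb mN)) => x; exact: indic_norm_le1.
apply: (@le_trans _ _ (rint (fun x => rint (f x)))); last first.
  by apply: (le_trans i2); rewrite (intZ _ ic) ec mulrC mulrA.
rewrite -(intZ _ i3); apply: int_le (itgZ kappa i3) i1 _ => x.
have -> : rint (f x) = u x ^+ 2 * voidc E rho x.
  rewrite /voidc -intZ; first by [].
  by apply: (itg_mulb (C := 1) ic (mi x)) => h; exact: indic_norm_le1.
rewrite mulrCA ler_wpM2l ?sqr_ge0// indicE; case: (boolP (x \in N)) => [|_].
  by rewrite inE mulr1; exact: hN.
by rewrite mulr0; apply: int_ge0 => h; apply: mulr_ge0; exact: c01.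
Qed.

Lemma voidc_ge (E : set V) rho x : open E -> (leb E < +oo)%E -> 0 <= rho ->
  (rho *+ 2) ^+ d - fine (leb E) <= voidc E rho x.
Proof.
move=> oE fE r0; have mE := open_measurable_leb oE; have iE := itg_indic mE fE.
have [ic ec] := itg_cube r0; have [j1 j2] := int_shift x iE.
have mi : measurable_fun setT (fun h => \1_E (x + h) : R) := @measurable_indic_shift E x mE.
have i1 : itg (fun h => \1_(cube rho) h * \1_E (x + h)).
  by apply: (itg_mulb (C := 1) ic mi) => h; exact: indic_norm_le1.
rewrite /voidc (_ : (fun h => _) = (fun h => \1_(cube rho) h - \1_(cube rho) h * \1_E (x + h))); last first.
  by apply/funext => h; rewrite indicC; ring.
rewrite (intB ic i1) ec lerD2l lerN2 -(int_indic _ mE) -j2.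
apply: int_le i1 j1 _ => h; rewrite [x + h]addrC.
by case/andP: (indic01 (cube rho) h) => a b; case/andP: (indic01 E (h + x)) => c e; rewrite ler_piMl.
Qed.

Lemma poincare (E : set V) : (0 < d)%N -> open E -> (leb E < +oo)%E ->
  exists2 C : R, 0 <= C & forall u g, grad u g -> (forall x, ~ E x -> u x = 0) ->
    rint (fun x => u x ^+ 2) <= C * gip g g.
Proof.
move=> d0 oE fE; pose m := fine (leb E).
have m0 : 0 <= m by rewrite fine_ge0.
(* The cube has side [|E| + 1], so in positive dimension at least a unit of volume lies outside
   [E]. *)
pose rho := (m + 1) / 2; have r0 : 0 <= rho by rewrite /rho; lra.
have r2 : rho *+ 2 = m + 1 by rewrite -mulr_natr /rho mulfVK.
exists ((rho *+ 2) ^+ d * (d%:R * rho ^+ 2)) => [|u g hg u0].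
  by rewrite mulr_ge0 ?exprn_ge0 ?mulrn_wge0// mulr_ge0// sqr_ge0.
have := @thick E setT u g 1 rho oE measurableT hg u0 r0.
rewrite mul1r (_ : (fun x => u x ^+ 2 * \1_setT x) = (fun x => u x ^+ 2)).
  by apply => x _; apply: le_trans (voidc_ge x oE fE r0); rewrite -/m r2 lerBrDr addrC ler_eXnr// lerDr.
by apply/funext => x; rewrite indicT mulr1.
Qed.

Definition fat_complement (E : set V) (delta r0 : R) :=
  forall y r, ~ E y -> 0 < r -> r <= r0 -> delta * r ^+ d <= fine (leb (eball y r `\` E)).

Definition nbhd (E : set V) (e : R) : set V := [set x | exists2 y, ~ E y & enorm (x - y) < e].

Lemma open_nbhd E e : open (nbhd E e).
Proof.
rewrite (_ : nbhd E e = \bigcup_(y in ~` E) eball y e); first by apply: bigcup_open => y _; exact: open_eball.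
by apply/seteqP; split => [x [y hy xy]|x [y hy xy]]; exists y.
Qed.

Lemma nbhd_bound (E : set V) delta r0 u g e : open E -> fat_complement E delta r0 -> 0 < delta ->
  0 < e -> e <= r0 -> grad u g -> (forall x, ~ E x -> u x = 0) ->
  rint (fun x => u x ^+ 2 * \1_(nbhd E (3 * e)) x) <=
  8 ^+ d * (d%:R * 16) / delta * e ^+ 2 * gip g g.
Proof.
move=> oE fat dl0 e0 er hg u0; have mE := open_measurable_leb oE.
have e4 : 0 <= 4 * e by lra.
(* If [x] is within [3 e] of a point [y] outside [E], the cube of half-side [4 e] about [x] contains
   the ball of radius [e] about [y], where the complement has volume at least [delta e^d]. *)
have := @thick E _ u g (delta * e ^+ d) (4 * e) oE (open_measurable_leb (@open_nbhd E (3 * e))) hg u0 e4.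
rewrite (_ : 4 * e *+ 2 = 8 * e); last by rewrite -mulr_natr; ring.
rewrite !exprMn => h; have {h} := h _.
set I := rint _; set G := gip g g => h.
have de0 : 0 < delta * e ^+ d by rewrite mulr_gt0// exprn_gt0.
rewrite -(ler_pM2l de0); apply: (le_trans (h _)).
  move=> x [y Ey xy]; apply: (le_trans (fat y e Ey e0 er)).
  have mB : measurable (eball y e `\` E) := measurableD (measurable_eball y e) mE.
  have fB : (leb (eball y e `\` E) < +oo)%E.
    apply: le_lt_trans (leb_eball_lty y e); apply: le_measure; rewrite ?inE//; exact: measurable_eball.
  have [i1 i2] := int_shift x (itg_indic mB fB).
  rewrite -(int_indic _ mB) -i2 /voidc; apply: int_le i1 _ _.
    have [ic _] := itg_cube e4.
    apply: (itg_mulb (C := 1) ic); last by move=> z; exact: indic_norm_le1.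
    exact: (@measurable_indic_shift (~` E) x (measurableC mE)).
  move=> z; rewrite !indicE addrC; case: (boolP (_ \in _ `\` _)) => [|_]; last by case: (_ \in _); case: (_ \in _); rewrite /= ?mulr0 ?mulr1.
  rewrite inE => -[h1 h2]; rewrite !mem_set /= ?mulr1//.
  apply/cubeP => i; have hz : enorm z < 4 * e.
    have -> : z = (x + z - y) - (x - y) by rewrite opprB addrA subrK addrAC subrr add0r.
    have := enormD (x + z - y) (- (x - y)); rewrite enormN; rewrite /eball /= in h1; lra.
  have := le_lt_trans (enorm_coord z i) hz; rewrite ltr_norml => /andP[-> /ltW ->]//.
by rewrite le_eqVlt; apply/orP; left; apply/eqP; field; lra.
Qed.

Lemma grad_rep (E : set V) u g : open E -> grad u g -> {ae @leb R d, forall x, ~ E x -> u x = 0} ->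
  grad (fun x => u x * \1_E x) g.
Proof.
move=> oE hg h; have mi := measurable_indic_leb (open_measurable_leb oE).
apply: (grad_ae hg); first exact: measurable_funM hg.1.1 mi.
apply: filterS h => x hx; rewrite indicE; case: (boolP (x \in E)); first by rewrite mulr1.
by rewrite notin_setE => /hx ->; rewrite mul0r.
Qed.

End thick.

(** * Cut-offs and the two Sobolev spaces *)

Section H10_characterisation.
Context {R : realType} {d : nat}.
Local Notation V := 'rV[R]_d.
Local Notation rint := (mintegral (@leb R d)).
Local Notation itg := (mintegrable (@leb R d)).
Local Notation L2 := (L2fun (@leb R d)).
Implicit Types (x y z h : V) (r s : R) (u v k f phi : V -> R) (i : 'I_d) (g : 'I_d -> V -> R).

Definition gsub g g' : 'I_d -> V -> R := fun i x => g i x - g' i x.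

Lemma gradB u v g g' : grad u g -> grad v g' -> grad (fun x => u x - v x) (gsub g g').
Proof.
move=> h h'; have := grad_lin (-1) h' h; congr grad.
  by apply/funext => x; ring.
by apply/funext => i; apply/funext => x; rewrite /gsub; ring.
Qed.

Lemma gip_triangle g g' : gL2 g -> gL2 g' ->
  gip (fun i x => g i x + g' i x) (fun i x => g i x + g' i x) <= 2 * gip g g + 2 * gip g' g'.
Proof.
move=> h h'; rewrite /gip !mulr_sumr -big_split /=; apply: ler_sum => i _.
exact: (int_sqrD_le (h i) (h' i)).
Qed.

Lemma H1norm_lt u g e : grad u g -> 0 < e ->
  (H1norm u < e) = (rint (fun x => u x ^+ 2) + gip g g < e ^+ 2).
Proof.
move=> hg e0; rewrite /H1norm (dirichletE hg hg) -/(rint _).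
have s0 : 0 <= rint (fun x => u x ^+ 2) + gip g g by rewrite addr_ge0 ?gip_ge0 ?int_sqr_ge0.
by rewrite -[in RHS](sqr_sqrtr s0) ltr_pXn2r ?nnegrE ?sqrtr_ge0// ltW.
Qed.

Lemma H10P (E : set V) u g : grad u g ->
  H10 E u <-> forall e, 0 < e -> exists2 phi, Ccoo E phi &
    rint (fun x => (u x - phi x) ^+ 2) + gip (gsub g (fun i => partial i phi)) (gsub g (fun i => partial i phi)) < e.
Proof.
move=> hg; split=> [[_ h] e e0|h].
  have s0 : 0 < Num.sqrt e by rewrite sqrtr_gt0.
  have [phi hp] := h _ s0; exists phi => //.
  have := H1norm_lt (gradB hg (grad_Ccoo hp)) s0.
  by rewrite sqr_sqrtr ?(ltW e0)// => <-.
split; first by apply/H1P; exists g.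
move=> e e0; have [phi hp hl] := h _ (exprn_gt0 2 e0); exists phi => //.
by rewrite (H1norm_lt (gradB hg (grad_Ccoo hp)) e0).
Qed.

Lemma Ccoo_out (U : set V) phi x : Ccoo U phi -> ~ U x -> phi x = 0.
Proof. by move=> [_ [K [_ KU K0]]] nU; apply: K0 => /KU. Qed.

Lemma int_le_sub f (A : set V) : itg f -> measurable A -> (forall x, 0 <= f x) ->
  itg (fun x => f x * \1_A x) /\ rint (fun x => f x * \1_A x) <= rint f.
Proof.
move=> hf mA f0; have i1 : itg (fun x => f x * \1_A x).
  apply: (itg_mulb (C := 1) hf (measurable_indic_leb mA)) => x; exact: indic_norm_le1.
split=> //; apply: int_le i1 hf _ => x; case/andP: (indic01 A x) => a b; exact: ler_piMr.
Qed.

Lemma H10_sub_tilde (E : set V) : open E -> H10 E `<=` H10_tilde E.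
Proof.
move=> oE u hu; have [hH _] := hu; split=> //; have [g hg] := (H1P u).1 hH.
have mC := measurableC (open_measurable_leb oE).
have [i1 _] := int_le_sub hg.1.2 mC (fun x => sqr_ge0 (u x)).
have z : rint (fun x => u x ^+ 2 * \1_(~` E) x) = 0.
  apply/eqP; rewrite eq_le; apply/andP; split; last first.
    by apply: int_ge0 => x; apply: mulr_ge0; [exact: sqr_ge0|case/andP: (indic01 (~` E) x)].
  apply/ler_addgt0Pr => e e0; rewrite add0r.
  have [phi hp] := (H10P E hg).1 hu e e0.
  have h1 := L2B hg.1 (Ccoo_L2 hp).
  have [i2 l2] := int_le_sub h1.2 mC (fun x => sqr_ge0 _).
  have := gip_ge0 (gsub g (fun i => partial i phi)).
  suff -> : rint (fun x => u x ^+ 2 * \1_(~` E) x) = rint (fun x => (u x - phi x) ^+ 2 * \1_(~` E) x) by lra.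
  congr rint; apply/funext => x; rewrite indicE; case: (boolP (x \in _)); last by rewrite !mulr0.
  by rewrite inE => /(Ccoo_out hp) ->; rewrite subr0.
have := int_eq0_ae i1 (fun x => mulr_ge0 (sqr_ge0 _) (proj1 (andP (indic01 (~` E) x)))) z.
apply: filterS => x + nE; rewrite indicE mem_set// mulr1 => /eqP.
by rewrite sqrf_eq0 => /eqP.
Qed.

Lemma near_all (P : 'I_d -> R -> Prop) : (forall i, \forall r \near 0^'+, P i r) ->
  \forall r \near 0^'+, forall i, P i r.
Proof. by move=> h; apply: filter_forall. Qed.

Lemma mollify_near u e : L2 u -> 0 < e ->
  \forall r \near 0^'+, rint (fun x => (conv u (kern r) x - u x) ^+ 2) < e.
Proof.
move=> hu e0; have [r0 r00 h] := mollify_L2 hu e0.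
near=> r; apply: h; first by near: r; exact: nbhs_right_gt.
by near: r; exact: nbhs_right_lt.
Unshelve. all: by end_near. Qed.

Lemma grad_mollify u g e : grad u g -> 0 < e -> \forall r \near 0^'+,
  rint (fun x => (u x - conv u (kern r) x) ^+ 2) +
  gip (gsub g (fun i => conv (g i) (kern r))) (gsub g (fun i => conv (g i) (kern r))) < e.
Proof.
move=> [hu hg] e0; pose e' := e / d.+1%:R.
have e'0 : 0 < e' by rewrite divr_gt0.
have h1 := mollify_near hu e'0.
have h2 : \forall r \near 0^'+, forall i, rint (fun x => (conv (g i) (kern r) x - g i x) ^+ 2) < e'.
  by apply: near_all => i; exact: mollify_near (hg i).1 e'0.
apply: filterS2 h1 h2 => r a b.
have sw f f' : rint (fun x => (f x - f' x) ^+ 2) = rint (fun x => (f' x - f x) ^+ 2).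
  by congr rint; apply/funext => x; rewrite -sqrrN opprB.
have : gip (gsub g (fun i => conv (g i) (kern r))) (gsub g (fun i => conv (g i) (kern r))) <= \sum_(i < d) e'.
  by apply: ler_sum => i _; rewrite [leLHS]sw; apply: ltW; exact: b.
rewrite sumr_const card_ord sw => c.
apply: (lt_le_trans (ltr_leD a c)).
by rewrite -mulrS -mulr_natr /e' divfK// pnatr_eq0.
Qed.

Definition inner (E : set V) (e : R) : set V := ~` nbhd E e.

Lemma inner_sub (E : set V) e : 0 < e -> inner E e `<=` E.
Proof. by move=> e0 x h; apply: contrapT => nE; apply: h; exists x => //; rewrite subrr enorm0. Qed.

(* Mollification at a scale below [e] keeps the support inside [E]. *)
Lemma H10_compact (E : set V) u g e r0 : grad u g -> 0 < e -> supp_in r0 u ->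
  (forall x, nbhd E e x -> u x = 0) -> H10 E u.
Proof.
move=> hg e0 ur0 ue; apply/(H10P E hg) => t t0.
have h1 := grad_mollify hg t0.
near (0 : R)^'+ => r.
have rp : 0 < r by near: r; exact: nbhs_right_gt.
have re : r < e / 2 by near: r; apply: nbhs_right_lt; lra.
exists (conv u (kern r)); last first.
  have -> : (fun i => partial i (conv u (kern r))) = (fun i => conv (g i) (kern r)).
    apply/funext => i; apply/funext => x.
    exact: (partial_conv_weak x (loc_L2 hg.1) (Ccoo_kern rp) (kern_supp rp) (hg.2 i).2).
  by near: r.
split=> [m|].
  by apply: (Ck_conv m (loc_L2 hg.1) _ (kern_supp rp)) => n; exact: Ck_kern.
exists ([set x | enorm x <= r0 + r] `&` inner E (e / 2)); split.
- apply: compact_closedI; first exact: compact_closed_ball.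
  by apply: open_closedC; exact: open_nbhd.
- by move=> x [_]; apply: inner_sub; lra.
move=> x nK; have [xr|xr] := ltP (r0 + r) (enorm x).
  by apply: (conv_supp ur0 (kern_supp rp)); exact: ltW.
have [y Ey xy] : nbhd E (e / 2) x by apply: contrapT => h; apply: nK; split.
rewrite /conv (_ : (fun y => _) = cst 0) ?int0//; apply/funext => z.
have [zx|zx] := ltP (enorm (x - z)) r; last by rewrite kern_supp// mulr0.
rewrite ue ?mul0r//; exists y => //.
have := enorm_triangle z x y; rewrite [enorm (z - x)]enormB; lra.
Unshelve. all: by end_near. Qed.

Lemma partial_le_lipschitz f i x L : Ck 1 f -> (forall y z, `|f y - f z| <= L * enorm (y - z)) ->
  `|partial i f x| <= L.
Proof.
move=> hf hL; have := Ck_der i x hf => /is_derive_line0/is_derive_cvg h.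
have cl : closed [set a : R | a <= L] by exact: closed_le.
suff nr : \forall t \near 0^', `|t^-1 * (f (x + (0 + t) *: (delta_mx 0 i : V)) - f (x + 0 *: (delta_mx 0 i : V)))| <= L.
  exact: (closed_cvg _ cl nr _ (cvg_norm h)).
near=> t.
have t0 : t != 0 by near: t; exact: nbhs_dnbhs_neq.
rewrite scale0r add0r addr0 normrM normfV mulrC ler_pdivrMr ?normr_gt0//.
apply: (le_trans (hL _ _)); rewrite addrC addKr enormZ.
have -> : enorm (delta_mx 0 i : V) = 1.
  rewrite /enorm (bigD1 i)//= mxE !eqxx big1 ?addr0 ?expr1n ?sqrtr1// => j ji.
  by rewrite mxE eqxx (negbTE ji) expr0n.
by rewrite mulr1.
Unshelve. all: by end_near. Qed.

(** Mollify at scale [e] the indicator of the points at distance at least [2 e] from the complement.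
    The Lipschitz constant of the kernel, of order [e^(-d-1)], times the volume of a ball gives the
    gradient bound; farther than [3 e] the mollified function is locally constant. *)
Lemma cutoff (E : set V) : exists2 C : R, 0 <= C & forall e, 0 < e -> exists chi : V -> R,
  [/\ forall m, Ck m chi, forall x, `|chi x| <= 1,
      (forall x, nbhd E e x -> chi x = 0) /\ (forall x, ~ nbhd E (3 * e) x -> chi x = 1) &
      forall i x, `|partial i chi x| <= C / e * \1_(nbhd E (3 * e)) x].
Proof.
have [L L0 hL] := @kern_lipschitz R d.
pose C := L * 2 ^+ d; exists C => [|e e0]; first by rewrite mulr_ge0 ?exprn_ge0 ?(ltW L0).
pose A := inner E (2 * e); pose chi := conv (\1_A : V -> R) (kern e).
have mA : measurable A by apply: measurableC; apply: open_measurable_leb; exact: open_nbhd.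
have lA : loc (\1_A : V -> R) by apply: (loc_bounded (C := 1)) (measurable_indic_leb mA) _ => x; exact: indic_norm_le1.
have ke := kern_supp e0 : supp_in e (kern e : V -> R).
have ck : continuous (kern e : V -> R) := Ck_cont (Ck_kern 0 e).
have cm m : Ck m chi by apply: (Ck_conv m lA _ ke) => n; exact: Ck_kern.
have out x z : ~ nbhd E (3 * e) x -> enorm (x - z) < e -> (\1_A z : R) = 1.
  move=> nx xz; rewrite indicE mem_set// => -[y Ey zy]; apply: nx; exists y => //.
  have := enorm_triangle x z y; lra.
exists chi; split => //.
- move=> x; have := @conv_kern_dist R d (\1_A) e x 0 1 e0 lA; rewrite subr0; apply => y _.
  by rewrite subr0; exact: indic_norm_le1.
- split=> x h.
    have := @conv_kern_dist R d (\1_A) e x 0 0 e0 lA; rewrite subr0 normr_le0 => h'.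
    apply/eqP/h' => z xz; rewrite subr0 indicE memNset ?normr0// => hz; apply: hz.
    case: h => y Ey xy; exists y => //.
    have := enorm_triangle z x y; rewrite [enorm (z - x)]enormB; lra.
  have := @conv_kern_dist R d (\1_A) e x 1 0 e0 lA; rewrite normr_le0 subr_eq0 => h'.
  by apply/eqP/h' => z xz; rewrite (out x z) ?subrr ?normr0.
move=> i x; rewrite indicE; case: (boolP (x \in _)) => [_|]; last first.
  rewrite notin_setE => nx; rewrite mulr0 normr_le0 /chi (partial_conv i x lA (Ck_kern 1 e) ke).
  rewrite /conv (_ : (fun y => _) = (fun y => partial i (kern e) (x - y))).
    by rewrite (int_partial0_reflect i x (Ck_kern 1 e) ke).
  apply/funext => z; have [xz|zx] := ltP (enorm (x - z)) e; first by rewrite (out x z)// mul1r.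
  rewrite (_ : partial i (kern e) (x - z) = 0) ?mulr0//.
  by rewrite partial_kern /dem2 !em_le0 ?karg_le0// !mulr0 addr0 !mulr0 mul0r oppr0.
rewrite mulr1 /chi (partial_conv i x lA (Ck_kern 1 e) ke).
have ei : 0 <= e^-1 by rewrite invr_ge0 ltW.
have ed : 0 <= e^-1 ^+ d by exact: exprn_ge0.
pose K := L * e^-1 ^+ d * e^-1.
have K0 : 0 <= K by apply: mulr_ge0 => //; apply: mulr_ge0 => //; exact: ltW.
have bk z : `|partial i (kern e) z| <= K.
  apply: (partial_le_lipschitz i z (Ck_kern 1 e)) => y y'; exact: hL.
have mB := measurable_eball x e; have fB := leb_eball_lty x e.
have i1 : itg (fun z => \1_A z * partial i (kern e) (x - z)).
  exact: (itg_conv1 x lA (Ck_cont (Ck_partial i (Ck_kern 1 e))) (supp_partial i (Ck_kern 1 e) ke)).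
apply: (le_trans (int_norm i1)).
apply: (@le_trans _ _ (rint (fun z => K * \1_(eball x e) z))).
  apply: int_le (itg_norm i1) (itgZ K (itg_indic mB fB)) _ => z.
  rewrite normrM [in leRHS]indicE; case: (boolP (z \in _)) => [_|].
    by rewrite mulr1 -[leRHS]mul1r; apply: ler_pM => //; exact: indic_norm_le1.
  rewrite notin_setE /eball /= => /negP; rewrite -leNgt enormB => hz.
  by rewrite partial_kern /dem2 !em_le0 ?karg_le0// !mulr0 addr0 !mulr0 mul0r oppr0 normr0 mulr0.
rewrite (intZ _ (itg_indic mB fB)) (int_indic _ mB).
have b2 : fine (leb (eball x e)) <= (e *+ 2) ^+ d.
  by rewrite -lee_fin fineK ?ge0_fin_numE//; apply: leb_eball_le; exact: ltW.
apply: (le_trans (ler_wpM2l K0 b2)); rewrite /K /C.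
have -> : e *+ 2 = 2 * e by rewrite mulr_natl.
have ee : e^-1 ^+ d * e ^+ d = 1 by rewrite -exprMn mulVf ?expr1n// gt_eqF.
rewrite exprMn (_ : L * e^-1 ^+ d * e^-1 * (2 ^+ d * e ^+ d) = L * 2 ^+ d * e^-1 * (e^-1 ^+ d * e ^+ d)); last by ring.
by rewrite ee mulr1.
Qed.

End H10_characterisation.

Section H10_equality.
Context {R : realType} {d : nat}.
Local Notation V := 'rV[R]_d.
Local Notation rint := (mintegral (@leb R d)).
Local Notation L2 := (L2fun (@leb R d)).
Implicit Types (x y z h : V) (r s : R) (u v k f phi : V -> R) (i : 'I_d) (g : 'I_d -> V -> R).

Lemma cvg_sumI (a : 'I_d -> nat -> R) (l : 'I_d -> R) : (forall i, a i n @[n --> \oo] --> l i) ->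
  (\sum_i a i n) @[n --> \oo] --> \sum_i l i.
Proof.
move=> h; elim: (index_enum _) => [|i s IH].
  by under eq_fun do rewrite big_nil; rewrite big_nil; exact: cvg_cst.
under eq_fun do rewrite big_cons; rewrite big_cons; apply: cvgD => //; exact: h.
Qed.

Lemma sqrD_le (a b A B : R) : a ^+ 2 <= A -> b ^+ 2 <= B -> (a + b) ^+ 2 <= 2 * A + 2 * B.
Proof. by have := sqr_ge0 (a - b); rewrite !expr2 => h1 h2 h3; lra. Qed.

Lemma weak_cvg (hn : nat -> V -> R) (h f : V -> R) K : (forall n, L2 (hn n)) -> L2 h -> L2 f ->
  (forall n, rint (fun x => hn n x ^+ 2) <= K) ->
  (forall phi, Ccoo setT phi -> rint (fun x => hn n x * phi x) @[n --> \oo] --> rint (fun x => h x * phi x)) ->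
  rint (fun x => hn n x * f x) @[n --> \oo] --> rint (fun x => h x * f x).
Proof.
move=> hhn hh hf hK hc; apply/cvgrPdist_lt => e e0.
have K0 : 0 <= K by apply: le_trans (hK 0%N); exact: int_sqr_ge0.
have [M [EM M0]] : exists M, M = 2 * rint (fun x => h x ^+ 2) + 2 * K + 1 /\ 0 < M.
  by eexists; split; first reflexivity; rewrite ltr_wpDl// addr_ge0// mulr_ge0// int_sqr_ge0.
have eM : 0 < e ^+ 2 / (4 * M) by rewrite divr_gt0 ?exprn_gt0 ?mulr_gt0.
have [phi hp hl] := Ccoo_dense_L2 hf eM.
have hp2 := Ccoo_L2 hp; have hfp := L2B hf hp2.
have e2 : 0 < e / 2 by lra.
move/cvgrPdist_lt : (hc _ hp) => /(_ _ e2) [N _ hN]; exists N => // n /hN /= h1.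
have hd := L2B hh (hhn n).
have E : rint (fun x => h x * f x) - rint (fun x => hn n x * f x) =
  (rint (fun x => h x * phi x) - rint (fun x => hn n x * phi x)) + rint (fun x => (h x - hn n x) * (f x - phi x)).
  rewrite -!intB; [|exact: (L2_mul hh hp2)|exact: (L2_mul (hhn n) hp2)|exact: (L2_mul hh hf)|exact: (L2_mul (hhn n) hf)].
  rewrite -intD; [|exact: (itgB (L2_mul hh hp2) (L2_mul (hhn n) hp2))|exact: (L2_mul hd hfp)].
  by congr rint; apply/funext => x; ring.
rewrite E; apply: (le_lt_trans (ler_normD _ _)).
suff h2 : `|rint (fun x => (h x - hn n x) * (f x - phi x))| < e / 2 by rewrite (splitr e); exact: ltrD.
rewrite -(@ltr_pXn2r _ 2) ?nnegrE ?(ltW e2)// real_normK ?num_real//.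
apply: (le_lt_trans (cauchy_schwarz hd hfp)).
have b1 : rint (fun x => (h x - hn n x) ^+ 2) <= M.
  apply: (le_trans (int_sqrD_le hh (L2N (hhn n)))).
  have -> : rint (fun x => (- hn n x) ^+ 2) = rint (fun x => hn n x ^+ 2).
    by congr rint; apply/funext => x; rewrite sqrrN.
  rewrite EM -addrA lerD2l; apply: (@le_trans _ _ (2 * K)); last by rewrite lerDl.
  by rewrite ler_wpM2l.
apply: (@le_lt_trans _ _ (M * rint (fun x => (f x - phi x) ^+ 2))).
  by rewrite ler_wpM2r// int_sqr_ge0.
rewrite -(ltr_pdivlMl _ _ M0); apply: (lt_le_trans hl).
by rewrite le_eqVlt; apply/orP; left; apply/eqP; field; rewrite gt_eqF.
Qed.

(** Cut-offs at infinity, normalised to take the value 1 at the origin; they tend to 1 pointwise,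
    with values and gradients bounded uniformly in [n]. *)
Definition bcut (n : nat) x : R := (em 0 1)^-1 * em 0 (karg n.+1%:R x).

Lemma bcutP : exists2 K : R, 0 <= K & forall n, [/\ forall m, Ck m (bcut n), forall x, `|bcut n x| <= K,
  forall i x, `|partial i (bcut n) x| <= K & supp_in n.+1%:R (bcut n)].
Proof.
have c0 : 0 < em 0 (1 : R) by exact: em_gt0.
have ci : 0 <= (em 0 (1 : R))^-1 by rewrite invr_ge0 ltW.
have [C2 C20 h2] := @em_le R 2.
exists ((em 0 1)^-1 * (1 + 2 * C2)) => [|n]; first by rewrite mulr_ge0//; lra.
have n1 : 1 <= n.+1%:R :> R by rewrite ler1n.
have np : 0 < n.+1%:R :> R by lra.
have ck m : Ck m (fun x => em 0 (karg n.+1%:R x)) by exact: Ck_em_karg.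
split.
- by move=> m; apply: CkZ.
- move=> x; rewrite normrM ger0_norm// ler_wpM2l// ger0_norm ?em_ge0//.
  by have := em0_le1 (karg n.+1%:R x); lra.
- move=> i x; rewrite (@partialZ _ _ 0) ?partial_em_karg; last exact: ck.
  rewrite oppr0 mul0r add0r normrM ger0_norm// ler_wpM2l//.
  have [xn|xn] := leP (n.+1%:R) (enorm x).
    by rewrite em_le0 ?karg_le0// mul0r normr0; lra.
  rewrite normrM; have hx : `|- (2 * n.+1%:R^-1 ^+ 2) * x 0 i| <= 2.
    rewrite mulNr normrN -mulrA normrM ger0_norm// -[leRHS]mulr1 ler_wpM2l//.
    rewrite expr2 -mulrA !normrM -[leRHS]mulr1; apply: ler_pM => //.
      by rewrite ger0_norm ?invr_ge0 ?(ltW np)// invf_le1.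
    rewrite ger0_norm ?invr_ge0 ?(ltW np)// mulrC ler_pdivrMr// mul1r.
    by apply: (le_trans (enorm_coord x i)); exact: ltW.
  have := ler_pM (normr_ge0 _) (normr_ge0 _) (h2 _ (karg_le1 n.+1%:R x)) hx; lra.
- by move=> x hx; rewrite /bcut (em_le0 0 (karg_le0 np hx)) mulr0.
Qed.

Lemma bcut_cvg x : bcut n x @[n --> \oo] --> (1 : R).
Proof.
have c0 : em 0 (1 : R) != 0 by rewrite gt_eqF// em_gt0.
have h : karg n.+1%:R x @[n --> \oo] --> (1 : R).
  rewrite -[X in _ --> X](subr0 1) -(mul0r (nsq x)) -[X in X * nsq x](mul0r 0).
  apply: cvgB; first exact: cvg_cst.
  apply: cvgM; last exact: cvg_cst.
  under eq_fun do rewrite expr2.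
  by apply: cvgM; exact: cvg_harmonic.
rewrite -[X in _ --> X](mulVf c0); apply: cvgM; first exact: cvg_cst.
exact: (cvg_comp _ _ h ((@Sk_em R 0 0).1 1 I)).
Qed.

Lemma gip_part_le g i : rint (fun x => g i x ^+ 2) <= gip g g.
Proof.
rewrite /gip (bigD1 i)//= lerDl.
by apply: sumr_ge0 => j _; apply: int_ge0 => x; rewrite -expr2 sqr_ge0.
Qed.

Lemma mulb_int_le f (b : V -> R) K : L2 f -> measurable_fun setT b -> 0 <= K -> (forall x, `|b x| <= K) ->
  rint (fun x => (f x * b x) ^+ 2) <= K ^+ 2 * rint (fun x => f x ^+ 2).
Proof.
move=> hf mb K0 hb; rewrite -(intZ _ hf.2).
apply: int_le (L2_mulb hf mb hb).2 (itgZ _ hf.2) _ => x.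
rewrite exprMn mulrC ler_wpM2r ?sqr_ge0//.
by rewrite -real_normK ?num_real// ler_pXn2r ?nnegrE.
Qed.

Lemma H10_ae (E : set V) u v g : grad u g -> grad v g -> {ae @leb R d, forall x, u x = v x} -> H10 E u -> H10 E v.
Proof.
move=> hu hv uv h; apply/(H10P E hv) => e e0; have [phi hp hl] := (H10P E hu).1 h e e0.
exists phi => //; apply: le_lt_trans hl; rewrite lerD2r le_eqVlt; apply/orP; left; apply/eqP.
apply: int_ae.
- exact: (itg_measurable (L2B hv.1 (Ccoo_L2 hp)).2).
- exact: (itg_measurable (L2B hu.1 (Ccoo_L2 hp)).2).
- by apply: filterS uv => x ->.
Qed.

Section sequence.
Variables (E : set V) (delta r0 : R).
Hypotheses (oE : open E) (fat : fat_complement E delta r0) (d0 : 0 < delta) (r00 : 0 < r0).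
Variables (v : V -> R) (g : 'I_d -> V -> R).
Hypotheses (hg : grad v g) (v0 : forall x, ~ E x -> v x = 0).

(** The gradient of the cut-off is of order [1 / e], but [nbhd_bound] makes the integral of [v^2]
    where it lives of order [e^2]. The gradients thus stay bounded in L^2, without any claim that
    they converge. *)
Lemma cut_sequence : exists (vn : nat -> V -> R) (gn : nat -> 'I_d -> V -> R) (K : R),
  [/\ forall n, grad (vn n) (gn n), forall n, H10 E (vn n),
      forall n i, rint (fun x => gn n i x ^+ 2) <= K &
      rint (fun x => (vn n x - v x) ^+ 2) @[n --> \oo] --> 0].
Proof.
have [hv hgi] := hg.
have [C C0 hC] := cutoff E; have [B B0 hB] := @bcutP.
pose e (n : nat) := r0 * n.+1%:R^-1.
have e0 n : 0 < e n by rewrite mulr_gt0// invr_gt0.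
have er n : e n <= r0 by rewrite /e ler_piMr ?(ltW r00)// invf_le1 ?ler1n.
have [chi hchi] := choice (fun n => hC (e n) (e0 n)).
pose xi n x := chi n x * bcut n x.
have [ckc bc zc pc] : [/\ forall n m, Ck m (chi n), forall n x, `|chi n x| <= 1,
   forall n, (forall x, nbhd E (e n) x -> chi n x = 0) /\ (forall x, ~ nbhd E (3 * e n) x -> chi n x = 1) &
   forall n i x, `|partial i (chi n) x| <= C / e n * \1_(nbhd E (3 * e n)) x].
  by split=> n; have [] := hchi n.
have ckb n : forall m, Ck m (bcut n) by have [] := hB n.
have bb n : forall x, `|bcut n x| <= B by have [] := hB n.
have pb n : forall i x, `|partial i (bcut n) x| <= B by have [] := hB n.
have ckx n m : Ck m (xi n) by apply: CkM; [exact: ckc|exact: ckb].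
have bx n x : `|xi n x| <= B.
  by rewrite normrM -[leRHS]mul1r; apply: ler_pM.
have px n i x : partial i (xi n) x = chi n x * partial i (bcut n) x + bcut n x * partial i (chi n) x.
  by rewrite (@partialM _ _ 0); [|exact: ckc|exact: ckb].
have Ce n : 0 <= C / e n by rewrite divr_ge0// ltW.
have pxb n i x : `|partial i (xi n) x| <= B + B * (C / e n).
  rewrite px; apply: (le_trans (ler_normD _ _)); rewrite (normrM (chi n x)) (normrM (bcut n x)); apply: lerD.
    by rewrite -[leRHS]mul1r; apply: ler_pM.
  apply: ler_pM => //; apply: (le_trans (pc n i x)).
  by case/andP: (indic01 (nbhd E (3 * e n)) x) => a b; rewrite ler_piMr.
pose vn n x := v x * xi n x.
pose gn n i x := g i x * xi n x + v x * partial i (xi n) x.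
have hgn n : grad (vn n) (gn n).
  apply: (@grad_mul _ _ (xi n) (B + B * (C / e n)) v g (ckx n)) => //.
  by move=> x; apply: (le_trans (bx n x)); rewrite lerDl mulr_ge0.
pose A := rint (fun x => v x ^+ 2).
pose D := 8 ^+ d * (d%:R * 16) / delta * gip g g.
have mN n : measurable (nbhd E (3 * e n)) by apply: open_measurable_leb; exact: open_nbhd.
have mxi n : measurable_fun setT (xi n) := continuous_measurable_leb (Ck_cont (ckx n 0)).
have mpx n i : measurable_fun setT (partial i (xi n)) := continuous_measurable_leb (Ck_cont (Ck_partial i (ckx n 1))).
exists vn, gn, (2 * (B ^+ 2 * gip g g) + 2 * (2 * B ^+ 2 * A + 2 * (B ^+ 2 * C ^+ 2 * D))); split.
- exact: hgn.
- move=> n; apply: (@H10_compact _ _ E (vn n) (gn n) (e n) n.+1%:R (hgn n) (e0 n)).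
    by move=> x hx; have [_ _ _ s] := hB n; rewrite /vn /xi s// !mulr0.
  by move=> x hx; rewrite /vn /xi (zc n).1// mul0r mulr0.
- move=> n i.
  have h1 := L2_mulb (hgi i).1 (mxi n) (bx n); have h2 := L2_mulb hv (mpx n i) (pxb n i).
  apply: (le_trans (int_sqrD_le h1 h2)); apply: lerD.
    rewrite ler_wpM2l//; apply: (le_trans (mulb_int_le (hgi i).1 (mxi n) B0 (bx n))).
    by rewrite ler_wpM2l ?sqr_ge0//; exact: gip_part_le.
  rewrite ler_wpM2l//.
  have [iN _] := int_le_sub hv.2 (mN n) (fun x => sqr_ge0 (v x)).
  have bN := nbhd_bound oE fat d0 (e0 n) (er n) hg v0.
  have c1 := itgZ (2 * B ^+ 2) hv.2; have c2 := itgZ (2 * (B ^+ 2 * (C / e n) ^+ 2)) iN.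
  apply: (@le_trans _ _ (rint (fun x => 2 * B ^+ 2 * v x ^+ 2 + 2 * (B ^+ 2 * (C / e n) ^+ 2) * (v x ^+ 2 * \1_(nbhd E (3 * e n)) x)))).
    apply: int_le h2.2 (itgD c1 c2) _ => x.
    set I := \1_(nbhd E (3 * e n)) x.
    have hp : (partial i (xi n) x) ^+ 2 <= 2 * B ^+ 2 + 2 * (B ^+ 2 * (C / e n) ^+ 2) * I.
      rewrite px; set a := chi n x * _; set b := bcut n x * _.
      have ha : a ^+ 2 <= B ^+ 2.
        rewrite -real_normK ?num_real// ler_pXn2r ?nnegrE// normrM -[leRHS]mul1r; apply: ler_pM => //.
      have hb : b ^+ 2 <= B ^+ 2 * (C / e n) ^+ 2 * I.
        have : `|b| <= B * (C / e n * I) by rewrite normrM; apply: ler_pM => //; exact: pc.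
        rewrite /I indicE; case: (x \in _) => /=; rewrite ?mulr1 ?mulr0.
          move=> hh; rewrite -exprMn -real_normK ?num_real// ler_pXn2r ?nnegrE// mulr_ge0//.
        by rewrite normr_le0 => /eqP ->; rewrite expr0n.
      apply: (le_trans (sqrD_le ha hb)).
      by rewrite -!mulrA.
    rewrite exprMn; apply: (le_trans (ler_wpM2l (sqr_ge0 _) hp)).
    by rewrite le_eqVlt; apply/orP; left; apply/eqP; ring.
  rewrite (intD c1 c2) (intZ _ hv.2) (intZ _ iN) lerD2l.
  have -> : 2 * (B ^+ 2 * C ^+ 2 * D) = 2 * (B ^+ 2 * (C / e n) ^+ 2) * (8 ^+ d * (d%:R * 16) / delta * (e n) ^+ 2 * gip g g).
    by rewrite /D; field; rewrite !gt_eqF.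
  apply: ler_wpM2l => //; apply: mulr_ge0 => //; apply: mulr_ge0; exact: sqr_ge0.
- have [|||| i1 i2] := @int_dct _ _ _ (@leb R d) (fun n x => (vn n x - v x) ^+ 2) (fun=> 0) (fun x => (B + 1) ^+ 2 * v x ^+ 2).
  + by move=> n; exact: (itg_measurable (L2B (hgn n).1 hv).2).
  + exact: itgZ hv.2.
  + move=> n x; rewrite ger0_norm ?sqr_ge0// /vn -exprMn -real_normK ?num_real// -[leRHS]real_normK ?num_real//.
    rewrite ler_pXn2r ?nnegrE// (_ : v x * xi n x - v x = (xi n x - 1) * v x); last by ring.
    rewrite !normrM ler_wpM2r// [leRHS]ger0_norm ?addr_ge0//.
    by apply: (le_trans (ler_normB _ _)); rewrite normr1 lerD2r.
  + move=> x; rewrite -[X in _ --> X](expr0n _ 2) /= expr2.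
    suff h : vn n x - v x @[n --> \oo] --> 0.
      by under eq_fun do rewrite expr2; exact: (cvgM h h).
    apply/subr_cvg0; have [Ex|nEx] := pselect (E x); last first.
      by rewrite /vn v0//; under eq_fun do rewrite mul0r; exact: cvg_cst.
    have h1 : v x * bcut n x @[n --> \oo] --> v x.
      by rewrite -[X in _ --> X]mulr1; apply: cvgM; [exact: cvg_cst|exact: bcut_cvg].
    apply: cvg_trans h1; apply: near_eq_cvg.
    have [rho rho0 hr] : exists2 rho : R, 0 < rho & forall y, enorm (x - y) < rho -> E y.
      move/open_bigcup_eball : oE => [F EF].
      move: Ex; rewrite {1}EF => -[k _ /=]; rewrite /eball /= => hk.
      exists ((F k).2 - enorm (x - (F k).1)) => [|y xy]; first by rewrite subr_gt0.
      rewrite EF; exists k => //; rewrite /eball /=.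
      have := enorm_triangle y x (F k).1; rewrite [enorm (y - x)]enormB; lra.
    have rr : 0 < rho / (3 * r0) by rewrite divr_gt0// mulr_gt0.
    have [N _ hN] := near_infty_natSinv_lt (PosNum rr).
    exists N => // n /hN /= hn; rewrite /vn /xi (zc n).2 ?mul1r// => -[y nEy xy].
    apply: nEy; apply: hr; apply: (lt_le_trans xy); rewrite /e.
    move: hn; rewrite ltr_pdivlMr ?mulr_gt0//; move: (n.+1%:R^-1) => a; lra.
  + by move: i2; rewrite int0.
Qed.

End sequence.
End H10_equality.

Section tilde_sub.
Context {R : realType} {d : nat}.
Local Notation V := 'rV[R]_d.
Local Notation rint := (mintegral (@leb R d)).
Implicit Types (x y z h : V) (r s : R) (u v k f phi : V -> R) (i : 'I_d) (g : 'I_d -> V -> R).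
Local Notation pd phi := (fun i => partial i phi).

Definition hip u g v (g' : 'I_d -> V -> R) := rint (fun x => u x * v x) + gip g g'.

Lemma hip_lin c u g v g' w g'' : grad u g -> grad v g' -> grad w g'' ->
  hip (fun x => c * u x + v x) (fun i x => c * g i x + g' i x) w g'' = c * hip u g w g'' + hip v g' w g''.
Proof.
move=> h1 h2 h3; rewrite /hip gip_lin; [|exact: grad_gL2 h1|exact: grad_gL2 h2|exact: grad_gL2 h3].
have -> : (fun x => (c * u x + v x) * w x) = (fun x => c * (u x * w x) + v x * w x) by apply/funext => x; ring.
by rewrite (int_lin _ (L2_mul h1.1 h3.1) (L2_mul h2.1 h3.1)); ring.
Qed.

Lemma hip_sym u g v g' : hip u g v g' = hip v g' u g.
Proof. by rewrite /hip gip_sym; congr (_ + _); congr rint; apply/funext => x; rewrite mulrC. Qed.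

Lemma hip_ge0 u g : 0 <= hip u g u g.
Proof. by rewrite addr_ge0 ?gip_ge0//; apply: int_ge0 => x; rewrite -expr2 sqr_ge0. Qed.

Lemma hip_sqr u g : hip u g u g = rint (fun x => u x ^+ 2) + gip g g.
Proof. by rewrite /hip; congr (_ + _). Qed.

Lemma hipB u g v g' w g'' : grad u g -> grad v g' -> grad w g'' ->
  hip (fun x => u x - v x) (gsub g g') w g'' = hip u g w g'' - hip v g' w g''.
Proof.
move=> h1 h2 h3; have := hip_lin (-1) h2 h1 h3; rewrite mulN1r addrC => <-.
by congr hip; [apply/funext => x|apply/funext => i; apply/funext => x; rewrite /gsub]; ring.
Qed.

Lemma hip_CS u g v g' : grad u g -> grad v g' -> hip u g v g' ^+ 2 <= hip u g u g * hip v g' v g'.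
Proof.
move=> h1 h2; rewrite [leRHS]mulrC [X in X ^+ 2]hip_sym mulrC; apply: quadratic_discriminant => t.
have h3 := grad_lin t h2 h1.
have := hip_ge0 (fun x => t * v x + u x) (fun i x => t * g' i x + g i x).
rewrite hip_lin// [hip v g' _ _]hip_sym [hip u g _ _]hip_sym !hip_lin// [hip u g v g']hip_sym; lra.
Qed.

Lemma pd_lin U c phi psi : Ccoo U phi -> Ccoo U psi ->
  pd (fun x => c * phi x + psi x) = (fun i x => c * partial i phi x + partial i psi x).
Proof.
move=> h1 h2; apply/funext => i; apply/funext => x.
rewrite (@partialD _ _ 0 (fun x => c * phi x)) ?(@partialZ _ _ 0)//.
- exact: h1.1.
- by apply: CkZ; exact: h1.1.
- exact: h2.1.
Qed.

Lemma pd_sub U phi psi : Ccoo U phi -> Ccoo U psi ->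
  pd (fun x => phi x - psi x) = gsub (pd phi) (pd psi).
Proof.
move=> h1 h2; apply/funext => i; apply/funext => x.
by rewrite (@partialB _ _ 0)//; [exact: h1.1|exact: h2.1].
Qed.

(** The orthogonal projection of [v] in H^1, obtained as a limit of test functions supported in
    [E]. *)
Lemma H10_project (E : set V) v g : grad v g -> exists p gp, [/\ grad p gp, H10 E p &
  forall (y : V -> R) gy, grad y gy -> H10 E y -> hip p gp y gy = hip v g y gy].
Proof.
move=> hg; have gC phi : Ccoo E phi -> grad phi (pd phi) := @grad_Ccoo R d E phi.
pose B (f f' : V -> R) := hip f (pd f) f' (pd f').
have [|c f f'|c f f' f'' hf hf' hf''|f f' _ _|f _|c f f' hf hf'|f hf|x [Sx xx xl]] :=
  @riesz_functions R V (Ccoo E) B (fun f => hip v g f (pd f)) (hip v g v g).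
- exact: Ccoo0.
- exact: Ccoo_lin.
- rewrite /B (pd_lin _ hf hf'); exact: (hip_lin c (gC _ hf) (gC _ hf') (gC _ hf'')).
- exact: hip_sym.
- exact: hip_ge0.
- rewrite (pd_lin _ hf hf') [LHS]hip_sym [X in _ = c * X + _]hip_sym [X in _ = _ + X]hip_sym.
  exact: (hip_lin c (gC _ hf) (gC _ hf') hg).
- exact: hip_CS hg (gC _ hf).
have [e e0|p [gp [hp cp cg]]] := @grad_complete R d x (fun n => pd (x n)) (fun n => gC _ (Sx n)).
- have [N hN] := xx e e0; exists N => m n Nm Nn.
  have := hN m n Nm Nn; rewrite /B (pd_sub (Sx m) (Sx n)) hip_sqr => h.
  have a := int_sqr_ge0 (@leb R d) (fun t => x m t - x n t).
  have b := gip_ge0 (gsub (pd (x m)) (pd (x n))).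
  by split; apply: le_trans h; rewrite ?lerDl ?lerDr.
have cgi : gip (gsub (pd (x n)) gp) (gsub (pd (x n)) gp) @[n --> \oo] --> 0.
  have := cvg_sumI cg; rewrite big1//.
have csum : hip (fun t => x n t - p t) (gsub (pd (x n)) gp) (fun t => x n t - p t) (gsub (pd (x n)) gp) @[n --> \oo] --> 0.
  have -> : (fun n => hip (fun t => x n t - p t) (gsub (pd (x n)) gp) (fun t => x n t - p t) (gsub (pd (x n)) gp)) =
    (fun n => rint (fun t => (x n t - p t) ^+ 2) + gip (gsub (pd (x n)) gp) (gsub (pd (x n)) gp)).
    by apply/funext => n; rewrite hip_sqr.
  by rewrite -[X in _ --> X](addr0 0); exact: (cvgD cp cgi).
have sm e : 0 < e -> exists n, hip (fun t => x n t - p t) (gsub (pd (x n)) gp) (fun t => x n t - p t) (gsub (pd (x n)) gp) < e.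
  move=> e0; move/cvgrPdist_lt : csum => /(_ _ e0) [N _ /(_ N (leqnn N))] /=.
  by rewrite sub0r normrN ger0_norm ?hip_ge0// => h; exists N.
have pC (y : V -> R) : Ccoo E y -> hip p gp y (pd y) = hip v g y (pd y).
  move=> hy; apply/eqP; rewrite -subr_eq0 -sqrf_eq0 eq_le sqr_ge0 andbT; apply/ler_addgt0Pr => e e0.
  rewrite add0r; have gy := gC _ hy.
  pose M := hip y (pd y) y (pd y); have M0 : 0 <= M by exact: hip_ge0.
  suff hs n : (hip p gp y (pd y) - hip (x n) (pd (x n)) y (pd y)) ^+ 2 <=
     hip (fun t => x n t - p t) (gsub (pd (x n)) gp) (fun t => x n t - p t) (gsub (pd (x n)) gp) * M.
    have l0 : hip p gp y (pd y) - hip (x n) (pd (x n)) y (pd y) @[n --> \oo] --> 0.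
      apply: (cvg0_of_sqr (K := M) _ csum) => n; rewrite mulrC; exact: hs.
    have l1 : hip p gp y (pd y) - hip (x n) (pd (x n)) y (pd y) @[n --> \oo] --> hip p gp y (pd y) - hip v g y (pd y).
      by apply: cvgB; [exact: cvg_cst|exact: (xl y hy)].
    have Z : hip p gp y (pd y) - hip v g y (pd y) = 0 by exact: (cvg_unique _ l1 l0).
    by rewrite Z expr0n /= ltW.
  rewrite -sqrrN opprB -(hipB (gC _ (Sx n)) hp gy).
  exact: hip_CS (gradB (gC _ (Sx n)) hp) gy.
have Hp : H10 E p.
  apply/(H10P E hp) => e e0; have [n hn] := sm e e0; exists (x n) => //.
  move: hn; rewrite hip_sqr; congr (_ + _ < e).
    by congr rint; apply/funext => t; rewrite -sqrrN opprB.
  apply: eq_bigr => i _; congr rint; apply/funext => t; rewrite /gsub; ring.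
exists p, gp; split=> // y gy hy Hy.
have hz := gradB hp hg.
apply/eqP; rewrite -subr_eq0 -(hipB hp hg hy) -sqrf_eq0 eq_le sqr_ge0 andbT; apply/ler_addgt0Pr => e e0.
rewrite add0r; pose M := hip (fun x => p x - v x) (gsub gp g) (fun x => p x - v x) (gsub gp g).
have M0 : 0 <= M by exact: hip_ge0.
have eM : 0 < e / (M + 1) by rewrite divr_gt0// ltr_wpDl.
have [phi hphi hl] := (H10P E hy).1 Hy _ eM.
have hyp := gradB hy (gC _ hphi).
have -> : hip (fun x => p x - v x) (gsub gp g) y gy = hip (fun x => p x - v x) (gsub gp g) (fun x => y x - phi x) (gsub gy (pd phi)).
  rewrite [RHS]hip_sym (hipB hy (gC _ hphi) hz) [X in _ - X]hip_sym (hipB hp hg (gC _ hphi)) pC// subrr subr0.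
  exact: hip_sym.
apply: (le_trans (hip_CS hz hyp)); rewrite -/M [X in _ * X]hip_sqr.
apply: (@le_trans _ _ (M * (e / (M + 1)))); first by rewrite ler_wpM2l// ltW.
rewrite mulrA ler_pdivrMr ?ltr_wpDl// mulrDr mulr1 mulrC lerDl; exact: ltW.
Qed.

(** With [p] the projection and [z = v - p], the bounded sequence [vn] of [H10 E] converges weakly
    to [v] in H^1, so [z], orthogonal to [H10 E], is also orthogonal to [v]; then [z] has norm 0. *)
Lemma H10_tilde_sub (E : set V) delta r0 : open E -> fat_complement E delta r0 -> 0 < delta -> 0 < r0 ->
  H10_tilde E `<=` H10 E.
Proof.
move=> oE fat d0 r00 u [/H1P [g hu] uE].
have hv := grad_rep oE hu uE; set v := (fun x => u x * \1_E x) in hv.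
have v0 x : ~ E x -> v x = 0 by move=> h; rewrite /v indicE memNset// mulr0.
suff : H10 E v.
  apply: (H10_ae hv hu); apply: filterS uE => x h; rewrite /v indicE.
  case: (boolP (x \in E)) => [_|]; first by rewrite mulr1.
  by rewrite notin_setE => /h ->; rewrite mul0r.
have [vn [gn [K [hn Hn Kn cn]]]] := cut_sequence oE fat d0 r00 hv v0.
have [p [gp [hp Hp pP]]] := H10_project E hv.
have hz := gradB hv hp; set z := (fun x => v x - p x) in hz; set gz := gsub g gp in hz.
have orth (y : V -> R) gy : grad y gy -> H10 E y -> hip y gy z gz = 0.
  by move=> hy Hy; rewrite hip_sym (hipB hv hp hy) pP// subrr.
have zv : hip v g z gz = 0.
  have l : hip (vn n) (gn n) z gz @[n --> \oo] --> hip v g z gz.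
    apply: cvgD; first exact: (L2cvg_ip (fun n => (hn n).1) hv.1 hz.1 cn).
    apply: (@cvg_sumI _ _ (fun i n => rint (fun x => gn n i x * gz i x))) => i.
    apply: (weak_cvg (fun n => ((hn n).2 i).1) (hv.2 i).1 (hz.2 i).1 (fun n => Kn n i)) => phi hphi.
    have h2 := Ccoo_L2 (Ccoo_partial i hphi).
    have -> : (fun n => rint (fun x => gn n i x * phi x)) = (fun n => - rint (fun x => vn n x * partial i phi x)).
      by apply/funext => n; rewrite (weakE ((hn n).2 i).2 hphi) opprK.
    have -> : rint (fun x => g i x * phi x) = - rint (fun x => v x * partial i phi x).
      by rewrite (weakE (hv.2 i).2 hphi) opprK.
    by apply: cvgN; exact: (L2cvg_ip (fun n => (hn n).1) hv.1 h2 cn).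
  have l0 : hip (vn n) (gn n) z gz @[n --> \oo] --> (0 : R).
    under eq_fun do rewrite (orth _ _ (hn _) (Hn _)); exact: cvg_cst.
  exact: (cvg_unique _ l l0).
have zz : hip z gz z gz = 0 by rewrite [LHS](hipB hv hp hz) zv (orth _ _ hp Hp) subrr.
apply/(H10P E hv) => e e0.
have e2 : 0 < e / 2 by lra.
have [phi hphi hl] := (H10P E hp).1 Hp _ e2.
exists phi => //.
have hpp := gradB hp (grad_Ccoo hphi).
move: zz; rewrite hip_sqr => zz.
have a1 := int_sqr_ge0 (@leb R d) z; have a2 := gip_ge0 gz.
have z1 : rint (fun x => z x ^+ 2) = 0 by apply/eqP; rewrite eq_le a1 andbT -zz lerDl.
have z2 : gip gz gz = 0 by apply/eqP; rewrite eq_le a2 andbT -zz lerDr.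
have b1 := int_sqrD_le hz.1 hpp.1.
have b2 := gip_triangle (grad_gL2 hz) (grad_gL2 hpp).
have -> : (fun x => (v x - phi x) ^+ 2) = (fun x => (z x + (p x - phi x)) ^+ 2).
  by apply/funext => x; rewrite /z; congr (_ ^+ 2); ring.
have -> : gsub g (pd phi) = (fun i x => gz i x + gsub gp (pd phi) i x).
  by apply/funext => i; apply/funext => x; rewrite /gz /gsub; ring.
rewrite z1 mulr0 add0r in b1; rewrite z2 mulr0 add0r in b2.
apply: (le_lt_trans (lerD b1 b2)); rewrite -mulrDr.
by rewrite mulrC -ltr_pdivlMr.
Qed.

Lemma H10_eq_tilde (E : set V) delta r0 : open E -> fat_complement E delta r0 -> 0 < delta -> 0 < r0 ->
  H10 E = H10_tilde E.
Proof.
move=> oE fat d0 r00; apply/seteqP; split; first exact: H10_sub_tilde.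
exact: (H10_tilde_sub oE fat).
Qed.

End tilde_sub.

(** * The torsion function *)

Section torsion.
Context {R : realType} {d : nat}.
Local Notation V := 'rV[R]_d.
Local Notation rint := (mintegral (@leb R d)).
Local Notation itg := (mintegrable (@leb R d)).
Local Notation L2 := (L2fun (@leb R d)).
Implicit Types (x y z h : V) (r s : R) (u v w k f phi : V -> R) (i : 'I_d) (g : 'I_d -> V -> R).
Local Notation pd phi := (fun i => partial i phi).

Lemma int_in (E : set V) v : (\int[leb]_(x in E) v x)%R = rint (fun x => v x * \1_E x).
Proof.
rewrite Rintegral_mkcond /Defs.leb -/(rint _); congr mintegral; apply/funext => x.
by rewrite patchE indicE; case: (x \in E); rewrite ?mulr1 ?mulr0.
Qed.

Definition off0 (E : set V) u := forall x, ~ E x -> u x = 0.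

Lemma off0E (E : set V) u : off0 E u -> (fun x => u x * \1_E x) = u.
Proof.
move=> h; apply/funext => x; rewrite indicE; case: (boolP (x \in E)) => [_|]; first by rewrite mulr1.
by rewrite notin_setE => /h ->; rewrite mul0r.
Qed.

Lemma off0_itg (E : set V) u : open E -> (leb E < +oo)%E -> L2 u -> off0 E u -> itg u.
Proof.
move=> oE fE hu /off0E <-; have iE := itg_indic (open_measurable_leb oE) fE.
exact: (L2_mul hu (L2_bounded iE (@indic_norm_le1 R d E))).
Qed.

Lemma off0_int_le (E : set V) u : open E -> (leb E < +oo)%E -> L2 u -> off0 E u ->
  rint u ^+ 2 <= fine (leb E) * rint (fun x => u x ^+ 2).
Proof.
move=> oE fE hu h0; have mE := open_measurable_leb oE; have iE := itg_indic mE fE.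
have l1 := L2_bounded iE (@indic_norm_le1 R d E).
have := cauchy_schwarz hu l1; rewrite (off0E h0) mulrC.
rewrite (_ : (fun x => \1_E x ^+ 2) = \1_E) ?(int_indic _ mE)//.
by apply/funext => x; rewrite indicE; case: (_ \in _); rewrite ?expr1n ?expr0n.
Qed.

Variable (E : set V).
Hypotheses (d_gt0 : (0 < d)%N) (oE : open E) (fE : (leb E < +oo)%E).
Variables (delta r0 : R).
Hypotheses (fat : fat_complement E delta r0) (delta_gt0 : 0 < delta) (r0_gt0 : 0 < r0).

Let S : set (V -> R) := [set v | (exists g, grad v g) /\ off0 E v].

(** Riesz representation for the Dirichlet form on functions vanishing off [E]: Poincare's
    inequality bounds the functional [v -> int v] and makes the minimising sequence Cauchy in
    H^1. *)
Lemma torsion_riesz : exists w g, [/\ grad w g, off0 E w &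
  forall v (h : 'I_d -> V -> R), grad v h -> off0 E v -> gip g h = rint v].
Proof.
have [P P0 hP] := poincare d_gt0 oE fE.
have m0 : 0 <= fine (leb E) by rewrite fine_ge0.
have [|c u v [[g hg] hu] [[g' hg'] hv]|c u v u' [[g hg] _] [[g' hg'] _] [[g'' hg''] _]|u v [[g hg] _] [[g' hg'] _]|u [[g hg] _]|c u v [[g hg] hu] [[g' hg'] hv]|u [[g hg] hu]|x [Sx xx xl]] :=
  @riesz_functions R V S dirichlet rint (fine (leb E) * P).
- by split=> //; exists (pd (cst 0)); exact: grad_Ccoo (Ccoo0 E).
- split; first by eexists; exact: (grad_lin c hg hg').
  by move=> x nE; rewrite hu// hv// mulr0 addr0.
- rewrite (dirichletE (grad_lin c hg hg') hg'') (dirichletE hg hg'') (dirichletE hg' hg'').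
  by apply: gip_lin; [exact: grad_gL2 hg|exact: grad_gL2 hg'|exact: grad_gL2 hg''].
- by rewrite (dirichletE hg hg') (dirichletE hg' hg) gip_sym.
- by rewrite (dirichletE hg hg) gip_ge0.
- by rewrite int_lin; [|exact: off0_itg oE fE hg.1 hu|exact: off0_itg oE fE hg'.1 hv].
- apply: (le_trans (off0_int_le oE fE hg.1 hu)); rewrite (dirichletE hg hg) -mulrA ler_wpM2l//.
  exact: hP hg hu.
have [gn hgn] := choice (fun n => (Sx n).1).
have xd n m : dirichlet (fun t => x n t - x m t) (fun t => x n t - x m t) = gip (gsub (gn n) (gn m)) (gsub (gn n) (gn m)).
  by have h := gradB (hgn n) (hgn m); rewrite (dirichletE h h).
have [e e0|w0 [gw [hw cw cg]]] := grad_complete hgn.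
  have eP : 0 < e / (P + 1) by rewrite divr_gt0// ltr_wpDl.
  have [N hN] := xx _ eP; exists N => m n Nm Nn.
  have := hN m n Nm Nn; rewrite xd => h.
  have h2 := hP _ _ (gradB (hgn m) (hgn n)) _.
  have P1 : 0 < P + 1 by rewrite ltr_wpDl.
  rewrite ler_pdivlMr// in h.
  have g0 := gip_ge0 (gsub (gn m) (gn n)).
  split; last by apply: le_trans h; rewrite mulrDr mulr1 lerDr mulr_ge0.
  apply: (le_trans (h2 _)); last by apply: le_trans h; rewrite mulrDr mulr1 mulrC lerDl.
  by move=> t nE; rewrite (Sx m).2// (Sx n).2// subrr.
(* The class asks for zeros at every point off [E], while an L^2 limit is only known almost
   everywhere. *)
pose w := fun t => w0 t * \1_E t.
have mi := measurable_indic_leb (open_measurable_leb oE).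
have hw2 : L2 w := L2_mulb hw.1 mi (@indic_norm_le1 R d E).
have w0E : off0 E w by move=> t nE; rewrite /w indicE memNset// mulr0.
have cw2 : rint (fun t => (x n t - w t) ^+ 2) @[n --> \oo] --> 0.
  apply: (squeeze_cvgr _ (@cvg_cst _ 0 _ _ _) cw).
  apply: nearW => n; rewrite int_sqr_ge0/=.
  apply: int_le (L2B (hgn n).1 hw2).2 (L2B (hgn n).1 hw.1).2 _ => t.
  rewrite /w indicE; case: (boolP (t \in E)) => [_|]; first by rewrite mulr1.
  by rewrite notin_setE => nE; rewrite mulr0 (Sx n).2// subrr expr0n sqr_ge0.
have hw1 : grad w gw by apply: (grad_closed hgn hw2 (grad_gL2 hw) cw2 cg).
exists w, gw; split=> // v h hh hv.
have l1 := xl v (conj (ex_intro _ h hh) hv).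
have l2 : dirichlet (x n) v @[n --> \oo] --> gip gw h.
  have -> : (fun n => dirichlet (x n) v) = (fun n => gip (gn n) h).
    by apply/funext => n; rewrite (dirichletE (hgn n) hh).
  apply: (@cvg_sumI _ _ (fun i n => rint (fun x => gn n i x * h i x))) => i.
  exact: (L2cvg_ip (fun n => ((hgn n).2 i).1) (hw.2 i).1 (hh.2 i).1 (cg i)).
exact: (cvg_unique _ l2 l1).
Qed.

Lemma measurable_maxr0 : measurable_fun setT (fun a : R => Num.max a 0).
Proof. by apply: continuous_measurable_fun; exact: continuous_max0. Qed.

Lemma max0_lip (a b : R) : `|Num.max a 0 - Num.max b 0| <= `|a - b|.
Proof.
rewrite /Num.max; case: ltP => ha; case: ltP => hb; rewrite ?subrr ?normr0// ?sub0r ?subr0 ?normrN.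
  by rewrite ger0_norm// ler0_norm; lra.
by rewrite ger0_norm// ger0_norm; lra.
Qed.

Lemma gip_sub g g' : gL2 g -> gL2 g' ->
  gip (gsub g g') (gsub g g') = gip g g - 2 * gip g g' + gip g' g'.
Proof.
move=> h h'; have := gip_sqr_lin (-1) h' h; rewrite [gip g' g]gip_sym.
rewrite (_ : (fun i x => -1 * g' i x + g i x) = gsub g g'); first by move=> ->; ring.
by apply/funext => i; apply/funext => x; rewrite /gsub; ring.
Qed.

(** Both [|w|] and [max (w - t phi) 0] vanish off [E] and are competitors in the minimisation, with
    Dirichlet integrals controlled by [grad_trunc]. The first gives the sign; the second, as [t]
    tends to 0, gives [- Delta w <= 1] on the whole space, including across the boundary of [E]. *)
Lemma torsion : exists w g, [/\ grad w g, off0 E w, forall x, 0 <= w x,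
  forall v (h : 'I_d -> V -> R), grad v h -> off0 E v -> gip g h = rint v &
  forall phi, Ccoo setT phi -> (forall x, 0 <= phi x) -> gip g (pd phi) <= rint phi].
Proof.
have [P P0 hP] := poincare d_gt0 oE fE.
have [w1 [g [hw1 w10 hg]]] := torsion_riesz.
have mn : measurable_fun setT (fun a : R => `|a|) by apply: mfun_norm; exact: measurable_id.
pose N (a : R) := `|a|.
have [g1 ha ga] := @grad_trunc R d N w1 g mn (@ler_dist_dist R R) (normr0 _) hw1.
have a0 : off0 E (N \o w1) by move=> x nE; rewrite /= w10// /N normr0.
have iw1 := off0_itg oE fE hw1.1 w10; have ia := off0_itg oE fE ha.1 a0.
have hd := gradB ha hw1.
have ww : gip (gsub g1 g) (gsub g1 g) <= 0.
  rewrite (gip_sub (grad_gL2 ha) (grad_gL2 hw1)) [gip g1 g]gip_sym (hg _ _ ha a0).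
  have := hg _ _ hw1 w10; have := int_le iw1 ia (fun x => ler_norm (w1 x)); move: ga.
  by move: (gip g1 g1) (gip g g) (rint w1) (rint (N \o w1)) => a b c e; lra.
have wae : {ae @leb R d, forall x, w1 x = `|w1 x|}.
  have h := hP _ _ hd _.
  have z : rint (fun x => ((N \o w1) x - w1 x) ^+ 2) = 0.
    apply/eqP; rewrite eq_le int_sqr_ge0 andbT; apply: (le_trans (h _)).
      by move=> x nE; rewrite a0// w10// subrr.
    by rewrite mulr_ge0_le0.
  have := int_eq0_ae hd.1.2 (fun x => sqr_ge0 _) z.
  by apply: filterS => x /= /eqP; rewrite sqrf_eq0 subr_eq0 => /eqP/esym.
have hw : grad (N \o w1) g := grad_ae hw1 ha.1.1 wae.
exists (N \o w1), g; split=> //; first by move=> x; exact: normr_ge0.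
move=> phi hp p0.
have hphi := grad_Ccoo hp; have iphi := Ccoo_itg hp.
set Pp := gip (pd phi) (pd phi).
suff key t : 0 < t -> gip g (pd phi) <= rint phi + t * Pp.
  apply/ler_addgt0Pr => e e0.
  have P1 : 0 < Pp + 1 by rewrite ltr_wpDl ?gip_ge0.
  apply: (le_trans (key (e / (Pp + 1)) (divr_gt0 e0 P1))); rewrite lerD2l mulrAC ler_pdivrMr//.
  by rewrite mulrDr mulr1 lerDl ltW.
move=> t0.
(* Off [E] the function [w - t phi] is nonpositive, so its positive part is admissible, and it is
   never below [w - t phi]. *)
have hu := grad_lin (- t) hphi hw.
set u := (fun x => _) in hu; set gu := (fun i x => _) in hu.
have [g' hv gv] := grad_trunc measurable_maxr0 max0_lip (max_l (lexx 0)) hu.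
set v := (_ \o u) in hv.
have v0 : off0 E v by move=> x nE; rewrite /v /u /= w10// /N normr0 addr0; apply/max_r; rewrite mulNr oppr_le0 mulr_ge0// ltW.
have iv := off0_itg oE fE hv.1 v0.
have := gip_ge0 (gsub g' g); rewrite (gip_sub (grad_gL2 hv) (grad_gL2 hw)) [gip g' g]gip_sym (hg _ _ hv v0).
have -> : gip g g = rint (N \o w1) by exact: hg hw a0.
have e1 : gip gu gu = t ^+ 2 * Pp - 2 * t * gip g (pd phi) + rint (N \o w1).
  have -> : rint (N \o w1) = gip g g by rewrite (hg _ _ hw a0).
  rewrite /gu (gip_sqr_lin (- t) (grad_gL2 hphi) (grad_gL2 hw)) -/Pp gip_sym; ring.
have e2 : rint (N \o w1) - t * rint phi <= rint v.
  rewrite -(intZ t iphi) -(intB ia (itgZ t iphi)); apply: int_le (itgB ia (itgZ t iphi)) iv _ => x.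
  by rewrite /v /= le_max; apply/orP; left; rewrite /u mulNr addrC.
move=> h; rewrite -(ler_pM2l t0).
have p0' : 0 <= t ^+ 2 * Pp by rewrite mulr_ge0 ?sqr_ge0 ?gip_ge0.
rewrite e1 in gv; move: h gv e2 p0'; rewrite mulrDr mulrA -expr2.
set G := gip g (pd phi); set F := rint phi; set W := rint (N \o w1); set I := rint v; set q := gip g' g'.
rewrite -mulrA; move: (t * G) (t * F) (t ^+ 2 * Pp) => a b c; lra.
Qed.

Lemma torsion_uniq u v : energy_function E u -> energy_function E v ->
  {ae @leb R d, forall x, u x = v x}.
Proof.
have [P P0 hP] := poincare d_gt0 oE fE.
move=> [[Hu Hu'] eu] [[Hv Hv'] ev].
have [g hg] := (H1P u).1 Hu; have [h hh] := (H1P v).1 Hv.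
have Hz : H10_tilde E (fun x => u x - v x).
  have [_ uE] := H10_sub_tilde oE (conj Hu Hu'); have [_ vE] := H10_sub_tilde oE (conj Hv Hv').
  split; first by apply/H1P; exists (gsub g h); exact: gradB.
  by apply: filterS2 uE vE => x a b nE; rewrite a// b// subrr.
have hz := gradB hg hh.
have Hz' := H10_tilde_sub oE fat delta_gt0 r0_gt0 Hz.
have z0 : gip (gsub g h) (gsub g h) = 0.
  have := eu _ Hz'; have := ev _ Hz'; rewrite (dirichletE hg hz) (dirichletE hh hz) => <- E0.
  have := gip_lin (-1) (grad_gL2 hh) (grad_gL2 hg) (grad_gL2 hz); rewrite E0 mulN1r addNr => <-.
  by congr gip; apply/funext => i; apply/funext => x; rewrite /gsub; ring.
have hr := grad_rep oE hz Hz.2.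
have z1 : rint (fun x => ((u x - v x) * \1_E x) ^+ 2) = 0.
  apply/eqP; rewrite eq_le int_sqr_ge0 andbT; apply: (le_trans (hP _ _ hr _)).
    by move=> x nE; rewrite indicE memNset// mulr0.
  by rewrite z0 mulr0.
have := int_eq0_ae hr.1.2 (fun x => sqr_ge0 _) z1.
apply: filterS2 Hz.2 => x hx /= /eqP; rewrite sqrf_eq0 mulf_eq0 indicE => /orP[|].
  by rewrite subr_eq0 => /eqP.
case: (boolP (x \in E)) => [_|]; first by rewrite oner_eq0.
by rewrite notin_setE => /hx /eqP; rewrite subr_eq0 => /eqP.
Qed.

Lemma torsion_energy w g : grad w g -> off0 E w ->
  (forall v (h : 'I_d -> V -> R), grad v h -> off0 E v -> gip g h = rint v) ->
  energy_function E w.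
Proof.
move=> hw w0 hg; split.
  apply: (H10_tilde_sub oE fat delta_gt0 r0_gt0); split; first by apply/H1P; exists g.
  by apply: nearW => x; exact: w0.
move=> v Hv; have [/H1P [h hh] vE] := H10_sub_tilde oE Hv.
rewrite (dirichletE hw hh) int_in; apply: hg; first exact: grad_rep.
by move=> x nE; rewrite indicE memNset// mulr0.
Qed.

End torsion.

(** * Perimeter and calibrations *)

Section perimeter_fields.
Context {R : realType} {d : nat}.
Local Notation V := 'rV[R]_d.
Local Notation rint := (mintegral (@leb R d)).
Local Notation itg := (mintegrable (@leb R d)).
Implicit Types (x y z h : V) (r s p : R) (a f phi : V -> R) (i : 'I_d) (F X Y Z : 'I_d -> V -> R) (U A : set V).

Definition dv F x := \sum_i partial i (F i) x.

Definition field F r := [/\ forall i, Ck 1 (F i), forall i, supp_in r (F i) &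
  forall x, \sum_i F i x ^+ 2 <= 1].

(** A real upper bound for the perimeter, which lets competitors be compared without extended reals;
    [perimeterP] is the link. *)
Definition Pb U p := forall F r, field F r -> rint (fun x => dv F x * \1_U x) <= p.

Lemma cont_dv F : (forall i, Ck 1 (F i)) -> continuous (dv F).
Proof. by move=> h; apply: (Ck_cont (k := 0)); apply: Ck_sum => i; apply: Ck_partial. Qed.

Lemma supp_dv F r : (forall i, Ck 1 (F i)) -> (forall i, supp_in r (F i)) -> supp_in (r + 1) (dv F).
Proof. by move=> h h' x hx; rewrite /dv big1// => i _; exact: (supp_partial i (h i) (h' i) hx). Qed.

Lemma itg_dv F r U : (forall i, Ck 1 (F i)) -> (forall i, supp_in r (F i)) -> measurable U ->
  itg (fun x => dv F x * \1_U x).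
Proof.
move=> h h' mU; have ii := itg_csuppc (cont_dv h) (supp_dv h h').
exact: (itg_mulb ii (measurable_indic_leb mU) (@indic_norm_le1 R d U)).
Qed.

Lemma int_dv F r : (forall i, Ck 1 (F i)) -> (forall i, supp_in r (F i)) -> rint (dv F) = 0.
Proof.
move=> h h'; rewrite /dv (int_sum _ (h := fun i => partial i (F i))) => [|i].
  by rewrite big1// => i _; exact: int_partial0 (h i) (h' i).
exact: itg_csuppc (Ck_cont (Ck_partial i (h i))) (supp_partial i (h i) (h' i)).
Qed.

Lemma int_set U f : measurable U -> itg (fun x => f x * \1_U x) ->
  (\int[leb]_(x in U) (f x)%:E)%E = (rint (fun x => f x * \1_U x))%:E.
Proof.
move=> mU hi; rewrite (EFin_int hi) [LHS]integral_mkcond /Defs.leb; congr integral; apply/funext => x.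
by rewrite patchE indicE; case: (x \in U); rewrite ?mulr1 ?mulr0.
Qed.

Lemma perimeterP U p : measurable U -> (perimeter U <= p%:E)%E <-> Pb U p.
Proof.
move=> mU; split=> [h F r [hF hr h1]|h].
  pose phi x : V := \row_i F i x.
  have e i : (fun x => phi x 0 i) = F i by apply/funext => x; rewrite mxE.
  have ed : divergence phi = dv F by apply/funext => x; apply: eq_bigr => i _; rewrite e.
  rewrite -lee_fin -(int_set mU (itg_dv hF hr mU)) -ed; apply: le_trans h.
  apply: ereal_sup_ubound; exists phi => //; split.
  - by move=> i; rewrite e.
  - exists [set x | enorm x <= r]; split; [exact: compact_closed_ball|by []|move=> x /negP].
    rewrite -ltNge => rx; apply/rowP => i; rewrite !mxE; apply: hr; exact: ltW.
  - move=> x; rewrite /enorm -[leRHS]sqrtr1 ler_sqrt//.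
    by under eq_bigr do rewrite mxE.
apply: ge_ereal_sup => _ [phi [hC [K [cK _ hK]] h1] <-].
have [r hr] : exists r, forall x, r <= enorm x -> enorm (phi x) = 0.
  by apply/csuppP; exists K; split=> // x /hK ->; exact: enorm0.
pose F i x := phi x 0 i.
have fF : field F r.
  split=> // [i x /hr/enorm_eq0 h0|x]; first by rewrite /F h0 mxE.
  by have := h1 x; rewrite /enorm -{1}sqrtr1 ler_sqrt.
have [hF hs _] := fF.
rewrite (int_set mU (itg_dv hF hs mU)) lee_fin; exact: h fF.
Qed.

Lemma partial_dvM a F x : Ck 1 a -> (forall i, Ck 1 (F i)) ->
  dv (fun i y => a y * F i y) x = a x * dv F x + \sum_i partial i a x * F i x.
Proof.
move=> ha hF; rewrite /dv mulr_sumr -big_split; apply: eq_bigr => i _ /=.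
by rewrite (@partialM _ _ 0) ?[F i x * _]mulrC.
Qed.

Lemma dvD F Y x : (forall i, Ck 1 (F i)) -> (forall i, Ck 1 (Y i)) ->
  dv (fun i y => F i y + Y i y) x = dv F x + dv Y x.
Proof. by move=> h h'; rewrite /dv -big_split; apply: eq_bigr => i _; rewrite (@partialD _ _ 0). Qed.

Lemma dvB F Y x : (forall i, Ck 1 (F i)) -> (forall i, Ck 1 (Y i)) ->
  dv (fun i y => F i y - Y i y) x = dv F x - dv Y x.
Proof. by move=> h h'; rewrite /dv -sumrB; apply: eq_bigr => i _; rewrite (@partialB _ _ 0). Qed.

(* Testing with [(1 - a) Y - a X]: the part [a (X + Y)] lives in [U], so its divergence integrates to zero there. *)
Lemma calibration A U a X Y r r' p : measurable A -> measurable U -> A `<=` U -> Pb A p ->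
  Ck 1 a -> (forall x, 0 <= a x <= 1) -> supp_in r' a ->
  (forall x, ~ U x -> a x = 0 /\ forall i, partial i a x = 0) ->
  (forall i, Ck 1 (X i)) -> (forall x, \sum_i X i x ^+ 2 <= 1) -> field Y r ->
  itg (fun x => (a x * (dv X x + dv Y x) + \sum_i partial i a x * (X i x + Y i x)) * \1_(U `\` A) x) /\
  rint (fun x => dv Y x * \1_A x) +
  rint (fun x => (a x * (dv X x + dv Y x) + \sum_i partial i a x * (X i x + Y i x)) * \1_(U `\` A) x) <= p.
Proof.
move=> mA mU AU hp ha a01 ar aU hX X1 [hY Yr Y1].
pose B i x := a x * (X i x + Y i x).
have hB i : Ck 1 (B i) := CkM ha (CkD (hX i) (hY i)).
have Br i : supp_in r' (B i) by move=> x hx; rewrite /B ar// mul0r.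
pose Z i x := Y i x - B i x.
have fZ : field Z (Num.max r r').
  split.
  - by move=> i; exact: CkB.
  - by move=> i x; rewrite ge_max => /andP[h1 h2]; rewrite /Z Yr// Br// subrr.
  - move=> x; have /andP[a0 a1] := a01 x.
    apply: (@le_trans _ _ ((1 - a x) * \sum_i Y i x ^+ 2 + a x * \sum_i X i x ^+ 2)).
      rewrite !mulr_sumr -big_split; apply: ler_sum => i _ /=; rewrite /Z /B.
      move: (X i x) (Y i x) a0 a1; move: (a x) => t u v t0 t1; rewrite -subr_ge0.
      rewrite (_ : _ - _ = (t * (1 - t)) * (u + v) ^+ 2); last by ring.
      by rewrite mulr_ge0 ?sqr_ge0// mulr_ge0// subr_ge0.
    have h1 : (1 - a x) * \sum_i Y i x ^+ 2 <= (1 - a x) * 1 by rewrite ler_wpM2l// subr_ge0.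
    have h2 : a x * \sum_i X i x ^+ 2 <= a x * 1 by rewrite ler_wpM2l.
    by apply: (le_trans (lerD h1 h2)); rewrite !mulr1 subrK.
have iY := itg_dv hY Yr mA; have iBA := itg_dv hB Br mA.
have iBF := itg_dv hB Br (measurableD mU mA).
have dB x : dv B x = a x * (dv X x + dv Y x) + \sum_i partial i a x * (X i x + Y i x).
  by rewrite (partial_dvM x ha (fun i => CkD (hX i) (hY i))) (dvD x hX hY).
have zero : rint (fun x => dv B x * \1_A x) + rint (fun x => dv B x * \1_(U `\` A) x) = 0.
  rewrite -(intD iBA iBF) -(int_dv hB Br); congr mintegral; apply/funext => x.
  rewrite -mulrDr !indicE in_setD; case: (boolP (x \in U)) => [xU|].
    by case: (x \in A); rewrite /= ?addr0 ?add0r mulr1.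
  rewrite notin_setE => nU; rewrite dB; have [-> h0] := aU x nU.
  by rewrite mul0r add0r big1 ?mul0r// => i _; rewrite h0 mul0r.
have := hp _ _ fZ.
have -> : (fun x => dv Z x * \1_A x) = (fun x => dv Y x * \1_A x - dv B x * \1_A x).
  by apply/funext => x; rewrite dvB// mulrBl.
rewrite (intB iY iBA) => h; have -> : (fun x => (a x * (dv X x + dv Y x) + \sum_i partial i a x * (X i x + Y i x)) * \1_(U `\` A) x) = (fun x => dv B x * \1_(U `\` A) x).
  by apply/funext => x; rewrite dB.
split; first exact: iBF.
move: h zero; move: (mintegral _ _) (mintegral _ _) (mintegral _ _) => u v w; lra.
Qed.

Lemma bcut01 n x : 0 <= bcut n x <= 1.
Proof.
have c0 : 0 < em 0 (1 : R) by exact: em_gt0.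
rewrite /bcut mulr_ge0 ?invr_ge0 ?em_ge0 ?(ltW c0)//= mulrC ler_pdivrMr// mul1r.
have k1 := karg_le1 n.+1%:R x; have [k0|k0] := leP (karg n.+1%:R x) 0; first by rewrite em_le0// ltW.
rewrite /em k0 ltr01 !expr0 !mul1r ler_expR lerN2 invr1.
by rewrite -[leLHS]invr1 lef_pV2// posrE.
Qed.

(** A translation by [h] costs at most [|h| p] of the overlap of [A] with itself. Averaged over the
    cube of half-side [rho], the overlap is at most [|A|^2 / (2 rho)^d <= |A| / 2], so half of [|A|]
    is paid for by [d rho p]. The free scale [rho] is what the later iteration tunes. *)
Lemma isoperimetric A p rho : measurable A -> (leb A < +oo)%E -> Pb A p -> 0 < rho ->
  2 * fine (leb A) <= (rho *+ 2) ^+ d -> fine (leb A) <= 2 * d%:R * rho * p.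
Proof.
move=> mA fA hp r0 hA; have iA := itg_indic mA fA; set m := fine (leb A) in hA *.
have m0 : 0 <= m by rewrite fine_ge0.
have lA := loc_itg iA.
have [ic ec] := @itg_cube R d rho (ltW r0).
have p0 : 0 <= p.
  have f0 : field (fun _ => cst 0) 0.
    split; [by move=> i; exact: Ck_cst|by []|by move=> x; rewrite big1// => i _; rewrite expr0n].
  have := hp _ _ f0; rewrite (_ : (fun x => _) = cst 0) ?int0//.
  by apply/funext => x; rewrite /dv big1 ?mul0r// => i _; rewrite partial_cst.
have tr phi h : Ccoo setT phi -> (forall x, 0 <= phi x <= 1) ->
  rint (fun x => \1_A x * phi x) - rint (fun x => \1_A x * phi (x + h)) <= enorm h * p.
  move=> hphi p01; have [r hr] := Ccoo_supp hphi.
  have [h0|hn] := eqVneq (enorm h) 0.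
    by rewrite h0 mul0r (enorm_eq0 h0); under [X in _ - rint X]eq_fun do rewrite addr0; rewrite subrr.
  pose G (s : R) := rint (fun x => \1_A x * phi (x + s *: h)).
  have [c _ E] := @MVT0 _ G _ 1 (fun s => derive_int_line h s lA (hphi.1 1) hr).
  pose w := c *: h; have hw := Ccoo_shift w hphi; have [r' hr'] := Ccoo_supp hw.
  have pE i x : partial i phi (x + w) = partial i (fun x => phi (x + w)) x.
    have := partial_affine 1 w i x (hphi.1 1); rewrite mul1r scale1r addrC => <-.
    by rewrite (_ : (fun x => phi (w + 1 *: x)) = (fun x => phi (x + w)))//; apply/funext => y; rewrite scale1r addrC.
  pose F i x := (- (h 0 i / enorm h)) * phi (x + w).
  have fF : field F r'.
    split.
    - by move=> i; apply: CkZ; exact: hw.1.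
    - by move=> i x hx; rewrite /F hr'// mulr0.
    - move=> x; rewrite /F.
      have -> : \sum_i (- (h 0 i / enorm h) * phi (x + w)) ^+ 2 = phi (x + w) ^+ 2 * ((enorm h)^-1 ^+ 2 * dot h h).
        by rewrite /dot !mulr_sumr; apply: eq_bigr => i _; ring.
      rewrite -enorm_sqr -exprMn mulVf// expr1n mulr1.
      by have /andP[a b] := p01 (x + w); rewrite exprn_ile1.
  have := hp _ _ fF; have [hF sF _] := fF.
  have -> : (fun x => dv F x * \1_A x) = (fun x => (- (enorm h)^-1) * (\1_A x * \sum_i h 0 i * partial i phi (x + c *: h))).
    apply/funext => x; rewrite /dv mulrC mulrCA; congr (_ * _); rewrite mulr_sumr; apply: eq_bigr => i _.
    rewrite /F (@partialZ _ _ 0) ?pE; [ring|exact: hw.1].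
  rewrite intZ; last first.
    have := itgZ (- enorm h) (itg_dv hF sF mA); congr mintegrable; apply/funext => x.
    rewrite /dv mulrC mulr_suml mulr_suml mulr_sumr; apply: eq_bigr => i _.
    by rewrite /F (@partialZ _ _ 0) ?pE; [field|exact: hw.1].
  have e0 : 0 < enorm h by rewrite lt_neqAle eq_sym hn enorm_ge0.
  have -> : rint (fun x => \1_A x * phi x) = G 0 by rewrite /G; congr mintegral; apply/funext => x; rewrite scale0r addr0.
  have -> : rint (fun x => \1_A x * phi (x + h)) = G 1 by rewrite /G; congr mintegral; apply/funext => x; rewrite scale1r.
  rewrite mul1r in E; rewrite -opprB E => hh.
  by rewrite -(ler_pdivrMl _ _ e0) mulrN -mulNr.
have main phi : Ccoo setT phi -> (forall x, 0 <= phi x <= 1) ->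
  (rho *+ 2) ^+ d * rint (fun x => \1_A x * phi x) - m * rint phi <= (rho *+ 2) ^+ d * (d%:R * rho * p).
  move=> hphi p01; have iphi := Ccoo_itg hphi; have cphi := Ck_cont (hphi.1 0).
  pose f h x := \1_(cube rho) h * (\1_A x * phi (x + h)).
  have ish h : itg (fun x => \1_A x * phi (x + h)).
    have := itg_mulb (C := 1) iA (Ccoo_measurable (Ccoo_shift h hphi)); apply=> x.
    by have /andP[a b] := p01 (x + h); rewrite ger0_norm.
  have i0 : itg (fun x => \1_A x * phi x) by have := ish 0; under eq_fun do rewrite addr0.
  have ishx x : itg (fun h => phi (x + h)) /\ rint (fun h => phi (x + h)) = rint phi.
    by have := int_shift x iphi; under eq_fun do rewrite addrC.
  have c01 (B : set V) x : 0 <= (\1_B x : R) by case/andP: (indic01 B x).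
  have c11 (B : set V) x : (\1_B x : R) <= 1 by case/andP: (indic01 B x).
  have pp x : 0 <= phi x by case/andP: (p01 x).
  have ifx x : itg (f ^~ x).
    rewrite (_ : f ^~ x = (fun h => \1_A x * (phi (x + h) * \1_(cube rho) h))); last by apply/funext => h; rewrite /f; ring.
    apply: itgZ; apply: (itg_mulb (C := 1) (ishx x).1 (measurable_indic_leb (measurable_cube rho))) => h.
    exact: indic_norm_le1.
  have [||||| | i1 i2] := @tonelli_le R _ _ _ _ (@leb R d) (@leb R d) f (fun x => rint phi * \1_A x).
  - apply: measurable_funM.
      exact: (measurableT_comp (measurable_indic_leb (measurable_cube rho)) measurable_fst).
    apply: measurable_funM; first exact: (measurableT_comp (measurable_indic_leb mA) measurable_snd).
    have := @measurable_comp_continuous _ _ _ _ (fun q : V * V => q.1 + q.2) phi (@measurable_add_coord R d) cphi.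
    by congr measurable_fun; apply/funext => q /=; rewrite addrC.
  - by move=> h x; apply: mulr_ge0; [exact: c01|apply: mulr_ge0; [exact: c01|exact: pp]].
  - by move=> h; apply: itgZ; exact: ish.
  - exact: ifx.
  - exact: itgZ.
  - move=> x; rewrite mulrC -(ishx x).2 -(intZ _ (ishx x).1); apply: int_le (ifx x) (itgZ _ (ishx x).1) _ => h.
    rewrite /f mulrCA ler_wpM2l//; by rewrite ler_piMl.
  have j : rint (fun h => \1_(cube rho) h * rint (fun x => \1_A x * phi (x + h))) <= m * rint phi.
    have -> : (fun h => \1_(cube rho) h * rint (fun x => \1_A x * phi (x + h))) = (fun h => rint (f h)).
      by apply/funext => h; rewrite /f (intZ _ (ish h)).
    by apply: (le_trans i2); rewrite (intZ _ iA) (int_indic _ mA) mulrC.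
  have j1 : itg (fun h => \1_(cube rho) h * rint (fun x => \1_A x * phi (x + h))).
    by move: i1; congr mintegrable; apply/funext => h; rewrite /f (intZ _ (ish h)).
  apply: (@le_trans _ _ (rint (fun h => rint (fun x => \1_A x * phi x) * \1_(cube rho) h - \1_(cube rho) h * rint (fun x => \1_A x * phi (x + h))))).
    by rewrite (intB (itgZ _ ic) j1) (intZ _ ic) ec mulrC lerD2l lerN2.
  rewrite mulrC -ec -(intZ _ ic); apply: int_le (itgB (itgZ _ ic) j1) (itgZ _ ic) _ => h.
  rewrite [\1_(cube rho) h * _]mulrC -mulrBl indicE; case: (boolP (h \in _)) => [|_]; last by rewrite !mulr0.
  rewrite inE => hc; rewrite !mulr1; apply: (le_trans (tr phi h hphi p01)); rewrite ler_wpM2r//.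
  apply: (le_trans (enorm_le_sum h)); apply: (@le_trans _ _ (\sum_(i < d) rho)).
    apply: ler_sum => i _; have /cubeP/(_ i)/andP[h1 h2] := hc.
    by rewrite ler_norml h2 andbT ltW.
  by rewrite sumr_const card_ord mulr_natl.
have l2A := L2_bounded iA (@indic_norm_le1 R d A).
have sq1 : (fun x => \1_A x ^+ 2) = (\1_A : V -> R).
  by apply/funext => x; rewrite indicE; case: (_ \in _); rewrite ?expr1n ?expr0n.
set K := (rho *+ 2) ^+ d in hA ec main *.
set Q := d%:R * rho * p in main.
have K0 : 0 < K by rewrite /K exprn_gt0// mulrn_wgt0.
(* The estimate [main] is for test functions: here it passes to the mollified indicator of [A], by a
   cut-off at infinity, and below to the indicator itself as the scale tends to 0. *)
have cv r : 0 < r -> K * rint (fun x => \1_A x * conv (\1_A) (kern r) x) - m * m <= K * Q.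
  move=> rp; set c := conv (\1_A : V -> R) (kern r).
  have cC n : Ck n c by apply: (Ck_conv n lA _ (kern_supp rp)) => k; exact: Ck_kern.
  have c0 x : 0 <= c x.
    by apply: int_ge0 => y; apply: mulr_ge0; [case/andP: (indic01 A y)|apply: kern_ge0; exact: ltW].
  have c1 x : c x <= 1.
    have := @conv_kern_dist R d (\1_A) r x 0 1 rp lA; rewrite subr0 => h.
    apply: (le_trans (ler_norm _)); apply: h => y _; rewrite subr0; exact: indic_norm_le1.
  have [ci ce] := conv_tonelli iA (fun y => proj1 (andP (indic01 A y))) (Ck_cont (Ck_kern 0 r)) (fun y => kern_ge0 y (ltW rp)) (kern_supp rp).
  rewrite (int_kern rp) mulr1 (int_indic _ mA) -/c -/m in ce.
  pose phi n x := c x * bcut n x.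
  have [B _ hB] := @bcutP R d.
  have hphi n : Ccoo setT (phi n).
    have [b1 _ _ b2] := hB n; split; first by move=> k; apply: CkM => //; exact: cC.
    by apply/csuppP; exists n.+1%:R => x hx; rewrite /phi b2// mulr0.
  have phi01 n x : 0 <= phi n x <= 1.
    have /andP[b0 b1] := bcut01 n x; rewrite mulr_ge0//= -[leRHS]mulr1; exact: ler_pM.
  have mb n : measurable_fun setT (phi n) := Ccoo_measurable (hphi n).
  have [|||| _ lim] := @int_dct _ _ _ (@leb R d) (fun n x => \1_A x * phi n x) (fun x => \1_A x * c x) (\1_A).
  - by move=> n; exact: measurable_funM (itg_measurable iA) (mb n).
  - exact: iA.
  - move=> n x; have /andP[b0 b1] := phi01 n x; have /andP[a0 a1] := indic01 A x.
    have h0 : 0 <= \1_A x * phi n x by exact: mulr_ge0.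
    by rewrite (ger0_norm h0); exact: ler_piMr.
  - move=> x; apply: cvgM; first exact: cvg_cst.
    by rewrite -[X in _ --> X]mulr1; apply: cvgM; [exact: cvg_cst|exact: bcut_cvg].
  have lim2 : K * rint (fun x => \1_A x * phi n x) - m * m @[n --> \oo] --> K * rint (fun x => \1_A x * c x) - m * m.
    by apply: cvgB; [apply: cvgM => //; exact: cvg_cst|exact: cvg_cst].
  have cl : closed [set t : R | t <= K * Q] by exact: closed_le.
  apply: (closed_cvg _ cl _ _ lim2); apply: nearW => n.
  apply: le_trans (main _ (hphi n) (phi01 n)); rewrite lerD2l lerN2 ler_wpM2l//.
  rewrite -ce; apply: int_le (Ccoo_itg (hphi n)) ci _ => x.
  by have /andP[b0 b1] := bcut01 n x; rewrite /phi ler_piMr.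
have lim : K * m - m * m <= K * Q.
  apply/ler_addgt0Pr => e e0.
  have e1 : 0 < (e / K) ^+ 2 / (m + 1) by rewrite divr_gt0 ?exprn_gt0 ?divr_gt0// ltr_wpDl.
  have [r1 r10 hr1] := mollify_L2 l2A e1.
  have r2 : 0 < r1 / 2 by lra.
  have := hr1 _ r2; have r3 : r1 / 2 < r1 by lra.
  move=> /(_ r3) hl; have := cv _ r2; set c := conv _ _ => hc.
  have hc2 := (kern_conv_L2 r2 l2A).1; rewrite -/c in hc2.
  have := cauchy_schwarz l2A (L2B hc2 l2A); rewrite sq1 (int_indic _ mA) -/m.
  have -> : (fun x => \1_A x * (c x - \1_A x)) = (fun x => \1_A x * c x - \1_A x).
    by apply/funext => x; rewrite mulrBr; congr (_ - _); rewrite indicE; case: (_ \in _); rewrite ?mulr1 ?mulr0.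
  rewrite (intB (L2_mul l2A hc2) iA) (int_indic _ mA) -/m; set I := rint _ in hc *.
  move=> h2; have {}h2 : (I - m) ^+ 2 <= (e / K) ^+ 2.
    apply: (le_trans h2); apply: (@le_trans _ _ (m * ((e / K) ^+ 2 / (m + 1)))).
      by rewrite ler_wpM2l// ltW.
    by rewrite mulrA ler_pdivrMr ?ltr_wpDl// mulrC ler_wpM2l ?sqr_ge0// lerDl.
  have eK : 0 <= e / K by rewrite divr_ge0 ?(ltW e0)// ltW.
  have h3 : m - I <= e / K.
    apply: (le_trans (ler_norm _)); rewrite -ler_sqr ?nnegrE// real_normK ?num_real//.
    by rewrite -sqrrN opprB.
  have h4 : K * (m - I) <= e by rewrite mulrC -ler_pdivlMr.
  by move: hc h4; rewrite mulrBr; move: (K * I) (K * m) (K * Q) (m * m) => t u v w; lra.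
have h5 : m * m <= K * m / 2.
  rewrite [K * m]mulrC -mulrA ler_wpM2l//; lra.
rewrite -(ler_pM2l K0) (_ : K * (2 * d%:R * rho * p) = 2 * (K * Q)); last by rewrite /Q; ring.
move: lim h5; move: (K * m) (m * m) (K * Q) => t u v; lra.
Qed.

End perimeter_fields.

(** * Maxima of semicontinuous functions *)

Section semicontinuity.
Context {R : realType}.

(** The superlevel sets at attained values form a filter base on [K]; semicontinuity makes any
    cluster point a maximum. *)
Lemma usc_max (T : topologicalType) (K : set T) (f : T -> R) : compact K -> K !=set0 ->
  (forall x, K x -> forall e, 0 < e -> \forall y \near x, f y < f x + e) ->
  exists2 x, K x & forall y, K y -> f y <= f x.
Proof.
move=> cK [y0 Ky0] usc.
pose B y := K `&` [set x | f y <= f x].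
have FF : ProperFilter (filter_from K B).
  apply: filter_from_proper; last by move=> y Ky; exists y; split=> //=.
  apply: filter_from_filter; first by exists y0.
  move=> i j Ki Kj; have [ij|ji] := leP (f i) (f j).
    by exists j => // x [Kx /= jx]; split; split=> //=; exact: le_trans jx.
  by exists i => // x [Kx /= ix]; split; split=> //=; exact: le_trans (ltW ji) ix.
have [|x [Kx cl]] := cK _ FF; first by exists y0 => // x [].
exists x => // y Ky; rewrite leNgt; apply/negP => xy.
have e0 : 0 < f y - f x by rewrite subr_gt0.
have nb : nbhs x [set z | f z < f y].
  by apply: filterS (usc x Kx _ e0) => z; rewrite addrC subrK.
have [|z [[_ /= yz] zy]] := cl (B y) [set z | f z < f y] _ nb; first by exists y.
by have := lt_le_trans zy yz; rewrite ltxx.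
Qed.

(* [sigma] minimises [m s - K s]; since [K] exceeds the mean slope, it is not the left end point. *)
Lemma slope_bound (m : R -> R) (s0 r K : R) : s0 < r -> {homo m : x y / x <= y} ->
  (forall s e, 0 < e -> exists2 del, 0 < del & forall s', s - del < s' -> m s - e < m s') ->
  m r - m s0 < K * (r - s0) ->
  exists2 sigma, s0 < sigma <= r & forall t, 0 <= t <= sigma - s0 -> m sigma - m (sigma - t) <= K * t.
Proof.
move=> sr mon lc hK.
have [||s sK smax] := @usc_max R `[s0, r]%classic (fun s => K * s - m s) (@segment_compact R s0 r).
- by exists s0; rewrite /= in_itv /= lexx ltW.
- move=> s _ e e0; have e2 : 0 < e / 2 by lra.
  have [del d0 hd] := lc s _ e2.
  have K1 : 0 < `|K| + 1 by rewrite ltr_wpDl.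
  have eK : 0 < e / 2 / (`|K| + 1) by rewrite divr_gt0.
  near=> y.
  have h1 : m s - e / 2 < m y by apply: hd; near: y; apply: lt_nbhsr; lra.
  have h2 : `|y - s| < e / 2 / (`|K| + 1) by near: y; apply: cvgr_distC_lt => //; exact: cvg_id.
  have h3 : K * y - K * s <= e / 2.
    rewrite -mulrBr; apply: (le_trans (ler_norm _)); rewrite normrM.
    rewrite ltr_pdivlMr// in h2; apply: le_trans (ltW h2); rewrite mulrC ler_wpM2l// lerDl//.
  lra.
move: sK; rewrite /= in_itv /= => /andP[s1 s2].
have hr := smax r; rewrite /= in_itv /= lexx andbT in hr.
have {}hr := hr (ltW sr).
exists s.
  rewrite s2 andbT lt_neqAle s1 andbT; apply/negP => /eqP es; move: hr hK; rewrite -es; lra.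
move=> t /andP[t0 ts]; have := smax (s - t); rewrite /= in_itv /= => h.
have {}h := h _; have h1 : s0 <= s - t <= r by apply/andP; split; lra.
have := h h1; lra.
Unshelve. all: by end_near. Qed.

End semicontinuity.

(** * Calibration by level sets *)

Section touching.
Context {R : realType} {d : nat}.
Local Notation V := 'rV[R]_d.
Local Notation rint := (mintegral (@leb R d)).
Local Notation itg := (mintegrable (@leb R d)).
Implicit Types (x y z h : V) (r s p k : R) (a f phi q : V -> R) (i : 'I_d) (F X Y Z : 'I_d -> V -> R) (U A : set V).

Definition gsq phi x := \sum_i partial i phi x ^+ 2.

(** The normalised gradient, with [k > 0] under the root to keep it C^1 where the gradient vanishes;
    the price is the error [sqrt k] in [grad_pairing]. *)
Definition Xk phi k : 'I_d -> V -> R := fun i x => partial i phi x * (Num.sqrt (gsq phi x + k))^-1.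

Lemma gsq_ge0 phi x : 0 <= gsq phi x.
Proof. by apply: sumr_ge0 => i _; exact: sqr_ge0. Qed.

Lemma Ck_gsq phi : Ck 2 phi -> Ck 1 (gsq phi).
Proof.
move=> h; apply: Ck_sum => i.
have := CkM (Ck_partial i h) (Ck_partial i h); congr Ck; apply/funext => x; exact: expr2.
Qed.

Lemma Ck_Xk phi k i : 0 < k -> Ck 2 phi -> Ck 1 (Xk phi k i).
Proof.
move=> k0 h; apply: CkM; first exact: Ck_partial.
exact: (Ck_comp (Sk_rsqrt k0) (Ck_gsq h) (gsq_ge0 phi)).
Qed.

Lemma Xk_le1 phi k x : 0 < k -> \sum_i Xk phi k i x ^+ 2 <= 1.
Proof.
move=> k0; have g0 := gsq_ge0 phi x.
under eq_bigr do rewrite exprMn; rewrite -mulr_suml -/(gsq phi x) exprVn sqr_sqrtr; last lra.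
rewrite ler_pdivrMr ?mul1r; lra.
Qed.

Lemma sum_mul_ge (b c : 'I_d -> R) S : 0 <= S -> \sum_i b i ^+ 2 <= S ^+ 2 -> \sum_i c i ^+ 2 <= 1 ->
  - S <= \sum_i b i * c i.
Proof.
move=> S0 hb hc; suff : `|\sum_i b i * c i| <= S by rewrite ler_norml => /andP[].
rewrite -ler_sqr ?nnegrE// real_normK ?num_real//.
apply: (le_trans (sqr_sum_le b c)); rewrite -[leRHS]mulr1; apply: ler_pM => //.
- by apply: sumr_ge0 => i _; exact: sqr_ge0.
- by apply: sumr_ge0 => i _; exact: sqr_ge0.
Qed.

(** For the exact unit normal the right-hand side is at least [|grad phi| - |grad phi| = 0]. With
    the regularisation, [s^2 / S >= s - sqrt k] where [S <= s + sqrt k]. *)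
Lemma grad_pairing phi k x Y : 0 < k -> \sum_i Y i x ^+ 2 <= 1 ->
  - Num.sqrt k <= \sum_i partial i phi x * (Xk phi k i x + Y i x).
Proof.
move=> k0 Y1; under eq_bigr do rewrite mulrDr; rewrite big_split /=.
have g0 := gsq_ge0 phi x; set s := Num.sqrt (gsq phi x).
have s0 : 0 <= s by exact: sqrtr_ge0.
have s2 : s ^+ 2 = gsq phi x by rewrite sqr_sqrtr.
have h1 : - s <= \sum_i partial i phi x * Y i x by apply: sum_mul_ge => //; rewrite s2.
have gk : 0 < gsq phi x + k by lra.
set S := Num.sqrt (gsq phi x + k); have S0 : 0 < S by rewrite sqrtr_gt0.
have S2 : S ^+ 2 = gsq phi x + k by rewrite sqr_sqrtr// ltW.
have -> : \sum_i partial i phi x * Xk phi k i x = s ^+ 2 / S.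
  by rewrite s2 /gsq mulr_suml; apply: eq_bigr => i _; rewrite /Xk -/S expr2 mulrA.
set K := Num.sqrt k; have K0 : 0 <= K by exact: sqrtr_ge0.
have K2 : K ^+ 2 = k by rewrite sqr_sqrtr// ltW.
have SK : S <= s + K.
  rewrite -ler_sqr ?nnegrE ?addr_ge0 ?(ltW S0)// S2 sqrrD s2 K2; have := mulr_ge0 s0 K0; lra.
suff : s - K <= s ^+ 2 / S by lra.
rewrite ler_pdivlMr//; have [sK|Ks] := leP s K.
  apply: (@le_trans _ _ 0); last exact: sqr_ge0.
  by rewrite mulr_le0_ge0 ?subr_le0// ltW.
apply: (@le_trans _ _ ((s - K) * (s + K))); first by rewrite ler_wpM2l// subr_ge0 ltW.
by rewrite -subr_sqr K2; lra.
Qed.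

Lemma Ck_theta f (c : R) : Ck 1 f -> Ck 1 (fun x => theta (c * f x)).
Proof. by move=> h; apply: (Ck_comp (@Sk_theta R) (CkZ c h)). Qed.

Lemma partial_theta f (c : R) i x : Ck 1 f ->
  partial i (fun x => theta (c * f x)) x = dtheta (c * f x) * (c * partial i f x).
Proof.
move=> h; rewrite (partial_comp (h' := dtheta) i (is_derive_theta _) (CkZ c h)).
by rewrite (@partialZ _ _ 0).
Qed.

Lemma measurable_pos2 phi q : continuous phi -> continuous q -> measurable [set x | 0 < phi x /\ 0 < q x].
Proof.
move=> cp cq; apply: open_measurable_leb.
rewrite (_ : [set x | _] = phi @^-1` [set t | 0 < t] `&` q @^-1` [set t | 0 < t])//.
by apply: openI; apply: open_comp => //; try (by move=> x _; exact: cp); try (by move=> x _; exact: cq); exact: open_gt.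
Qed.

Lemma le_chain (t1 t2 t3 t4 t5 p : R) : t1 + t2 <= p -> t3 - t4 <= t2 -> t4 <= t5 -> t1 + t3 <= p + t5.
Proof. move=> *; lra. Qed.

(** Calibrate with [Xk phi k] and the cut-off [theta (phi / e) theta (q / c)]. On the added part
    [q >= c], so the second factor is constant with zero gradient; the gradient of the first points
    along that of [phi], where [grad_pairing] gives the sign up to an error sent to 0 with [e]. The
    divergence bound [lam] then becomes a gain of volume. *)
Lemma touch A phi q c lam k0 r0 p : measurable A -> Ck 2 phi -> Ck 1 q -> 0 < c -> 0 < k0 ->
  (forall x, r0 <= enorm x -> q x <= 0) ->
  (forall x, 0 < phi x -> 0 < q x -> ~ A x -> c <= q x) ->
  (forall k x, 0 < k < k0 -> 0 < phi x -> 0 < q x -> ~ A x -> lam <= dv (Xk phi k) x) ->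
  Pb A p ->
  Pb (A `|` [set x | 0 < phi x /\ 0 < q x])
     (p - lam * fine (leb ((A `|` [set x | 0 < phi x /\ 0 < q x]) `\` A))).
Proof.
set G := [set x | _]; set U := A `|` G; set F := U `\` A.
move=> mA hphi hq c0 k00 qr qc Xlam hp Y r fY; have [hY Yr Y1] := fY.
have hphi1 := CkS hphi.
have mG : measurable G := measurable_pos2 (Ck_cont hphi) (Ck_cont hq).
have mU : measurable U := measurableU A G mA mG.
have mF : measurable F := measurableD mU mA.
have FG x : F x -> [/\ 0 < phi x, 0 < q x & ~ A x] by move=> [[h|[h1 h2]] nA].
have fF : (leb F < +oo)%E.
  apply: le_lt_trans (leb_eball_lty 0 r0); apply: le_measure; rewrite ?inE//; first exact: measurable_eball.
  move=> x /FG [_ qx _]; rewrite /eball /= subr0 ltNge; apply/negP => /qr; lra.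
have iF := itg_indic mF fF; set m := fine (leb F); have m0 : 0 <= m by rewrite fine_ge0.
pose e (n : nat) : R := n.+1%:R^-1.
have e0 n : 0 < e n by rewrite invr_gt0.
(* The gradient of the cut-off contributes a factor [2 / e n]; this choice makes the total
   regularisation error [(2 / e n) sqrt (k n) |F|] at most [e n]. *)
pose k n := Num.min (k0 / 2) ((e n ^+ 2 / (2 * (m + 1))) ^+ 2).
have m1 : 0 < m + 1 by rewrite ltr_wpDl.
have kp n : 0 < k n < k0.
  rewrite /k lt_min gt_min; apply/andP; split.
    by rewrite exprn_gt0 ?andbT ?divr_gt0 ?exprn_gt0 ?mulr_gt0.
  by apply/orP; left; lra.
have kk n : (2 / e n) * Num.sqrt (k n) * m <= e n.
  have h : Num.sqrt (k n) <= e n ^+ 2 / (2 * (m + 1)).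
    rewrite -[leRHS]ger0_norm; last by rewrite divr_ge0 ?sqr_ge0// mulr_ge0// ltW.
    by rewrite -sqrtr_sqr ler_sqrt ?sqr_ge0// /k ge_min lexx orbT.
  have en := e0 n; have e2 : 0 <= 2 / e n by rewrite divr_ge0// ltW.
  apply: (@le_trans _ _ (2 / e n * (e n ^+ 2 / (2 * (m + 1))) * m)).
    by rewrite ler_wpM2r// ler_wpM2l.
  rewrite (_ : 2 / e n * (e n ^+ 2 / (2 * (m + 1))) * m = e n * (m / (m + 1))); last first.
    by field; rewrite !gt_eqF.
  by rewrite ler_piMr ?(ltW en)// ler_pdivrMr// mul1r lerDl.
pose a n x := theta ((e n)^-1 * phi x) * theta (c^-1 * q x).
have Ca n : Ck 1 (a n) by apply: CkM; exact: Ck_theta.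
have a01 n x : 0 <= a n x <= 1.
  have /andP[h1 h2] := theta_bounds ((e n)^-1 * phi x); have /andP[h3 h4] := theta_bounds (c^-1 * q x).
  by rewrite mulr_ge0//= -[leRHS]mulr1; exact: ler_pM.
have pa n i x : partial i (a n) x = theta ((e n)^-1 * phi x) * (dtheta (c^-1 * q x) * (c^-1 * partial i q x)) +
    theta (c^-1 * q x) * (dtheta ((e n)^-1 * phi x) * ((e n)^-1 * partial i phi x)).
  rewrite /a (@partialM _ _ 0 (fun x => theta ((e n)^-1 * phi x)) (fun x => theta (c^-1 * q x))) ?partial_theta//; exact: Ck_theta.
have ei n : 0 < (e n)^-1 by rewrite invr_gt0.
have ci : 0 < c^-1 by rewrite invr_gt0.
have ar n : supp_in r0 (a n).
  by move=> x hx; rewrite /a [theta (c^-1 * _)]theta_le0 ?mulr0// pmulr_rle0//; exact: qr.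
have aU n x : ~ U x -> a n x = 0 /\ forall i, partial i (a n) x = 0.
  move=> nU; have : phi x <= 0 \/ q x <= 0.
    have [p1|p1] := leP (phi x) 0; first by left.
    have [q1|q1] := leP (q x) 0; first by right.
    by exfalso; apply: nU; right.
  case=> h.
    have h' : (e n)^-1 * phi x <= 0 by rewrite pmulr_rle0.
    have t0 := theta_le0 h'; have dt0 := dtheta_le0 h'.
    by split=> [|i]; [rewrite /a t0 mul0r|rewrite pa t0 dt0 !mul0r mulr0 addr0].
  have h' : c^-1 * q x <= 0 by rewrite pmulr_rle0.
  have t0 := theta_le0 h'; have dt0 := dtheta_le0 h'.
  by split=> [|i]; [rewrite /a t0 mulr0|rewrite pa t0 dt0 !mul0r mulr0 addr0].
have iYF := itg_dv hY Yr mF; have iYA := itg_dv hY Yr mA.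
have mth n : measurable_fun setT (fun x => theta ((e n)^-1 * phi x)) := continuous_measurable_leb (Ck_cont (Ck_theta (e n)^-1 hphi1)).
have bth n x : `|theta ((e n)^-1 * phi x)| <= 1.
  by have /andP[h1 h2] := theta_bounds ((e n)^-1 * phi x); rewrite ger0_norm.
have iw : itg (fun x => dv Y x * \1_F x + lam * \1_F x) := itgD iYF (itgZ lam iF).
have iwn n : itg (fun x => (dv Y x * \1_F x + lam * \1_F x) * theta ((e n)^-1 * phi x)).
  exact: (itg_mulb iw (mth n) (bth n)).
have step n : rint (fun x => dv Y x * \1_A x) +
   rint (fun x => (dv Y x * \1_F x + lam * \1_F x) * theta ((e n)^-1 * phi x)) <= p + e n.
  have /andP[kn0 kn1] := kp n.
  have [iI hI] := calibration mA mU (@subsetUl _ A G) hp (Ca n) (a01 n) (ar n) (aU n) (fun i => Ck_Xk i kn0 hphi) (fun x => Xk_le1 phi x kn0) fY.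
  rewrite -/F in iI hI.
  have i2 := itgZ ((2 / e n) * Num.sqrt (k n)) iF.
  have : rint (fun x => (dv Y x * \1_F x + lam * \1_F x) * theta ((e n)^-1 * phi x) - (2 / e n) * Num.sqrt (k n) * \1_F x) <=
    rint (fun x => (a n x * (dv (Xk phi (k n)) x + dv Y x) + \sum_i partial i (a n) x * (Xk phi (k n) i x + Y i x)) * \1_F x).
    apply: int_le (itgB (iwn n) i2) iI _ => x; rewrite indicE; case: (boolP (x \in F)) => [|_]; last by rewrite !mulr0 addr0 mul0r subr0.
    rewrite inE => /FG [p1 q1 nA]; rewrite !mulr1.
    have cq : 1 <= c^-1 * q x by rewrite mulrC ler_pdivlMr// mul1r; exact: qc.
    have pE i : partial i (a n) x = dtheta ((e n)^-1 * phi x) * (e n)^-1 * partial i phi x.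
      by rewrite pa [dtheta (c^-1 * _)]dtheta_ge1// [theta (c^-1 * _)]theta_ge1// mul0r mulr0 add0r mul1r mulrA.
    have -> : a n x = theta ((e n)^-1 * phi x) by rewrite /a [theta (c^-1 * _)]theta_ge1// mulr1.
    have -> : \sum_i partial i (a n) x * (Xk phi (k n) i x + Y i x) = dtheta ((e n)^-1 * phi x) * (e n)^-1 * \sum_i partial i phi x * (Xk phi (k n) i x + Y i x).
      by rewrite mulr_sumr; apply: eq_bigr => i _; rewrite pE mulrA.
    have h1 := grad_pairing phi kn0 (Y1 x).
    have h2 := Xlam (k n) x (kp n) p1 q1 nA.
    have /andP[t0 t1] := theta_bounds ((e n)^-1 * phi x).
    have /andP[u0 u1] := dtheta_bounds ((e n)^-1 * phi x).
    set T := theta _ in t0 t1 *; set D := dtheta _ in u0 u1 *.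
    have h3 : T * (dv Y x + lam) <= T * (dv (Xk phi (k n)) x + dv Y x).
      by rewrite ler_wpM2l// addrC lerD2r.
    have h4 : - (2 / e n * Num.sqrt (k n)) <= D * (e n)^-1 * \sum_i partial i phi x * (Xk phi (k n) i x + Y i x).
      have De : 0 <= D * (e n)^-1 by rewrite mulr_ge0// ltW.
      apply: le_trans (ler_wpM2l De h1); rewrite mulrN lerN2.
      by rewrite ler_wpM2r ?sqrtr_ge0// ler_wpM2r// ltW.
    rewrite [(_ + lam) * T]mulrC; exact: lerD.
  rewrite (intB (iwn n) i2) (intZ _ iF) (int_indic _ mF) -/m => h.
  exact: (le_chain hI h (kk n)).
have [|||| _ lim] := @int_dct _ _ _ (@leb R d) (fun n x => (dv Y x * \1_F x + lam * \1_F x) * theta ((e n)^-1 * phi x)) (fun x => dv Y x * \1_F x + lam * \1_F x) (fun x => `|dv Y x * \1_F x + lam * \1_F x|).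
- by move=> n; exact: (itg_measurable (iwn n)).
- exact: itg_norm iw.
- by move=> n x; rewrite normrM ler_piMr.
- move=> x; rewrite [in X in X --> _]indicE [in X in _ --> X]indicE; case: (boolP (x \in F)) => [|_]; last first.
    by rewrite !mulr0 addr0; under eq_fun do rewrite mul0r; exact: cvg_cst.
  rewrite inE => /FG [p1 _ _]; rewrite -[X in _ --> X]mulr1; apply: cvgM; first exact: cvg_cst.
  have [N _ hN] := near_infty_natSinv_lt (PosNum p1).
  apply: cvg_near_cst; exists N => // n /hN /= hn; apply: theta_ge1.
  by rewrite mulrC ler_pdivlMr// mul1r; exact: ltW.
have lim2 : rint (fun x => dv Y x * \1_A x) +
   rint (fun x => (dv Y x * \1_F x + lam * \1_F x) * theta ((e n)^-1 * phi x)) - e n @[n --> \oo] -->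
   rint (fun x => dv Y x * \1_A x) + rint (fun x => dv Y x * \1_F x + lam * \1_F x) - 0.
  apply: cvgB; last exact: cvg_harmonic.
  by apply: cvgD => //; exact: cvg_cst.
have cl : closed [set t : R | t <= p] by exact: closed_le.
have := closed_cvg _ cl _ _ lim2 => h.
have {}h : rint (fun x => dv Y x * \1_A x) + rint (fun x => dv Y x * \1_F x + lam * \1_F x) - 0 <= p.
  by apply: h; apply: nearW => n /=; rewrite lerBlDr.
rewrite (intD iYF (itgZ lam iF)) (intZ _ iF) (int_indic _ mF) -/m subr0 in h.
have -> : (fun x => dv Y x * \1_U x) = (fun x => dv Y x * \1_A x + dv Y x * \1_F x).
  apply/funext => x; rewrite -mulrDr; congr (_ * _); rewrite /F !indicE in_setD.
  have [xA|xA] := boolP (x \in A); last by rewrite andbT add0r.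
  by rewrite andbF addr0 mem_set//; left; rewrite -inE.
rewrite (intD iYA iYF); lra.
Qed.

End touching.

(** * Density estimate *)

Section density_estimate.
Context {R : realType} {d : nat}.
Local Notation V := 'rV[R]_d.
Local Notation rint := (mintegral (@leb R d)).
Local Notation itg := (mintegrable (@leb R d)).
Implicit Types (x y z h : V) (r s p k : R) (a f phi q : V -> R) (i : 'I_d) (F X Y Z : 'I_d -> V -> R) (U A Om : set V).

Lemma leb_sub_lty A U : measurable A -> measurable U -> A `<=` U -> (leb U < +oo)%E -> (leb A < +oo)%E.
Proof. by move=> mA mU AU; apply: le_lt_trans; apply: le_measure; rewrite ?inE. Qed.

(** Only the added part [U \ Om] enters, and [|mu|] in place of [mu] gives a nonnegative coefficient
    whatever the sign of [mu]. *)
Lemma superP mu Om p0 : measurable Om -> (leb Om < +oo)%E -> perimeter Om = p0%:E ->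
  local_supersolution mu setT Om -> exists2 r1, 0 < r1 & forall U y p, measurable U -> Om `<=` U ->
    U `\` Om `<=` eball y r1 -> Pb U p -> p0 <= p + `|mu| * fine (leb (U `\` Om)).
Proof.
move=> mO fO eO [r1 r10 H]; exists r1 => // U y p mU OU UO hU.
have mF := measurableD mU mO.
have fF : (leb (U `\` Om) < +oo)%E.
  exact: leb_sub_lty mF (measurable_eball y r1) UO (leb_eball_lty y r1).
have eU : leb U = (leb Om + leb (U `\` Om))%E.
  rewrite -[in LHS](setUIDK U Om) setIidr//.
  by rewrite measureU// setDE setICA setICr setI0.
have := H U mU OU (@subsetT _ U).
have -> : (exists x0, U `+` Om `<=` eball x0 r1) = True.
  apply/propext; split=> // _; exists y => x [h|[h1 h2]]; first exact: UO.
  by case: h2; apply: OU.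
move=> /(_ I); rewrite eO eU.
have hP : (perimeter U <= p%:E)%E by apply/perimeterP.
have m0 : (0 <= leb Om)%E by exact: measure_ge0.
have n0 : (0 <= leb (U `\` Om))%E by exact: measure_ge0.
move: fO fF m0 n0; case: (leb Om) => [m||] // _; case: (leb (U `\` Om)) => [n||] // _ _ n0 h.
have := le_trans h (leeD2r _ hP); rewrite /= -EFinD -!EFinM -!EFinD lee_fin => {}h.
rewrite lee_fin in n0; have := ler_wpM2r n0 (ler_norm mu).
by move: h; rewrite mulrDr; move: (mu * m) (mu * n) (`|mu| * n) => t u v; lra.
Qed.

Lemma le_chain2 (p0 L e o yf zf K : R) : p0 - L - e <= o + yf -> o + (zf + yf) <= p0 + K ->
  zf <= L + K + e.
Proof. move=> *; lra. Qed.

(** In the calibration inequality the calibrating field is the arbitrary field [Z] and the cut-off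
    is that of the ball, so the divergence of [Z] over the hole gets bounded. The field [Y] almost
    realises the perimeter of the union with the ball; its terms cancel against the supersolution
    property up to volume, and the cut-off gradient leaves the shell term [8 K]. *)
Lemma cacc Om y sigma t0 K Lam p0 : measurable Om -> 0 < sigma -> 0 < t0 -> t0 <= sigma -> Pb Om p0 ->
  (forall e, 0 < e -> exists Y r, field Y r /\
     p0 - Lam * fine (leb (eball y sigma `\` Om)) - e <= rint (fun x => dv Y x * \1_(Om `|` eball y sigma) x)) ->
  (forall t, 0 < t -> t < t0 -> fine (leb ((eball y sigma `\` eball y (sigma - t)) `\` Om)) <= K * t) ->
  Pb (eball y sigma `\` Om) (Lam * fine (leb (eball y sigma `\` Om)) + 8 * K).
Proof.
move=> mO s0 t00 ts hp HY HK Z r' fZ; have [hZ Zr Z1] := fZ.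
set B := eball y sigma in HY HK *; set F := B `\` Om in HY *.
have mB : measurable B := measurable_eball y sigma.
have mF : measurable F := measurableD mB mO.
have mU : measurable (Om `|` B) := measurableU _ _ mO mB.
have EF : (Om `|` B) `\` Om = F.
  by apply/seteqP; split => x [h h']; split=> //; [case: h|right].
set m := fine (leb F) in HY *; apply/ler_addgt0Pr => e e0.
have [Y [r [fY hl]]] := HY e e0; have [hY Yr Y1] := fY.
have iYF := itg_dv hY Yr mF; have iYO := itg_dv hY Yr mO; have iZF := itg_dv hZ Zr mF.
pose t n : R := t0 / 2 * n.+1%:R^-1.
have tp n : 0 < t n by rewrite mulr_gt0 ?divr_gt0// invr_gt0.
have tt n : t n < t0.
  rewrite /t; apply: (@le_lt_trans _ _ (t0 / 2)); last lra.
  by rewrite ler_piMr ?divr_ge0 ?(ltW t00)// invf_le1 ?ler1n.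
(* The cut-off depends on [sigma^2 - |x - y|^2], which is smooth at the centre. Since
   [D n >= t n sigma], the slope bound 2 of [theta] becomes a gradient bound [4 / t n]; as
   [|Z + Y| <= 2], this accounts for the factor 8. *)
pose D n := sigma ^+ 2 - (sigma - t n) ^+ 2.
have DE n : D n = t n * (2 * sigma - t n) by rewrite /D; ring.
have Ds n : t n * sigma <= D n.
  by rewrite DE ler_wpM2l ?(ltW (tp n))//; have := tt n; lra.
have Dp n : 0 < D n by apply: lt_le_trans (Ds n); rewrite mulr_gt0.
pose f x := sigma ^+ 2 - nsq (x - y).
have hf m' : Ck m' f by apply: CkB; [exact: Ck_cst|exact: Ck_nsq].
have pf i x : partial i f x = - (2 * (x 0 i - y 0 i)).
  rewrite (@partialB _ _ 0 (fun=> sigma ^+ 2) (fun x => nsq (x - y))) ?partial_cst ?partial_nsq ?sub0r//.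
    exact: Ck_cst.
  exact: Ck_nsq.
have fle x : ~ B x -> f x <= 0.
  rewrite /B /eball /= => /negP; rewrite -leNgt => h.
  by rewrite subr_le0 nsqE ler_pXn2r ?nnegrE ?enorm_ge0// ltW.
pose a n x := theta ((D n)^-1 * f x).
have Di n : 0 < (D n)^-1 by rewrite invr_gt0.
have Ca n : Ck 1 (a n) := Ck_theta (D n)^-1 (hf 1).
have a01 n x : 0 <= a n x <= 1 := theta_bounds _.
have pa n i x := partial_theta (D n)^-1 i x (hf 1).
have aB n x : ~ B x -> a n x = 0 /\ forall i, partial i (a n) x = 0.
  move=> /fle h; have h' : (D n)^-1 * f x <= 0 by rewrite pmulr_rle0.
  split=> [|i]; first exact: theta_le0.
  by rewrite /a pa dtheta_le0// mul0r.
have ar n : supp_in (sigma + enorm y) (a n).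
  move=> x hx; apply: (aB n x _).1; rewrite /B /eball /= => h.
  by have := enorm_dist x y => h'; have := ler_norm (enorm x - enorm y); lra.
pose sh n := (B `\` eball y (sigma - t n)) `\` Om.
have msh n : measurable (sh n) := measurableD (measurableD mB (measurable_eball _ _)) mO.
have ish n : itg (\1_(sh n)).
  by apply: (itg_indic (msh n)); apply: leb_sub_lty (leb_eball_lty y sigma) => //; move=> x [[]].
have mW n : measurable_fun setT (a n) := continuous_measurable_leb (Ck_cont (Ca n)).
have ba n x : `|a n x| <= 1 by have /andP[h1 h2] := a01 n x; rewrite ger0_norm.
have iw : itg (fun x => dv Z x * \1_F x + dv Y x * \1_F x) := itgD iZF iYF.
have iwn n : itg (fun x => (dv Z x * \1_F x + dv Y x * \1_F x) * a n x) := itg_mulb iw (mW n) (ba n).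
have step n : rint (fun x => dv Y x * \1_Om x) + rint (fun x => (dv Z x * \1_F x + dv Y x * \1_F x) * a n x) <= p0 + 8 * K.
  have [iI hI] := calibration mO mU (@subsetUl _ Om B) hp (Ca n) (a01 n) (ar n)
    (fun x nU => aB n x (fun b => nU (or_intror b))) hZ Z1 fY.
  rewrite EF in iI hI.
  have i2 := itgZ (8 / t n) (ish n).
  have h : rint (fun x => (dv Z x * \1_F x + dv Y x * \1_F x) * a n x - 8 / t n * \1_(sh n) x) <=
    rint (fun x => (a n x * (dv Z x + dv Y x) + \sum_i partial i (a n) x * (Z i x + Y i x)) * \1_F x).
    apply: int_le (itgB (iwn n) i2) iI _ => x.
    have [xF|] := boolP (x \in F); last first.
      rewrite notin_setE => nF; have nS : ~ sh n x by move=> [[h1 _] h2]; apply: nF.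
      by rewrite [\1_F x]indicE [\1_(sh n) x]indicE (memNset nF) (memNset nS) !mulr0 addr0 mul0r subrr.
    rewrite [\1_F x]indicE xF !mulr1 mulrC lerD2l.
    have tn := tp n.
    have [c1|c1] := leP 1 ((D n)^-1 * f x).
      rewrite big1 => [|i _]; last by rewrite /a pa dtheta_ge1// !mul0r.
      rewrite oppr_le0; apply: mulr_ge0; first by rewrite divr_ge0// ltW.
      by case/andP: (indic01 (sh n) x).
    rewrite inE in xF; have [xB xO] := xF.
    have xs : sh n x.
      split=> //; split=> //; rewrite /eball /= => hx.
      move: c1; rewrite mulrC ltr_pdivrMr// mul1r /f /D ltrD2l ltrN2 nsqE ltr_pXn2r ?nnegrE ?enorm_ge0//.
        by move=> /(lt_trans hx); rewrite ltxx.
      by have := tt n; lra.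
    rewrite indicE mem_set// mulr1.
    have S0 : 0 <= 4 / t n by rewrite divr_ge0// ltW.
    have hb : \sum_i partial i (a n) x ^+ 2 <= (4 / t n) ^+ 2.
      have /andP[u0 u1] := dtheta_bounds ((D n)^-1 * f x).
      under eq_bigr do rewrite /a pa pf.
      set T := dtheta _ in u0 u1 *.
      have -> : \sum_i (T * ((D n)^-1 * - (2 * (x 0 i - y 0 i)))) ^+ 2 = (2 * T * (D n)^-1 * enorm (x - y)) ^+ 2.
        rewrite [RHS]exprMn enorm_sqr /dot mulr_sumr; apply: eq_bigr => i _.
        by rewrite !mxE; ring.
      have T0 : 0 <= 2 * T * (D n)^-1 by rewrite mulr_ge0 ?mulr_ge0// ltW.
      have TE := mulr_ge0 T0 (enorm_ge0 (x - y)).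
      rewrite ler_pXn2r ?nnegrE//.
      apply: (@le_trans _ _ (4 * (D n)^-1 * sigma)).
        apply: ler_pM; [exact: T0|exact: enorm_ge0|apply: ler_wpM2r; [exact: ltW|lra]|exact: ltW].
      by rewrite -mulrA ler_wpM2l// ler_pdivrMl// ler_pdivlMr// mulrC; exact: Ds.
    have h1 := sum_mul_ge S0 hb (Z1 x); have h2 := sum_mul_ge S0 hb (Y1 x).
    under eq_bigr do rewrite mulrDr; rewrite big_split /=.
    rewrite (_ : 8 / t n = 4 / t n + 4 / t n); last by rewrite -mulrDl; congr (_ / _); ring.
    by rewrite opprD; exact: lerD.
  rewrite (intB (iwn n) i2) (intZ _ (ish n)) (int_indic _ (msh n)) in h.
  apply: (le_chain hI h); rewrite mulrAC ler_pdivrMr// -mulrA ler_wpM2l//; exact: HK.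
have [|||| _ lim] := @int_dct _ _ _ (@leb R d) (fun n x => (dv Z x * \1_F x + dv Y x * \1_F x) * a n x) (fun x => dv Z x * \1_F x + dv Y x * \1_F x) (fun x => `|dv Z x * \1_F x + dv Y x * \1_F x|).
- by move=> n; exact: (itg_measurable (iwn n)).
- exact: itg_norm iw.
- by move=> n x; rewrite normrM ler_piMr.
- move=> x; rewrite [in X in X --> _]indicE [in X in _ --> X]indicE; case: (boolP (x \in F)) => [|_]; last first.
    by rewrite !mulr0 addr0; under eq_fun do rewrite mul0r; exact: cvg_cst.
  rewrite inE => -[xB _]; rewrite -[X in _ --> X]mulr1; apply: cvgM; first exact: cvg_cst.
  have gp : 0 < (sigma - enorm (x - y)) / t0 by rewrite divr_gt0// subr_gt0.
  have [N _ hN] := near_infty_natSinv_lt (PosNum gp).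
  apply: cvg_near_cst; exists N => // n /hN /= hn; apply: theta_ge1.
  rewrite mulrC ler_pdivlMr// mul1r /f /D lerD2l lerN2 nsqE.
  have h : t n <= sigma - enorm (x - y).
    move: hn; rewrite ltr_pdivlMr// /t; move: (n.+1%:R^-1) (invr_ge0 (n.+1%:R : R)) => b; rewrite ler0n => b0 hn.
    have := mulr_ge0 b0 (ltW t00); lra.
  rewrite ler_pXn2r ?nnegrE ?enorm_ge0//; [lra|have := tt n; lra].
have cl : closed [set t : R | t <= p0 + 8 * K] by exact: closed_le.
have lim2 : rint (fun x => dv Y x * \1_Om x) + rint (fun x => (dv Z x * \1_F x + dv Y x * \1_F x) * a n x) @[n --> \oo] -->
   rint (fun x => dv Y x * \1_Om x) + rint (fun x => dv Z x * \1_F x + dv Y x * \1_F x).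
  by apply: cvgD => //; exact: cvg_cst.
have h : rint (fun x => dv Y x * \1_Om x) + rint (fun x => dv Z x * \1_F x + dv Y x * \1_F x) <= p0 + 8 * K.
  by apply: (closed_cvg _ cl _ _ lim2); apply: nearW => n; exact: step.
rewrite (intD iZF iYF) in h.
have hU : (fun x => dv Y x * \1_(Om `|` B) x) = (fun x => dv Y x * \1_Om x + dv Y x * \1_F x).
  apply/funext => x; rewrite -mulrDr; congr (_ * _); rewrite -EF !indicE in_setD.
  have [xA|xA] := boolP (x \in Om); last by rewrite andbT add0r.
  by rewrite andbF addr0 mem_set//; left; rewrite -inE.
rewrite hU (intD iYO iYF) in hl; exact: (le_chain2 hl h).
Qed.

End density_estimate.

(** * Iteration of the volume estimate *)

Section density_iteration.
Context {R : realType} {d : nat}.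
Local Notation V := 'rV[R]_d.
Local Notation rint := (mintegral (@leb R d)).
Local Notation itg := (mintegrable (@leb R d)).
Implicit Types (x y z h : V) (r s p : R) (U A Om : set V).

Definition hole Om y s : R := fine (leb (eball y s `\` Om)).

Lemma eball_le y r s : r <= s -> eball y r `<=` eball y s.
Proof. by move=> rs x; rewrite /eball /= => /lt_le_trans; apply. Qed.

Lemma itg_hole Om y s : measurable Om ->
  measurable (eball y s `\` Om) /\ itg (\1_(eball y s `\` Om)).
Proof.
move=> mO; have mF := measurableD (measurable_eball y s) mO; split=> //.
apply: (itg_indic mF); apply: leb_sub_lty (leb_eball_lty y s) => //; exact: measurable_eball.
Qed.

Lemma holeE Om y s : measurable Om -> hole Om y s = rint (\1_(eball y s `\` Om)).
Proof. by move=> mO; rewrite (int_indic _ (itg_hole y s mO).1). Qed.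

Lemma hole_ge0 Om y s : 0 <= hole Om y s. Proof. by rewrite fine_ge0. Qed.

Lemma indic_le A U x : A `<=` U -> (\1_A x : R) <= \1_U x.
Proof.
move=> AU; rewrite !indicE; case: (boolP (x \in A)) => [|_]; last by case: (_ \in _).
by rewrite inE => /AU h; rewrite mem_set.
Qed.

Lemma hole_mono Om y : measurable Om -> {homo hole Om y : s r / s <= r}.
Proof.
move=> mO s r sr; rewrite !holeE//; apply: int_le (itg_hole y s mO).2 (itg_hole y r mO).2 _ => x.
by apply: indic_le => z [h h']; split=> //; exact: (eball_le sr).
Qed.

Lemma hole_lc Om y s e : measurable Om -> 0 < e ->
  exists2 del, 0 < del & forall s', s - del < s' -> hole Om y s - e < hole Om y s'.
Proof.
move=> mO e0; pose u (n : nat) : R := n.+1%:R^-1.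
have [|||| _ lim] := @int_dct _ _ _ (@leb R d) (fun n x => \1_(eball y (s - u n) `\` Om) x) (\1_(eball y s `\` Om)) (\1_(eball y s `\` Om)).
- by move=> n; exact: (itg_measurable (itg_hole y (s - u n) mO).2).
- exact: (itg_hole y s mO).2.
- move=> n x; have /andP[a b] := indic01 (eball y (s - u n) `\` Om) x; rewrite ger0_norm//.
  apply: indic_le => z [h h']; split=> //; apply: eball_le h; have : 0 < u n by rewrite invr_gt0.
  lra.
- move=> x; have [[xB xO]|nF] := pselect ((eball y s `\` Om) x); last first.
    rewrite [in X in _ --> X]indicE memNset//; apply: cvg_near_cst; apply: nearW => n.
    rewrite indicE memNset// => -[h h']; apply: nF; split=> //; apply: eball_le h.
    have : 0 < u n by rewrite invr_gt0.
    lra.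
  rewrite [in X in _ --> X]indicE mem_set//.
  have gp : 0 < s - enorm (x - y) by rewrite subr_gt0.
  have [N _ hN] := near_infty_natSinv_lt (PosNum gp).
  apply: cvg_near_cst; exists N => // n /hN /= hn; rewrite indicE mem_set//; split=> //.
  by rewrite /eball /= /u; move: (n.+1%:R^-1) hn => b; lra.
have {}lim : hole Om y (s - u n) @[n --> \oo] --> hole Om y s.
  rewrite holeE//; under eq_fun do rewrite holeE//; exact: lim.
move/cvgrPdist_lt : lim => /(_ _ e0) [N _ /(_ N (leqnn N))] /= h.
exists (u N) => [|s' hs]; first by rewrite invr_gt0.
have := hole_mono y mO (ltW hs); move: h; move: (hole _ _ _) (hole _ _ _) (hole _ _ _) => a b c.
rewrite ltr_norml => /andP[]; lra.
Qed.

Lemma hole_shell Om y s t : measurable Om -> 0 <= t ->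
  fine (leb ((eball y s `\` eball y (s - t)) `\` Om)) = hole Om y s - hole Om y (s - t).
Proof.
move=> mO t0; have mS := measurableD (measurableD (measurable_eball y s) (measurable_eball y (s - t))) mO.
rewrite !holeE// -(int_indic _ mS) -intB; [|exact: (itg_hole y s mO).2|exact: (itg_hole y _ mO).2].
congr mintegral; apply/funext => x; rewrite !indicE !in_setD.
have [h|h] := boolP (x \in eball y (s - t)).
  rewrite (_ : x \in eball y s) ?subrr ?andbF//.
  by move: h; rewrite !inE; apply: eball_le; lra.
by rewrite /= andbT subr0.
Qed.

Section step.
Variables (Om : set V) (p0 Lam r1 : R).
Hypotheses (mO : measurable Om) (fO : (leb Om < +oo)%E) (hp : Pb Om p0) (Lam0 : 0 <= Lam) (r10 : 0 < r1).
Hypothesis super : forall U y p, measurable U -> Om `<=` U ->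
    U `\` Om `<=` eball y r1 -> Pb U p -> p0 <= p + Lam * fine (leb (U `\` Om)).

(** Between [s0] and [r] there is a radius at which the left difference quotients of the hole are
    bounded by [K]; the Caccioppoli inequality [cacc] at that radius, followed by the isoperimetric
    one, gives the claim. *)
Lemma density_step y s0 r rho : 0 < s0 -> s0 < r -> r <= r1 -> 0 < rho ->
  2 * hole Om y r <= (rho *+ 2) ^+ d ->
  hole Om y s0 <= 2 * d%:R * rho * (Lam * hole Om y r + 16 * hole Om y r / (r - s0)).
Proof.
move=> s00 sr rr1 rho0 hr; have rs : 0 < r - s0 by rewrite subr_gt0.
have [m0|mn] := eqVneq (hole Om y r) 0.
  by rewrite !m0 !(mulr0, mul0r, addr0) -m0; exact: hole_mono (ltW sr).
have mp : 0 < hole Om y r by rewrite lt_neqAle eq_sym mn hole_ge0.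
(* The factor 2 makes [K] strictly exceed the mean slope, as [slope_bound] requires; with the 8 of
   [cacc] it gives the 16 of the statement. *)
pose K := 2 * hole Om y r / (r - s0).
have hK : hole Om y r - hole Om y s0 < K * (r - s0).
  by rewrite /K divfK ?gt_eqF//; have := hole_ge0 Om y s0; lra.
have [sig /andP[ss sr'] hs] := slope_bound sr (hole_mono y mO) (fun s e => @hole_lc Om y s e mO) hK.
have sig0 : 0 < sig by lra.
have t00 : 0 < sig - s0 by rewrite subr_gt0.
have ts : sig - s0 <= sig by lra.
have mF := (itg_hole y sig mO).1.
have EF : (Om `|` eball y sig) `\` Om = eball y sig `\` Om.
  by apply/seteqP; split => x [h h']; split=> //; [case: h|right].
have hY e : 0 < e -> exists Y q, field Y q /\
     p0 - Lam * fine (leb (eball y sig `\` Om)) - e <= rint (fun x => dv Y x * \1_(Om `|` eball y sig) x).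
  move=> e0; apply: contrapT => hn.
  have hb : Pb (Om `|` eball y sig) (p0 - Lam * fine (leb (eball y sig `\` Om)) - e).
    move=> Y q hYq; rewrite leNgt; apply/negP => hlt; apply: hn; exists Y, q; split=> //; exact: ltW.
  have mU : measurable (Om `|` eball y sig) := measurableU _ _ mO (measurable_eball y sig).
  have := super mU (@subsetUl _ _ _) _ hb; rewrite EF => /(_ y) h.
  have := h _; have hsub : eball y sig `\` Om `<=` eball y r1.
    by move=> x [hx _]; apply: eball_le hx; exact: le_trans rr1.
  by move=> /(_ hsub); lra.
have hsh t : 0 < t -> t < sig - s0 -> fine (leb ((eball y sig `\` eball y (sig - t)) `\` Om)) <= K * t.
  by move=> tp tlt; rewrite hole_shell ?(ltW tp)//; apply: hs; rewrite !ltW.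
have hb := cacc mO sig0 t00 ts hp hY hsh.
have fF : (leb (eball y sig `\` Om) < +oo)%E.
  by apply: leb_sub_lty (leb_eball_lty y sig) => //; exact: measurable_eball.
have msr : hole Om y sig <= hole Om y r := hole_mono y mO sr'.
have iso := isoperimetric mF fF hb rho0.
have {}iso : hole Om y sig <= 2 * d%:R * rho * (Lam * hole Om y sig + 8 * K).
  by apply: iso; apply: le_trans hr; rewrite ler_wpM2l.
apply: (le_trans (hole_mono y mO (ltW ss))); apply: (le_trans iso).
rewrite ler_wpM2l ?mulr_ge0 ?(ltW rho0)//; apply: lerD; first by rewrite ler_wpM2l.
by rewrite /K !mulrA (_ : 8 * 2 = 16 :> R)//; ring.
Qed.

Hypotheses (d_gt0 : (0 < d)%N) (Lr1 : Lam * r1 <= 1).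

(** Chosen so that [2 d eps0 (1 + 64) = 2^-d]: the 1 bounds [Lam r], and 64 is 16 divided by the
    quarter in the gap [r b / 4] between two successive radii. *)
Definition eps0 : R := (2^-1) ^+ d / (130 * d%:R).

(** The value for which the smallness condition of the isoperimetric inequality at scale
    [rho = eps0 r b] reads exactly [hole <= delta0 (r b)^d]. *)
Definition delta0 : R := (2 * eps0) ^+ d / 2.

Lemma eps0_gt0 : 0 < eps0.
Proof. by rewrite divr_gt0 ?exprn_gt0// mulr_gt0// ltr0n. Qed.

Lemma delta0_gt0 : 0 < delta0.
Proof. by rewrite divr_gt0// exprn_gt0// mulr_gt0// eps0_gt0. Qed.

(** Along the radii [(r / 2) (1 + 2^-k)] the hole is multiplied by at most [2^-d] at each step while
    the gap is halved. Shrinking the isoperimetric scale [rho] with the gap keeps its smallness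
    condition true, so the hole is at most [delta0 r^d 2^(-k d)] for every [k]. *)
Lemma density_decay y r : 0 < r -> r <= r1 -> hole Om y r < delta0 * r ^+ d -> hole Om y (r / 2) = 0.
Proof.
move=> r0 rr1 hr; have e0 := eps0_gt0; have de0 := delta0_gt0.
pose b (k : nat) : R := (2^-1) ^+ k.
have b0 k : 0 < b k by rewrite exprn_gt0.
have b1 k : b k <= 1 by rewrite exprn_ile1//; lra.
pose rk k := r / 2 + r / 2 * b k.
have rd : 0 < r ^+ d by rewrite exprn_gt0.
have key k : hole Om y (rk k) <= delta0 * r ^+ d * (b k) ^+ d.
  elim: k => [|k IH].
    have -> : rk 0%N = r by rewrite /rk /b expr0 mulr1 -splitr.
    by rewrite /b expr0 expr1n mulr1 ltW.
  have rb : 0 < r * b k by rewrite mulr_gt0.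
  have gap : rk k - rk k.+1 = r * b k / 4 by rewrite /rk /b exprS; field.
  have s0 : 0 < rk k.+1 by rewrite /rk addr_gt0 ?mulr_gt0 ?divr_gt0.
  have sr : rk k.+1 < rk k by rewrite -subr_gt0 gap divr_gt0.
  have rr : rk k <= r1.
    apply: le_trans rr1; rewrite /rk [leRHS]splitr lerD2l ler_piMr//; lra.
  pose rho := eps0 * (r * b k); have rho0 : 0 < rho by rewrite mulr_gt0.
  have h2 : 2 * hole Om y (rk k) <= (rho *+ 2) ^+ d.
    have -> : (rho *+ 2) ^+ d = 2 * (delta0 * r ^+ d * b k ^+ d).
      have -> : rho *+ 2 = 2 * eps0 * r * b k by rewrite -mulr_natl /rho; ring.
      rewrite exprMn [(2 * eps0 * r) ^+ d]exprMn /delta0.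
      by move: ((2 * eps0) ^+ d) (r ^+ d) (b k ^+ d) => A B C; field.
    by rewrite ler_wpM2l.
  have h3 := @density_step y _ _ _ s0 sr rr rho0 h2; apply: (le_trans h3); rewrite gap.
  set M := hole Om y (rk k) in IH *; have M0 : 0 <= M by exact: hole_ge0.
  have dd : 0 < d%:R :> R by rewrite ltr0n.
  have -> : 2 * d%:R * rho * (Lam * M + 16 * M / (r * b k / 4)) = 2 * d%:R * eps0 * (Lam * (r * b k) + 64) * M.
    by rewrite /rho; move: (r * b k) rb => t tp; field; rewrite gt_eqF.
  apply: (@le_trans _ _ ((2^-1) ^+ d * M)).
    rewrite ler_wpM2r//; apply: (@le_trans _ _ (2 * d%:R * eps0 * 65)); last first.
      by rewrite /eps0 le_eqVlt; apply/orP; left; apply/eqP; field; rewrite gt_eqF.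
    rewrite ler_wpM2l ?mulr_ge0 ?(ltW e0) ?(ltW dd)//.
    have : Lam * (r * b k) <= 1.
      apply: le_trans Lr1; rewrite ler_wpM2l//; apply: le_trans rr1; rewrite ler_piMr//; exact: ltW.
    lra.
  have -> : delta0 * r ^+ d * b k.+1 ^+ d = (2^-1) ^+ d * (delta0 * r ^+ d * b k ^+ d).
    by rewrite /b exprS exprMn; ring.
  by rewrite ler_wpM2l// exprn_ge0.
apply/eqP; rewrite eq_le hole_ge0 andbT; apply/ler_addgt0Pr => e ep; rewrite add0r.
have C0 : 0 < delta0 * r ^+ d by rewrite mulr_gt0.
have eC : 0 < e / (delta0 * r ^+ d) by rewrite divr_gt0.
have [k hk] : exists k, b k < e / (delta0 * r ^+ d).
  have /cvgrPdist_lt /(_ _ eC) [N _ /(_ N (leqnn N))] : (fun k => b k) @ \oo --> 0.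
    by apply: cvg_expr; rewrite ger0_norm//; lra.
  by rewrite /= sub0r normrN ger0_norm ?(ltW (b0 N))// => h; exists N.
apply: (@le_trans _ _ (hole Om y (rk k))).
  by apply: hole_mono => //; rewrite /rk lerDl mulr_ge0// ?(ltW (b0 k))//; lra.
apply: (le_trans (key k)).
apply: (@le_trans _ _ (delta0 * r ^+ d * b k)).
  rewrite ler_wpM2l ?(ltW C0)//; have := d_gt0; case: (d) => // n _.
  rewrite exprS ler_piMr ?(ltW (b0 k))// exprn_ile1 ?(ltW (b0 k))//.
by rewrite mulrC -ler_pdivlMr// ltW.
Qed.

End step.
End density_iteration.

(** * The set of points of density one *)

Section density_one.
Context {R : realType} {d : nat}.
Local Notation V := 'rV[R]_d.
Local Notation rint := (mintegral (@leb R d)).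
Implicit Types (x y z h : V) (r s p : R) (U A Om : set V).

Lemma leb_split U A : measurable U -> measurable A -> (leb U < +oo)%E ->
  fine (leb U) = fine (leb (A `&` U)) + fine (leb (U `\` A)).
Proof.
move=> mU mA fU; have mI := measurableI _ _ mA mU; have mD := measurableD mU mA.
have fI : (leb (A `&` U) < +oo)%E by apply: leb_sub_lty fU => //; exact: subIsetr.
have fD : (leb (U `\` A) < +oo)%E by apply: leb_sub_lty fU => //; exact: subDsetl.
have iI := itg_indic mI fI; have iD := itg_indic mD fD.
rewrite -(int_indic _ mU) -(int_indic _ mI) -(int_indic _ mD) -(intD iI iD).
congr mintegral; apply/funext => x; rewrite !indicE in_setI in_setD.
by case: (x \in A); case: (x \in U); rewrite /= ?addr0 ?add0r.
Qed.

Lemma hole_sub Om y y' r s : measurable Om -> eball y r `<=` eball y' s -> hole Om y' s = 0 -> hole Om y r = 0.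
Proof.
move=> mO h h0; apply/eqP; rewrite eq_le hole_ge0 andbT -h0 !holeE//.
apply: int_le (itg_hole y r mO).2 (itg_hole y' s mO).2 _ => x.
by apply: indic_le => z [h1 h2]; split=> //; exact: h.
Qed.

Section fat.
Variables (Om : set V) (delta r1 : R).
Hypotheses (mO : measurable Om) (fO : (leb Om < +oo)%E) (del0 : 0 < delta) (r10 : 0 < r1).
Hypothesis decay : forall y r, 0 < r -> r <= r1 -> hole Om y r < delta * r ^+ d -> hole Om y (r / 2) = 0.

(** The limit is used at a single small radius: once the missing proportion is below a threshold,
    [decay] produces a ball with nothing missing, where the ratio is constantly 1. *)
Lemma density1P x : density1 Om x <-> exists2 r, 0 < r & hole Om x r = 0.
Proof.
have pos r : 0 < r -> 0 < fine (leb (eball x r)).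
  by move=> r0; rewrite fine_gt0// leb_eball_lty andbT leb_eball_gt0.
have spl r : fine (leb (eball x r)) = fine (leb (Om `&` eball x r)) + hole Om x r.
  exact: leb_split (measurable_eball x r) mO (leb_eball_lty x r).
split=> [h|[r r0 hr]].
  (* The ball has volume at most [(2 r)^d], whence the factor [2^d] between proportion and
     volume. *)
  have e0 : 0 < delta / 2 ^+ d by rewrite divr_gt0// exprn_gt0.
  move/cvgrPdist_lt : h => /(_ _ e0) h.
  near (0 : R)^'+ => r.
  have rp : 0 < r by near: r; exact: nbhs_right_gt.
  have rr : r <= r1 by near: r; exact: nbhs_right_le.
  have hc : `|1 - fine (leb (Om `&` eball x r)) / fine (leb (eball x r))| < delta / 2 ^+ d by near: r.
  exists (r / 2); first lra.
  apply: decay => //; have bp := pos r rp.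
  have b2 : fine (leb (eball x r)) <= 2 ^+ d * r ^+ d.
    rewrite -lee_fin fineK ?ge0_fin_numE ?leb_eball_lty//.
    by apply: (le_trans (leb_eball_le x (ltW rp))); rewrite -exprMn mulr_natl.
  have E : 1 - fine (leb (Om `&` eball x r)) / fine (leb (eball x r)) = hole Om x r / fine (leb (eball x r)).
    have -> : fine (leb (Om `&` eball x r)) = fine (leb (eball x r)) - hole Om x r by rewrite [in RHS]spl addrK.
    by field; rewrite gt_eqF.
  rewrite E ger0_norm ?divr_ge0 ?hole_ge0 ?(ltW bp)// ltr_pdivrMr// in hc.
  apply: (lt_le_trans hc); rewrite mulrAC ler_pdivrMr ?exprn_gt0// -mulrA ler_wpM2l ?(ltW del0)//.
  by rewrite mulrC.
apply: cvg_near_cst; near=> s.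
have sp : 0 < s by near: s; exact: nbhs_right_gt.
have sr : s <= r by near: s; exact: nbhs_right_le.
have hs : hole Om x s = 0 by apply: (hole_sub mO _ hr); exact: eball_le.
by have := spl s; rewrite hs addr0 => <-; rewrite mulfV// gt_eqF// pos.
Unshelve. all: by end_near. Qed.

Lemma open_density1 : open (density1 Om).
Proof.
rewrite openE => x /density1P[r r0 hr]; rewrite /interior.
have r2 : 0 < r / 2 by lra.
have nb : nbhs x (eball x (r / 2)).
  by apply: open_nbhs_nbhs; split; [exact: open_eball|rewrite /eball /= subrr enorm0].
apply: filterS nb => y; rewrite /eball /= => yx; apply/density1P; exists (r / 2) => //.
apply: (hole_sub mO _ hr) => z; rewrite /eball /= => zy.
have := enorm_triangle z y x; lra.
Qed.

(** Each point of density one has a ball with a null hole, and countably many such balls suffice. *)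
Lemma density1_null : leb (density1 Om `\` Om) = 0%E.
Proof.
have [|F [F1 F2]] := @countable_eballs R d (fun c r => leb (eball c r `\` Om) = 0%E).
  move=> x e y r h hs; apply/eqP; rewrite -measure_le0 -h; apply: le_measure; rewrite ?inE.
  - exact: (itg_hole y r mO).1.
  - exact: (itg_hole x e mO).1.
  - by move=> z [h1 h2]; split=> //; exact: hs.
have N n : leb (eball (F n).1 (F n).2 `\` Om) = 0%E.
  case: (F1 n) => [->|//]; rewrite (_ : _ `\` _ = set0) ?measure0//.
  by apply/seteqP; split => // x []; rewrite /eball /= => h; have := enorm_ge0 (x - (F n).1); lra.
have mD := measurableD (open_measurable_leb open_density1) mO.
apply/(negligibleP _ mD); apply: (@negligibleS _ _ _ _ (\bigcup_n (eball (F n).1 (F n).2 `\` Om))).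
  move=> x [/density1P[r r0 hr] nx]; have [|n hn] := F2 x r r0; last by exists n.
  have fF : (leb (eball x r `\` Om) < +oo)%E.
    by apply: leb_sub_lty (leb_eball_lty x r) => //; [exact: (itg_hole x r mO).1|exact: measurable_eball].
  by rewrite -(@fineK _ (leb (eball x r `\` Om))) ?ge0_fin_numE// -/(hole Om x r) hr.
apply: negligible_bigcup => n; apply/negligibleP; [exact: (itg_hole _ _ mO).1|exact: N].
Qed.

Lemma leb_density1 : (leb (density1 Om) < +oo)%E.
Proof.
have mE := open_measurable_leb open_density1; have mD := measurableD mE mO.
apply: (@le_lt_trans _ _ (leb Om)) => //.
apply: (@le_trans _ _ (leb (Om `|` (density1 Om `\` Om)))).
  apply: le_measure; rewrite ?inE//; first exact: measurableU.
  by move=> x hx; have [h|h] := pselect (Om x); [left|right].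
have := measureU2 (@leb R d) mO mD; rewrite [X in (_ <= _ + X)%E]density1_null adde0.
by apply.
Qed.

Lemma fat_density1 : fat_complement (density1 Om) delta r1.
Proof.
move=> y r Ey r0 rr1; have mE := open_measurable_leb open_density1.
have h1 : delta * r ^+ d <= hole Om y r.
  by rewrite leNgt; apply/negP => /(decay r0 rr1) h; apply: Ey; apply/density1P; exists (r / 2) => //; lra.
apply: (le_trans h1); rewrite -/(hole (density1 Om) y r) !holeE//.
have i1 := (itg_hole y r mO).2; have i2 := (itg_hole y r mE).2.
have mD := measurableD mE mO.
have fD : (leb (density1 Om `\` Om) < +oo)%E by rewrite density1_null.
have i3 := itg_indic mD fD.
have z : rint (\1_(density1 Om `\` Om)) = 0 by rewrite (int_indic _ mD) [X in fine X]density1_null.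
rewrite -[leRHS]addr0 -z -(intD i2 i3); apply: int_le i1 (itgD i2 i3) _ => x.
have c01 (B : set V) : 0 <= (\1_B x : R) by case/andP: (indic01 B x).
rewrite [leLHS]indicE; case: (boolP (x \in _)) => [|_]; last exact: addr_ge0.
rewrite inE => -[h2 h3]; have [h|h] := pselect (density1 Om x).
  have e1 : (\1_(density1 Om `\` Om) x : R) = 1 by rewrite indicE mem_set.
  by rewrite -[leLHS]add0r -[X in 0 + X]e1; exact: lerD (c01 _) (lexx _).
have e1 : (\1_(eball y r `\` density1 Om) x : R) = 1 by rewrite indicE mem_set.
by rewrite -[leLHS]addr0 -[X in X + 0]e1; exact: lerD (lexx _) (c01 _).
Qed.

End fat.
End density_one.

(** * Boundary charts *)

Section linear_change.
Context {R : realType} {d m : nat}.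
Local Notation V := 'rV[R]_d.
Local Notation W := 'rV[R]_m.

Lemma mulmx_norm_le (M : 'M[R]_(d, m)) (w : V) : `|w *m M| <= `|w| * \sum_l \sum_j `|M j l|.
Proof.
apply: (le_trans (norm_le_enorm _)); apply: (le_trans (enorm_le_sum _)).
rewrite mulr_sumr; apply: ler_sum => l _; rewrite mxE mulr_sumr.
apply: (le_trans (ler_norm_sum _ _ _)); apply: ler_sum => j _.
by rewrite normrM ler_wpM2r// coord_le_norm.
Qed.

Lemma Ck_linear k (g : W -> R) (M : 'M[R]_(d, m)) : Ck k g -> Ck k (fun z : V => g (z *m M)).
Proof.
have cont0 (g' : W -> R) : continuous g' -> continuous (fun z : V => g' (z *m M)).
  move=> cg; apply: continuous_normP => x e e0.
  have [r r0 hr] := continuousP_norm cg (x *m M) e0.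
  pose K : R := \sum_l \sum_j `|M j l|.
  have K0 : 0 <= K by apply: sumr_ge0 => l _; apply: sumr_ge0 => j _.
  have K1 : 0 < K + 1 by rewrite ltr_wpDl.
  exists (r / (K + 1)) => [|y yx]; first by rewrite divr_gt0.
  apply: hr; rewrite -mulmxBl; apply: (le_lt_trans (mulmx_norm_le M _)); rewrite -/K.
  rewrite ltr_pdivlMr// in yx; apply: le_lt_trans yx; rewrite ler_wpM2l// lerDl//.
elim: k g => [|k IH] g hg; first by split=> //; apply: cont0; exact: Ck_cont hg.
pose dg (i : 'I_d) (z : V) : R := \sum_l ((delta_mx 0 i : V) *m M) 0 l * partial l g (z *m M).
have hd (i : 'I_d) (x : V) : is_derive x (delta_mx 0 i) (fun z : V => g (z *m M)) (dg i x).
  have h1 := Ck1_dir (x *m M) (delta_mx 0 i *m M) (Ck_le (isT : (1 <= k.+1)%N) hg).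
  apply/is_derive_line0; move/is_derive_line0 : h1; congr (is_derive _ _ _ _).
  by apply/funext => s; rewrite mulmxDl -scalemxAl.
apply: (CkI (df := dg)) => // [|i].
  by apply: cont0; exact: Ck_cont hg.
by apply: Ck_sum => l; apply: CkZ; apply: IH; exact: Ck_partial hg.
Qed.

End linear_change.

Section boundary_balls.
Context {R : realType} {d : nat}.
Local Notation V := 'rV[R]_d.
Implicit Types (x y z h v : V) (r s p C rho : R) (U A D : set V) (phi q : V -> R) (i : 'I_d).

Lemma Pb_ae U U' p : measurable U -> measurable U' -> {ae @leb R d, forall x, (\1_U x : R) = \1_U' x} ->
  Pb U p -> Pb U' p.
Proof.
move=> mU mU' h hp F r fF; have [hF Fr _] := fF; apply: le_trans (hp F r fF).
rewrite le_eqVlt; apply/orP; left; apply/eqP; apply: int_ae.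
- exact: (itg_measurable (itg_dv hF Fr mU')).
- exact: (itg_measurable (itg_dv hF Fr mU)).
- by apply: filterS h => x ->.
Qed.

Lemma PbC U p : measurable U -> Pb U p -> Pb (~` U) p.
Proof.
move=> mU hp F r fF; have [hF Fr F1] := fF.
have fN : field (fun i x => - F i x) r.
  split=> [i|i x hx|x]; [exact: CkN|by rewrite Fr// oppr0|].
  by under eq_bigr do rewrite sqrrN.
have := hp _ _ fN; have i1 := itg_dv hF Fr mU.
have dN x : dv (fun i x => - F i x) x = - dv F x.
  by rewrite /dv -sumrN; apply: eq_bigr => i _; rewrite (@partialN _ _ 0).
have -> : (fun x => dv (fun i x => - F i x) x * \1_U x) = (fun x => - (dv F x * \1_U x)).
  by apply/funext => x; rewrite dN mulNr.
rewrite (intN i1) => h.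
have -> : (fun x => dv F x * \1_(~` U) x) = (fun x => dv F x - dv F x * \1_U x).
  by apply/funext => x; rewrite indicC mulrBr mulr1.
have i0 := itg_csuppc (cont_dv hF) (supp_dv hF Fr).
by rewrite (intB i0 i1) (int_dv hF Fr) sub0r.
Qed.

(** The local form of the cut-off in part (a). It persists for smaller balls and larger constants,
    which is what gluing by compactness needs. *)
Definition good D x rho C := forall U p, measurable U -> U `\` D `<=` eball x rho -> Pb U p ->
  Pb (U `&` D) (p + C * fine (leb (U `\` D))).

Lemma good_le D x rho C x' rho' C' : good D x rho C -> eball x' rho' `<=` eball x rho -> C <= C' ->
  good D x' rho' C'.
Proof.
move=> h hs CC U p mU UD hp F r fF; apply: (le_trans (h U p mU (subset_trans UD hs) hp F r fF)).
by rewrite lerD2l ler_wpM2r// fine_ge0.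
Qed.

Lemma good_interior D x rho : eball x rho `<=` D -> good D x rho 0.
Proof.
move=> hx U p mU UD hp; rewrite mul0r addr0 (_ : U `&` D = U)//.
apply/seteqP; split=> [z []//|z Uz]; split=> //; have [//|nD] := pselect (D z).
exact: hx (UD z (conj Uz nD)).
Qed.

(** Removing a superlevel set from [U] is adding it to the complement, and a set and its complement
    have the same perimeter bounds. *)
Lemma Pb_remove U phi q c lam k0 r0 p : measurable U -> Ck 2 phi -> Ck 1 q -> 0 < c -> 0 < k0 ->
  (forall x, r0 <= enorm x -> q x <= 0) ->
  (forall x, 0 < phi x -> 0 < q x -> U x -> c <= q x) ->
  (forall k x, 0 < k < k0 -> 0 < phi x -> 0 < q x -> U x -> lam <= dv (Xk phi k) x) ->
  Pb U p ->
  Pb (U `\` [set x | 0 < phi x /\ 0 < q x])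
     (p - lam * fine (leb (U `&` [set x | 0 < phi x /\ 0 < q x]))).
Proof.
move=> mU hphi hq c0 k00 qr qc Xl hp; set G := [set x | _].
have mG : measurable G := measurable_pos2 (Ck_cont hphi) (Ck_cont hq).
have mA := measurableC mU.
have h := touch mA hphi hq c0 k00 qr (fun x a b nn => qc x a b (contrapT nn))
  (fun k x a b e nn => Xl k x a b e (contrapT nn)) (PbC mU hp).
rewrite -/G in h.
have E1 : (~` U `|` G) `\` ~` U = U `&` G.
  by apply/seteqP; split=> [z [[h1|h1] h2]|z [h1 h2]]; [by []|split=> //; exact: contrapT|split; [right|]].
have E2 : U `\` G = ~` (~` U `|` G) by rewrite setCU setCK.
rewrite E1 in h; rewrite E2; apply: PbC h.
exact: measurableU.
Qed.

Lemma Ck_q (c : R) x k : Ck k (fun z => c - nsq (z - x)).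
Proof. by apply: CkB; [exact: Ck_cst|exact: Ck_nsq]. Qed.

Lemma q_pos (a : R) x z : 0 <= a -> (0 < a ^+ 2 - nsq (z - x)) = (enorm (z - x) < a).
Proof. by move=> a0; rewrite subr_gt0 nsqE ltr_pXn2r ?nnegrE ?enorm_ge0. Qed.

Lemma q_out (a : R) x z : 0 <= a -> a + enorm x <= enorm z -> a ^+ 2 - nsq (z - x) <= 0.
Proof.
move=> a0 h; rewrite leNgt q_pos// -leNgt; have := enorm_dist z x => h'.
have := ler_norm (enorm z - enorm x); lra.
Qed.

(** With [phi] constant the calibrating field is 0, and the cut-off depends on [q] alone: a piece of
    [U] well inside a ball that misses [D] is deleted at no cost. *)
Lemma good_exterior D x rho : 0 < rho -> (forall z, eball x (2 * rho) z -> ~ D z) -> good D x rho 0.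
Proof.
move=> r0 hx U p mU UD hp; rewrite mul0r addr0.
have r2 : 0 <= 2 * rho by lra.
pose q z := (2 * rho) ^+ 2 - nsq (z - x).
have c0 : 0 < 3 * rho ^+ 2 by rewrite mulr_gt0// exprn_gt0.
have qE z : 0 < q z <-> eball x (2 * rho) z by rewrite /q q_pos.
have h := @Pb_remove U (fun=> 1) q (3 * rho ^+ 2) 0 1 (2 * rho + enorm x) p mU (Ck_cst 2 1) (Ck_q _ _ 1) c0 ltr01 _ _ _ hp.
have -> : U `&` D = U `\` [set z | 0 < (1 : R) /\ 0 < q z].
  apply/seteqP; split=> z [Uz h1]; split=> //.
    by move=> [_ /qE/hx].
  apply: contrapT => nD; apply: h1; split=> //; apply/qE; have := UD z (conj Uz nD).
  by apply: eball_le; lra.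
rewrite mul0r subr0 in h; apply: h.
- by move=> z; exact: q_out.
- move=> z _ /qE qz Uz; have : eball x rho z by apply: UD; split=> //; exact: hx.
  rewrite /eball /= /q => hz.
  have : nsq (z - x) <= rho ^+ 2 by rewrite nsqE ler_pXn2r ?nnegrE ?enorm_ge0 ?(ltW r0)// ltW.
  rewrite exprMn (_ : 2 ^+ 2 = 4); last by ring.
  lra.
- move=> k z _ _ _ _; rewrite /dv big1// => i _.
  have -> : Xk (fun=> 1) k i = (fun=> 0 : R).
    by apply/funext => y; rewrite /Xk partial_cst mul0r.
  by rewrite partial_cst.
Qed.

Lemma dv_Xk phi k x : 0 < k -> Ck 2 phi -> dv (Xk phi k) x =
  lap phi x * (Num.sqrt (gsq phi x + k))^-1 -
  (2 * (gsq phi x + k) * Num.sqrt (gsq phi x + k))^-1 * \sum_i partial i phi x * partial i (gsq phi) x.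
Proof.
move=> k0 h; have sk : 0 < gsq phi x + k by have := gsq_ge0 phi x; lra.
rewrite /dv /lap mulr_suml mulr_sumr -sumrB; apply: eq_bigr => i _.
have c1 : Ck 1 (fun z => (Num.sqrt (gsq phi z + k))^-1) := Ck_comp (Sk_rsqrt k0) (Ck_gsq h) (gsq_ge0 phi).
rewrite (@partialM _ _ 0 (partial i phi)); [|exact: Ck_partial|exact: c1].
rewrite (partial_comp (h' := fun s => - (2 * (s + k) * Num.sqrt (s + k))^-1) i (is_derive_rsqrt sk) (Ck_gsq h)).
by rewrite addrC [X in X + _]mulrC; ring.
Qed.

Lemma bounded_on_ball (f : V -> R) x r : continuous f -> exists2 M, 0 <= M & forall z, enorm (z - x) <= r -> `|f z| <= M.
Proof.
move=> cf; have cK := @compact_eball_closed R d x r.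
have cfK := continuous_compact (continuous_subspaceT cf) cK.
have [M [_ hM]] := compact_bounded cfK.
exists (`|M| + 1) => [|z hz]; first by rewrite addr_ge0.
by apply: (hM (`|M| + 1)); [rewrite ltr_pwDr// ler_norm|exists z].
Qed.

(** A positive lower bound for the gradient keeps the divergence bounded uniformly in the
    regularisation [k]. *)
Lemma dv_Xk_bound phi x r gam : Ck 2 phi -> 0 < gam -> (forall z, gam <= gsq phi z) ->
  exists2 C, 0 <= C & forall k z, 0 < k < 1 -> enorm (z - x) <= r -> - C <= dv (Xk phi k) z.
Proof.
move=> h g0 hg.
have c1 : continuous (lap phi) by apply: (Ck_cont (k := 0)); apply: Ck_sum => i; do 2!apply: Ck_partial.
have c2 : continuous (fun z => \sum_i partial i phi z * partial i (gsq phi) z).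
  apply: (Ck_cont (k := 0)); apply: Ck_sum => i; apply: CkM; last exact: Ck_partial (Ck_gsq h).
  by apply: CkS; exact: Ck_partial.
have [M1 M10 h1] := bounded_on_ball x r c1; have [M2 M20 h2] := bounded_on_ball x r c2.
pose s := Num.sqrt gam; have s0 : 0 < s by rewrite sqrtr_gt0.
have a1 : 0 <= M1 * s^-1 by rewrite mulr_ge0// invr_ge0 ltW.
have a2 : 0 <= (2 * gam * s)^-1 * M2 by rewrite mulr_ge0// invr_ge0 mulr_ge0 ?(ltW s0)// mulr_ge0// ltW.
exists (M1 * s^-1 + (2 * gam * s)^-1 * M2) => [|k z /andP[k0 k1] hz]; first exact: addr_ge0.
rewrite dv_Xk//; have gz := hg z.
set S := Num.sqrt (gsq phi z + k).
have sS : s <= S by rewrite ler_sqrt; lra.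
have S0 : 0 < S by lra.
have b1 : `|lap phi z * S^-1| <= M1 * s^-1.
  rewrite normrM [X in _ * X]ger0_norm ?invr_ge0 ?(ltW S0)//; apply: ler_pM; rewrite ?invr_ge0 ?(ltW S0)//; first exact: h1.
  by rewrite lef_pV2 ?posrE.
have b2 : `|(2 * (gsq phi z + k) * S)^-1 * \sum_i partial i phi z * partial i (gsq phi) z| <= (2 * gam * s)^-1 * M2.
  have gk : 0 < gsq phi z + k by lra.
  have p0 : 0 < 2 * (gsq phi z + k) * S by rewrite !mulr_gt0.
  rewrite normrM [X in X * _]ger0_norm ?invr_ge0 ?(ltW p0)//; apply: ler_pM; rewrite ?invr_ge0 ?(ltW p0)//; last exact: h2.
  rewrite lef_pV2 ?posrE ?mulr_gt0//; apply: ler_pM; rewrite ?mulr_ge0 ?(ltW s0) ?(ltW g0)//.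
  by rewrite ler_wpM2l//; lra.
move: b1 b2; rewrite !ler_norml => /andP[b1 _] /andP[_ b2]; rewrite opprD; exact: lerB.
Qed.

End boundary_balls.

Section boundary_charts.
Context {R : realType} {d : nat}.
Local Notation V := 'rV[R]_d.
Local Notation rint := (mintegral (@leb R d)).
Local Notation itg := (mintegrable (@leb R d)).
Implicit Types (x y z h v : V) (r s p C rho : R) (U A D Z : set V) (phi q : V -> R).

(* Infinitely many translates of [Z] are disjoint and lie in one ball. *)
Lemma null_level phi v x r Z : measurable Z -> Z `<=` eball x r ->
  (forall z s, phi (z + s *: v) = phi z - s) -> (forall z, Z z -> phi z = 0) -> leb Z = 0%E.
Proof.
move=> mZ Zr hv Z0.
have fZ : (leb Z < +oo)%E := leb_sub_lty mZ (measurable_eball x r) Zr (leb_eball_lty x r).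
pose B := eball x (r + enorm v).
have iB := itg_indic (measurable_eball x (r + enorm v)) (leb_eball_lty _ _).
have iZ := itg_indic mZ fZ.
pose t (n : nat) : R := n.+1%:R^-1.
have t01 n : 0 < t n <= 1 by rewrite /t invr_gt0 ltr0n invf_le1// ler1n.
have sh n := int_shift (- t n *: v) iZ.
have key N : N%:R * rint \1_Z <= rint \1_B.
  have -> : N%:R * rint \1_Z = \sum_(j < N) rint (fun z => \1_Z (z + - t j *: v)).
    rewrite (eq_bigr (fun=> rint \1_Z)); last by move=> j _; exact: (sh j).2.
    by rewrite sumr_const card_ord mulr_natl.
  have iS : itg (fun z => \sum_(j < N) \1_Z (z + - t j *: v)) by apply: itg_sum => j; exact: (sh j).1.
  rewrite -int_sum; last by move=> j; exact: (sh j).1.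
  apply: int_le iS iB _ => z.
  have B0 : 0 <= (\1_B z : R) by case/andP: (indic01 B z).
  have [[j hj]|nj] := pselect (exists j : 'I_N, Z (z + - t j *: v)); last first.
    by rewrite big1// => j _; rewrite indicE memNset//; apply: contra_not nj => h; exists j.
  have pz : phi z = - t j.
    by have := hv z (- t j); rewrite (Z0 _ hj); lra.
  rewrite (bigD1 j)//= big1 => [|k kj]; last first.
    rewrite indicE memNset// => hk; have := hv z (- t k); rewrite (Z0 _ hk) pz => e.
    have e2 : t k = t j by lra.
    move/invr_inj/eqP: e2; rewrite eqr_nat eqSS => /eqP e3.
    by move/eqP: kj; apply; apply: val_inj.
  rewrite addr0 [leRHS]indicE mem_set; first by case/andP: (indic01 Z (z + - t j *: v)).
  have := Zr _ hj; rewrite /B /eball /= => h1.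
  have h2 := enorm_triangle z (z + - t j *: v) x.
  rewrite opprD addNKr -scaleNr opprK enormZ in h2.
  have [t0 t1] := andP (t01 j); rewrite ger0_norm ?(ltW t0)// in h2.
  have := ler_wpM2r (enorm_ge0 v) t1; rewrite mul1r; lra.
have Z00 : 0 <= rint \1_Z by rewrite int_indic// fine_ge0.
have e : rint \1_Z = 0.
  apply/eqP; rewrite eq_le Z00 andbT leNgt; apply/negP => h.
  have [N hN] : exists N : nat, rint \1_B / rint \1_Z < N%:R.
    exists (Num.truncn (rint \1_B / rint \1_Z)).+1; apply: truncnS_gt.
  by rewrite ltr_pdivrMr// in hN; have := key N; rewrite leNgt hN.
by rewrite -(@fineK _ (leb Z)) ?ge0_fin_numE// -(int_indic _ mZ) e.
Qed.

(** In the chart, the exterior of [D] is the set [phi >= 0] and [phi] decreases at unit rate along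
    [v], so its gradient is bounded below and [Pb_remove] applies to the set [phi > 0]. The level
    [phi = 0] remains and is null. *)
Lemma good_boundary D x r (Q : 'M[R]_d) (i : 'I_d) (g : 'rV[R]_d.-1 -> R) : measurable D ->
  0 < r -> Q *m Q^T = 1%:M -> Ck 2 g ->
  (forall z, eball x r z -> (D z <-> g (col' i (z *m Q)) < (z *m Q) 0 i)) ->
  exists rho C, 0 < rho /\ good D x rho C.
Proof.
move=> mD r0 QQ hg hD.
pose phi z := g (z *m col' i Q) - (z *m Q) 0 i.
have hphi : Ck 2 phi.
  apply: CkB; first exact: Ck_linear.
  exact: (@Ck_linear R d d 2 (fun w => w 0 i) Q (@Ck_coord R d 2 i)).
have colE z : col' i (z *m Q) = z *m col' i Q.
  by apply/rowP => j; rewrite !mxE; apply: eq_bigr => l _; rewrite !mxE.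
have Dphi z : eball x r z -> (D z <-> phi z < 0).
  by move=> hz; rewrite /phi subr_lt0 -colE; exact: hD.
pose v : V := (delta_mx 0 i : V) *m Q^T.
have vQ : v *m Q = delta_mx 0 i by rewrite /v -mulmxA mulmx1C// mulmx1.
have hv z s : phi (z + s *: v) = phi z - s.
  rewrite /phi -!colE mulmxDl -scalemxAl vQ.
  have -> : col' i (z *m Q + s *: delta_mx 0 i) = col' i (z *m Q).
    by apply/rowP => j; rewrite !mxE eq_sym (negbTE (neq_lift _ _)) andbF mulr0 addr0.
  by rewrite !mxE !eqxx mulr1 opprD addrA.
have dphi z : \sum_j v 0 j * partial j phi z = -1.
  have h1 := Ck1_dir z v (CkS hphi).
  have h2 : is_derive z v phi (-1).
    apply/is_derive_line0.
    have -> : (fun s => phi (z + s *: v)) = (fun s => phi z - s) by apply/funext => s; exact: hv.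
    have := @is_deriveB R R R (fun=> phi z) id 0 1 0 1 _ _.
    by rewrite sub0r; apply.
  by rewrite -(@derive_val _ _ _ _ _ _ _ h1) (@derive_val _ _ _ _ _ _ _ h2).
(* Cauchy-Schwarz for the derivative -1 of [phi] along [v]. *)
have gz z : 1 <= nsq v * gsq phi z.
  pose G : V := \row_j partial j phi z.
  have GE j : G 0 j = partial j phi z by rewrite mxE.
  have dE : dot v G = -1 by rewrite -(dphi z); apply: eq_bigr => j _; rewrite GE.
  have gE : gsq phi z = enorm G ^+ 2 by rewrite enorm_sqr; apply: eq_bigr => j _; rewrite GE expr2.
  have := dot_le v G; rewrite dE normrN1 gE nsqE -exprMn => h1.
  by rewrite -(expr1n _ 2) ler_pXn2r ?nnegrE ?mulr_ge0 ?enorm_ge0.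
have nv : 0 < nsq v.
  rewrite lt_neqAle nsq_ge0 andbT; apply/eqP => e; have := gz 0; rewrite -e mul0r ler10.
  by [].
have gz' z : (nsq v)^-1 <= gsq phi z by rewrite -[leLHS]mul1r ler_pdivrMr// mulrC.
have nv' : 0 < (nsq v)^-1 by rewrite invr_gt0.
have [C C0 hC] := @dv_Xk_bound R d phi x r (nsq v)^-1 hphi nv' gz'.
exists (r / 2), C; split=> [|U p mU UD hp]; first lra.
pose q z := r ^+ 2 - nsq (z - x).
have qE z : 0 < q z <-> eball x r z by rewrite /q q_pos// ltW.
have hq : Ck 1 q := Ck_q (r ^+ 2) x 1.
pose G := [set z | 0 < phi z /\ 0 < q z].
have mG : measurable G := measurable_pos2 (Ck_cont hphi) (Ck_cont hq).
have c0 : 0 < 3 * (r / 2) ^+ 2 by rewrite mulr_gt0// exprn_gt0// divr_gt0.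
have GD z : G z -> ~ D z by move=> [p1 /qE qz] /(Dphi _ qz); lra.
have h := @Pb_remove R d U phi q (3 * (r / 2) ^+ 2) (- C) 1 (r + enorm x) p mU hphi hq c0 ltr01 _ _ _ hp.
rewrite -/G mulNr opprK in h.
have {}h : Pb (U `\` G) (p + C * fine (leb (U `&` G))).
  apply: h.
  - by move=> z; apply: q_out; exact: ltW.
  - move=> z pz qz Uz; have /UD : (U `\` D) z by split=> //; exact: GD.
    rewrite /eball /= /q => hz.
    have : nsq (z - x) <= (r / 2) ^+ 2.
      by rewrite nsqE ler_pXn2r ?nnegrE ?enorm_ge0 ?divr_ge0 ?(ltW r0)// ltW.
    have -> : r ^+ 2 = 4 * (r / 2) ^+ 2 by field.
    lra.
  - by move=> k z hk pz /qE qz _; apply: hC => //; apply: ltW.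
have mUD := measurableD mU mD; have mUG := measurableI _ _ mU mG.
have UGD : U `&` G `<=` U `\` D by move=> z [? /GD].
have fUD : (leb (U `\` D) < +oo)%E := leb_sub_lty mUD (measurable_eball x (r / 2)) UD (leb_eball_lty _ _).
have fUG := leb_sub_lty mUG mUD UGD fUD.
have hle : fine (leb (U `&` G)) <= fine (leb (U `\` D)).
  by rewrite fine_le ?ge0_fin_numE//; apply: le_measure; rewrite ?inE.
(* The part of the graph in [U]: neither in [D] nor removed with [G]. *)
pose Z := (U `\` G) `\` D.
have mZ : measurable Z := measurableD (measurableD mU mG) mD.
have Zr : Z `<=` eball x r by move=> z [[Uz _] nD]; apply: eball_le (UD z (conj Uz nD)); lra.
have Z0 z : Z z -> phi z = 0.
  move=> Zz; have bz := Zr _ Zz; case: Zz => -[Uz nG] nD; apply/eqP; rewrite eq_le.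
  rewrite leNgt; apply/andP; split.
    by apply/negP => h1; apply: nG; split=> //; exact/qE.
  by rewrite leNgt; apply/negP => h1; apply: nD; exact/(Dphi _ bz).
have nZ := null_level mZ Zr hv Z0.
have h2 : Pb (U `&` D) (p + C * fine (leb (U `&` G))).
  apply: Pb_ae h; [exact: measurableD|exact: measurableI|].
  exists Z; split=> // z /= hz; apply: contrapT => nZz; apply: hz.
  rewrite !indicE in_setI in_setD; have [Uz|nU] := pselect (U z); last by rewrite (memNset nU).
  rewrite (mem_set Uz)/=; have [Dz|nD] := pselect (D z).
    by rewrite (mem_set Dz) memNset// => /GD.
  rewrite (memNset nD) mem_set//; apply: contrapT => nG; apply: nZz; split=> //; split=> //.
move=> F s fF; apply: (le_trans (h2 F s fF)); rewrite lerD2l; exact: ler_wpM2l.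
Qed.

Lemma nbhs_eball_sub x U : nbhs x U -> exists2 e, 0 < e & eball x e `<=` U.
Proof.
move=> /nbhs_normP[e e0 he]; exists e => // z; rewrite /eball /= => hz; apply: he.
by rewrite /= -normrN opprB; exact: le_lt_trans (norm_le_enorm _) hz.
Qed.

Lemma good_uniform D : open D -> bounded_set D -> C2_boundary D ->
  exists rho C, [/\ 0 < rho, 0 <= C & forall x, good D x rho C].
Proof.
move=> oD bD hD; have mD := open_measurable_leb oD.
have [M [M0 hM]] : exists M, 0 < M /\ forall z, D z -> enorm z <= M.
  have [M [_ hM]] := bD; exists (d%:R * (`|M| + 1) + 1); split.
    by rewrite ltr_wpDl// mulr_ge0// addr_ge0.
  move=> z Dz; apply: (le_trans (enorm_le_norm z)); rewrite -[leLHS]addr0; apply: lerD => //.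
  by rewrite ler_wpM2l//; apply: hM Dz; rewrite ltr_pwDr// ler_norm.
have loc x : exists rho C, 0 < rho /\ good D x rho C.
  have [Dx|nD] := pselect (D x).
    have [e e0 he] := nbhs_eball_sub (open_nbhs_nbhs (conj oD Dx)).
    by exists e, 0; split=> //; exact: good_interior.
  have [cx|ncx] := pselect (closure D x).
    have [] := hD x; first by split=> //; apply: contra_not nD; exact: interior_subset.
    move=> r [Q [i [g [r0 QQ hg hd]]]]; exact: (good_boundary mD r0 QQ hg hd).
  have oC : open (~` closure D) by apply: closed_openC; exact: closed_closure.
  have [e e0 he] := nbhs_eball_sub (open_nbhs_nbhs (conj oC ncx)).
  exists (e / 2), 0; split; first lra.
  apply: good_exterior => [|z hz Dz]; first lra.
  apply: (he z); last exact: subset_closure.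
  by apply: eball_le hz; lra.
pose K : set V := [set z | enorm (z - 0) <= M + 2].
have cK : compact K := @compact_eball_closed R d 0 (M + 2).
(* One integer [n] encodes both the radius [1 / (n + 1)] and the constant [n], so that compactness
   yields both at once; points outside [K] are at distance more than 2 from [D]. *)
have [|N _ hN] := (compact_near_coveringP K).1 cK nat \oo (fun n x => good D x n.+1%:R^-1 n%:R) _.
  move=> x _; have [rho [C [r0 hg]]] := loc x.
  have [N1 hN1] : exists N : nat, 2 / rho < N%:R by exists (Num.truncn (2 / rho)).+1; exact: truncnS_gt.
  have [N2 hN2] : exists N : nat, C < N%:R by exists (Num.truncn C).+1; exact: truncnS_gt.
  exists (eball x (rho / 2), [set n | (N1 + N2 <= n)%N]).
    split=> /=; last by exists (N1 + N2)%N.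
    by apply: open_nbhs_nbhs; split; [exact: open_eball|rewrite /eball /= subrr enorm0 divr_gt0].
  move=> [y n] /= [hy hn]; apply: good_le hg _ _.
    move=> z; rewrite /eball /= => hz; rewrite /eball /= in hy.
    have h1 := enorm_triangle z y x.
    have h2 : n.+1%:R^-1 <= rho / 2 :> R.
      rewrite -[rho / 2]invrK lef_pV2 ?posrE ?invr_gt0 ?divr_gt0// invf_div ltW//.
      by apply: (lt_le_trans hN1); rewrite ler_nat (leq_trans (leq_addr N2 N1))// (leq_trans hn).
    apply: (le_lt_trans h1); rewrite [ltRHS]splitr; apply: ltrD => //; exact: lt_le_trans hz h2.
  by apply: (le_trans (ltW hN2)); rewrite ler_nat (leq_trans (leq_addl N1 N2)).
exists (Num.min (N.+1%:R^-1) 1), N%:R; split=> // x.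
have [Kx|nK] := pselect (K x).
  apply: (good_le (hN N (leqnn N) x Kx) _ (lexx _)).
  by apply: eball_le; rewrite ge_min lexx.
apply: (@good_le _ _ D x 1 0) => [|z|//].
  apply: good_exterior => // z; rewrite /eball /= => hz Dz; apply: nK; rewrite /K /= subr0.
  have := hM z Dz; have := enorm_triangle x z 0; rewrite !subr0 enormB; lra.
by apply: eball_le; rewrite ge_min lexx orbT.
Qed.

Lemma perimeter_ge0 U : (0 <= perimeter U)%E.
Proof.
apply: ereal_sup_ubound; exists (cst 0).
  split=> [i||x]; first by under eq_fun do rewrite mxE; exact: Ck_cst.
    exists set0; split=> //; exact: compact0.
  by rewrite enorm0 ler01.
rewrite (_ : (fun x => _) = cst 0%E) ?integral0//; apply/funext => x; congr EFin.
by rewrite /divergence big1// => i _; under eq_fun do rewrite mxE; rewrite partial_cst.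
Qed.

Lemma leb_subset A B : measurable A -> measurable B -> A `<=` B -> leb B = (leb A + leb (B `\` A))%E.
Proof.
move=> mA mB AB; have mD := measurableD mB mA; rewrite -[in LHS](setUIDK B A) setIidr//.
by rewrite measureU// setDE setICA setICr setI0.
Qed.

(** A competitor [U] is compared with its intersection with [D], which is admissible in [D]; the
    volumes added inside and outside [D] are paid for by [mu] and [C], whence their maximum. *)
Lemma good_supersolution D Om mu rho C p0 : measurable D -> measurable Om -> Om `<=` D ->
  perimeter Om = p0%:E -> (leb Om < +oo)%E -> 0 < rho -> 0 <= C -> (forall x, good D x rho C) ->
  local_supersolution mu D Om -> exists mu1 : R, local_supersolution mu1 setT Om.
Proof.
move=> mD mO OD eO fO r0 C0 hg [r1 r10 hr1].
exists (Num.max mu C), (Num.min r1 rho) => [|U mU OU _ [x0 hx0]]; first by rewrite lt_min r10.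
have b1 : eball x0 (Num.min r1 rho) `<=` eball x0 r1 by apply: eball_le; rewrite ge_min lexx.
have b2 : eball x0 (Num.min r1 rho) `<=` eball x0 rho by apply: eball_le; rewrite ge_min lexx orbT.
have UOb : U `\` Om `<=` eball x0 (Num.min r1 rho) by move=> z h; apply: hx0; left.
have mUO := measurableD mU mO; have mUD := measurableD mU mD.
have mW := measurableI _ _ mU mD; have mWO := measurableD mW mO.
have fin A : measurable A -> A `<=` U `\` Om -> (leb A < +oo)%E.
  move=> mA h; apply: leb_sub_lty mA (measurable_eball x0 rho) _ (leb_eball_lty _ _).
  by move=> z /h/UOb/b2.
have UDO : U `\` D `<=` U `\` Om by move=> z [? h]; split=> // /OD.
have WOO : (U `&` D) `\` Om `<=` U `\` Om by move=> z [[? ?] ?].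
have fUD := fin _ mUD UDO; have fWO := fin _ mWO WOO.
have OW : Om `<=` U `&` D by move=> z h; split; [exact: OU|exact: OD].
have eU : leb U = (leb (U `&` D) + leb (U `\` D))%E.
  rewrite (leb_subset mW mU (@subIsetl _ _ _)).
  by congr (_ + leb _)%E; apply/seteqP; split=> z [h1 h2]; split=> //; [move=> h; apply: h2|case].
rewrite eU (leb_subset mO mW OW) eO.
have [hU|hU] := eqVneq (perimeter U) +oo%E.
  rewrite hU; have n0 : (0 <= leb Om)%E := measure_ge0 _ _.
  have n1 : (0 <= leb ((U `&` D) `\` Om))%E := measure_ge0 _ _.
  have n2 : (0 <= leb (U `\` D))%E := measure_ge0 _ _.
  move: fO fUD fWO n0 n1 n2; case: (leb Om) => [a||]//; case: (leb (_ `\` Om)) => [b||]//.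
  by case: (leb (_ `\` D)) => [c||]// _ _ _ _ _ _; rewrite -!EFinD -EFinM addye// leey.
have [p hp] : exists p, perimeter U = p%:E.
  by exists (fine (perimeter U)); rewrite fineK// ge0_fin_numE ?perimeter_ge0// ltey.
have hPU : Pb U p by apply/(perimeterP p mU); rewrite hp.
have hW := hg x0 U p mU (subset_trans UDO (subset_trans UOb b2)) hPU.
have hpW := (perimeterP _ mW).2 hW.
have := hr1 (U `&` D) mW OW (@subIsetr _ _ _).
have -> : (exists x1, (U `&` D) `+` Om `<=` eball x1 r1) = True.
  apply/propext; split=> // _; exists x0 => z [h|[h1 h2]]; first by apply/b1/UOb/WOO.
  by case: h2; apply: OW.
move=> /(_ I); rewrite eO (leb_subset mO mW OW) hp.
have n0 : (0 <= leb Om)%E := measure_ge0 _ _.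
have n1 : (0 <= leb ((U `&` D) `\` Om))%E := measure_ge0 _ _.
have n2 : (0 <= leb (U `\` D))%E := measure_ge0 _ _.
move: fO fUD fWO n0 n1 n2 hpW; case: (leb Om) => [a||]//; case: (leb (_ `\` Om)) => [b||]//.
case: (leb (_ `\` D)) => [c||]// _ _ _ _; rewrite !lee_fin => b0 c0 hpW h.
have := le_trans h (leeD2r _ hpW); rewrite /= -EFinD -!EFinM -!EFinD lee_fin => {}h.
have [m1 m2] : mu <= Num.max mu C /\ C <= Num.max mu C by rewrite !le_max !lexx orbT.
have h1 := ler_wpM2r b0 m1; have h2 := ler_wpM2r c0 m2.
move: h h1 h2; rewrite !mulrDr; move: (Num.max mu C) => M.
move: (mu * a) (mu * b) (C * c) (M * a) (M * b) (M * c) => t1 t2 t3 t4 t5 t6; lra.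
Qed.

End boundary_charts.

(** * Averages of the torsion function *)

Section mean_values.
Context {R : realType} {d : nat}.
Local Notation V := 'rV[R]_d.
Local Notation rint := (mintegral (@leb R d)).
Local Notation itg := (mintegrable (@leb R d)).
Local Notation pd phi := (fun i => partial i phi).
Implicit Types (x y z h : V) (r s : R) (u v k f phi K : V -> R) (i : 'I_d).

Lemma Ccoo_Kpot r : 0 < r -> Ccoo setT (Kpot r : V -> R).
Proof.
move=> r0; split=> [k|]; first exact: Ck_Kpot.
by apply/csuppP; exists r; exact: Kpot_supp.
Qed.

Lemma Kpot_even r z : Kpot r (- z) = Kpot r z.
Proof. by rewrite /Kpot /karg !nsqE enormN. Qed.

Lemma int_reflect_even K x : Ccoo setT K -> (forall z, K (- z) = K z) ->
  rint (fun y => K (x - y)) = rint K.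
Proof.
move=> hK hE; have [_ <-] := int_shift (- x) (Ccoo_itg hK); congr mintegral; apply/funext => y.
by rewrite -hE opprB.
Qed.

(** This constant reappears in the correction [C r^2] that makes the averages monotone. *)
Lemma int_Kpot_le : exists2 C : R, 0 <= C & forall r, 0 < r -> rint (Kpot r : V -> R) <= C * r ^+ 2.
Proof.
have km := @kmass_gt0 R d.
pose m := @kmass R d; rewrite -/m in km.
exists (m^-1 * 2^-1 * 2 ^+ d) => [|r r0]; first by rewrite !mulr_ge0 ?invr_ge0 ?(ltW km)// exprn_ge0.
pose c := m^-1 * (2^-1 * r ^+ 2 * r^-1 ^+ d).
have c0 : 0 <= c by rewrite !mulr_ge0 ?invr_ge0 ?(ltW km) ?exprn_ge0 ?invr_ge0 ?(ltW r0).
have i1 := itg_indic (measurable_eball (0 : V) r) (leb_eball_lty (0 : V) r).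
apply: (@le_trans _ _ (rint (fun z => c * \1_(eball (0 : V) r) z))).
  apply: int_le (Ccoo_itg (Ccoo_Kpot r0)) (itgZ c i1) _ => z.
  have [hz|hz] := ltP (enorm z) r.
    rewrite indicE mem_set /eball /= ?subr0// mulr1 /Kpot /c ler_wpM2l ?invr_ge0 ?(ltW km)//.
    rewrite -!mulrA !ler_wpM2l ?invr_ge0 ?exprn_ge0 ?(ltW r0)//.
    by rewrite ler_piMr ?em0_le1// exprn_ge0// invr_ge0 ltW.
  rewrite Kpot_supp// mulr_ge0//; by case/andP: (indic01 (eball (0 : V) r) z).
rewrite (intZ c i1) (int_indic _ (measurable_eball (0 : V) r)).
apply: (@le_trans _ _ (c * (r *+ 2) ^+ d)).
  rewrite ler_wpM2l// -lee_fin fineK ?ge0_fin_numE ?leb_eball_lty//.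
  exact: leb_eball_le (ltW r0).
have e : r^-1 ^+ d * (r *+ 2) ^+ d = 2 ^+ d.
  by rewrite -exprMn mulrnAr mulVf// gt_eqF.
have -> : c * (r *+ 2) ^+ d = m^-1 * 2^-1 * 2 ^+ d * r ^+ 2; last by [].
rewrite /c; move: e; move: (r ^+ 2) (r^-1 ^+ d) ((r *+ 2) ^+ d) (2 ^+ d) => a b b' q <-.
ring.
Qed.

Lemma lap_conv u k x r : loc u -> (forall m, Ck m k) -> supp_in r k ->
  lap (conv u k) x = conv u (lap k) x.
Proof.
move=> lu hk hr; rewrite /lap.
have hp i := supp_partial i (hk 1%N) hr; have hpp i := supp_partial i (Ck_partial i (hk 2%N)) (hp i).
have e i : partial i (partial i (conv u k)) x = conv u (partial i (partial i k)) x.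
  have -> : partial i (conv u k) = conv u (partial i k).
    by apply/funext => y; exact: partial_conv (hk 1%N) hr.
  exact: partial_conv (Ck_partial i (hk 2%N)) (hp i).
have hi i : itg (fun y => u y * partial i (partial i k) (x - y)).
  exact: itg_conv1 lu (Ck_cont (Ck_partial i (Ck_partial i (hk 2%N)))) (hpp i).
apply: (etrans (eq_bigr _ (fun i _ => e i))); apply: (etrans (esym (int_sum (index_enum _) hi))).
rewrite /conv; have -> // : (fun y => u y * \sum_i partial i (partial i k) (x - y)) =
  (fun y => \sum_i u y * partial i (partial i k) (x - y)).
by apply/funext => y; rewrite mulr_sumr.
Qed.

Lemma gip_reflect w g K x : grad w g -> Ccoo setT K ->
  gip g (pd (fun y => K (x - y))) = - conv w (lap K) x.
Proof.
move=> [hw hg] hK; have hr := Ccoo_reflect x hK; rewrite /gip /conv.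
have [s Ks] := Ccoo_supp hK.
have e1 i : partial i (fun y => K (x - y)) = (fun y => - partial i K (x - y)).
  by apply/funext => y; exact: partial_reflect (Ccoo_Ck 1 hK).
have e2 i y : partial i (partial i (fun y => K (x - y))) y = partial i (partial i K) (x - y).
  rewrite e1 (@partialN _ _ 0); last by apply: Ck_reflect; exact: Ck_partial (Ccoo_Ck 2 hK).
  by rewrite partial_reflect ?opprK//; exact: Ck_partial (Ccoo_Ck 2 hK).
have e3 i : rint (fun y => g i y * partial i (fun y => K (x - y)) y) =
    - rint (fun y => w y * partial i (partial i K) (x - y)).
  have := weakE (hg i).2 (Ccoo_partial i hr) => h.
  have -> : (fun y => w y * partial i (partial i K) (x - y)) =
      (fun y => w y * partial i (partial i (fun y => K (x - y))) y).
    by apply/funext => y; rewrite e2.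
  by rewrite h opprK.
have hi i : itg (fun y => w y * partial i (partial i K) (x - y)); last first.
  rewrite (eq_bigr _ (fun i _ => e3 i)) sumrN -(int_sum (index_enum _) hi).
  have -> // : (fun y => w y * lap K (x - y)) = (fun y => \sum_i w y * partial i (partial i K) (x - y)).
  by apply/funext => y; rewrite /lap mulr_sumr.
have hpp := Ccoo_partial i (Ccoo_partial i hK); have [s' hs'] := Ccoo_supp hpp.
exact: itg_conv1 (loc_L2 hw) (Ck_cont (Ccoo_Ck 0 hpp)) hs'.
Qed.

Section torsion_mean.
Variables (E : set V) (w : V -> R) (g : 'I_d -> V -> R).
Hypotheses (hg : grad w g).
Hypothesis w_eq : forall v (h : 'I_d -> V -> R), grad v h -> off0 E v -> gip g h = rint v.
Hypothesis w_sub : forall phi, Ccoo setT phi -> (forall x, 0 <= phi x) -> gip g (pd phi) <= rint phi.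

Let lw : loc w. Proof. exact: loc_L2 hg.1. Qed.
Local Notation W r := (conv w (kern r)).

Lemma mean_derive x r : 0 < r ->
  is_derive r (1 : R) (fun r => W r x) (- (r^-1 * gip g (pd (fun y => Kpot r (x - y))))).
Proof.
move=> r0; rewrite (gip_reflect x hg (Ccoo_Kpot r0)) mulrN opprK.
exact: is_derive_conv_kern lw r0.
Qed.

(** The derivative of the average in [r] is [- r^-1] times the pairing of [grad w] with the gradient
    of the nonnegative [Kpot]; by [- Delta w <= 1] it is at least [- r^-1 int Kpot >= - C r]. *)
Lemma mean_monotone : exists2 C : R, 0 <= C & forall x r s, 0 < r -> r <= s ->
  W r x + C * r ^+ 2 <= W s x + C * s ^+ 2.
Proof.
have [C C0 hC] := int_Kpot_le; exists C => // x r s r0 rs.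
have pos t : r <= t <= s -> 0 < t by move=> /andP[h _]; exact: lt_le_trans h.
apply: (@derive_ge0_le _ (fun t => W t x + C * t ^+ 2)
  (fun t => - (t^-1 * gip g (pd (fun y => Kpot t (x - y)))) + C * (t + t)) r s rs) => t ht.
  have h1 := mean_derive x (pos t ht).
  have h2 : is_derive t (1 : R) (fun t => C * t ^+ 2) (C * (t + t)).
    have := @is_deriveM R R id id t 1 1 1 (is_derive_id _ _) (is_derive_id _ _) => h.
    have := @is_deriveZ R R R _ C t 1 _ h.
    by rewrite /GRing.scale /= !mulr1.
  exact: is_deriveD.
have t0 := pos t ht.
have h1 := w_sub (Ccoo_reflect x (Ccoo_Kpot t0)) (fun y => Kpot_ge0 (x - y) (ltW t0)).
rewrite (int_reflect_even x (Ccoo_Kpot t0) (Kpot_even t)) in h1.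
have h2 := le_trans h1 (hC t t0).
have h3 : t^-1 * gip g (pd (fun y => Kpot t (x - y))) <= C * t.
  by rewrite mulrC ler_pdivrMr// -mulrA -expr2.
have h4 : 0 <= C * t by rewrite mulr_ge0// ltW.
by move: h3; rewrite mulrDr; move: (t^-1 * _) (C * t) h4 => a b; lra.
Qed.

Lemma gip_inside K x r : Ccoo setT K -> (forall z, K (- z) = K z) -> supp_in r K -> eball x r `<=` E ->
  gip g (pd (fun y => K (x - y))) = rint K.
Proof.
move=> hK hE Kr hx; have hr := Ccoo_reflect x hK.
rewrite (w_eq (grad_Ccoo hr)) ?(int_reflect_even x hK hE)// => y nE; apply: Kr.
by rewrite leNgt enormB; apply/negP => h; apply: nE; exact: hx.
Qed.

(** When the ball lies in [E] the equation holds exactly, so the derivative in the radius is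
    [- r^-1 int Kpot], the same at every centre: differences of averages do not depend on the
    radius. *)
Lemma mean_inside x y r s : 0 < r -> r <= s -> eball x s `<=` E -> eball y s `<=` E ->
  W r x - W r y = W s x - W s y.
Proof.
move=> r0 rs hx hy.
have key x1 y1 : eball x1 s `<=` E -> eball y1 s `<=` E -> W r x1 - W r y1 <= W s x1 - W s y1.
  move=> hx1 hy1; apply: (@derive_ge0_le _ (fun t => W t x1 - W t y1) (fun=> 0) r s rs) => // t /andP[rt ts].
  have t0 : 0 < t := lt_le_trans r0 rt.
  have e z : eball z s `<=` E -> gip g (pd (fun y => Kpot t (z - y))) = rint (Kpot t : V -> R).
    move=> hz; apply: (gip_inside (Ccoo_Kpot t0) (Kpot_even t) (Kpot_supp t0)).
    by apply: subset_trans hz; exact: eball_le.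
  have h1 := mean_derive x1 t0; rewrite (e x1 hx1) in h1.
  have h2 := mean_derive y1 t0; rewrite (e y1 hy1) in h2.
  move: (- _) h1 h2 => q h1 h2.
  by have h3 := is_deriveB h1 h2; rewrite (subrr q) in h3.
have := key x y hx hy; have := key y x hy hx.
move: (conv w (kern r) x) (conv w (kern r) y) (conv w (kern s) x) (conv w (kern s) y) => a b a' b'; lra.
Qed.

Lemma mean_lap x r : 0 < r -> eball x r `<=` E -> lap (W r) x = -1.
Proof.
move=> r0 hx; have hK := @Ccoo_kern R d r r0.
rewrite (lap_conv x lw (fun m => Ccoo_Ck m hK) (kern_supp r0)).
have := gip_reflect x hg hK; rewrite (gip_inside hK (kern_even r) (kern_supp r0) hx) int_kern// => ->.
by rewrite opprK.
Qed.

End torsion_mean.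
End mean_values.

Lemma lt_chain3 {R : realFieldType} (a b c p q e : R) : a + c < p + e / 2 -> q <= b + c ->
  - (e / 2) < a - b -> q < p + e.
Proof. lra. Qed.

Lemma lt_chain6 {R : realFieldType} (a w b1 b2 t k c : R) : a <= w + c -> w <= b1 -> b1 <= b2 ->
  b2 = a - 3 * t - k -> 0 < k -> c <= t -> 0 < t -> False.
Proof. lra. Qed.

(** * The upper semicontinuous representative *)

Section representative.
Context {R : realType} {d : nat}.
Local Notation V := 'rV[R]_d.
Local Notation rint := (mintegral (@leb R d)).
Local Notation itg := (mintegrable (@leb R d)).
Local Notation L2 := (L2fun (@leb R d)).
Implicit Types (x y z h : V) (r s e : R) (u v k f phi K : V -> R) (i : 'I_d).

Variables (E : set V) (w : V -> R) (C delta r0 : R).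
Hypotheses (oE : open E) (fE : (leb E < +oo)%E) (L2w : L2 w) (w_off : off0 E w) (w0 : forall x, 0 <= w x).
Hypotheses (C0 : 0 <= C) (mono : forall x r s, 0 < r -> r <= s ->
  conv w (kern r) x + C * r ^+ 2 <= conv w (kern s) x + C * s ^+ 2).
Hypotheses (fat : fat_complement E delta r0) (del0 : 0 < delta) (r00 : 0 < r0).

Let lw : loc w. Proof. exact: loc_L2. Qed.
Local Notation W r := (conv w (kern r)).
Local Notation M r x := (W r x + C * r ^+ 2).
(** By monotonicity this infimum is the limit as [r] tends to 0; as an infimum of continuous
    functions it is upper semicontinuous, and it is defined at every point. *)
Definition mean_inf x : R := inf [set M r x | r in [set r | 0 < r]].
Local Notation wb := mean_inf.

Let W_ge0 r x : 0 <= r -> 0 <= W r x.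
Proof. by move=> rp; apply: int_ge0 => y; rewrite mulr_ge0// kern_ge0. Qed.

Let M_ge0 r x : 0 < r -> 0 <= M r x.
Proof. by move=> rp; apply: addr_ge0; [exact: W_ge0 (ltW rp)|rewrite mulr_ge0// exprn_ge0// ltW]. Qed.

Let set_inf x : has_inf [set M r x | r in [set r | 0 < r]].
Proof. by split; [exists (M 1 x), 1 => //=|exists 0 => _ [r /= rp <-]; exact: M_ge0]. Qed.

Lemma mean_inf_le r x : 0 < r -> wb x <= conv w (kern r) x + C * r ^+ 2.
Proof. by move=> rp; apply: ge_inf; [case: (set_inf x)|exists r]. Qed.

Lemma mean_inf_ge0 x : 0 <= wb x.
Proof. by apply: lb_le_inf; [case: (set_inf x)|move=> _ [r /= rp <-]; exact: M_ge0]. Qed.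

Lemma mean_inf_lt x e : 0 < e -> exists2 r1, 0 < r1 & forall r, 0 < r -> r <= r1 ->
  conv w (kern r) x + C * r ^+ 2 < wb x + e.
Proof.
move=> e0; have [_ [r1 /= r10 <-] h] := inf_adherent e0 (set_inf x).
by exists r1 => // r rp rr; apply: le_lt_trans h; exact: mono.
Qed.

Lemma mean_inf_usc x e : 0 < e -> \forall y \near x, wb y < wb x + e.
Proof.
move=> e0; have e2 : 0 < e / 2 by lra.
have [r1 r10 h] := mean_inf_lt x e2; have {}h := h r1 r10 (lexx _).
have cW : continuous (W r1) := conv_cont lw (Ck_kern 1 r1) (kern_supp r10).
have /cvgrPdist_lt /(_ _ e2) := cW x; apply: filterS => y hy.
have h2 := mean_inf_le y r10.
by rewrite ltr_norml in hy; have [h3 _] := andP hy; exact: lt_chain3 h h2 h3.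
Qed.

Lemma mean_inf_cvg x : conv w (kern n.+1%:R^-1) x @[n --> \oo] --> wb x.
Proof.
apply/cvgrPdist_lt => e e0; have e2 : 0 < e / 2 by lra.
have [r1 r10 h] := mean_inf_lt x e2.
have p2 : 0 < e / 2 / (C + 1) by rewrite divr_gt0// ltr_wpDl.
near=> n.
have rr : n.+1%:R^-1 <= r1 by apply: ltW; near: n; exact: (near_infty_natSinv_lt (PosNum r10)).
have r2 : n.+1%:R^-1 < e / 2 / (C + 1) by near: n; exact: (near_infty_natSinv_lt (PosNum p2)).
have rle1 : n.+1%:R^-1 <= 1 :> R by rewrite invf_le1// ler1n.
have rp : 0 < n.+1%:R^-1 :> R by rewrite invr_gt0.
move: (n.+1%:R^-1 : R) rr r2 rle1 rp => r rr r2 rle1 rp.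
have h1 := h r rp rr; have h2 := mean_inf_le x rp.
have h3 : C * r ^+ 2 < e / 2.
  rewrite ltr_pdivlMr ?ltr_wpDl// in r2.
  have a1 : r ^+ 2 <= r by rewrite expr2 ler_piMr// ltW.
  have a2 := ler_wpM2l C0 a1; have a3 : r * (C + 1) = C * r + r by ring.
  move: r2 a2 a3 rp; move: (C * r ^+ 2) (C * r) (r * _) => u v t; move=> *; lra.
have h4 : 0 <= C * r ^+ 2 by rewrite mulr_ge0// exprn_ge0// ltW.
rewrite ltr_norml; move: h1 h2 h3 h4; move: (conv w (kern r) x) (C * r ^+ 2) (wb x) => a b c.
move=> *; apply/andP; split; lra.
Unshelve. all: by end_near. Qed.

Lemma measurable_mean_inf : measurable_fun setT wb.
Proof.
apply: (@measurable_fun_cvg _ _ _ setT (fun n => conv w (kern n.+1%:R^-1))) => [n|x _]; last exact: mean_inf_cvg.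
have rp : 0 < n.+1%:R^-1 :> R by rewrite invr_gt0.
exact: continuous_measurable_leb (conv_cont lw (Ck_kern 1 _) (kern_supp rp)).
Qed.

(** Averages converge to [w] in L^2 and to [mean_inf] pointwise; Fatou's lemma identifies the
    limits. *)
Lemma mean_inf_ae : {ae @leb R d, forall x, w x = wb x}.
Proof.
pose D x := (wb x - w x) ^+ 2.
have key e : 0 < e -> itg D /\ rint D <= e.
  move=> e0; have [s s0 hs] := mollify_L2 L2w e0.
  have [N _ hN] := near_infty_natSinv_lt (PosNum s0).
  have pos n : 0 < (n + N).+1%:R^-1 :> R by rewrite invr_gt0.
  pose fn n x := (W (n + N).+1%:R^-1 x - w x) ^+ 2.
  apply: (@int_fatou _ _ _ _ fn D e) => [n|n x|x|n].
  - by have [_ h] := L2B (kern_conv_L2 (pos n) L2w).1 L2w.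
  - exact: sqr_ge0.
  - have h : conv w (kern n.+1%:R^-1) x @[n --> \oo] --> wb x := @mean_inf_cvg x; rewrite -(cvg_shiftn N) in h.
    have h2 : (W (n + N).+1%:R^-1 x - w x) @[n --> \oo] --> wb x - w x.
      by apply: cvgB; [exact: h|exact: cvg_cst].
    rewrite /D expr2 /fn; under eq_fun do rewrite expr2; exact: (cvgM h2 h2).
  - by apply/ltW/hs => //; apply: hN => /=; exact: leq_addl.
have iD := (key 1 ltr01).1.
have D0 : rint D = 0.
  apply/eqP; rewrite eq_le int_ge0 ?andbT; last by move=> x; exact: sqr_ge0.
  by apply/ler_addgt0Pr => e e0; rewrite add0r; exact: (key e e0).2.
have := int_eq0_ae iD (fun x => sqr_ge0 _) D0; apply: filterS => x /eqP.
by rewrite sqrf_eq0 subr_eq0 => /eqP.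
Qed.

Lemma conv_mean_inf r x : conv w (kern r) x = rint (fun y => wb y * \1_E y * kern r (x - y)).
Proof.
apply: int_ae.
- apply: measurable_funM; first exact: L2w.1.
  exact: continuous_measurable_leb (cont_reflect (Ck_cont (Ck_kern 0 r))).
- apply: measurable_funM; last exact: continuous_measurable_leb (cont_reflect (Ck_cont (Ck_kern 0 r))).
  by apply: measurable_funM; [exact: measurable_mean_inf|exact: measurable_indic_leb (open_measurable_leb oE)].
- apply: filterS mean_inf_ae => y e; congr (_ * _); rewrite indicE.
  have [Ey|nE] := pselect (E y); first by rewrite mem_set// mulr1.
  by rewrite memNset// mulr0 w_off.
Qed.

Lemma itg_conv_mean_inf r x : 0 < r -> itg (fun y => wb y * \1_E y * kern r (x - y)).
Proof.
move=> rp; apply: (itg_ae _ (@itg_conv1 R d w (kern r) r x lw (Ck_cont (Ck_kern 0 r)) (kern_supp rp))).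
  apply: measurable_funM; last exact: continuous_measurable_leb (cont_reflect (Ck_cont (Ck_kern 0 r))).
  by apply: measurable_funM; [exact: measurable_mean_inf|exact: measurable_indic_leb (open_measurable_leb oE)].
apply: filterS mean_inf_ae => z e; congr (_ * _); rewrite indicE.
have [Ez|nEz] := pselect (E z); first by rewrite mem_set// mulr1.
by rewrite memNset// mulr0 w_off.
Qed.

(** If the value at [y] were [a > 0], semicontinuity would keep nearby values below [a + a kap / 4],
    while the complement takes a fixed fraction [kap] of the kernel mass, where the averaged
    function is 0. The average would then fall below [a] by more than [C r^2] allows. *)
Lemma mean_inf_off0 : off0 E wb.
Proof.
move=> y nE; apply/eqP; rewrite eq_le mean_inf_ge0 andbT leNgt; apply/negP => a0.
set a := wb y in a0; have [c c0 hc] := @kern_lower R d.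
pose kap := c * delta * (2^-1) ^+ d.
have k0 : 0 < kap by rewrite mulr_gt0 ?mulr_gt0// exprn_gt0.
have e0 : 0 < a * kap / 4 by rewrite divr_gt0// mulr_gt0.
have [s s0 hs] := nbhs_eball_sub (mean_inf_usc y e0).
have p2 : 0 < a * kap / 4 / (C + 1) by rewrite divr_gt0// ltr_wpDl.
have [r [rp rs rr r1 r2]] : exists r, [/\ 0 < r, r <= s, r <= r0, r <= 1 & r <= a * kap / 4 / (C + 1)].
  exists (Num.min (Num.min s r0) (Num.min 1 (a * kap / 4 / (C + 1)))).
  by rewrite !lt_min s0 r00 ltr01 p2; split=> //; rewrite !ge_min lexx ?orbT.
have h3 : C * r ^+ 2 <= a * kap / 4.
  rewrite ler_pdivlMr ?ltr_wpDl// in r2.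
  have a1 : r ^+ 2 <= r by rewrite expr2 ler_piMr// ltW.
  have a2 := ler_wpM2l C0 a1; have a3 : r * (C + 1) = C * r + r by ring.
  move: r2 a2 a3 rp; move: (C * r ^+ 2) (C * r) (r * _) (a * _ / _) => t u v t'; move=> *; lra.
pose H := eball y (r / 2) `\` E.
have mH : measurable H := measurableD (measurable_eball y (r / 2)) (open_measurable_leb oE).
have fH : (leb H < +oo)%E.
  by apply: leb_sub_lty mH (measurable_eball y (r / 2)) _ (leb_eball_lty _ _); exact: subDsetl.
have iH := itg_indic mH fH; have ik := itg_kern_reflect y rp.
pose q := c * r^-1 ^+ d.
have q0 : 0 <= q by rewrite mulr_ge0 ?(ltW c0)// exprn_ge0// invr_ge0 ltW.
pose b := a + a * kap / 4; have b0 : 0 <= b by rewrite /b addr_ge0 ?ltW.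
have hW : W r y <= b * (1 - q * fine (leb H)).
  have -> : b * (1 - q * fine (leb H)) = rint (fun z => b * (kern r (y - z) - q * \1_H z)).
    by rewrite (intZ b (itgB ik (itgZ q iH))) (intB ik (itgZ q iH)) (intZ q iH) int_kern_reflect0// (int_indic _ mH).
  rewrite conv_mean_inf; apply: int_le.
  - exact: itg_conv_mean_inf.
  - exact: itgZ (itgB ik (itgZ q iH)).
  - move=> z; have kz := kern_ge0 (y - z) (ltW rp).
    have [Ez|nEz] := pselect (E z).
      rewrite !indicE (mem_set Ez) (memNset (A := H)) ?mulr0 ?subr0 ?mulr1; last by case.
      have [hz|hz] := ltP (enorm (y - z)) r; last by rewrite kern_supp// !mulr0.
      rewrite ler_wpM2r//; apply: ltW; apply: hs; rewrite /eball /= enormB; exact: lt_le_trans rs.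
    rewrite [X in _ * X * _]indicE (memNset nEz) mulr0 mul0r mulr_ge0// subr_ge0.
    rewrite indicE; have [hz|hz] := boolP (z \in H); last by rewrite mulr0.
    rewrite mulr1; apply: hc => //; move: hz; rewrite inE => -[+ _].
    by rewrite /eball /= enormB => /ltW.
have hH : delta * (r / 2) ^+ d <= fine (leb H).
  by apply: fat => //; [rewrite divr_gt0|apply: le_trans rr; rewrite ler_pdivrMr// ler_peMr ?(ltW rp)// ler1n].
have hq : kap <= q * fine (leb H).
  apply: le_trans (ler_wpM2l q0 hH); rewrite /q exprMn le_eqVlt; apply/orP; left; apply/eqP.
  have e : r^-1 ^+ d * r ^+ d = 1 by rewrite -exprMn mulVf ?expr1n// gt_eqF.
  have -> : c * r^-1 ^+ d * (delta * (r ^+ d * 2^-1 ^+ d)) = (r^-1 ^+ d * r ^+ d) * kap.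
    by rewrite /kap; move: (r ^+ d) (r^-1 ^+ d) (2^-1 ^+ d) => *; ring.
  by rewrite e mul1r.
have h4 := mean_inf_le y rp; rewrite -/a in h4.
have h5 : b * (1 - q * fine (leb H)) <= b * (1 - kap) by rewrite ler_wpM2l// lerD2l lerN2.
have h6 : b * (1 - kap) = a - 3 * (a * kap / 4) - (a * kap / 4) * kap by rewrite /b; field.
have h7 : 0 < (a * kap / 4) * kap by rewrite mulr_gt0.
exact: lt_chain6 h4 hW h5 h6 h7 h3 e0.
Qed.

Lemma mean_le : exists2 Q : R, 0 < Q & forall r x (A : set V), 0 < r -> measurable A -> eball x r `<=` A ->
  conv w (kern r) x <= Q * r^-1 ^+ d * rint (fun y => w y * \1_A y).
Proof.
have [Q Q0 hQ] := @kern_upper R d; exists Q => // r x A rp mA hA.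
have q0 : 0 <= Q * r^-1 ^+ d by rewrite mulr_ge0 ?(ltW Q0)// exprn_ge0// invr_ge0 ltW.
have i1 := itg_mulb (off0_itg oE fE L2w w_off) (measurable_indic_leb mA) (@indic_norm_le1 R d A).
have i2 := @itg_conv1 R d w (kern r) r x lw (Ck_cont (Ck_kern 0 r)) (kern_supp rp).
rewrite -(intZ (Q * r^-1 ^+ d) i1); apply: (int_le i2 (itgZ (Q * r^-1 ^+ d) i1)) => y.
have A0 : 0 <= (\1_A y : R) by case/andP: (indic01 A y).
have [hy|hy] := ltP (enorm (x - y)) r; last first.
  by rewrite kern_supp// mulr0; apply: mulr_ge0 => //; exact: mulr_ge0.
rewrite indicE mem_set; last by apply: hA; rewrite /eball /= enormB.
by rewrite mulr1 mulrC ler_wpM2r// hQ.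
Qed.

Lemma mean_inf_bounded : exists2 K : R, 0 <= K & forall x, wb x <= K.
Proof.
have [Q Q0 hQ] := mean_le; pose K := Q * 1^-1 ^+ d * rint (fun y => w y * \1_[set: V] y) + C * 1 ^+ 2.
have h x : wb x <= K.
  apply: (le_trans (mean_inf_le x ltr01)); rewrite lerD2r; apply: hQ => //; exact: measurableT.
by exists K => //; exact: le_trans (mean_inf_ge0 0) (h 0).
Qed.

Lemma mean_inf_decay e : 0 < e -> exists n : R, forall x, n <= enorm x -> wb x < e.
Proof.
move=> e0; have [Q Q0 hQ] := mean_le; have e2 : 0 < e / 2 by lra.
have p2 : 0 < e / 2 / (C + 1) by rewrite divr_gt0// ltr_wpDl.
have [r [rp r1 r2]] : exists r, [/\ 0 < r, r <= 1 & r <= e / 2 / (C + 1)].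
  exists (Num.min 1 (e / 2 / (C + 1))).
  by rewrite !lt_min ltr01 p2; split=> //; rewrite !ge_min lexx ?orbT.
have h3 : C * r ^+ 2 <= e / 2.
  rewrite ler_pdivlMr ?ltr_wpDl// in r2; apply: le_trans r2; rewrite mulrDr mulr1 mulrC.
  apply: (@le_trans _ _ (r * C)); last by rewrite lerDl ltW.
  by rewrite ler_wpM2r// expr2 ler_piMr// ltW.
have iw := off0_itg oE fE L2w w_off.
pose A (n : nat) : set V := ~` eball 0 n%:R.
have mA n : measurable (A n) by apply: measurableC; exact: measurable_eball.
have [_ hc] : itg (cst 0) /\ rint (fun y => w y * \1_(A n) y) @[n --> \oo] --> rint (cst 0).
  apply: (@int_dct _ _ _ _ (fun n y => w y * \1_(A n) y) (cst 0) w) => [n||n y|y].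
  - exact: measurable_funM L2w.1 (measurable_indic_leb (mA n)).
  - exact: iw.
  - have /andP[a0 a1] := indic01 (A n) y.
    by rewrite ger0_norm ?mulr_ge0// ler_piMr.
  - apply: cvg_near_cst; near=> n; rewrite indicE memNset ?mulr0// /A /eball /= subr0; apply.
    by near: n; apply: filterS (nbhs_infty_gtr (enorm y)).
have q0 : 0 < Q * r^-1 ^+ d by rewrite mulr_gt0// exprn_gt0// invr_gt0.
have e3 : 0 < e / 2 / (Q * r^-1 ^+ d) by rewrite divr_gt0.
rewrite int0 in hc; have /cvgrPdist_lt /(_ _ e3) [n _ hn] := hc.
exists (n%:R + r) => x hx; have := hn n (leqnn n); rewrite /= sub0r normrN.
rewrite ger0_norm; last first.
  by apply: int_ge0 => y; apply: mulr_ge0 => //; case/andP: (indic01 (A n) y).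
rewrite ltr_pdivlMr// mulrC => h4.
have h5 := hQ r x (A n) rp (mA n) _.
have h6 := mean_inf_le x rp; apply: (le_lt_trans h6); rewrite [ltRHS]splitr.
apply: ltr_leD => //; apply: le_lt_trans h4; apply: h5 => y.
rewrite /A /eball /= subr0 => hy; apply/negP; rewrite -leNgt.
have := enorm_triangle x y 0; rewrite !subr0 enormB => h7.
by rewrite -(lerD2r r); apply: (le_trans hx); apply: (le_trans h7); rewrite addrC lerD2l ltW.
Unshelve. all: by end_near. Qed.

Hypothesis mean_sub : forall x y r s, 0 < r -> r <= s -> eball x s `<=` E -> eball y s `<=` E ->
  conv w (kern r) x - conv w (kern r) y = conv w (kern s) x - conv w (kern s) y.

Lemma mean_inf_sub x y s : 0 < s -> eball x s `<=` E -> eball y s `<=` E ->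
  wb x - wb y = conv w (kern s) x - conv w (kern s) y.
Proof.
move=> s0 hx hy.
have h1 : (W n.+1%:R^-1 x - W n.+1%:R^-1 y) @[n --> \oo] --> wb x - wb y.
  by apply: cvgB; exact: mean_inf_cvg.
have h2 : (W n.+1%:R^-1 x - W n.+1%:R^-1 y) @[n --> \oo] --> W s x - W s y.
  apply: cvg_near_cst; near=> n; apply: mean_sub => //.
  by apply: ltW; near: n; exact: (near_infty_natSinv_lt (PosNum s0)).
exact: (cvg_unique _ h1 h2).
Unshelve. all: by end_near. Qed.

(** By [mean_inf_sub] the difference equals that of two averages at the single scale [r], so the
    Lipschitz bound of the kernel applies, times the bound [K] and the volume of the ball of radius
    [2 r]. *)
Lemma mean_inf_interior : exists2 L : R, 0 <= L & forall x x' r (K : R), 0 < r -> 0 <= K ->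
  eball x (2 * r) `<=` E -> enorm (x - x') <= r -> (forall z, enorm (z - x) < 2 * r -> wb z <= K) ->
  `|wb x - wb x'| <= L * K * r^-1 * enorm (x - x').
Proof.
have [Q Q0 hQ] := @kern_lipschitz R d; exists (Q * 4 ^+ d) => [|x x' r K rp K0 hx xx hK].
  by rewrite mulr_ge0 ?(ltW Q0)// exprn_ge0.
have tri z : enorm (x' - z) < r -> enorm (x - z) < 2 * r.
  by move=> h; have := enorm_triangle x x' z; lra.
have hx1 : eball x r `<=` E by apply: subset_trans hx; apply: eball_le; lra.
have hx2 : eball x' r `<=` E.
  by move=> z hz; apply: hx; rewrite /eball /= enormB; apply: tri; rewrite enormB.
rewrite (mean_inf_sub rp hx1 hx2) !conv_mean_inf.
have i1 := itg_conv_mean_inf x rp; have i2 := itg_conv_mean_inf x' rp.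
rewrite -(intB i1 i2).
pose c := K * (Q * r^-1 ^+ d * r^-1 * enorm (x - x')).
have c0 : 0 <= c.
  apply: mulr_ge0 => //; do 2 ?apply: mulr_ge0; rewrite ?enorm_ge0 ?invr_ge0 ?(ltW rp)//.
  by rewrite mulr_ge0 ?(ltW Q0)// exprn_ge0// invr_ge0 ltW.
pose B := eball x (2 * r); have iB := itg_indic (measurable_eball x (2 * r)) (leb_eball_lty _ _).
apply: (le_trans (int_norm (itgB i1 i2))).
apply: (@le_trans _ _ (rint (fun y => c * \1_B y))).
  apply: int_le (itg_norm (itgB i1 i2)) (itgZ c iB) _ => y.
  rewrite -mulrBr normrM; have B0 : 0 <= (\1_B y : R) by case/andP: (indic01 B y).
  have [hy|hy] := ltP (enorm (x - y)) (2 * r).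
    rewrite [\1_B y]indicE mem_set ?mulr1; last by rewrite /B /eball /= enormB.
    apply: ler_pM => //; last first.
      apply: (le_trans (hQ r (x - y) (x' - y) rp)).
      by rewrite opprB addrA subrK.
    rewrite ger0_norm; last by rewrite mulr_ge0 ?mean_inf_ge0//; case/andP: (indic01 E y).
    apply: (@le_trans _ _ (wb y)); last by apply: hK; rewrite enormB.
    by rewrite ler_piMr ?mean_inf_ge0//; case/andP: (indic01 E y).
  rewrite (kern_supp rp (x := x - y)); last by apply: le_trans hy; lra.
  rewrite (kern_supp rp (x := x' - y)); last by rewrite leNgt; apply/negP => /tri; rewrite ltNge hy.
  by rewrite subrr normr0 mulr0 mulr_ge0.
rewrite (intZ c iB) (int_indic _ (measurable_eball x (2 * r))).
apply: (@le_trans _ _ (c * ((2 * r) *+ 2) ^+ d)).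
  rewrite ler_wpM2l// -lee_fin fineK ?ge0_fin_numE ?leb_eball_lty//.
  by apply: leb_eball_le; rewrite mulr_ge0// ltW.
have e : r^-1 ^+ d * ((2 * r) *+ 2) ^+ d = 4 ^+ d.
  by rewrite -exprMn -mulr_natr mulrC -!mulrA mulrCA; congr (_ ^+ d); field; rewrite gt_eqF.
have -> : c * ((2 * r) *+ 2) ^+ d = Q * 4 ^+ d * K * r^-1 * enorm (x - x'); last by [].
rewrite /c; move: e; move: (r^-1 ^+ d) (_ ^+ d) (4 ^+ d) => a b q <-; ring.
Qed.

End representative.

(** * Linear growth from the boundary *)

Section second_order.
Context {R : realType}.
Implicit Types (f : R -> R) (l m b e s t : R).

Lemma near0_ball (P : R -> Prop) : (\forall h \near 0^', P h) -> exists2 e : R, 0 < e & forall h, h != 0 -> `|h| < e -> P h.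
Proof.
move=> /nbhs_ballP[e /= e0 he]; exists e => // h h0 hh; apply: he => //.
by rewrite -ball_normE /= sub0r normrN.
Qed.

(** The function [c] ([f] minus the linear term plus [b s^2]) has a local maximum at 0. The second
    derivative exists at 0 only, so a positive one is excluded by integrating the first order
    expansion of [c1] near 0. *)
Lemma second_order f (f1 : R -> R) l m b e : 0 < e -> (forall s, is_derive s (1 : R) f (f1 s)) ->
  is_derive 0 (1 : R) f1 l -> (forall s, `|s| < e -> f s <= f 0 + m * s - b * s ^+ 2) ->
  f1 0 = m /\ l <= - 2 * b.
Proof.
move=> e0 hf /is_derive_cvg hl hle.
pose c s := f s - m * s + b * s ^+ 2; pose c1 s := f1 s - m + 2 * b * s.
have dc s : is_derive s (1 : R) c (c1 s).
  have h1 : is_derive s (1 : R) (fun s : R => s) 1 := is_derive_id _ _.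
  have h2 := is_deriveB (hf s) (@is_deriveZ R R R _ m s 1 _ h1).
  have h3 := @is_deriveZ R R R _ b s 1 _ (is_deriveM h1 h1).
  have := is_deriveD h2 h3; rewrite /GRing.scale /= !mulr1.
  have -> : b * (s + s) = 2 * b * s by ring.
  by apply.
have cle s : `|s| < e -> c s <= c 0.
  by move=> hs; rewrite /c mulr0 subr0 expr0n mulr0 addr0; have := hle s hs; lra.
have near1 eps : 0 < eps -> exists2 e1, 0 < e1 & forall s, `|s| < e1 -> `|c1 s - c1 0 - (l + 2 * b) * s| <= eps * `|s|.
  move=> eps0; have /cvgrPdist_le /(_ _ eps0) /near0_ball[e1 e10 h] := hl.
  exists e1 => // s hs; have [->|s0] := eqVneq s 0; first by rewrite subrr mulr0 subrr !normr0 mulr0.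
  have := h s s0 hs; rewrite add0r distrC => h1.
  have -> : c1 s - c1 0 - (l + 2 * b) * s = (s^-1 * (f1 s - f1 0) - l) * s.
    by rewrite /c1 mulr0 addr0; field.
  by rewrite normrM ler_wpM2r.
have q0 : c1 0 = 0.
  apply/eqP; rewrite -normr_eq0; apply: contraT => q0.
  have {}q0 : 0 < `|c1 0| by rewrite lt_neqAle eq_sym q0 normr_ge0.
  have [e1 e10 h1] := near1 1 ltr01.
  pose K := 1 + `|l + 2 * b|; have K0 : 0 < K by rewrite /K ltr_pwDl.
  pose del := Num.min (e / 2) (Num.min (e1 / 2) (`|c1 0| / (2 * K))).
  have d0 : 0 < del by rewrite !lt_min !divr_gt0// mulr_gt0.
  have [d1 [d2 d3]] : del <= e / 2 /\ del <= e1 / 2 /\ del <= `|c1 0| / (2 * K).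
    by rewrite /del !ge_min !lexx ?orbT.
  have main s : `|s| = del -> 0 < s * c1 0 -> False.
    move=> hs hsc; have [t ht htc] := MVT0 s dc.
    have tl : `|t| < e1 by rewrite (le_lt_trans ht)// hs; lra.
    have h2 := h1 t tl; rewrite mul1r in h2.
    have h3 : `|c1 t - c1 0| <= K * del.
      have -> : c1 t - c1 0 = (c1 t - c1 0 - (l + 2 * b) * t) + (l + 2 * b) * t by ring.
      apply: (le_trans (ler_normD _ _)); rewrite /K [(1 + _) * del]mulrDl mul1r; apply: lerD.
        by apply: (le_trans h2); rewrite -hs.
      by rewrite normrM ler_wpM2l// -hs.
    have h4 : K * del <= `|c1 0| / 2.
      by rewrite mulrC; move: d3; rewrite ler_pdivlMr ?mulr_gt0// => d3; lra.
    have h5 : 0 < s * c1 t.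
      have -> : s * c1 t = s * c1 0 + s * (c1 t - c1 0) by ring.
      have h6 : `|s * (c1 t - c1 0)| <= s * c1 0 / 2.
        rewrite normrM hs -(gtr0_norm hsc) normrM hs -mulrA ler_wpM2l ?(ltW d0)//.
        exact: le_trans h3 h4.
      by rewrite ler_norml in h6; have [h7 _] := andP h6; lra.
    have := cle s; rewrite hs => /(_ _); have : c s - c 0 = s * c1 t := htc.
    by move=> h7 h8; have := h8 ltac:(lra); lra.
  have [cp|cn|cz] := ltgtP 0 (c1 0).
  - by case: (main del); [rewrite gtr0_norm|rewrite mulr_gt0].
  - by case: (main (- del)); [rewrite normrN gtr0_norm|rewrite mulNr -mulrN mulr_gt0// oppr_gt0].
  - by move: q0; rewrite -cz normr0 ltxx.
split; first by move: q0; rewrite /c1 mulr0 addr0 => /eqP; rewrite subr_eq0 => /eqP.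
rewrite leNgt; apply/negP => lb; pose k := l + 2 * b; have k0 : 0 < k by rewrite /k; lra.
have k2 : 0 < k / 2 by lra.
have [e1 e10 h1] := near1 _ k2.
pose del := Num.min (e / 2) (e1 / 2).
have d0 : 0 < del by rewrite lt_min !divr_gt0.
have [d1 d2] : del <= e / 2 /\ del <= e1 / 2 by rewrite /del !ge_min !lexx ?orbT.
have := @derive_ge0_le _ (fun s => c s - k / 4 * s ^+ 2) (fun s => c1 s - k / 2 * s) 0 del (ltW d0).
rewrite expr0n mulr0 subr0 => /(_ _ _) h.
have : c 0 <= c del - k / 4 * del ^+ 2.
  apply: h => s /andP[s0 sd].
    have hs : is_derive s (1 : R) (fun s : R => s) 1 := is_derive_id _ _.
    have h3 := @is_deriveZ R R R _ (k / 4) s 1 _ (is_deriveM hs hs).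
    have := is_deriveB (dc s) h3; rewrite /GRing.scale /= !mulr1.
    have -> : k / 4 * (s + s) = k / 2 * s by field.
    by apply.
  have sl : `|s| < e1 by rewrite ger0_norm//; lra.
  have := h1 s sl; rewrite q0 subr0 (ger0_norm s0) ler_norml -/k => /andP[h2 _].
  have e4 : k * s = k / 2 * s + k / 2 * s by field.
  by rewrite e4 lerBrDr addKr in h2; rewrite subr_ge0.
have dl : `|del| < e by rewrite gtr0_norm//; lra.
have := cle del dl; have : 0 < k / 4 * del ^+ 2 by rewrite mulr_gt0 ?exprn_gt0// divr_gt0.
lra.
Qed.

End second_order.

(** * Mean curvature of level sets and the touching contradiction *)

Section mean_curvature.
Context {R : realType} {d : nat}.
Local Notation V := 'rV[R]_d.
Implicit Types (x y z h : V) (r s p k L m : R) (phi q : V -> R) (i : 'I_d) (U A E : set V).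

(** Twice the Hessian of [phi] evaluated on its gradient. *)
Definition gsq_flux phi x := \sum_i partial i phi x * partial i (gsq phi) x.

(** The divergence is the regularised mean curvature [(L (g + k) - Q / 2) / (g + k)^(3/2)] with [g]
    the squared gradient, [L] the Laplacian and [Q] the flux; the margin [c] absorbs the terms in
    [k]. *)
Lemma dv_Xk_ge phi y k m S1 c : Ck 2 phi -> 0 < k -> 0 <= m -> 0 < S1 -> gsq phi y + k <= S1 ^+ 2 ->
  c <= lap phi y * gsq phi y - gsq_flux phi y / 2 - m * gsq phi y -> k * (m - lap phi y) <= c ->
  m / S1 <= dv (Xk phi k) y.
Proof.
move=> h k0 m0 S0 hS hc hk; rewrite dv_Xk// -/(gsq_flux phi y).
move: (lap phi y) (gsq_flux phi y) (gsq_ge0 phi y) hS hc hk => L Q; move: (gsq phi y) => g g0 hS hc hk.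
have s0 : 0 < g + k by lra.
set S := Num.sqrt (g + k); have Sp : 0 < S by rewrite sqrtr_gt0.
have SS1 : S <= S1 by rewrite -(ler_pXn2r (n := 2)) ?nnegrE ?(ltW Sp) ?(ltW S0)// sqr_sqrtr// ltW.
have -> : L * S^-1 - (2 * (g + k) * S)^-1 * Q = (L * (g + k) - Q / 2) / ((g + k) * S).
  by field; rewrite !gt_eqF.
apply: (@le_trans _ _ (m / S)); first by rewrite ler_wpM2l// lef_pV2.
rewrite ler_pdivlMr ?mulr_gt0//.
have -> : m / S * ((g + k) * S) = m * (g + k) by field; rewrite gt_eqF.
have -> : L * (g + k) - Q / 2 = (L * g - Q / 2 - m * g) + m * g + k * L by ring.
have -> : m * (g + k) = m * g + k * m by ring.
by move: hk; rewrite mulrBr; lra.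
Qed.

Lemma partial_gsq phi i x : Ck 2 phi -> partial i (gsq phi) x = 2 * \sum_j partial j phi x * partial i (partial j phi) x.
Proof.
move=> hphi; apply: partialE; rewrite mulr_sumr.
have -> : gsq phi = \sum_j (fun x => partial j phi x ^+ 2) by apply/funext => z; rewrite fct_sumE.
apply: is_derive_sum => j.
have hj := Ck_der i x (Ck_partial j hphi).
have := is_deriveM hj hj; rewrite /GRing.scale /=.
have -> : partial j phi * partial j phi = (fun x => partial j phi x ^+ 2) by apply/funext => z; rewrite expr2.
have -> : partial j phi x * partial i (partial j phi) x + partial j phi x * partial i (partial j phi) x =
  2 * (partial j phi x * partial i (partial j phi) x) by ring.
by [].
Qed.

Lemma Ck_gsq_flux phi : Ck 2 phi -> continuous (gsq_flux phi).
Proof.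
move=> h; apply: (Ck_cont (k := 0)); apply: Ck_sum => i; apply: CkM; first exact: CkS (Ck_partial i h).
exact: Ck_partial (Ck_gsq h).
Qed.

Lemma Ck_lap phi : Ck 2 phi -> continuous (lap phi).
Proof. by move=> h; apply: (Ck_cont (k := 0)); apply: Ck_sum => i; do 2!apply: Ck_partial. Qed.

Lemma continuous_eball (f : V -> R) y e : continuous f -> 0 < e ->
  exists2 s, 0 < s & forall z, enorm (z - y) < s -> `|f z - f y| < e.
Proof.
move=> cf e0; have [s s0 hs] := continuousP_norm cf y e0; exists s => // z hz; apply: hs.
exact: le_lt_trans (norm_le_enorm _) hz.
Qed.

End mean_curvature.

Section viscosity.
Context {R : realType} {d : nat}.
Local Notation V := 'rV[R]_d.
Implicit Types (x y z h : V) (r s p k L m : R) (f phi q : V -> R) (i : 'I_d) (U : set V).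

Lemma pos_min2 (a b : R) : 0 < a -> 0 < b -> exists2 c, 0 < c & c <= a /\ c <= b.
Proof. by move=> a0 b0; exists (Num.min a b); rewrite ?lt_min ?a0// !ge_min !lexx orbT. Qed.

Lemma fine_leb_le U U' : measurable U -> measurable U' -> U `<=` U' -> (leb U' < +oo)%E ->
  fine (leb U) <= fine (leb U').
Proof.
move=> mU mU' UU fU'; have fU := leb_sub_lty mU mU' UU fU'.
by rewrite fine_le ?ge0_fin_numE//; apply: le_measure; rewrite ?inE.
Qed.

Lemma partial_addc (c : R) f i : Ck 1 f -> partial i (fun z => f z + c) = partial i f.
Proof. by move=> hf; apply/funext => z; rewrite (@partialD _ _ 0)// ?partial_cst ?addr0//; exact: Ck_cst. Qed.

(* A positive superlevel set of [f] minus a small paraboloid, added to [A],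
   would decrease the perimeter by more than [super] allows. *)
Lemma viscosity A E p0 Lam r1 f y0 s0 (a : R) : (0 < d)%N -> measurable A -> E `<=` A -> Pb A p0 ->
  0 <= Lam -> 0 < r1 ->
  (forall U y p, measurable U -> A `<=` U -> U `\` A `<=` eball y r1 -> Pb U p ->
     p0 <= p + Lam * fine (leb (U `\` A))) ->
  (forall y r, ~ E y -> 0 < r -> r <= r1 -> 0 < fine (leb (eball y r `\` A))) ->
  Ck 2 f -> 0 < s0 -> ~ E y0 -> f y0 = 0 ->
  (forall y, enorm (y - y0) < s0 -> ~ E y -> f y <= 0) ->
  (forall y, enorm (y - y0) < s0 -> lap f y = -1) ->
  1 <= a -> 0 < gsq f y0 -> gsq f y0 <= a ^+ 2 ->
  gsq_flux f y0 <= - 4 * gsq f y0 * (1 + Lam * a) -> False.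
Proof.
move=> d_gt0 mA EA hp Lam0 r10 super fatA hf s00 nE f0 fE lf a1 g0 ga hflux.
have dp : 0 < d%:R :> R by rewrite ltr0n.
(* The paraboloid makes the touching strict and lowers the Laplacian by [2 b d = 1/2] only. *)
pose b : R := (4 * d%:R)^-1; have b0 : 0 < b by rewrite invr_gt0 mulr_gt0.
have bd : 2 * b * d%:R = 2^-1 by rewrite /b; field; rewrite gt_eqF.
clearbody b.
pose n0 y := nsq (y - y0).
have hn (k : nat) : Ck k n0 := Ck_nsq k y0.
pose G y := f y - b * n0 y.
have hG : Ck 2 G := CkB hf (CkZ b (hn 2)).
have pn i : partial i n0 = (fun y => 2 * (y 0 i - y0 0 i)) by apply/funext => y; exact: partial_nsq.
have pG i : partial i G = (fun y => partial i f y - b * (2 * (y 0 i - y0 0 i))).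
  apply/funext => y; rewrite (partialB i y (CkS hf) (CkZ b (hn 1%N))).
  by rewrite (partialZ b i y (hn 1%N)) pn.
have GE y : G y = f y - b * nsq (y - y0) by [].
clearbody G.
have hc0 i : Ck 1 (fun y : V => y 0 i - y0 0 i) := CkB (@Ck_coord R d 1 i) (Ck_cst 1 _).
have hc1 i : Ck 1 (fun y : V => 2 * (y 0 i - y0 0 i)) := CkZ 2 (hc0 i).
have ppG i j y : partial j (partial i G) y = partial j (partial i f) y - b * (2 * (i == j)%:R).
  rewrite pG (partialB j y (Ck_partial i hf) (CkZ b (hc1 i))) (partialZ b j y (hc1 i)) (partialZ 2 j y (hc0 i)).
  by rewrite (partialB j y (@Ck_coord R d 1 i) (Ck_cst 1 _)) partial_coord partial_cst subr0.
have pG0 i : partial i G y0 = partial i f y0 by rewrite pG subrr !mulr0 subr0.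
have gG : gsq G y0 = gsq f y0 by apply: eq_bigr => i _; rewrite pG0.
have flG : gsq_flux G y0 <= gsq_flux f y0.
  have e i : partial i G y0 * partial i (gsq G) y0 =
      partial i f y0 * partial i (gsq f) y0 - 4 * b * partial i f y0 ^+ 2.
    have e3 : \sum_j partial j f y0 * (j == i)%:R = partial i f y0.
      by rewrite (bigD1 i)//= eqxx mulr1 big1 ?addr0// => j /negbTE ->; rewrite mulr0.
    have e2 : \sum_j partial j G y0 * partial i (partial j G) y0 =
        \sum_j partial j f y0 * partial i (partial j f) y0 - 2 * b * partial i f y0.
      rewrite -[in RHS]e3 mulr_sumr -sumrB.
      by apply: eq_bigr => j _; rewrite pG0 ppG; move: (partial j f y0) (partial i _ y0) => u1 u2; ring.
    have q1 := etrans (partial_gsq i y0 hG) (congr1 (fun t => 2 * t) e2).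
    have q2 := partial_gsq i y0 hf.
    move: q1 q2; move: (\sum_j partial j f y0 * _) => S q1 q2.
    by rewrite q1 q2 pG0; ring.
  apply: ler_sum => i _; rewrite e lerBlDr lerDl.
  by rewrite mulr_ge0 ?sqr_ge0// mulr_ge0// ltW.
have lG y : enorm (y - y0) < s0 -> lap G y = - (3 / 2).
  move=> hy; rewrite /lap; under eq_bigr do rewrite ppG eqxx mulr1.
  have -> : \sum_(i < d) (partial i (partial i f) y - b * 2) = lap f y - b * 2 * d%:R.
    by rewrite sumrB sumr_const card_ord; congr (_ - _); exact: esym (mulr_natr _ _).
  rewrite lf//; have -> : b * 2 * d%:R = 2 * b * d%:R by ring.
  by rewrite bd; field.
(* The value 3/8 leaves room on both sides: [2 - 3/2 - 3/8 = 1/8] keeps [Phi y0] positive, and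
   [3/8 > 1/4] makes [S1 = m / lam], with [lam = Lam + 1 / (4 a)], exceed the gradient bound [a]. *)
pose m := Lam * a + 3 / 8.
have a0 : 0 < a := lt_le_trans ltr01 a1.
have La0 : 0 <= Lam * a := mulr_ge0 Lam0 (ltW a0).
have m0 : 0 < m by rewrite /m; clear -La0; lra.
pose lam := Lam + (4 * a)^-1.
have lamL : Lam < lam by rewrite /lam ltrDl invr_gt0 mulr_gt0.
have lam0 : 0 < lam := le_lt_trans Lam0 lamL.
have lama : lam * a = Lam * a + 4^-1 by rewrite /lam; field; rewrite gt_eqF.
pose S1 := m / lam.
have S1a : a < S1 by rewrite ltr_pdivlMr// mulrC lama /m; clear -La0; lra.
have S10 : 0 < S1 := lt_trans a0 S1a.
have mS : m / S1 = lam by rewrite /S1; field; rewrite !gt_eqF.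
have e1 : 0 < (S1 ^+ 2 - a ^+ 2) / 2.
  by rewrite divr_gt0// subr_gt0 ltr_pXn2r// nnegrE ltW.
pose Phi y := lap G y * gsq G y + ((- 2^-1) * gsq_flux G y + (- m) * gsq G y).
have cg : continuous (gsq G) := Ck_cont (Ck_gsq hG).
have cPhi : continuous Phi.
  have cc (c : R) : continuous (fun _ : V => c) := Ck_cont (Ck_cst 0 c).
  exact: contD (contM (Ck_lap hG) cg) (contD (contM (cc (- 2^-1)) (Ck_gsq_flux hG)) (contM (cc (- m)) cg)).
have Phi0 : gsq f y0 / 8 <= Phi y0.
  rewrite /Phi lG ?subrr ?enorm0// gG.
  have h1 : 0 <= gsq f y0 * (Lam * a) by rewrite mulr_ge0// ltW.
  have h2 : - 4 * gsq f y0 * (1 + Lam * a) = - 4 * gsq f y0 - 4 * (gsq f y0 * (Lam * a)) by ring.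
  have h3 : (- m) * gsq f y0 = - (gsq f y0 * (Lam * a)) - 3 / 8 * gsq f y0 by rewrite /m; field.
  rewrite h3; rewrite h2 in hflux; move: flG hflux h1 g0.
  move: (gsq_flux G y0) (gsq_flux f y0) (gsq f y0 * (Lam * a)) (gsq f y0) => u1 u2 u3 u4.
  clear; move=> *; lra.
pose c1 := gsq f y0 / 16; have c10 : 0 < c1 by rewrite divr_gt0.
have [s1 s10 hs1] := continuous_eball y0 cPhi c10.
have [s2 s20 hs2] := continuous_eball y0 cg e1.
have [s [sp ss0 ss1 ss2 ssr]] : exists s, [/\ 0 < s, s <= s0, s <= s1, s <= s2 & s <= r1].
  exists (Num.min (Num.min s0 s1) (Num.min s2 r1)).
  by rewrite !lt_min s00 s10 s20 r10; split=> //; rewrite !ge_min lexx ?orbT.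
(* Raising [G] by [tau] makes it positive at [y0], while off [E] it can be positive only where
   [|y - y0|^2 < s^2 / 2], well inside the ball. *)
pose tau := b * s ^+ 2 / 2; have t0 : 0 < tau by rewrite divr_gt0// mulr_gt0// exprn_gt0.
pose k0 := Num.min ((S1 ^+ 2 - a ^+ 2) / 2) (c1 / (m + 3 / 2)).
have m3 : 0 < m + 3 / 2 by clear -m0; lra.
have k00 : 0 < k0 by rewrite lt_min e1 divr_gt0.
have c0 : 0 < s ^+ 2 / 2 by rewrite divr_gt0// exprn_gt0.
pose F y := G y + tau; have hF : Ck 2 F := CkD hG (Ck_cst 2 tau).
have FE y : F y = G y + tau by [].
have pF i : partial i F = partial i G by exact: partial_addc (CkS hG).
clearbody F.
have gF : gsq F = gsq G by apply/funext => y; apply: eq_bigr => i _; rewrite pF.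
have lF : lap F = lap G by apply/funext => y; apply: eq_bigr => i _; rewrite pF.
have flF : gsq_flux F = gsq_flux G by apply/funext => y; apply: eq_bigr => i _; rewrite pF gF.
pose q y := s ^+ 2 - nsq (y - y0).
have hq : Ck 1 q := Ck_q (s ^+ 2) y0 1.
have qE y : 0 < q y <-> eball y0 s y.
  rewrite /q (q_pos y0 y (ltW sp)); exact: iff_refl.
pose GG := [set y | 0 < F y /\ 0 < q y].
have mG : measurable GG := measurable_pos2 (Ck_cont hF) (Ck_cont hq).
have T : Pb (A `|` GG) (p0 - lam * fine (leb ((A `|` GG) `\` A))).
  apply: (@touch R d A F q (s ^+ 2 / 2) lam k0 (s + enorm y0) p0 mA hF hq c0 k00 _ _ _ hp).
  - by move=> y; apply: q_out; exact: ltW.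
  - move=> y Fy /qE qy nA; have nEy : ~ E y by move/EA.
    have fy := fE y (lt_le_trans qy ss0) nEy.
    have h1 : b * nsq (y - y0) < b * (s ^+ 2 / 2).
      move: Fy fy; rewrite FE GE /tau mulrA; move: (f y) (b * nsq _) (b * s ^+ 2 / 2) => u1 u2 u3.
      by clear; move=> *; lra.
    rewrite (ltr_pM2l b0) in h1; rewrite /q; move: h1; move: (nsq _) (s ^+ 2) => u1 u2.
    by clear; move=> *; lra.
  - move=> k y /andP[kp kk] Fy /qE qy nA; rewrite -mS.
    have [k1 k2] : k < (S1 ^+ 2 - a ^+ 2) / 2 /\ k < c1 / (m + 3 / 2).
      by apply/andP; rewrite -lt_min.
    have h1 := hs1 y (lt_le_trans qy ss1); have h2 := hs2 y (lt_le_trans qy ss2).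
    rewrite ltr_norml in h1; rewrite ltr_norml in h2; have [h3 _] := andP h1; have [_ h4] := andP h2.
    apply: (@dv_Xk_ge R d F y k m S1 c1 hF kp (ltW m0) S10).
    + rewrite gF; move: h4 k1 ga; rewrite gG; move: (gsq G y) (gsq f y0) (S1 ^+ 2) (a ^+ 2) => u1 u2 u3 u4.
      by clear; move=> *; lra.
    + rewrite lF flF gF; move: h3 Phi0; rewrite /Phi /c1.
      move: (lap G y * _) (gsq_flux G y) (lap G y0 * _ + _) => u1 u2 u3; rewrite !mulNr.
      move: (gsq f y0) (m * gsq G y) => u4 u5; clear; move=> *; lra.
    + rewrite lF (lG y (lt_le_trans qy ss0)) opprK.
      rewrite (ltr_pdivlMr _ _ m3) in k2; exact: ltW.
have AU : A `<=` A `|` GG by move=> y; left.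
have UG : (A `|` GG) `\` A `<=` eball y0 r1.
  move=> y [[Ay|[_ /qE qy]] nAy]; [case: (nAy Ay)|exact: lt_le_trans qy ssr].
have mU := measurableU _ _ mA mG.
have h1 := super _ _ _ mU AU UG T.
have F0 : F y0 = tau by rewrite FE GE subrr f0 nsqE enorm0 expr0n mulr0 subr0 add0r.
have [s3 s30 hs3] := continuous_eball y0 (Ck_cont hF) t0.
have [rho rho0 [rs rs3]] := pos_min2 sp s30.
have pos := fatA _ _ nE rho0 (le_trans rs ssr).
have sub : eball y0 rho `\` A `<=` (A `|` GG) `\` A.
  move=> y [hy nA]; split; last exact: nA.
  right; split; last by apply/qE; exact: lt_le_trans hy rs.
  have := hs3 y (lt_le_trans hy rs3); rewrite F0 ltr_norml => /andP[+ _].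
  by rewrite ltrBrDr addNr.
have mD1 := measurableD (measurable_eball y0 rho) mA; have mD2 := measurableD mU mA.
have f2 : (leb ((A `|` GG) `\` A) < +oo)%E := leb_sub_lty mD2 (measurable_eball y0 r1) UG (leb_eball_lty _ _).
have f1 := leb_sub_lty mD1 mD2 sub f2.
have h2 : fine (leb (eball y0 rho `\` A)) <= fine (leb ((A `|` GG) `\` A)).
  exact: fine_leb_le mD1 mD2 sub f2.
have h3 := lt_le_trans pos h2.
have h4 : 0 < (lam - Lam) * fine (leb ((A `|` GG) `\` A)) by apply: mulr_gt0 h3; rewrite subr_gt0.
move: h1 h4; rewrite mulrBl.
move: (lam * _) (Lam * _) => u1 u2; clear; move=> *; lra.
Qed.

End viscosity.

(** * Doubling of variables *)

Section doubling.
Context {R : realType} {d : nat}.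
Local Notation V := 'rV[R]_d.
Implicit Types (x y z h u : V) (r s p k L m t : R) (f phi q w : V -> R) (i : 'I_d) (U A E : set V).

Lemma nsqD u h s : nsq (u + s *: h) = nsq u + 2 * s * dot u h + s ^+ 2 * nsq h.
Proof. by rewrite /nsq !dotDl !dotDr !dotZl !dotZr (dotC h u); ring. Qed.

Lemma scale_small r h : 0 < r -> exists2 e : R, 0 < e & forall s, `|s| < e -> enorm (s *: h) < r.
Proof.
move=> r0; have h0 := enorm_ge0 h; have h1 : 0 < enorm h + 1 by rewrite ltr_wpDl.
exists (r / (enorm h + 1)) => [|s]; first exact: divr_gt0.
rewrite ltr_pdivlMr// enormZ; apply: le_lt_trans.
by rewrite ler_wpM2l// lerDl.
Qed.

Lemma psi_increment (a B t r : R) : (a * r - B * r ^+ 2) - (a * t - B * t ^+ 2) =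
  (a - 2 * B * t) * (r - t) - B * (r - t) ^+ 2.
Proof. ring. Qed.

(* AM-GM: [r - t <= (r^2 - t^2) / (2 t)], so that no square root is differentiated. *)
Lemma psi_increment_le (a B t r : R) : 0 <= B -> 0 < t -> 0 <= a - 2 * B * t ->
  (a * r - B * r ^+ 2) - (a * t - B * t ^+ 2) <= (a - 2 * B * t) / (2 * t) * (r ^+ 2 - t ^+ 2).
Proof.
move=> B0 t0 p0; rewrite psi_increment; move: (a - 2 * B * t) p0 => p p0.
have -> : p / (2 * t) * (r ^+ 2 - t ^+ 2) = p * (r - t) + p / (2 * t) * (r - t) ^+ 2 by field; rewrite gt_eqF.
have h1 : 0 <= B * (r - t) ^+ 2 by rewrite mulr_ge0// sqr_ge0.
have h2 : 0 <= p / (2 * t) * (r - t) ^+ 2.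
  by rewrite mulr_ge0 ?sqr_ge0// divr_ge0// mulr_ge0// ltW.
lra.
Qed.

(* At a maximum of [w x - psi |x - y|] over [y] outside [E], with
   [psi t = a t - B t^2] and [w = f + cst] near [x0], the function [f] has
   gradient [psi'(t) e] and [e]-second derivative at most [psi''(t) = - 2 B]. *)
Lemma doubling_derivatives f x0 y0 (a B t t0 : R) : Ck 3 f -> 0 <= B ->
  enorm (x0 - y0) = t -> 0 < t -> t < t0 -> 0 <= a - 2 * B * t ->
  (forall x, enorm (x - x0) < t / 2 -> enorm (x - y0) <= t0 ->
     f x - f x0 <= (a * enorm (x - y0) - B * enorm (x - y0) ^+ 2) - (a * t - B * t ^+ 2)) ->
  (forall i, partial i f x0 = (a - 2 * B * t) / t * (x0 - y0) 0 i) /\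
  \sum_j (x0 - y0) 0 j * (\sum_i (x0 - y0) 0 i * partial j (partial i f) x0) <= - 2 * (B * t ^+ 2).
Proof.
move=> hf B0 ut tp tt0 p0 H.
have [u Eu] : exists u, u = x0 - y0 by exists (x0 - y0).
rewrite -Eu in ut *; have t2 : nsq u = t ^+ 2 by rewrite nsqE ut.
have xu h : x0 + h - y0 = u + h by rewrite Eu addrAC.
have [r rp [r1 r2]] : exists2 r, 0 < r & r <= t / 2 /\ r <= t0 - t.
  by apply: pos_min2; [rewrite divr_gt0|rewrite subr_gt0].
have Hh h s : enorm (s *: h) < r -> f (x0 + s *: h) - f x0 <=
    (a * enorm (u + s *: h) - B * enorm (u + s *: h) ^+ 2) - (a * t - B * t ^+ 2).
  move=> hs; have := H (x0 + s *: h); rewrite xu addrAC subrr add0r; apply.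
    exact: lt_le_trans hs r1.
  apply: (le_trans (enormD _ _)); rewrite ut -lerBrDl; apply: ltW; exact: lt_le_trans hs r2.
split=> [i|].
  pose e_ : V := delta_mx 0 i.
  have [e e0 he] := scale_small e_ rp.
  have c1 := Ck_partial i hf.
  have hd s : is_derive s (1 : R) (fun s => f (x0 + s *: e_)) (partial i f (x0 + s *: e_)).
    by apply/is_derive_line; exact: Ck_der hf.
  have hd2 : is_derive 0 (1 : R) (fun s => partial i f (x0 + s *: e_)) (partial i (partial i f) x0).
    by apply/is_derive_line0; exact: Ck_der c1.
  have due : dot u e_ = u 0 i.
    rewrite /dot (bigD1 i)//= big1 => [|j ji]; first by rewrite mxE !eqxx mulr1 addr0.
    by rewrite mxE (negbTE ji) andbF mulr0.
  have [] := @second_order R _ _ _ ((a - 2 * B * t) / t * u 0 i)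
    (- ((a - 2 * B * t) / (2 * t) * nsq e_)) e e0 hd hd2; last by rewrite scale0r addr0.
  move=> s hs; rewrite scale0r addr0; have h1 := Hh e_ s (he s hs).
  have h2 := le_trans h1 (psi_increment_le (enorm (u + s *: e_)) B0 tp p0).
  rewrite -nsqE nsqD t2 due in h2; rewrite -lerBlDl.
  have {}h2 : f (x0 + s *: e_) - f x0 <= (a - 2 * B * t) / t * u 0 i * s +
      (a - 2 * B * t) / (2 * t) * nsq e_ * s ^+ 2.
    apply: (le_trans h2); rewrite le_eqVlt; apply/orP; left; apply/eqP.
    move: (a - 2 * B * t) (nsq e_) (u 0 i) => p n v; field; exact: lt0r_neq0.
  rewrite mulNr opprK opprD addrA lerBlDl; exact: h2.
have [e e0 he] := scale_small u rp.
have [e' e'0 [ee e1]] := pos_min2 e0 (@ltr01 R).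
pose D x := \sum_i u 0 i * partial i f x.
have hD : Ck 2 D by apply: Ck_sum => i; apply: CkZ; exact: Ck_partial.
have hd s : is_derive s (1 : R) (fun s => f (x0 + s *: u)) (D (x0 + s *: u)).
  by apply/is_derive_line; exact: Ck1_dir (Ck_le (isT : (1 <= 3)%N) hf).
have hd2 : is_derive 0 (1 : R) (fun s => D (x0 + s *: u)) (\sum_j u 0 j * partial j D x0).
  by apply/is_derive_line0; exact: Ck1_dir (CkS hD).
have [] := @second_order R _ _ _ ((a - 2 * B * t) * t) (B * t ^+ 2) e' e'0 hd hd2.
  move=> s hs; rewrite scale0r addr0; have h1 := Hh u s (he s (lt_le_trans hs ee)).
  have s1 : 0 <= 1 + s.
    by have := lt_le_trans hs e1; rewrite ltr_norml => /andP[h2 _]; rewrite -lerBlDl sub0r ltW.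
  have e2 : enorm (u + s *: u) = (1 + s) * t.
    by rewrite -[X in X + _]scale1r -scalerDl enormZ ut ger0_norm.
  rewrite e2 psi_increment lerBlDl in h1; apply: (le_trans h1).
  rewrite le_eqVlt; apply/orP; left; apply/eqP; ring.
move=> _; apply: le_trans; rewrite le_eqVlt; apply/orP; left; apply/eqP; apply: eq_bigr => j _; congr (_ * _).
have hi i : Ck 1 (fun x => u 0 i * partial i f x) := CkZ (u 0 i) (CkS (Ck_partial i hf)).
apply/esym/partialE; rewrite /D.
have -> : (fun x => \sum_i u 0 i * partial i f x) = \sum_i (fun x => u 0 i * partial i f x).
  by apply/funext => z; rewrite fct_sumE.
apply: is_derive_sum => i; have := Ck_der j x0 (hi i).
by rewrite (partialZ (u 0 i) j x0 (CkS (Ck_partial i hf))).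
Qed.

(** Since [1 + Lam a <= (1 + Lam) a], the range [t0] does not depend on [a]; the slope [a] can
    afterwards be enlarged until [a t0] dominates the supremum of [w]. *)
Lemma doubling_constants (Lam a : R) : 0 <= Lam -> 1 <= a ->
  let t0 := (4 * (1 + Lam))^-1 in 0 < t0 /\ (1 + Lam * a) * t0 <= a / 4.
Proof.
move=> L0 a1 t0; have p : 0 < 4 * (1 + Lam) by rewrite mulr_gt0// ltr_wpDr.
split; first by rewrite invr_gt0.
rewrite /t0 ler_pdivrMr//; have -> : a / 4 * (4 * (1 + Lam)) = a + Lam * a by field.
by rewrite lerD2r.
Qed.

(** Distance 0 is excluded because [w] vanishes off [E], and distance [t0] because [psi t0 > K]. As
    [psi] increases, the ball of radius [t = |x0 - y0|] about [x0] lies in [E], so [w] is smooth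
    there up to a constant; translated to [y0], it has slope [p <= a] and second derivative at most
    [- 2 B] in that direction, with [B = 1 + Lam a] exactly the value demanded by [viscosity]. *)
Lemma doubling_max A E p0 Lam r1 w x0 y0 (a K t0 : R) : (0 < d)%N -> measurable A -> E `<=` A -> Pb A p0 ->
  0 <= Lam -> 0 < r1 ->
  (forall U y p, measurable U -> A `<=` U -> U `\` A `<=` eball y r1 -> Pb U p ->
     p0 <= p + Lam * fine (leb (U `\` A))) ->
  (forall y r, ~ E y -> 0 < r -> r <= r1 -> 0 < fine (leb (eball y r `\` A))) ->
  off0 E w -> (forall x, w x <= K) ->
  (forall x t, 0 < t -> eball x t `<=` E -> exists f, [/\ Ck 3 f,
     forall z, enorm (z - x) < t / 2 -> w z - w x = f z - f x &
     forall z, enorm (z - x) < t / 2 -> lap f z = -1]) ->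
  1 <= a -> 0 < t0 -> (1 + Lam * a) * t0 <= a / 4 -> K < 3 / 4 * a * t0 ->
  ~ E y0 -> enorm (x0 - y0) <= t0 ->
  0 < w x0 - (a * enorm (x0 - y0) - (1 + Lam * a) * enorm (x0 - y0) ^+ 2) ->
  (forall x y, ~ E y -> enorm (x - y) <= t0 ->
     w x - (a * enorm (x - y) - (1 + Lam * a) * enorm (x - y) ^+ 2) <=
     w x0 - (a * enorm (x0 - y0) - (1 + Lam * a) * enorm (x0 - y0) ^+ 2)) -> False.
Proof.
move=> d0 mA EA hp Lam0 r10 super fatA w_off wK loc a1 t00 Bt0 Kt nE.
have [B EB] : exists B, B = 1 + Lam * a by exists (1 + Lam * a).
have B0 : 0 <= B by rewrite EB addr_ge0// mulr_ge0//; apply: le_trans a1.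
have [t Et] : exists t, t = enorm (x0 - y0) by exists (enorm (x0 - y0)).
rewrite -EB in Bt0 *; rewrite -Et => tt pos H.
have a0 : 0 < a := lt_le_trans ltr01 a1.
have tp : 0 < t.
  rewrite lt_neqAle eq_sym; apply/andP; split; last by rewrite Et enorm_ge0.
  apply/eqP => z; move: pos; rewrite z expr0n !mulr0 subrr subr0.
  have /eqP := enorm_eq0 (etrans (esym Et) z); rewrite subr_eq0 => /eqP ->.
  by rewrite w_off ?ltxx.
have tlt : t < t0.
  rewrite lt_neqAle tt andbT; apply/eqP => z; move: pos; rewrite z.
  have h1 : B * t0 ^+ 2 <= a / 4 * t0 by rewrite expr2 mulrA ler_wpM2r// ltW.
  by have := wK x0; move: (w x0) (B * _) h1 Kt => u v; clear; move=> *; lra.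
have Bt : B * t <= a / 4 by apply: le_trans Bt0; rewrite ler_wpM2l// ltW.
have p_gt0 : 0 < a - 2 * B * t by rewrite -mulrA; move: Bt a0; move: (B * t) => u; clear; move=> *; lra.
have p_le : a - 2 * B * t <= a by rewrite gerBl mulr_ge0 ?(ltW tp)// mulr_ge0.
have ball : eball x0 t `<=` E.
  move=> z; rewrite /eball /= => hz; apply: contrapT => nz.
  have := H x0 z nz; rewrite enormB => /(_ (ltW (lt_trans hz tlt))); rewrite lerD2l lerN2 => h.
  have s0 := enorm_ge0 (z - x0); move: (enorm (z - x0)) s0 hz h => s s0 hz h.
  have e : (a * t - B * t ^+ 2) - (a * s - B * s ^+ 2) = (t - s) * (a - B * t - B * s) by ring.
  have h2 : B * s <= a / 4 by apply: le_trans Bt; rewrite ler_wpM2l// ltW.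
  have h3 : 0 < (t - s) * (a - B * t - B * s).
    rewrite mulr_gt0 ?subr_gt0//; move: Bt h2 a0; move: (B * t) (B * s) => u v; clear; move=> *; lra.
  by move: h3; rewrite -e subr_gt0 ltNge h.
have [f [hf wf lf]] := loc x0 t tp ball.
have t20 : 0 < t / 2 by rewrite divr_gt0.
have [|hgrad hhess] := doubling_derivatives hf B0 (esym Et) tp tlt (ltW p_gt0).
  move=> x hx hxy; rewrite -(wf x hx); have := H x y0 nE hxy.
  by move: (_ - B * enorm _ ^+ 2) (a * t - _) (w x) (w x0) => u1 u2 u3 u4; clear; move=> *; lra.
have [p Ep] : exists p, p = a - 2 * B * t by exists (a - 2 * B * t).
rewrite -Ep in p_gt0 p_le hgrad.
have [u Eu] : exists u, u = x0 - y0 by exists (x0 - y0).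
rewrite -Eu in hgrad hhess.
have uy : u + y0 = x0 by rewrite Eu subrK.
pose F y := f (u + 1 *: y) - f x0.
have hF0 : Ck 3 (fun y => f (u + 1 *: y)) := Ck_affine 1 u hf.
have hF : Ck 2 F := CkB (CkS hF0) (Ck_cst 2 _).
have pF i : partial i F = (fun y => partial i f (u + 1 *: y)).
  apply/funext => y; rewrite /F (partialB i y (CkS (CkS hF0)) (Ck_cst 1 _)) partial_cst subr0.
  by rewrite (partial_affine 1 u i y hf) mul1r.
have ppF i j y : partial j (partial i F) y = partial j (partial i f) (u + 1 *: y).
  by rewrite pF (partial_affine 1 u j y (Ck_partial i hf)) mul1r.
have pF0 i : partial i F y0 = p / t * u 0 i by rewrite pF scale1r uy hgrad.
have nu : nsq u = t ^+ 2 by rewrite nsqE Eu -Et.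
have gF : gsq F y0 = p ^+ 2.
  have -> : gsq F y0 = (p / t) ^+ 2 * nsq u.
    by rewrite /gsq /nsq /dot mulr_sumr; apply: eq_bigr => i _; rewrite pF0 exprMn expr2.
  by rewrite nu; field; exact: lt0r_neq0.
apply: (@viscosity R d A E p0 Lam r1 F y0 (t / 2) a d0 mA EA hp Lam0 r10 super fatA hF t20 nE).
- by rewrite /F scale1r uy subrr.
- move=> y hy nEy; have e1 : u + 1 *: y - x0 = y - y0 by rewrite scale1r -uy opprD addrACA subrr add0r.
  have e2 : u + 1 *: y - y = x0 - y0 by rewrite scale1r Eu addrK.
  rewrite /F -wf ?e1//; have := H (u + 1 *: y) y nEy; rewrite e2 -Et => /(_ (ltW tlt)).
  by rewrite lerD2r subr_le0.
- move=> y hy; have e1 : u + 1 *: y - x0 = y - y0 by rewrite scale1r -uy opprD addrACA subrr add0r.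
  apply: (etrans _ (lf (u + 1 *: y) _)); last by rewrite e1.
  by rewrite /lap; apply: eq_bigr => i _; exact: ppF.
- exact: a1.
- by rewrite gF exprn_gt0.
- by rewrite gF ler_pXn2r// nnegrE ltW.
- rewrite gF -EB.
  have -> : gsq_flux F y0 = 2 * (p / t) ^+ 2 *
      \sum_j u 0 j * (\sum_i u 0 i * partial j (partial i f) x0).
    rewrite /gsq_flux mulr_sumr; apply: eq_bigr => j _.
    rewrite (partial_gsq j y0 hF) pF0.
    have -> : \sum_i partial i F y0 * partial j (partial i F) y0 =
        p / t * \sum_i u 0 i * partial j (partial i f) x0.
      by rewrite mulr_sumr; apply: eq_bigr => i _; rewrite pF0 ppF scale1r uy mulrA.
    by move: (\sum_i _) (u 0 j) (p / t) => v1 v2 v3; ring.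
  have c0 : 0 <= 2 * (p / t) ^+ 2 by rewrite mulr_ge0// sqr_ge0.
  apply: (le_trans (ler_wpM2l c0 hhess)); rewrite le_eqVlt; apply/orP; left; apply/eqP.
  by field; exact: lt0r_neq0.
Qed.

End doubling.

(** * From boundary growth to the Lipschitz bound *)

Section boundary_growth.
Context {R : realType} {d : nat}.
Local Notation V := 'rV[R]_d.
Implicit Types (x y z h u : V) (r s p t e : R) (f w : V -> R) (i : 'I_d) (U A E : set V).

Lemma pair_max E w (N t0 : R) (psi : R -> R) x1 y1 : open E -> continuous psi ->
  (forall x e, 0 < e -> \forall z \near x, w z < w x + e) ->
  enorm x1 <= N -> ~ E y1 -> enorm (x1 - y1) <= t0 ->
  exists x0 y0, [/\ ~ E y0, enorm (x0 - y0) <= t0 & forall x y, enorm x <= N -> ~ E y -> enorm (x - y) <= t0 ->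
    w x - psi (enorm (x - y)) <= w x0 - psi (enorm (x0 - y0))].
Proof.
move=> oE cpsi usc xN ny xy.
have cD : continuous (fun p : V * V => enorm (p.1 - p.2)).
  move=> p; apply: (@continuous_comp _ _ _ (fun p : V * V => p.1 - p.2) (@enorm R d)); last exact: continuous_enorm.
  by apply: cvgB; [exact: cvg_fst|exact: cvg_snd].
pose K1 : set V := [set z | enorm (z - 0) <= N]; pose K2 : set V := [set z | enorm (z - 0) <= N + t0].
pose S := (K1 `*` K2) `&` ((fun p : V * V => p.2) @^-1` (~` E) `&` (fun p : V * V => enorm (p.1 - p.2)) @^-1` [set t | t <= t0]).
have cS : compact S.
  apply: compact_closedI; first by apply: compact_setX; exact: compact_eball_closed.
  apply: closedI; apply: preimage_closed.
  - by move=> p _; exact: cvg_snd.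
  - exact: open_closedC.
  - by move=> p _; exact: cD.
  - exact: closed_le.
have inS x y : enorm x <= N -> ~ E y -> enorm (x - y) <= t0 -> S (x, y).
  move=> h1 h2 h3; split; last by split.
  split; rewrite /= /K1 /K2 /= subr0//.
  have := enorm_triangle y x 0; rewrite !subr0 enormB => h.
  by apply: (le_trans h); rewrite addrC lerD.
have ne : S !=set0 by exists (x1, y1); exact: inS.
pose f (p : V * V) := w p.1 - psi (enorm (p.1 - p.2)).
have fu (p : V * V) : S p -> forall e, 0 < e -> \forall q \near p, f q < f p + e.
  move=> _ e e0; have e2 : 0 < e / 2 by rewrite divr_gt0.
  have u1 : \forall q \near p, w q.1 < w p.1 + e / 2.
    by have := @cvg_fst _ _ (nbhs p.1) (nbhs p.2) _ _ (usc p.1 _ e2); apply.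
  have cp : continuous (fun q : V * V => psi (enorm (q.1 - q.2))).
    by move=> q; apply: (@continuous_comp _ _ _ (fun p : V * V => enorm (p.1 - p.2)) psi); [exact: cD|exact: cpsi].
  have /cvgrPdist_lt /(_ _ e2) u2 := cp p.
  apply: filterS2 u1 u2 => q /= h1 h2; rewrite ltr_norml in h2; have [_ h3] := andP h2.
  by rewrite /f; move: (w q.1) (w p.1) (psi _) (psi _) h1 h3 => a b c c'; clear; move=> *; lra.
have [[x0 y0] [_ [h1 h2]] hmax] := usc_max cS ne fu.
exists x0, y0; split=> // x y a b c; exact: (hmax (x, y) (inS x y a b c)).
Qed.

(** A pair with [w x > psi |x - y|] would yield, by compactness, a maximal pair of positive value,
    which [doubling_max] excludes; beyond distance [t0] the bound [K] suffices. *)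
Lemma boundary_growth A E p0 Lam r1 w (K : R) : (0 < d)%N -> measurable A -> E `<=` A -> Pb A p0 ->
  0 <= Lam -> 0 < r1 ->
  (forall U y p, measurable U -> A `<=` U -> U `\` A `<=` eball y r1 -> Pb U p ->
     p0 <= p + Lam * fine (leb (U `\` A))) ->
  (forall y r, ~ E y -> 0 < r -> r <= r1 -> 0 < fine (leb (eball y r `\` A))) ->
  off0 E w -> 0 <= K -> (forall x, w x <= K) ->
  (forall x t, 0 < t -> eball x t `<=` E -> exists f, [/\ Ck 3 f,
     forall z, enorm (z - x) < t / 2 -> w z - w x = f z - f x &
     forall z, enorm (z - x) < t / 2 -> lap f z = -1]) ->
  open E -> (forall x e, 0 < e -> \forall z \near x, w z < w x + e) ->
  (forall e, 0 < e -> exists n : R, forall x, n <= enorm x -> w x < e) ->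
  exists2 a, 0 <= a & forall x y, ~ E y -> w x <= a * enorm (x - y).
Proof.
move=> d0 mA EA hp Lam0 r10 super fatA w_off K0 wK loc oE usc decay.
pose t0 : R := (4 * (1 + Lam))^-1; have t00 : 0 < t0 by rewrite invr_gt0 mulr_gt0// ltr_wpDr.
(* Then [a t0 = t0 + 2 K], so that three quarters of it exceed [K]. *)
pose a := 1 + 2 * K / t0.
have a1 : 1 <= a by rewrite lerDl divr_ge0 ?(ltW t00)// mulr_ge0.
have a0 : 0 < a := lt_le_trans ltr01 a1.
have [_ Bt0] := doubling_constants Lam0 a1; rewrite -/t0 in Bt0.
have at0 : a * t0 = t0 + 2 * K by rewrite /a mulrDl mul1r divfK// gt_eqF.
have Kt : K < 3 / 4 * a * t0 by rewrite -mulrA at0; move: t00 K0; clear; move: t0 => t; move=> *; lra.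
have B0 : 0 <= 1 + Lam * a by rewrite addr_ge0// mulr_ge0// ltW.
pose psi s := a * s - (1 + Lam * a) * s ^+ 2.
have cpsi : continuous psi.
  move=> s; apply: cvgB; first by apply: cvgM; [exact: cvg_cst|exact: cvg_id].
  by apply: cvgM; [exact: cvg_cst|rewrite /=; under eq_fun do rewrite expr2; apply: cvgM; exact: cvg_id].
have psi0 s : 0 <= s -> s <= t0 -> 0 <= psi s.
  move=> s0 st; have -> : psi s = s * (a - (1 + Lam * a) * s) by rewrite /psi; ring.
  rewrite mulr_ge0// subr_ge0; apply: (le_trans (ler_wpM2l B0 st)); apply: (le_trans Bt0).
  by rewrite ler_pdivrMr// ler_peMr ?(ltW a0)// ler1n.
have main x y : ~ E y -> enorm (x - y) <= t0 -> w x <= psi (enorm (x - y)).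
  move=> nE xy; rewrite leNgt; apply/negP => h.
  pose e := w x - psi (enorm (x - y)); have e0 : 0 < e by rewrite subr_gt0.
  (* Beyond radius [n] the function is below the violation [e] and [psi] is nonnegative, so a
     maximum over [|x| <= N] is a maximum over all admissible pairs. *)
  have [n hn] := decay e e0; pose N := Num.max n (enorm x).
  have xN : enorm x <= N by rewrite le_max lexx orbT.
  have nN : n <= N by rewrite le_max lexx.
  have [x0 [y0 [nE0 xy0 hmax]]] := pair_max oE cpsi usc xN nE xy.
  have h1 : e <= w x0 - psi (enorm (x0 - y0)) := hmax x y xN nE xy.
  apply: (@doubling_max R d A E p0 Lam r1 w x0 y0 a K t0 d0 mA EA hp Lam0 r10 super fatA w_off wK loc a1 t00 Bt0 Kt nE0 xy0).
    exact: lt_le_trans e0 h1.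
  move=> x' y' nE' xy'; have [hN|hN] := leP (enorm x') N; first exact: hmax.
  apply: le_trans h1; apply: (@le_trans _ _ (w x')).
    by rewrite gerBl; apply: psi0 => //; exact: enorm_ge0.
  apply: ltW; apply: hn; apply: ltW; exact: le_lt_trans nN hN.
exists a => [|x y nE]; first exact: ltW.
have [xy|xy] := leP (enorm (x - y)) t0.
  apply: (le_trans (main x y nE xy)); rewrite /psi gerBl mulr_ge0// exprn_ge0//; exact: enorm_ge0.
apply: (le_trans (wK x)); apply: (@le_trans _ _ (a * t0)); last by rewrite ler_wpM2l ?(ltW a0)// ltW.
by rewrite at0; move: t00 K0; clear; move: t0 => t; move=> *; lra.
Qed.

(** If the complement is within [2 |x - x'|] of [x], both values are of order [a |x - x'|].
    Otherwise the interior estimate applies at half the distance [del] to the complement, where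
    growth makes [K] proportional to [del] and the radius cancels. *)
Lemma elipschitz_of_growth E w (a L : R) : (exists y, ~ E y) -> 0 <= a -> 0 <= L -> (forall x, 0 <= w x) ->
  (forall x y, ~ E y -> w x <= a * enorm (x - y)) ->
  (forall x x' r (K : R), 0 < r -> 0 <= K -> eball x (2 * r) `<=` E -> enorm (x - x') <= r ->
     (forall z, enorm (z - x) < 2 * r -> w z <= K) -> `|w x - w x'| <= L * K * r^-1 * enorm (x - x')) ->
  elipschitz w.
Proof.
move=> [y1 ny1] a0 L0 w0 wa int; exists (3 * a + 6 * a * L) => x x'.
have s0 := enorm_ge0 (x - x'); have aL : 0 <= 6 * a * L by rewrite !mulr_ge0.
have [[y ny hy]|far] := pselect (exists2 y, ~ E y & enorm (x - y) <= 2 * enorm (x - x')).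
  have h1 := wa x y ny; have h2 := wa x' y ny.
  have h3 := enorm_triangle x' x y; rewrite (enormB x' x) in h3.
  have h4 : w x <= 3 * a * enorm (x - x').
    apply: (le_trans h1); apply: (le_trans (ler_wpM2l a0 hy)); rewrite mulrA ler_wpM2r//; lra.
  have h5 : w x' <= 3 * a * enorm (x - x').
    have h6 : enorm (x' - y) <= 3 * enorm (x - x') by lra.
    by apply: (le_trans h2); apply: (le_trans (ler_wpM2l a0 h6)); rewrite mulrCA mulrA.
  have h7 : 0 <= 6 * a * L * enorm (x - x') by rewrite mulr_ge0.
  rewrite mulrDl ler_norml; have := w0 x; have := w0 x'.
  move: h4 h5 h7; move: (w x) (w x') (3 * a * _) (6 * a * L * _) => u1 u2 u3 u4.
  by clear; move=> *; apply/andP; split; lra.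
have [z|s_neq0] := eqVneq (enorm (x - x')) 0; first last.
  have sp : 0 < enorm (x - x') by rewrite lt_neqAle eq_sym s_neq0.
  pose S := [set enorm (x - y) | y in ~` E].
  have iS : has_inf S.
    split; first by exists (enorm (x - y1)), y1.
    by exists 0 => _ [y _ <-]; exact: enorm_ge0.
  have [del Edel] : exists del, del = inf S by exists (inf S).
  have dl : 2 * enorm (x - x') <= del.
    rewrite Edel; apply: lb_le_inf; first by case: iS.
    by move=> _ [y ny <-]; rewrite leNgt; apply/negP => h; apply: far; exists y => //; exact: ltW.
  have dp : 0 < del by lra.
  have [_ [y ny <-] hy] := inf_adherent dp iS; rewrite -Edel in hy.
  have inE z : enorm (z - x) < del -> E z.
    move=> hz; apply: contrapT => nz; have : del <= enorm (x - z).
      by rewrite Edel; apply: ge_inf; [case: iS|exists z].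
    by rewrite enormB leNgt hz.
  have r0 : 0 < del / 2 by rewrite divr_gt0.
  (* The point [y] satisfies [|x - y| < 2 del], so points within [del] of [x] are within [3 del] of
     [y]. *)
  have K0 : 0 <= 3 * a * del by rewrite mulr_ge0 ?(ltW dp)// mulr_ge0.
  have d2 : 2 * (del / 2) = del by field.
  have := int x x' (del / 2) (3 * a * del) r0 K0; rewrite d2 => h.
  have h1 : `|w x - w x'| <= L * (3 * a * del) * (del / 2)^-1 * enorm (x - x').
    apply: h => [z hz||z hz]; first exact: inE.
      lra.
    apply: (le_trans (wa z y ny)).
    have := enorm_triangle z x y => h3; have h4 : enorm (z - y) <= 3 * del by lra.
    by apply: (le_trans (ler_wpM2l a0 h4)); rewrite mulrCA mulrA.
  apply: (le_trans h1); rewrite ler_wpM2r//.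
  have -> : L * (3 * a * del) * (del / 2)^-1 = 6 * a * L by field; rewrite gt_eqF.
  by rewrite lerDr mulr_ge0.
by have /eqP := enorm_eq0 z; rewrite subr_eq0 => /eqP ->; rewrite !subrr normr0 enorm0 mulr0.
Qed.

End boundary_growth.

(** * Conclusion *)

Section assembly.
Context {R : realType} {d : nat}.
Local Notation V := 'rV[R]_d.
Implicit Types (x y z h u : V) (r s p t e : R) (f w : V -> R) (i : 'I_d) (U A E Om : set V).

Lemma compl_nonempty E : (0 < d)%N -> open E -> (leb E < +oo)%E -> exists y, ~ E y.
Proof.
move=> d0 oE fE; apply: contrapT => ne.
have ET x : E x by apply: contrapT => nx; apply: ne; exists x.
pose a : R := fine (leb E) + 1; have e0 : 0 <= fine (leb E) by rewrite fine_ge0.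
have a1 : 1 <= a *+ 2 by rewrite mulr2n /a; lra.
have a0 : 0 <= a by rewrite /a addr_ge0.
have h : (leb (cube a : set V) <= leb E)%E.
  by apply: le_measure; rewrite ?inE; [exact: measurable_cube|exact: open_measurable_leb|move=> x _; exact: ET].
rewrite leb_cube// in h; have := ler_eXnr d0 a1 => h2.
have h3 : (a *+ 2) ^+ d <= fine (leb E) by rewrite -lee_fin fineK// ge0_fin_numE.
have := le_trans h2 h3; rewrite mulr2n /a; lra.
Qed.

Lemma torsion_lipschitz A E p0 Lam r1 delta r0 : (0 < d)%N -> measurable A -> E `<=` A -> Pb A p0 ->
  0 <= Lam -> 0 < r1 ->
  (forall U y p, measurable U -> A `<=` U -> U `\` A `<=` eball y r1 -> Pb U p ->
     p0 <= p + Lam * fine (leb (U `\` A))) ->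
  (forall y r, ~ E y -> 0 < r -> r <= r1 -> 0 < fine (leb (eball y r `\` A))) ->
  open E -> (leb E < +oo)%E -> fat_complement E delta r0 -> 0 < delta -> 0 < r0 ->
  exists w, [/\ energy_function E w, off0 E w & elipschitz w].
Proof.
move=> d0 mA EA hp Lam0 r10 super fatA oE fE fat del0 r00.
have [w [g [hg w_off w0 weq wsub]]] := torsion d0 oE fE.
have L2w := hg.1.
have [C C0 mono] := mean_monotone hg wsub.
pose wb := mean_inf w C.
have wb_off : off0 E wb := mean_inf_off0 oE L2w w_off w0 C0 mono fat del0 r00.
have wb0 : forall x, 0 <= wb x := mean_inf_ge0 w0 C0.
have gwb : grad wb g.
  by apply: (grad_ae hg); [exact: measurable_mean_inf L2w w0 C0 mono|exact: mean_inf_ae L2w w0 C0 mono].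
have [K K0 wK] := mean_inf_bounded oE fE L2w w_off w0 C0.
have msub := mean_inside hg weq.
have isub := mean_inf_sub w0 C0 mono msub.
have loc x t : 0 < t -> eball x t `<=` E -> exists f, [/\ Ck 3 f,
     forall z, enorm (z - x) < t / 2 -> wb z - wb x = f z - f x &
     forall z, enorm (z - x) < t / 2 -> lap f z = -1].
  move=> t0 ht; have t2 : 0 < t / 2 by rewrite divr_gt0.
  have sub z : enorm (z - x) < t / 2 -> eball z (t / 2) `<=` E.
    move=> hz y hy; apply: ht; rewrite /eball /=; apply: (le_lt_trans (enorm_triangle y z x)).
    by rewrite [ltRHS]splitr; apply: ltrD.
  exists (conv w (kern (t / 2))); split=> [|z hz|z hz].
  - apply: Ck_conv (loc_L2 L2w) _ (kern_supp t2) => m; exact: Ck_kern.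
  - by apply: isub => //; [exact: sub|apply: sub; rewrite subrr enorm0].
  - exact: (mean_lap hg weq t2 (sub z hz)).
have [a a0 growth] := boundary_growth d0 mA EA hp Lam0 r10 super fatA wb_off K0 wK loc oE
  (fun x e => @mean_inf_usc R d w C L2w w0 C0 mono x e) (mean_inf_decay oE fE L2w w_off w0 C0).
have [L L0 inter] := mean_inf_interior oE L2w w_off w0 C0 mono msub.
exists wb; split=> //; first exact: (torsion_energy oE fat del0 r00 gwb wb_off weq).
exact: elipschitz_of_growth (compl_nonempty d0 oE fE) a0 L0 wb0 growth inter.
Qed.

Lemma ae_indic (N B B' : set V) : measurable N -> leb N = 0%E -> (forall x, ~ N x -> (B x <-> B' x)) ->
  {ae @leb R d, forall x, (\1_B x : R) = \1_B' x}.
Proof.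
move=> mN N0 h; exists N; split=> // z /= hz; apply: contrapT => nz; apply: hz.
have hB := h z nz; rewrite !indicE; have [Bz|nB] := pselect (B z).
  by rewrite !mem_set//; exact/hB.
by rewrite !memNset// => /hB.
Qed.

Section density1.
Variables (mu p0 : R) (Om : set V).
Hypotheses (d0 : (0 < d)%N) (mO : measurable Om) (fO : (leb Om < +oo)%E) (eO : perimeter Om = p0%:E).
Hypothesis super : local_supersolution mu setT Om.

Lemma density1_regular : exists delta r, [/\ 0 < delta, 0 < r, open (density1 Om),
  (leb (density1 Om) < +oo)%E & fat_complement (density1 Om) delta r] /\
  (exists w, [/\ energy_function (density1 Om) w, off0 (density1 Om) w & elipschitz w]).
Proof.
have hp : Pb Om p0 by apply/(perimeterP p0 mO); rewrite eO.
have [r1 r10 sup1] := superP mO fO eO super.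
(* The iteration needs [Lam r <= 1], hence radii at most [1 / (|mu| + 1)]. *)
have m0 : 0 < (`|mu| + 1)^-1 by rewrite invr_gt0 ltr_wpDl.
have [r rp [rr1 r2]] := pos_min2 r10 m0.
have Lr : `|mu| * r <= 1.
  rewrite -(@divrr _ (`|mu| + 1)) ?unitfE ?gt_eqF ?ltr_wpDl//.
  by apply: ler_pM => //; [exact: ltW|rewrite lerDl].
have sup U y p : measurable U -> Om `<=` U -> U `\` Om `<=` eball y r -> Pb U p ->
    p0 <= p + `|mu| * fine (leb (U `\` Om)).
  move=> mU OU hU; apply: sup1 mU OU _; exact: subset_trans hU (eball_le rr1).
have decay := density_decay mO hp (normr_ge0 mu) sup d0 Lr.
have del0 := @delta0_gt0 R d d0.
have oE := open_density1 mO del0 rp decay.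
have fE := leb_density1 mO fO del0 rp decay.
have fat := fat_density1 mO del0 rp decay.
have nul := density1_null mO del0 rp decay.
exists (@delta0 R d), r; split; first by split.
(* [A] differs from [Om] by a null set and contains [E]: it inherits the supersolution property and
   can be the set that the level sets of [w] touch. *)
pose E := density1 Om; pose N := E `\` Om; pose A := Om `|` E.
have mE : measurable E := open_measurable_leb oE.
have mN : measurable N := measurableD mE mO.
have mA : measurable A := measurableU _ _ mO mE.
have hA : Pb A p0.
  apply: Pb_ae hp => //; apply: (ae_indic mN nul) => x nx; split=> [Ox|[//|Ex]]; first by left.
  by apply: contrapT => nO; apply: nx.
have supA U y p : measurable U -> A `<=` U -> U `\` A `<=` eball y r -> Pb U p ->
    p0 <= p + `|mu| * fine (leb (U `\` A)).
  move=> mU AU hU hpU; pose U' := U `\` N.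
  have mU' : measurable U' := measurableD mU mN.
  have e : U' `\` Om = U `\` A.
    apply/seteqP; split=> x; first by move=> [[Ux nN] nO]; split=> // -[//|Ex]; apply: nN.
    by move=> [Ux nA]; split; [split=> // -[Ex _]; apply: nA; right|move=> Ox; apply: nA; left].
  rewrite -e; apply: (sup U' y) => //.
  - by move=> x Ox; split; [apply: AU; left|case].
  - by rewrite e.
  - apply: Pb_ae hpU => //; apply: (ae_indic mN nul) => x nx; split=> [Ux|[]//]; by split.
apply: (torsion_lipschitz d0 mA (@subsetUr _ Om E) hA (normr_ge0 mu) rp supA _ oE fE fat del0 rp).
move=> y s nE s0 sr.
have h1 : 0 < hole Om y s.
  apply: (lt_le_trans (mulr_gt0 del0 (exprn_gt0 d s0))); rewrite leNgt; apply/negP => /(decay _ _ s0 sr) h.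
  by apply: nE; apply/(density1P mO del0 rp decay); exists (s / 2) => //; rewrite divr_gt0.
rewrite -/(hole A y s) -[X in _ < X](_ : hole Om y s = _)//; rewrite (holeE y s mO) (holeE y s mA).
apply: int_ae; [exact: itg_measurable (itg_hole y s mO).2|exact: itg_measurable (itg_hole y s mA).2|].
apply: (ae_indic mN nul) => x nx; split=> -[bx nOx]; split=> //.
  by move=> [//|Ex]; apply: nx.
by move=> Ox; apply: nOx; left.
Qed.

End density1.
End assembly.

Theorem proposition5p1 (R : realType) (d : nat) (D Omega : set 'rV[R]_d)
    (mu : R) :
  (2 <= d)%N ->
  ([/\ open D, bounded_set D & C2_boundary D] \/ D = setT) ->
  measurable Omega -> Omega `<=` D ->
  (perimeter Omega + leb Omega < +oo)%E ->
  local_supersolution mu D Omega ->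
  [/\ exists mu1 : R, local_supersolution mu1 setT Omega,
      [/\ open (density1 Omega),
          H10 (density1 Omega) = H10_tilde (density1 Omega),
          forall k, (1 <= k)%N ->
            min_max k (H10 (density1 Omega)) =
            min_max k (H10_tilde (density1 Omega)) &
          forall (p : \bar R) (f : 'rV[R]_d -> R),
            (2%:E <= p)%E -> f \* \1_D \in Lfun leb p ->
            min_energy (f \* \1_D) (H10 (density1 Omega)) =
            min_energy (f \* \1_D) (H10_tilde (density1 Omega))] &
      exists w : 'rV[R]_d -> R,
        [/\ energy_function (density1 Omega) w,
            forall v, energy_function (density1 Omega) v ->
              {ae leb, forall x, v x = w x},
            forall x, ~ density1 Omega x -> w x = 0 &
            elipschitz w]].
Proof.
move=> d2 hD mO OD fin super; have d0 : (0 < d)%N by exact: ltn_trans d2.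
have P0 := perimeter_ge0 Omega; have L0 : (0 <= leb Omega)%E := measure_ge0 _ _.
have fP : (perimeter Omega < +oo)%E by apply: le_lt_trans fin; exact: leeDl.
have fO : (leb Omega < +oo)%E by apply: le_lt_trans fin; exact: leeDr.
have eO : perimeter Omega = (fine (perimeter Omega))%:E by rewrite fineK// ge0_fin_numE.
have [mu1 super1] : exists mu1 : R, local_supersolution mu1 setT Omega.
  case: hD => [[oD bD cD]|DT]; last by exists mu; rewrite -DT.
  have [rho [C [rho0 C0 hg]]] := good_uniform oD bD cD.
  exact: good_supersolution (open_measurable_leb oD) mO OD eO fO rho0 C0 hg super.
have [delta [r [[del0 r0 oE fE fat] [w [ew w_off lw]]]]] := density1_regular d0 mO fO eO super1.
have e := H10_eq_tilde oE fat del0 r0.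
split; first by exists mu1.
  (* The two spaces are equal as sets of functions, so eigenvalues and energies agree by
     rewriting. *)
  by split=> // [k _|p f _ _]; rewrite e.
by exists w; split=> // v ev; exact: (torsion_uniq d0 oE fE fat del0 r0 ev ew).
Qed.
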